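(* Let $X\subseteq\mathbb{C}^N$ be the affine cone over a smooth projective complete intersection $Y\subseteq\mathbb{P}^{N-1}$ of degree $d<2n+\nu-1$, where $n=\dim X$ and $\nu=\operatorname{codim}X=N-n$. Let $\Omega\subset\subset\Omega'\subset\subset\mathbb{C}^N$ be two strictly pseudoconvex domains, $D:=X\cap\Omega$, $D':=X\cap\Omega'$, and let $\mathcal{K}$ be the Andersson--Samuelsson integral operator on $D'$ (defined in the context). Let $\varphi\in L^p_{0,q}(D')$ be such that $\varphi\in\operatorname{Dom}\bar\partial_s$, where $q\in\{1,\dots,n\}$ and $$\frac{2n}{2n-(d-\nu)}<p\leq2n.$$ Then $$\varphi=\bar\partial_s\mathcal{K}\varphi+\mathcal{K}\big(\bar\partial_s\varphi\big)$$ in the sense of distributions on $D$.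
   Context: **Setting.** $f=(f_1,\dots,f_\nu)$ are homogeneous polynomials on $\mathbb{C}^N$ of degrees $d_1,\dots,d_\nu$, $d:=d_1+\dots+d_\nu$ (the ''degree'' of $X$ and of $Y$), $Y=\{[z]\in\mathbb{P}^{N-1}: f(z)=0\}$ and $X=\{\zeta\in\mathbb{C}^N: f(\zeta)=0\}$ has pure dimension $n=N-\nu$. That $Y$ is a smooth complete intersection means that $\partial f/\partial\zeta$ has rank $\nu$ at every point of $X\setminus\{0\}$. **Spaces and $\bar\partial_s$.** $X^*=\operatorname{Reg}X$ carries the Hermitian metric induced from $\mathbb{C}^N$; $dV_X$ is the induced volume measure, extended by zero to $\operatorname{Sing}X$. $L^p_{0,q}(D)$ is the space of $(0,q)$-forms on $D\cap X^*$ with pointwise norm in $L^p(D,dV_X)$. $\bar\partial_s=\bar\partial_s^{(p)}$ is the closure of the graph of $\bar\partial$ on smooth forms with support away from the singularity: $\varphi\in L^p_{0,q}(D)$ is in $\operatorname{Dom}\bar\partial_s$ if there is a sequence of smooth forms $\varphi_j\in L^p_{0,q}(D)$ with $\operatorname{supp}\varphi_j\cap\{0\}=\emptyset$ such that $\varphi_j\to\varphi$ in $L^p_{0,q}(D)$ and $\bar\partial\varphi_j\to\bar\partial\varphi$ in $L^p_{0,q+1}(D)$; then $\bar\partial_s\varphi=\bar\partial\varphi$ (in the sense of distributions). For $q=n$, $\bar\partial_s\varphi=0$. **The operator.** Write $\eta_j=\zeta_j-z_j$, with $d\eta_j$ treated as formal $(1,0)$-generators and $d\bar\eta_j=d\bar\zeta_j-d\bar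 z_j$; $\bar\partial$ acts in $(\zeta,z)$; $\delta_\eta$ is interior multiplication by $2\pi i\sum_j\eta_j\,\partial/\partial\eta_j$. - Structure form: $\omega_X$ is the pull-back to $X$ of $(2\pi i)^\nu\,\dfrac{\sum_I\overline{\det(\partial f/\partial\zeta_I)}\;\widehat{d\zeta_I}}{\|m(\nu,\partial f/\partial\zeta)\|^2}$, the sum over $I=(I_1<\dots<I_\nu)\subseteq\{1,\dots,N\}$, where $\widehat{d\zeta_I}$ is defined by $d\zeta_I\wedge\widehat{d\zeta_I}=d\zeta_1\wedge\dots\wedge d\zeta_N$ and $m(\nu,\partial f/\partial\zeta)$ is the tuple of all $\nu\times\nu$ minors of $\partial f/\partial\zeta$. - Hefer form: $h=h_1\wedge\dots\wedge h_\nu$, $h_i=\sum_jh_i^j(\zeta,z)\,d\eta_j$ with $\delta_\eta h_i=f_i(\zeta)-f_i(z)$, where the $h_i^j$ are homogeneous polynomials in $(\zeta,z)$ of degree $d_i-1$. - Weight: $\chi(\zeta)$ is a smooth cut-off function with compact support in $\Omega'$, $\chi\equiv1$ near $\overline\Omega$; $s=\sum_is_i(\zeta,z)\,d\eta_i$ satisfies $\delta_\eta s=1$ and is smooth for $\zeta$ near $\operatorname{supp}\bar\partial\chi$ and $z$ near $\overline\Omega$, holomorphic in $z$; $g:=\chi-\bar\partial\chi\wedge\big(s+s\wedge\bar\partial s+\dots+s\wedge(\bar\partial s)^{n-1}\big)$. - Bochner--Martinelli form: $b:=\dfrac{1}{2\pi i}\dfrac{\sum_j\bar\eta_j\,d\eta_j}{\|\eta\|^2}$,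 $B:=b+b\wedge\bar\partial b+\dots+b\wedge(\bar\partial b)^{n-1}$. $\tilde K$ is defined by $\tilde K\wedge d\eta_1\wedge\dots\wedge d\eta_N=h\wedge(g\wedge B)_n$, where $(\cdot)_n$ denotes the part of degree $n$ in the $d\eta_j$. Put $K=\pm\,\omega_X(\zeta)\wedge\tilde K(\zeta,z)$, the sign (depending only on $n,N$ and orientation conventions) being the one for which the Andersson--Samuelsson Koppelman formula $\varphi=\bar\partial\mathcal K\varphi+\mathcal K\bar\partial\varphi$ holds on $D$ for smooth $(0,q)$-forms $\varphi$ on $D'$, $q\ge1$ (a known result of Andersson and Samuelsson). Then $(\mathcal K\varphi)(z)=\int_{D'}K(\zeta,z)\wedge\varphi(\zeta)$ for $z\in D$, integration being over $\zeta$ (component of bidegree $(n,n)$ in $\zeta$). *)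

(* Defs.v *)
(* Points of C^N are row vectors 'rV[R[i]]_N, with R an arbitrary realType; a *)
(* pair (zeta, z) in C^N x C^N is row_mx zeta z : 'rV[R[i]]_(N + N).          *)
From HB Require Import structures.
From mathcomp Require Import all_boot all_order all_algebra.
From mathcomp Require Import all_classical all_reals all_analysis.
From mathcomp Require Import complex.
From mathcomp Require Import -(notations) mpoly.
Set Implicit Arguments.
Unset Strict Implicit.
Unset Printing Implicit Defensive.
Import Order.TTheory GRing.Theory Num.Theory.
Import numFieldNormedType.Exports.
Local Open Scope classical_set_scope.
Local Open Scope ring_scope.
Local Open Scope complex_scope.

(* The topology of a numFieldType is attached to K^o; this transports it to   *)
(* R[i], so that 'rV[R[i]]_N carries the usual topology.                      *)
HB.instance Definition _ (R : realType) := NormedModule.copy R[i] (R[i]^o).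

Definition Borel (R : realType) (N : nat) :=
  g_sigma_algebraType (@open 'rV[R[i]]_N).

Section ExteriorAlgebra.
Context {R : realType}.
Local Notation C := R[i].

(* Exterior algebra on generators indexed by the finite type G: a S is the    *)
(* coefficient of the product of the generators of S, in the order of enum G. *)
Definition ext (G : finType) := {ffun {set G} -> C}.
HB.instance Definition _ (G : finType) := GRing.Zmodule.on (ext G).

Definition shuffle_sign (G : finType) (A B : {set G}) : C :=
  (-1) ^+ #|[set x : G * G | [&& x.1 \in A, x.2 \in B
                               & (enum_rank x.2 < enum_rank x.1)%N]]|.

Definition wedge (G : finType) (a b : ext G) : ext G :=
  [ffun S : {set G} => \sum_(A : {set G} | A \subset S)
     shuffle_sign A (S :\: A) * a A * b (S :\: A)].

Definition monom (G : finType) (S : {set G}) : ext G :=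
  [ffun S' : {set G} => (S' == S)%:R].

Definition ext1 (G : finType) : ext G := monom finset.set0.

Definition gen (G : finType) (g : G) : ext G := monom [set g].

Definition escale (G : finType) (c : C) (a : ext G) : ext G :=
  [ffun S : {set G} => c * a S].

Definition wexp (G : finType) (a : ext G) (k : nat) : ext G :=
  iter k (wedge a) (ext1 G).

(* The algebra morphism with g |-> M g, for M g of degree 1. *)
Definition subst (G G' : finType) (M : G -> ext G') (a : ext G) : ext G' :=
  \sum_(S : {set G}) escale (a S) (\big[@wedge G'/ext1 G']_(g <- enum S) M g).

End ExteriorAlgebra.

Section Calculus.
Context {R : realType}.
Local Notation C := R[i].

(* The notation 'i of numClosedFieldType denotes an abstract square root of   *)
(* -1; here i is explicit.                                                    *)
Definition imC : C := 0 +i* 1.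

(* Real directional derivative at x, along v, of a complex-valued function. *)
Definition dirder (M : nat) (v : 'rV[C]_M) (h : 'rV[C]_M -> C)
    (x : 'rV[C]_M) : C :=
  derive1 (fun t : R => complex.Re (h (x + t%:C *: v))) 0
  +i* derive1 (fun t : R => complex.Im (h (x + t%:C *: v))) 0.

Definition dirderivable (M : nat) (v : 'rV[C]_M) (h : 'rV[C]_M -> C)
    (x : 'rV[C]_M) : Prop :=
  derivable (fun t : R => complex.Re (h (x + t%:C *: v))) 0 1 /\
  derivable (fun t : R => complex.Im (h (x + t%:C *: v))) 0 1.

Definition iterder (M : nat) (vs : seq 'rV[C]_M) (h : 'rV[C]_M -> C) :=
  foldr (@dirder M) h vs.

(* Class C^k, in the real sense, on an open set U. *)
Definition Ck_on (M k : nat) (U : set 'rV[C]_M) (h : 'rV[C]_M -> C) : Prop :=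
  forall x, U x -> forall vs : seq 'rV[C]_M,
    ((size vs <= k)%N -> {for x, continuous (iterder vs h)}) /\
    ((size vs < k)%N -> forall v, dirderivable v (iterder vs h) x).

Definition smooth_on (M : nat) (U : set 'rV[C]_M) (h : 'rV[C]_M -> C) : Prop :=
  forall k, Ck_on k U h.

Definition wirt (M : nat) (j : 'I_M) (h : 'rV[C]_M -> C) (x : 'rV[C]_M) : C :=
  (dirder (delta_mx 0 j) h x - imC * dirder (imC *: delta_mx 0 j) h x) / 2%:R.

Definition wirtbar (M : nat) (j : 'I_M) (h : 'rV[C]_M -> C)
    (x : 'rV[C]_M) : C :=
  (dirder (delta_mx 0 j) h x + imC * dirder (imC *: delta_mx 0 j) h x) / 2%:R.

(* dbar of a form on C^M; c j is the generator standing for the conjugate of  *)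
(* dx_j, and every generator is dbar-closed.                                  *)
Definition dbarform (M : nat) (G : finType) (c : 'I_M -> G)
    (u : 'rV[C]_M -> @ext R G) (x : 'rV[C]_M) : @ext R G :=
  \sum_(j < M) wedge (gen (c j))
                 [ffun S : {set G} => wirtbar j (fun y => u y S) x].

(* Bounded domains of class C^2 whose Levi form is positive definite on the   *)
(* complex tangent space at each boundary point; positivity in R[i] includes  *)
(* being real.                                                                *)
Definition strictly_pseudoconvex (N : nat) (Om : set 'rV[C]_N) : Prop :=
  [/\ open Om, connected Om, compact (closure Om) &
   exists (W : set 'rV[C]_N) (rho : 'rV[C]_N -> R),
   let bd := closure Om `\` Om in
   let r := fun z => (rho z)%:C in
   [/\ open W /\ bd `<=` W,
       Ck_on 2 W r,
       Om `&` W = [set z | rho z < 0] `&` W,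
       (forall z, bd z -> exists j, wirt j r z != 0) &
       (forall z, bd z -> forall v : 'rV[C]_N, v != 0 ->
          \sum_(j < N) wirt j r z * v 0 j = 0 ->
          0 < \sum_(j < N) \sum_(k < N)
                wirt j (wirtbar k r) z * v 0 j * (v 0 k)^*)]].

(* Lebesgue integral on C^n = R^(2n) of a nonnegative Borel function, as an   *)
(* iterated integral (Tonelli).                                               *)
Fixpoint lebesgueC (n : nat) : ('rV[C]_n -> \bar R) -> \bar R :=
  match n with
  | 0%N => fun F => F 0
  | m.+1 => fun F =>
     (\int[@lebesgue_measure R]_x \int[@lebesgue_measure R]_y
        lebesgueC (fun w : 'rV[C]_m =>
          F (row_mx (const_mx (x +i* y) : 'rV[C]_1) w)))%E
  end.

Definition cintegral (N : nat) (mu : {measure set (Borel R N) -> \bar R})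
    (D : set 'rV[C]_N) (g : 'rV[C]_N -> C) : C :=
  Rintegral mu D (fun x => complex.Re (g x))
  +i* Rintegral mu D (fun x => complex.Im (g x)).

Definition twopii : C := 0 +i* (pi *+ 2).

End Calculus.

Section Cone.
Context {R : realType} (N nu n : nat).
Local Notation C := R[i].
Local Notation point := 'rV[C]_N.
Variable f : 'I_nu -> mpoly N C.

Definition peval (M : nat) (p : mpoly M C) (x : 'rV[C]_M) : C :=
  meval (fun j => x 0 j) p.

Definition cone : set point := [set z | forall i, peval (f i) z = 0].

Definition jac (z : point) : 'M[C]_(nu, N) :=
  \matrix_(i < nu, j < N) peval (mderiv j (f i)) z.

Definition smooth_complete_intersection (d : 'I_nu -> nat) : Prop :=
  (forall i, (0 < d i)%N /\
     f i \is ishomog1 (d i) (@mdeg N)) /\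
  (forall z, cone z -> z != 0 -> \rank (jac z) = nu).

(* X^* = Reg X, by the Jacobian criterion (0 is a regular point when all f_i  *)
(* are linear).                                                               *)
Definition regcone : set point := [set z | cone z /\ \rank (jac z) = nu].

(* The induced volume measure, extended by zero to Sing X: in a holomorphic   *)
(* parametrization psi the induced metric has matrix psi' (psi')^*, whose     *)
(* determinant is the density with respect to Lebesgue measure on C^n. Since  *)
(* the images of parametrizations cover X^*, this determines mu.              *)
Definition psi_jac (psi : 'rV[C]_n -> point) (w : 'rV[C]_n) : 'M[C]_(n, N) :=
  \matrix_(k < n, j < N) wirt k (fun w' => psi w' 0 j) w.

Definition is_parametrization (U : set 'rV[C]_n) (psi : 'rV[C]_n -> point) :
    Prop :=
  [/\ open U,
      (forall j : 'I_N, smooth_on U (fun w => psi w 0 j)),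
      (forall (j : 'I_N) (k : 'I_n) w,
          U w -> wirtbar k (fun w' => psi w' 0 j) w = 0),
      (forall w, U w -> regcone (psi w) /\ \rank (psi_jac psi w) = n) &
      {in U &, injective psi}].

Definition is_volume (mu : {measure set (Borel R N) -> \bar R}) : Prop :=
  mu (~` regcone) = 0%E /\
  forall U psi, is_parametrization U psi ->
  forall E : set (Borel R N), measurable E -> E `<=` psi @` U ->
    mu E = lebesgueC (fun w => (\1_(U `&` psi @^-1` E) w *
      complex.Re (\det (psi_jac psi w *m (map_mx conjc (psi_jac psi w))^T)))%:E).

(* The rows of frame z form an orthonormal basis of T_z X, for z in X^*. All  *)
(* notions below are independent of the basis chosen.                         *)
Definition frame (z : point) : 'M[C]_(n, N) :=
  xget 0 [set A | A *m (jac z)^T = 0 /\ A *m (map_mx conjc A)^T = 1%:M].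

(* (0,q)-forms on open subsets of X^* are given by ambient coefficients in    *)
(* the conjugates of d zeta_j, and only their restrictions to T_z X matter.   *)
Definition formX := point -> @ext R 'I_N.

Definition restr (z : point) (a : @ext R 'I_N) : @ext R 'I_n :=
  subst (fun j => \sum_(k < n) escale (frame z k j)^* (gen k)) a.

Definition eq_on (V : set point) (u v : formX) : Prop :=
  forall z, V z -> regcone z -> restr z (u z) = restr z (v z).

Definition of_degree (q : nat) (u : formX) : Prop :=
  forall z (S : {set 'I_N}), #|S| != q -> u z S = 0.

Definition fnorm (z : point) (a : @ext R 'I_N) : R :=
  Num.sqrt (\sum_(S : {set 'I_n}) (complex.Re (restr z a S) ^+ 2
                                   + complex.Im (restr z a S) ^+ 2)).

(* u is smooth of degree (0,q) near each point of A, with dbar u = v: locally *)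
(* u is the restriction of a smooth ambient form and v that of its dbar.      *)
Definition smooth_dbar (A : set point) (q : nat) (u v : formX) : Prop :=
  [/\ of_degree q u, of_degree q.+1 v &
   forall z0, A z0 -> exists (V : set point) (Phi : formX),
     [/\ open V /\ V z0, of_degree q Phi,
         forall S : {set 'I_N}, smooth_on V (fun z => Phi z S),
         eq_on V u Phi & eq_on V v (dbarform id Phi)]].

Definition supp (Om : set point) (u : formX) : set point :=
  cone `&` Om `&`
  closure [set z | [/\ regcone z, Om z & restr z (u z) <> 0]].

Section Spaces.
Variable mu : {measure set (Borel R N) -> \bar R}.

Definition Lp_power (p : R) (Om : set point) (u : formX) : \bar R :=
  (\int[mu]_(z in Om `&` regcone) (fnorm z (u z) `^ p)%:E)%E.

(* The frame need not depend measurably on z, so measurability is required of *)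
(* some ambient representative.                                               *)
Definition Lp (p : R) (Om : set point) (q : nat) (u : formX) : Prop :=
  [/\ of_degree q u,
      (exists Phi : formX, eq_on Om u Phi /\
         forall S : {set 'I_N},
           measurable_fun setT (fun z : Borel R N => complex.Re (Phi z S)) /\
           measurable_fun setT (fun z : Borel R N => complex.Im (Phi z S))) &
      (Lp_power p Om u < +oo)%E].

(* u belongs to Dom dbar_s^(p) on D = X `&` Om, and dbar_s u = v. For q = n   *)
(* forms of degree (0,n+1) restrict to zero, hence so does v.                 *)
Definition dbar_s (p : R) (Om : set point) (q : nat) (u v : formX) : Prop :=
  [/\ Lp p Om q u, Lp p Om q.+1 v &
   exists us vs : nat -> formX,
     [/\ (forall j, [/\ smooth_dbar (regcone `&` Om) q (us j) (vs j),
                        Lp p Om q (us j) & ~ supp Om (us j) 0]),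
         (fun j => Lp_power p Om (fun z => us j z - u z)) @ \oo --> 0%E &
         (fun j => Lp_power p Om (fun z => vs j z - v z)) @ \oo --> 0%E]].

End Spaces.

(* The generators of the kernel calculus, in this order: d eta_j, d zeta_j,   *)
(* and the conjugates of d zeta_j and of d z_j.                               *)
Definition kgen : finType := (('I_N + 'I_N) + ('I_N + 'I_N))%type.
Definition deta (j : 'I_N) : kgen := inl (inl j).
Definition dzeta (j : 'I_N) : kgen := inl (inr j).
Definition dzetab (j : 'I_N) : kgen := inr (inl j).
Definition dzb (j : 'I_N) : kgen := inr (inr j).

(* Generators dw_k, their conjugates, and the conjugates of dz_j. *)
Definition wgen : finType := (('I_n + 'I_n) + 'I_N)%type.

(* Restriction in zeta to T_zeta X, in terms of a frame A; applied only to    *)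
(* forms free of the d eta_j.                                                 *)
Definition krestr (A : 'M[C]_(n, N)) (g : kgen) : @ext R wgen :=
  match g with
  | inl (inl _) => 0
  | inl (inr j) => \sum_(k < n) escale (A k j) (gen (inl (inl k) : wgen))
  | inr (inl j) => \sum_(k < n) escale (A k j)^* (gen (inl (inr k) : wgen))
  | inr (inr j) => gen (inr j : wgen)
  end.

(* Coefficient of dV_X /\ d zbar_L in the (n,n)-part in zeta of a. One has    *)
(* dw_1 ... dw_n dwbar_1 ... dwbar_n = (-1)^(n(n-1)/2) (-2i)^n dV.            *)
Definition density (z : point) (L : {set 'I_N}) (a : @ext R kgen) : C :=
  (-1) ^+ 'C(n, 2) * (- 2%:R * imC) ^+ n *
  subst (krestr (frame z)) a
    ([set inl g | g : 'I_n + 'I_n] :|: [set inr j | j in L])%SET.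

Definition fiber_integral (mu : {measure set (Borel R N) -> \bar R})
    (Om : set point) (u : point -> @ext R kgen) : @ext R 'I_N :=
  [ffun L : {set 'I_N} =>
     cintegral mu (Om `&` regcone) (fun zeta => density zeta L (u zeta))].

Definition in_zetab (a : @ext R 'I_N) : @ext R kgen :=
  subst (fun j => gen (dzetab j)) a.

Definition test_form (Om : set point) (q : nat)
    (theta : point -> @ext R kgen) : Prop :=
  [/\ forall S : {set kgen}, smooth_on setT (fun z => theta z S),
      (exists K : set point, [/\ compact K, K `<=` Om &
         forall z, ~ K z -> theta z = 0]) &
      forall z (S : {set kgen}), theta z S != 0 ->
        exists A B : {set 'I_N}, [/\ #|A| = n, #|B| = (n - q)%N &
          S = ([set dzeta j | j in A] :|: [set dzetab j | j in B])%SET]].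

(* Equality of two (0,q)-forms as distributions on D = X `&` Om. *)
Definition eq_distr (mu : {measure set (Borel R N) -> \bar R})
    (Om : set point) (q : nat) (u v : formX) : Prop :=
  forall theta, test_form Om q theta ->
    let pairing a z := density z finset.set0 (wedge (in_zetab (a z)) (theta z)) in
    (forall a : formX, a = u \/ a = v ->
       mu.-integrable (Om `&` regcone)
         (fun z => (complex.Re (pairing a z))%:E) /\
       mu.-integrable (Om `&` regcone)
         (fun z => (complex.Im (pairing a z))%:E)) /\
    cintegral mu (Om `&` regcone) (pairing u) =
    cintegral mu (Om `&` regcone) (pairing v).

Definition increasing (I : {ffun 'I_nu -> 'I_N}) : bool :=
  [forall k : 'I_nu, forall l : 'I_nu, (k < l)%N ==> (I k < I l)%N].

Definition jac_minor (I : {ffun 'I_nu -> 'I_N}) (z : point) : C :=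
  \det (colsub I (jac z)).

Definition minors_sqnorm (z : point) : C :=
  \sum_(I | increasing I) jac_minor I z * (jac_minor I z)^*.

Definition omegaX (z : point) : @ext R kgen :=
  escale (twopii ^+ nu) (\sum_(I | increasing I)
    let S := [set I k | k : 'I_nu]%SET in
    escale ((jac_minor I z)^* / minors_sqnorm z * shuffle_sign S (~: S)%SET)
           (monom [set dzeta j | j in (~: S)%SET]%SET)).

Definition is_hefer (d : 'I_nu -> nat)
    (h : 'I_nu -> 'I_N -> mpoly (N + N) C) : Prop :=
  (forall i j, h i j \is ishomog1 (d i).-1 (@mdeg (N + N))) /\
  (forall i (zeta z : point),
     twopii * \sum_(j < N) (zeta 0 j - z 0 j) * peval (h i j) (row_mx zeta z)
     = peval (f i) zeta - peval (f i) z).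

Definition hefer_form (h : 'I_nu -> 'I_N -> mpoly (N + N) C)
    (x : 'rV[C]_(N + N)) : @ext R kgen :=
  \big[@wedge R kgen/ext1 kgen]_(i < nu)
    \sum_(j < N) escale (peval (h i j) x) (gen (deta j)).

Definition is_cutoff (Om Om' : set point) (chi : point -> R) : Prop :=
  [/\ smooth_on setT (fun z => (chi z)%:C),
      compact (closure [set z | chi z != 0]),
      closure [set z | chi z != 0] `<=` Om' &
      exists W : set point, [/\ open W, closure Om `<=` W &
        forall z, W z -> chi z = 1]].

Definition supp_dbar (chi : point -> R) : set point :=
  closure [set z | exists j : 'I_N, wirtbar j (fun y => (chi y)%:C) z != 0].

Definition is_weight (Om : set point) (chi : point -> R)
    (s : 'I_N -> 'rV[C]_(N + N) -> C) : Prop :=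
  exists U V : set point,
    let UV := [set x : 'rV[C]_(N + N) | U (lsubmx x) /\ V (rsubmx x)] in
    [/\ open U /\ supp_dbar chi `<=` U,
        open V /\ closure Om `<=` V,
        (forall i, smooth_on UV (s i)),
        (forall i j x, UV x -> wirtbar (rshift N j) (s i) x = 0) &
        (forall x, UV x ->
           twopii * \sum_(i < N) (lsubmx x 0 i - rsubmx x 0 i) * s i x = 1)].

Definition kdbar : ('rV[C]_(N + N) -> @ext R kgen) ->
    'rV[C]_(N + N) -> @ext R kgen :=
  dbarform (fun j : 'I_(N + N) => match fintype.split j with
                     | inl k => dzetab k
                     | inr k => dzb k
                     end).

(* a + a /\ dbar a + ... + a /\ (dbar a)^(n-1) *)
Definition geom_sum (a : 'rV[C]_(N + N) -> @ext R kgen)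
    (x : 'rV[C]_(N + N)) : @ext R kgen :=
  \sum_(k < n) wedge (a x) (wexp (kdbar a x) k).

Definition eta_form (a : 'I_N -> 'rV[C]_(N + N) -> C)
    (x : 'rV[C]_(N + N)) : @ext R kgen :=
  \sum_(j < N) escale (a j x) (gen (deta j)).

Definition bm_form : 'rV[C]_(N + N) -> @ext R kgen :=
  eta_form (fun j x =>
    let e := lsubmx x - rsubmx x : point in
    twopii^-1 * ((e 0 j)^* / \sum_(k < N) e 0 k * (e 0 k)^*)).

Definition weight_form (chi : point -> R) (s : 'I_N -> 'rV[C]_(N + N) -> C)
    (x : 'rV[C]_(N + N)) : @ext R kgen :=
  let c := fun y => escale (chi (lsubmx y))%:C (ext1 kgen) in
  c x - wedge (kdbar c x) (geom_sum (eta_form s) x).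

Definition all_deta : {set kgen} := [set deta j | j : 'I_N]%SET.

Definition eta_part (m : nat) (a : @ext R kgen) : @ext R kgen :=
  [ffun S : {set kgen} => if #|S :&: all_deta| == m then a S else 0].

(* The form A free of the d eta_j with A /\ d eta_1 /\ ... /\ d eta_N = a,    *)
(* for a of degree N in the d eta_j.                                          *)
Definition strip_eta (a : @ext R kgen) : @ext R kgen :=
  [ffun S : {set kgen} => if [disjoint S & all_deta]
     then shuffle_sign S all_deta * a (S :|: all_deta)%SET else 0].

Definition Ktilde (h : 'I_nu -> 'I_N -> mpoly (N + N) C)
    (chi : point -> R) (s : 'I_N -> 'rV[C]_(N + N) -> C)
    (x : 'rV[C]_(N + N)) : @ext R kgen :=
  strip_eta (wedge (hefer_form h x)
    (eta_part n (wedge (weight_form chi s x) (geom_sum bm_form x)))).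

(* eps : bool encodes the sign (-1)^eps. *)
Definition Kker (eps : bool) (h : 'I_nu -> 'I_N -> mpoly (N + N) C)
    (chi : point -> R) (s : 'I_N -> 'rV[C]_(N + N) -> C)
    (zeta z : point) : @ext R kgen :=
  escale ((-1) ^+ eps) (wedge (omegaX zeta) (Ktilde h chi s (row_mx zeta z))).

Definition Kop (mu : {measure set (Borel R N) -> \bar R}) (Om' : set point)
    (eps : bool) (h : 'I_nu -> 'I_N -> mpoly (N + N) C)
    (chi : point -> R) (s : 'I_N -> 'rV[C]_(N + N) -> C) (u : formX) : formX :=
  fun z => fiber_integral mu Om'
    (fun zeta => wedge (Kker eps h chi s zeta z) (in_zetab (u zeta))).

(* phi = dbar K phi + K dbar phi on D, for smooth (0,q)-forms phi on D' and   *)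
(* q >= 1; smooth forms on D' are locally restrictions of smooth ambient      *)
(* forms, also at the singular point, and K phi is smooth on D `&` X^*. This  *)
(* known formula is what determines the sign eps.                             *)
Definition koppelman_smooth (Om Om' : set point) (K : formX -> formX) : Prop :=
  forall (q : nat) (u du : formX), (1 <= q <= n)%N ->
    smooth_dbar (cone `&` Om') q u du ->
    smooth_dbar (regcone `&` Om) q.-1 (K u) (fun z => u z - K du z).

End Cone.

(* Main.v *)
(* The operator K is applied to the approximations phi_j of phi. By homogeneity
   the kernel is bounded by C (|zeta - z|^(1-2n) + |z|^(-al) |zeta|^(-be)) with
   al p < 2n and be p' < 2n, p' the conjugate exponent; such al, be exist exactly
   because p > 2n / (2n - (d - nu)). Schur's test, based on the volume growth
   mu (B(z, r)) <= C r^(2n), then makes K bounded on L^p, so that K phi_j and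
   phi_j - K dbar phi_j = dbar K phi_j converge in L^p. Since phi_j vanishes
   near 0, K phi_j is bounded near 0, and p <= 2n allows to multiply it by
   logarithmic cut-off functions m_k which vanish near 0 and satisfy
   ||dbar m_k||_p -> 0. The distributional identity holds because the
   form dbar_s K phi found in this way is phi - K dbar_s phi.

   Pull-backs to X are handled without frames: a form on T_z X is represented by
   its orthogonal lift, whose coefficients are Borel functions of z. *)
Require Import Defs.
From HB Require Import structures.
From mathcomp Require Import all_boot all_order all_algebra.
From mathcomp Require Import all_classical all_reals all_analysis.
From mathcomp Require Import measurable_realfun complex.
From mathcomp Require Import -(notations) mpoly.
From mathcomp Require Import ring lra zify.
Set Implicit Arguments.
Unset Strict Implicit.
Unset Printing Implicit Defensive.
Import Order.TTheory GRing.Theory Num.Theory.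
Import numFieldNormedType.Exports.
Local Open Scope classical_set_scope.
Local Open Scope ring_scope.
Local Open Scope complex_scope.

(** * Exterior algebras *)

(** The exponents come from three homogeneous factors. With m = d - nu, the structure form has size
    at most |zeta|^(-m), by compactness of the link of the cone, the Hefer form (|zeta| + |z|)^m,
    and the Bochner-Martinelli form |zeta - z|^(1-2n), up to constants. The exponents [al] and [be]
    matter only where |z| > 2 |zeta|. The Hefer forms serve twice: with their coefficients f(zeta) -
    f(z) is exactly linear in zeta - z, so charts of X come from a contraction, and their Lipschitz
    constants and holomorphy from one matrix identity. Dilating a chart preserves its volume
    constant, so compactness of an annulus controls all balls up to the vertex. The obstacle at 0 is
    that the Koppelman formula is available for forms smooth across the singular point, while K of
    such a form is known to be smooth only on the regular part. Hence cut-offs occur twice: before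
    K, where the form restricts to 0 wherever their gradient lives, and after K, where only
    boundedness is left and the logarithmic scale is needed. *)

Section ExtRing.
Context {R : realType}.
Local Notation C := R[i].
Variable G : finType.
Implicit Types (A B D S T : {set G}) (a b c : @ext R G).

Lemma disj_setUl A B D : [disjoint (A :|: B)%SET & D]%B = [disjoint A & D]%B && [disjoint B & D]%B.
Proof. by rewrite -!setI_eq0 finset.setIUl finset.setU_eq0. Qed.

Lemma disj_setUr A B D : [disjoint A & (B :|: D)%SET]%B = [disjoint A & B]%B && [disjoint A & D]%B.
Proof. by rewrite -!setI_eq0 finset.setIUr finset.setU_eq0. Qed.

Lemma disj_set0l A : [disjoint (finset.set0 : {set G}) & A]%B.
Proof. by rewrite -setI_eq0 finset.set0I. Qed.

Lemma disj_set0r A : [disjoint A & (finset.set0 : {set G})]%B.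
Proof. by rewrite -setI_eq0 finset.setI0. Qed.

(** The definition counts a classical set; as a finite set it is within reach of the lemmas on
    cardinals. *)
Lemma shuffle_signE A B : shuffle_sign A B =
  (-1) ^+ #|[set x : G * G | [&& x.1 \in A, x.2 \in B
                               & (enum_rank x.2 < enum_rank x.1)%N]]%SET| :> C.
Proof.
by congr (_ ^+ _); apply: eq_card => x; rewrite [RHS]inE; apply/idP/idP; rewrite in_setE.
Qed.

(** Inversions against a fixed set add up over a disjoint union, so the sign is multiplicative. This
    property and its mirror image make the product associative. *)
Lemma shuffle_signUl A B D : [disjoint A & B]%B ->
  shuffle_sign (A :|: B)%SET D = shuffle_sign A D * shuffle_sign B D :> C.
Proof.
move=> dAB; rewrite !shuffle_signE -exprD; congr (_ ^+ _).
rewrite -cardsUI [X in (_ + X)%N](_ : _ = 0%N) ?addn0.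
  apply: eq_card => -[x y]; rewrite !inE /=.
  by rewrite andb_orl.
apply/eqP; rewrite cards_eq0; apply/eqP/setP => -[x y]; rewrite !inE /=.
apply/negP => /andP[/and3P[xA _ _] /and3P[xB _ _]].
by have := disjointFr dAB xA; rewrite xB.
Qed.

Lemma shuffle_signUr A B D : [disjoint B & D]%B ->
  shuffle_sign A (B :|: D)%SET = shuffle_sign A B * shuffle_sign A D :> C.
Proof.
move=> dAB; rewrite !shuffle_signE -exprD; congr (_ ^+ _).
rewrite -cardsUI [X in (_ + X)%N](_ : _ = 0%N) ?addn0.
  by apply: eq_card => -[x y]; rewrite !inE /=; case: (x \in A); case: (_ < _)%N;
    rewrite ?andbT ?andbF ?orbF.
apply/eqP; rewrite cards_eq0; apply/eqP/setP => -[x y]; rewrite !inE /=.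
apply/negP => /andP[/and3P[_ xA _] /and3P[_ xB _]].
by have := disjointFr dAB xA; rewrite xB.
Qed.

Lemma shuffle_sign0l A : shuffle_sign finset.set0 A = 1 :> C.
Proof.
rewrite !shuffle_signE (_ : [set _ | _]%SET = finset.set0) ?cards0 //.
by apply/setP => -[x y]; rewrite !inE.
Qed.

Lemma shuffle_sign0r A : shuffle_sign A finset.set0 = 1 :> C.
Proof.
rewrite !shuffle_signE (_ : [set _ | _]%SET = finset.set0) ?cards0 //.
by apply/setP => -[x y]; rewrite !inE andbF.
Qed.

Lemma ext_scaleA (x y : C) a : escale x (escale y a) = escale (x * y) a.
Proof. by apply/ffunP => S; rewrite !ffunE mulrA. Qed.
Lemma ext_scale1 a : escale 1 a = a.
Proof. by apply/ffunP => S; rewrite !ffunE mul1r. Qed.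
Lemma ext_scaleDr : right_distributive (@escale R G) +%R.
Proof. by move=> x a b; apply/ffunP => S; rewrite !ffunE mulrDr. Qed.
Lemma ext_scaleDl a : {morph (fun x => escale x a) : x y / x + y}.
Proof. by move=> x y; apply/ffunP => S; rewrite !ffunE mulrDl. Qed.

HB.instance Definition _ := GRing.Zmodule_isLmodule.Build C (@ext R G)
  ext_scaleA ext_scale1 ext_scaleDr ext_scaleDl.

Lemma escaleE (x : C) a : escale x a = x *: a. Proof. by []. Qed.

Lemma extZE (x : C) a S : (x *: a) S = x * a S. Proof. by rewrite ffunE. Qed.

Lemma extDE a b S : (a + b) S = a S + b S. Proof. by rewrite ffunE. Qed.
Lemma extNE a S : (- a) S = - a S. Proof. by rewrite ffunE. Qed.
Lemma extBE a b S : (a - b) S = a S - b S. Proof. by rewrite !ffunE. Qed.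
Lemma ext0E S : (0 : @ext R G) S = 0. Proof. by rewrite ffunE. Qed.
Lemma ext_sumE (I : Type) (r : seq I) (P : pred I) (F : I -> @ext R G) S :
  (\sum_(i <- r | P i) F i) S = \sum_(i <- r | P i) F i S.
Proof. exact: (big_morph (fun a : @ext R G => a S) (fun a b => extDE a b S) (ext0E S)). Qed.

Lemma wedgeDl : left_distributive (@wedge R G) +%R.
Proof.
move=> a b c; apply/ffunP => S; rewrite !ffunE -big_split /=.
by apply: eq_bigr => A _; rewrite !ffunE mulrDr mulrDl.
Qed.
Lemma wedgeDr : right_distributive (@wedge R G) +%R.
Proof.
move=> a b c; apply/ffunP => S; rewrite !ffunE -big_split /=.
by apply: eq_bigr => A _; rewrite !ffunE mulrDr.
Qed.
Lemma wedge0l a : wedge 0 a = 0.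
Proof. by apply/ffunP => S; rewrite !ffunE big1 // => A _; rewrite ffunE mulr0 mul0r. Qed.
Lemma wedge0r a : wedge a 0 = 0.
Proof. by apply/ffunP => S; rewrite !ffunE big1 // => A _; rewrite ffunE mulr0. Qed.
Lemma wedgeZl (x : C) a b : wedge (x *: a) b = x *: wedge a b.
Proof.
apply/ffunP => S; rewrite !ffunE mulr_sumr.
by apply: eq_bigr => A _; rewrite !ffunE mulrCA !mulrA.
Qed.
Lemma wedgeZr (x : C) a b : wedge a (x *: b) = x *: wedge a b.
Proof.
apply/ffunP => S; rewrite !ffunE mulr_sumr.
by apply: eq_bigr => A _; rewrite !ffunE mulrCA !mulrA.
Qed.

Lemma ext_monomE a : a = \sum_(S : {set G}) a S *: monom S.
Proof.
apply/ffunP => S; rewrite ext_sumE (bigD1 S) //= big1 ?addr0 => [|T neTS].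
  by rewrite !ffunE eqxx mulr1.
by rewrite !ffunE eq_sym (negbTE neTS) mulr0.
Qed.

Lemma wedge_suml (I : Type) (r : seq I) (P : pred I) (F : I -> @ext R G) b :
  wedge (\sum_(i <- r | P i) F i) b = \sum_(i <- r | P i) wedge (F i) b.
Proof. exact: (big_morph (fun a => wedge a b) (fun x y => wedgeDl x y b) (wedge0l b)). Qed.
Lemma wedge_sumr (I : Type) (r : seq I) (P : pred I) (F : I -> @ext R G) b :
  wedge b (\sum_(i <- r | P i) F i) = \sum_(i <- r | P i) wedge b (F i).
Proof. exact: (big_morph (wedge b) (wedgeDr b) (wedge0r b)). Qed.

Lemma wedge_monom A B : wedge (monom A) (monom B) =
  if [disjoint A & B]%B then shuffle_sign A B *: monom (A :|: B)%SET
  else 0 :> @ext R G.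
Proof.
apply/ffunP => S; rewrite ffunE.
transitivity (\sum_(A' : {set G} | A' \subset S)
   (if (A' == A) && (S :\: A == B)%SET then shuffle_sign A B else 0 : C)).
  apply: eq_bigr => A' _; rewrite !ffunE; case: eqP => [->|] /=; last by rewrite mulr0 mul0r.
  by case: eqP => [->|]; rewrite ?mulr1 ?mulr0.
rewrite -big_mkcondr /= big_mkcondl /=.
have [dAB|ndAB] := ifP.
  rewrite !ffunE.
  case: (eqVneq S (A :|: B)%SET) => [->|neS].
    rewrite (big_pred1 A) => [|T /=]; first by rewrite finset.subsetUl mulr1.
    by rewrite finset.setDUl finset.setDv finset.set0U (finset.setDidPl _) ?eqxx ?andbT // disjoint_sym.
  rewrite mulr0 big1 // => T /andP[/eqP-> /eqP eB].
  case: ifP => // sub; case/eqP: neS; by rewrite -eB -{1}(finset.setID S A) (finset.setIidPr sub).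
rewrite ffunE big1 // => T /andP[/eqP-> /eqP eB].
by rewrite -eB -setI_eq0 finset.setIDA (finset.setIC A) -finset.setIDA finset.setDv finset.setI0 eqxx in ndAB.
Qed.

(** By multilinearity it is enough to compare monomials. Both bracketings give the union of the
    three sets, and each sign is the product of the three pairwise shuffle signs. *)
Lemma wedgeA : associative (@wedge R G).
Proof.
move=> a b c; rewrite (ext_monomE a) (ext_monomE b) (ext_monomE c).
rewrite !wedge_suml; apply: eq_bigr => A _.
rewrite !wedgeZl; congr (_ *: _).
rewrite (wedge_sumr _ _ (fun S => b S *: monom S) (monom A)) !wedge_suml wedge_sumr; apply: eq_bigr => B _.
rewrite !wedgeZl !wedgeZr !wedgeZl; congr (_ *: _).
rewrite !wedge_sumr; apply: eq_bigr => D _.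
rewrite !wedgeZr; congr (_ *: _).
rewrite !wedge_monom.
case: ifP => dBD; case: ifP => dAB; rewrite ?wedgeZr ?wedgeZl ?wedge_monom ?wedge0l ?wedge0r //.
- have -> : [disjoint A & (B :|: D)%SET]%B = [disjoint A & D]%B.
    by rewrite disj_setUr dAB.
  have -> : [disjoint (A :|: B)%SET & D]%B = [disjoint A & D]%B by rewrite disj_setUl dBD andbT.
  case: ifP => // dAD; last by rewrite !scaler0.
  rewrite !scalerA finset.setUA; congr (_ *: _).
  by rewrite shuffle_signUr // shuffle_signUl // mulrC -mulrA.
- by rewrite disj_setUr dAB /= scaler0.
- by rewrite disj_setUl dBD andbF scaler0.
Qed.

Lemma ext1E : ext1 G = monom finset.set0 :> @ext R G. Proof. by []. Qed.

Lemma wedge1l : left_id (ext1 G) (@wedge R G).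
Proof.
move=> a; rewrite {1}(ext_monomE a) wedge_sumr {2}(ext_monomE a); apply: eq_bigr => A _.
by rewrite wedgeZr wedge_monom disj_set0l shuffle_sign0l scale1r finset.set0U.
Qed.
Lemma wedge1r : right_id (ext1 G) (@wedge R G).
Proof.
move=> a; rewrite {1}(ext_monomE a) wedge_suml {2}(ext_monomE a); apply: eq_bigr => A _.
by rewrite wedgeZl wedge_monom disj_set0r shuffle_sign0r scale1r finset.setU0.
Qed.
Lemma ext1_neq0 : ext1 G != 0 :> @ext R G.
Proof. by apply/eqP => /ffunP/(_ finset.set0)/eqP; rewrite !ffunE eqxx oner_eq0. Qed.

(** With [wedge] as ring product, the iterated products of the definitions become [\prod] and [^+],
    and the general theory of big operators applies to forms. *)
HB.instance Definition _ := GRing.Zmodule_isNzRing.Build (@ext R G)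
  wedgeA wedge1l wedge1r wedgeDl wedgeDr ext1_neq0.
HB.instance Definition _ := GRing.Lmodule_isLalgebra.Build C (@ext R G)
  (fun x a b => esym (wedgeZl x a b)).
HB.instance Definition _ := GRing.Lalgebra_isAlgebra.Build C (@ext R G)
  (fun x a b => esym (wedgeZr x a b)).

Lemma wedgeE a b : wedge a b = a * b. Proof. by []. Qed.
Lemma ext1_1 : ext1 G = 1 :> @ext R G. Proof. by []. Qed.
Lemma big_wedge (I : Type) (r : seq I) (P : pred I) (F : I -> @ext R G) :
  \big[@wedge R G/ext1 G]_(i <- r | P i) F i = \prod_(i <- r | P i) F i.
Proof. by []. Qed.
Lemma wexpE a k : wexp a k = a ^+ k.
Proof. by elim: k => // k IH; rewrite exprS -IH. Qed.
End ExtRing.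

Section EnumRank.
Variable G : finType.
Implicit Types (A B S : {set G}).

(** Monomials are products in this order, and [enum] lists a set increasingly for it. This is the
    link between [subst], which multiplies along [enum], and [shuffle_sign]. *)
Definition rank_lt (x y : G) := (enum_rank x < enum_rank y)%N.

Lemma rank_lt_trans : transitive rank_lt.
Proof. by move=> y x z; apply: ltn_trans. Qed.

Lemma rank_lt_irr : irreflexive rank_lt.
Proof. by move=> x; rewrite /rank_lt ltnn. Qed.

Lemma rank_lt_neq x y : x != y -> ~~ rank_lt x y -> rank_lt y x.
Proof.
move=> ne; rewrite /rank_lt -leqNgt leq_eqVlt => /orP[/eqP/val_inj/enum_rank_inj e|//].
by rewrite e eqxx in ne.
Qed.

Lemma enum_rank_sorted A : sorted rank_lt (enum A).
Proof.
rewrite /enum_mem; apply: sorted_filter; first exact: rank_lt_trans.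
rewrite -enumT.
case E : (enum G) => [//|x0 l]; rewrite -E.
apply/(sortedP x0) => i hi.
have hi' : (i < #|G|)%N by rewrite cardE; apply: ltnW.
have hi'' : (i.+1 < #|G|)%N by rewrite cardE.
rewrite /rank_lt.
have -> : nth x0 (enum G) i = enum_val (Ordinal hi') by rewrite (enum_val_nth x0).
have -> : nth x0 (enum G) i.+1 = enum_val (Ordinal hi'') by rewrite (enum_val_nth x0).
by rewrite !enum_valK.
Qed.

Lemma enum_rank_eq A (l : seq G) : sorted rank_lt l -> l =i A -> enum A = l.
Proof.
move=> sl eA; apply: (irr_sorted_eq rank_lt_trans rank_lt_irr) => //.
  exact: enum_rank_sorted.
by move=> x; rewrite mem_enum eA.
Qed.

Lemma enum_cons_min A : A != finset.set0 -> exists2 g, g \in A &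
  enum A = g :: enum (A :\ g)%SET /\ forall x, x \in (A :\ g)%SET -> rank_lt g x.
Proof.
move=> A0; have := enum_rank_sorted A; case E : (enum A) => [|g l] sl.
  by case/set0Pn: A0 => x; rewrite -mem_enum E.
have mE x : (x \in A) = (x \in g :: l) by rewrite -mem_enum E.
have al := order_path_min rank_lt_trans sl.
have gl : g \notin l by apply/negP => /(allP al); rewrite rank_lt_irr.
have eqA : l =i (A :\ g)%SET.
  move=> x; rewrite !inE mE inE; case: eqVneq => [->|//] /=.
  exact: negbTE.
exists g; first by rewrite mE mem_head.
split=> [|x]; last by rewrite -eqA => /(allP al).
by congr cons; apply/esym/enum_rank_eq; first exact: path_sorted sl.
Qed.

Lemma enum_split g A : enum A = enum [set x in A | rank_lt x g]%SET ++ enum [set x in A | ~~ rank_lt x g]%SET.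
Proof.
apply: enum_rank_eq; last by move=> x; rewrite mem_cat !mem_enum !inE; case: (_ \in _) => //=; rewrite orbN.
rewrite (sorted_pairwise rank_lt_trans) pairwise_cat -!(sorted_pairwise rank_lt_trans) !enum_rank_sorted !andbT.
apply/allrelP => x y; rewrite !mem_enum !inE => /andP[_ xg] /andP[_ yg].
rewrite /rank_lt -leqNgt in xg yg *; exact: leq_trans xg yg.
Qed.

End EnumRank.

(** * Substitution of generators as an algebra morphism *)

Section Subst.
Context {R : realType}.
Local Notation C := R[i].

Definition hdeg (G : finType) (k : nat) (a : @ext R G) := forall S : {set G}, #|S| != k -> a S = 0.

Lemma hdeg0 (G : finType) k : hdeg k (0 : @ext R G).
Proof. by move=> S _; rewrite ext0E. Qed.
Lemma hdegD (G : finType) k (a b : @ext R G) : hdeg k a -> hdeg k b -> hdeg k (a + b).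
Proof. by move=> ha hb S hS; rewrite extDE ha // hb // addr0. Qed.
Lemma hdegN (G : finType) k (a : @ext R G) : hdeg k a -> hdeg k (- a).
Proof. by move=> ha S hS; rewrite extNE ha // oppr0. Qed.
Lemma hdegZ (G : finType) k c (a : @ext R G) : hdeg k a -> hdeg k (c *: a).
Proof. by move=> ha S hS; rewrite extZE ha // mulr0. Qed.
Lemma hdeg_sum (G : finType) k (I : Type) (r : seq I) (P : pred I) (F : I -> @ext R G) :
  (forall i, P i -> hdeg k (F i)) -> hdeg k (\sum_(i <- r | P i) F i).
Proof. by move=> h; elim/big_ind: _ => //; [exact: hdeg0|move=> a b; exact: hdegD]. Qed.
Lemma hdeg_monom (G : finType) (S : {set G}) : hdeg #|S| (monom S : @ext R G).
Proof. by move=> T; rewrite ffunE => hT; case: eqP => // eT; rewrite eT eqxx in hT. Qed.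
Lemma hdegM (G : finType) j k (a b : @ext R G) : hdeg j a -> hdeg k b -> hdeg (j + k) (a * b).
Proof.
move=> ha hb S hS; rewrite ffunE big1 // => A sA.
have [cA|/ha->] := eqVneq #|A| j; last by rewrite mulr0 mul0r.
rewrite hb ?mulr0 //; apply: contraNneq hS => <-; rewrite -cA.
by rewrite -(cardsID A S) (finset.setIidPr sA).
Qed.
Lemma hdeg1 (G : finType) : hdeg 0 (1 : @ext R G).
Proof. by rewrite -(@cards0 G); exact: hdeg_monom. Qed.
Lemma hdeg_gen (G : finType) (g : G) : hdeg 1 (gen g : @ext R G).
Proof. by rewrite -(@cards1 G g); exact: hdeg_monom. Qed.
Lemma ext_monomsE (G : finType) (a : @ext R G) : a = \sum_(S : {set G}) a S *: monom S.
Proof. exact: ext_monomE. Qed.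

Lemma hdeg1E (G : finType) (a : @ext R G) : hdeg 1 a -> a = \sum_g a [set g]%SET *: gen g.
Proof.
move=> ha; apply/ffunP => S; rewrite ext_sumE.
have [/eqP/cards1P[g ->]|hS] := eqVneq #|S| 1%N.
  rewrite (bigD1 g) //= big1 => [|h hg]; first by rewrite !ffunE eqxx mulr1 addr0.
  rewrite !ffunE; case: eqP => [/set1_inj e|]; last by rewrite mulr0.
  by rewrite e eqxx in hg.
rewrite ha // big1 // => g _; rewrite !ffunE; case: eqP => [e|]; last by rewrite mulr0.
by rewrite e cards1 in hS.
Qed.

Lemma shuffle_sign1 (G : finType) (g h : G) :
  shuffle_sign [set g]%SET [set h]%SET = (-1) ^+ rank_lt h g :> C.
Proof.
rewrite shuffle_signE; congr (_ ^+ _); rewrite /rank_lt; case: (boolP (_ < _)%N) => hg.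
  rewrite -[RHS](cards1 (g, h)); apply: eq_card => -[x y]; rewrite !inE /= -pair_eqE /=.
  by case: eqP => [->|//]; case: eqP => [->|//]; rewrite hg.
apply: eq_card0 => -[x y]; rewrite !inE /=.
by case: eqP => [->|//]; case: eqP => [->|//]; rewrite (negbTE hg).
Qed.

Lemma gen_sqr (G : finType) (g : G) : gen g * gen g = 0 :> @ext R G.
Proof. by rewrite -wedgeE wedge_monom -setI_eq0 finset.setIid -finset.cards_eq0 cards1. Qed.

Lemma gen_anticomm (G : finType) (g h : G) : gen g * gen h = - (gen h * gen g) :> @ext R G.
Proof.
have [->|hg] := eqVneq h g; first by rewrite gen_sqr oppr0.
rewrite -!wedgeE !wedge_monom !disjoints1 !inE [g == h]eq_sym (negbTE hg) /=.
rewrite finset.setUC !shuffle_sign1 -scaleNr; congr (_ *: _).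
have gh : g != h by rewrite eq_sym.
case: (boolP (rank_lt h g)) => l1; case: (boolP (rank_lt g h)) => l2; rewrite ?expr1 ?expr0 ?opprK //.
  by have := rank_lt_trans l1 l2; rewrite rank_lt_irr.
by have := rank_lt_neq gh l2; rewrite (negbTE l1).
Qed.

Lemma hdeg1_anticomm (G : finType) (a b : @ext R G) : hdeg 1 a -> hdeg 1 b -> a * b = - (b * a).
Proof.
move=> /hdeg1E-> /hdeg1E->; rewrite !mulr_suml -sumrN.
under eq_bigr do rewrite mulr_sumr.
under [RHS]eq_bigr do rewrite mulr_sumr -sumrN.
rewrite exchange_big; apply: eq_bigr => g _; apply: eq_bigr => h _.
by rewrite -!scalerAl -!scalerAr !scalerA gen_anticomm scalerN mulrC.
Qed.

Lemma hdeg1_sqr (G : finType) (a : @ext R G) : hdeg 1 a -> a * a = 0.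
Proof.
move=> ha; have /eqP := hdeg1_anticomm ha ha; rewrite -subr_eq0 opprK -mulr2n -scaler_nat scaler_eq0.
by rewrite pnatr_eq0 /= => /eqP.
Qed.

Section Hom.
Variables (G G' : finType) (M : G -> @ext R G').
Hypothesis M1 : forall g, hdeg 1 (M g).
Implicit Types (A B S : {set G}).

Let P A := \prod_(g <- enum A) M g.

Lemma prod_comm1 (l : seq G) g : M g * \prod_(h <- l) M h = (-1) ^+ size l *: (\prod_(h <- l) M h * M g).
Proof.
elim: l => [|h l IH]; first by rewrite !big_nil mul1r mulr1 scale1r.
rewrite !big_cons mulrA (hdeg1_anticomm (M1 g) (M1 h)) mulNr -!mulrA IH /= exprS mulN1r scaleNr.
by rewrite -scalerAr.
Qed.

(** [M g] is moved past the factors preceding [g], with one sign for each. If [g] already occurs, it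
    meets its own copy, and an element of degree 1 has square 0. *)
Lemma prod_insert g A : M g * P A = if g \in A then 0 else shuffle_sign [set g]%SET A *: P (g |: A)%SET.
Proof.
rewrite /P (enum_split g A) big_cat /= mulrA prod_comm1 -scalerAl -mulrA.
case: ifP => gA.
  set A2 := [set x in A | ~~ rank_lt x g]%SET.
  have gA2 : g \in A2 by rewrite !inE gA rank_lt_irr.
  have /enum_cons_min [h hA2 [-> hmin]] : A2 != finset.set0 by apply/set0Pn; exists g.
  have -> : h = g.
    apply/eqP/negP => /negP hg; have /hmin : g \in (A2 :\ h)%SET by rewrite in_setD1 eq_sym hg.
    by move: hA2; rewrite inE => /andP[_] /negbTE->.
  by rewrite big_cons (mulrA (M g)) hdeg1_sqr // mul0r mulr0 scaler0.
have -> : enum (g |: A)%SET = enum [set x in A | rank_lt x g]%SET ++ g :: enum [set x in A | ~~ rank_lt x g]%SET.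
  rewrite (enum_split g); congr (_ ++ _).
    by apply: eq_enum => x; rewrite !inE; case: eqP => //= ->; rewrite gA rank_lt_irr.
  apply: enum_rank_eq => /=.
    rewrite path_sortedE; last exact: rank_lt_trans.
    rewrite enum_rank_sorted andbT; apply/allP => x; rewrite mem_enum inE => /andP[xA].
    by apply: rank_lt_neq; apply: contraFneq gA => <-.
  by move=> x; rewrite !inE mem_enum !inE; case: eqP => //= ->; rewrite rank_lt_irr.
rewrite big_cat big_cons /=; congr (_ *: _); rewrite shuffle_signE; congr (_ ^+ _).
rewrite -cardE -(card_imset _ (_ : injective (pair g))); last by move=> x y [].
apply: eq_card => -[x y]; rewrite !inE /=; apply/imsetP/idP.
  by move=> [z]; rewrite inE => /andP[zA zg] [-> ->]; rewrite eqxx zA.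
by move=> /and3P[/eqP-> yA yx]; exists y; rewrite // inE yA.
Qed.

(** Induction on the size of [A]: its least element is split off, has no inversion with the rest of
    [A], and is inserted into the product over the remaining union. *)
Lemma prod_monom A B : P A * P B = if [disjoint A & B]%B then shuffle_sign A B *: P (A :|: B)%SET else 0.
Proof.
have [k] := ubnP #|A|; elim: k A => // k IH A hA.
have [->|A0] := eqVneq A finset.set0.
  by rewrite disj_set0l shuffle_sign0l finset.set0U scale1r /P enum_set0 big_nil mul1r.
have [g gA [eA gmin]] := enum_cons_min A0.
have AE : A = (g |: A :\ g)%SET by rewrite finset.setD1K.
rewrite {1}/P eA big_cons -mulrA IH; last by rewrite (cardsD1 g A) gA in hA.
rewrite [in RHS]AE disj_setUl disjoints1.
case: ifP => dAB; last by rewrite andbF mulr0.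
rewrite -scalerAr prod_insert !inE eqxx /= andbT.
case: ifP => gB; first by rewrite scaler0.
have dg : [disjoint [set g]%SET & (A :\ g)%SET]%B by rewrite disjoints1 !inE eqxx.
rewrite scalerA finset.setUA; congr (_ *: _).
rewrite shuffle_signUl // shuffle_signUr // mulrC.
suff -> : shuffle_sign [set g]%SET (A :\ g)%SET = 1 :> C by rewrite mul1r.
rewrite shuffle_signE eq_card0 // => -[x y]; rewrite !inE /=.
apply/negP => /and3P[/eqP-> yA yg].
by have := gmin y; rewrite !inE => /(_ yA) /rank_lt_trans/(_ yg); rewrite rank_lt_irr.
Qed.

Lemma subst_is_linear : linear (subst M).
Proof.
move=> c a b; rewrite /subst scaler_sumr -big_split /=; apply: eq_bigr => S _.
by rewrite !escaleE extDE extZE scalerDl scalerA.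
Qed.
HB.instance Definition _ := GRing.isLinear.Build C (@ext R G) (@ext R G') _ (subst M) subst_is_linear.

Lemma subst_monom A : subst M (monom A) = P A.
Proof.
rewrite /subst (bigD1 A) //= big1 ?addr0 => [|S SA]; first by rewrite ffunE eqxx escaleE scale1r.
by rewrite ffunE (negbTE SA) escaleE scale0r.
Qed.

Lemma substD a b : subst M (a + b) = subst M a + subst M b.
Proof. exact: linearD. Qed.
Lemma substN a : subst M (- a) = - subst M a.
Proof. exact: linearN. Qed.
Lemma substZ c a : subst M (c *: a) = c *: subst M a.
Proof. exact: linearZ. Qed.
Lemma subst0 : subst M 0 = 0.
Proof. exact: linear0. Qed.
Lemma subst_sum (I : Type) (r : seq I) (Q : pred I) (F : I -> @ext R G) :
  subst M (\sum_(i <- r | Q i) F i) = \sum_(i <- r | Q i) subst M (F i).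
Proof. exact: linear_sum. Qed.

Local Opaque subst.

(** Elements of degree 1 anticommute and have square zero, so the images of the generators satisfy
    the relations of the exterior algebra; on monomials this is [prod_monom]. *)
Lemma substM a b : subst M (a * b) = subst M a * subst M b.
Proof.
rewrite (ext_monomsE a) (ext_monomsE b) mulr_suml !subst_sum mulr_suml.
apply: eq_bigr => A _; rewrite !mulr_sumr subst_sum; apply: eq_bigr => B _.
rewrite -scalerAl -scalerAr !substZ -scalerAl -scalerAr; do 2 congr (_ *: _).
rewrite -wedgeE wedge_monom !subst_monom prod_monom; case: ifP => _; last by rewrite subst0.
by rewrite substZ subst_monom.
Qed.

Lemma subst1 : subst M 1 = 1.
Proof. by rewrite -ext1_1 ext1E subst_monom /P enum_set0 big_nil. Qed.

Lemma subst_gen g : subst M (gen g) = M g.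
Proof. by rewrite /gen subst_monom /P enum_set1 big_seq1. Qed.

Global Opaque subst.

End Hom.

Lemma monom_prod (G : finType) (A : {set G}) : monom A = \prod_(g <- enum A) gen g :> @ext R G.
Proof.
have [k] := ubnP #|A|; elim: k A => // k IH A hA.
have [->|A0] := eqVneq A finset.set0; first by rewrite enum_set0 big_nil.
have [g gA [eA gmin]] := enum_cons_min A0.
rewrite eA big_cons -IH; last by rewrite (cardsD1 g A) gA in hA.
rewrite -wedgeE wedge_monom disjoints1 !inE eqxx /= finset.setD1K //.
rewrite shuffle_signE eq_card0 ?scale1r // => -[x y]; rewrite !inE /=.
apply/negP => /and3P[/eqP-> yA yg].
by have := gmin y; rewrite !inE => /(_ yA) /rank_lt_trans/(_ yg); rewrite rank_lt_irr.
Qed.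

Lemma subst_prod (G G' : finType) (M : G -> @ext R G') (I : Type) (r : seq I) (F : I -> @ext R G) :
  (forall g, hdeg 1 (M g)) ->
  subst M (\prod_(i <- r) F i) = \prod_(i <- r) subst M (F i).
Proof. by move=> M1; elim: r => [|i r IH]; rewrite ?big_nil ?subst1 // !big_cons substM // IH. Qed.

Lemma subst_comp (G G' G'' : finType) (M : G -> @ext R G') (M' : G' -> @ext R G'') (a : @ext R G) :
  (forall g, hdeg 1 (M g)) -> (forall g, hdeg 1 (M' g)) ->
  subst M' (subst M a) = subst (fun g => subst M' (M g)) a.
Proof.
move=> h1 h2; rewrite [in LHS](ext_monomE a) [in RHS](ext_monomE a) (subst_sum M) (subst_sum M').
rewrite (subst_sum (fun g => subst M' (M g))); apply: eq_bigr => S _.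
by rewrite (substZ M) (substZ M') substZ !subst_monom subst_prod.
Qed.

Lemma hdeg_subst (G G' : finType) (M : G -> @ext R G') k (a : @ext R G) :
  (forall g, hdeg 1 (M g)) -> hdeg k a -> hdeg k (subst M a).
Proof.
move=> M1 ha; rewrite (ext_monomE a) subst_sum; apply: hdeg_sum => S _; rewrite substZ.
have [<-|/ha->] := eqVneq #|S| k; last by rewrite scale0r; exact: hdeg0.
apply: hdegZ; rewrite subst_monom cardE; elim: (enum S) => [|g l IH].
  by rewrite big_nil; exact: hdeg1.
by rewrite big_cons; exact: (hdegM (M1 g) IH).
Qed.

Lemma subst_id (G : finType) (a : @ext R G) : subst (@gen R G) a = a.
Proof.
rewrite {2}(ext_monomE a) {1}(ext_monomE a) subst_sum; apply: eq_bigr => S _.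
by rewrite substZ subst_monom -monom_prod.
Qed.

Lemma eq_subst (G G' : finType) (M M' : G -> @ext R G') : M =1 M' -> subst M =1 subst M'.
Proof. by move=> e a; rewrite (funext e). Qed.

End Subst.

(** * Frames and restriction to the tangent space *)

Section ComplexNorm.
Context {R : realType}.
Local Notation C := R[i].
Implicit Types (x y : C).

(** The modulus as an element of [R]: the norm of [R[i]] has values in [R[i]], which can be fed
    neither to [powR] nor to integrals. *)
Definition cn x : R := complex.Re `|x|.

Lemma cnE x : `|x| = (cn x)%:C.
Proof. by rewrite /cn RRe_real // normr_real. Qed.
Lemma cn_ge0 x : 0 <= cn x. Proof. by rewrite -ler0c -cnE normr_ge0. Qed.
Lemma cn0 : cn 0 = 0. Proof. by rewrite /cn normr0. Qed.
Lemma cn1 : cn 1 = 1. Proof. by rewrite /cn normr1. Qed.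
Lemma cnM x y : cn (x * y) = cn x * cn y.
Proof. by apply: complexI; rewrite rmorphM /= -!cnE normrM. Qed.
Lemma cnD x y : cn (x + y) <= cn x + cn y.
Proof. by rewrite -lecR rmorphD /= -!cnE ler_normD. Qed.
Lemma cnN x : cn (- x) = cn x. Proof. by rewrite /cn normrN. Qed.
Lemma cnBC x y : cn (x - y) = cn (y - x). Proof. by rewrite -cnN opprB. Qed.
Lemma cn_eq0 x : (cn x == 0) = (x == 0).
Proof. by rewrite -[RHS]normr_eq0 cnE -(inj_eq (@complexI R)). Qed.
Lemma cn_gt0 x : (0 < cn x) = (x != 0).
Proof. by rewrite lt_neqAle cn_ge0 andbT eq_sym cn_eq0. Qed.
Lemma cnV x : cn x^-1 = (cn x)^-1.
Proof. by apply: complexI; rewrite fmorphV /= -!cnE normfV. Qed.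
Lemma cnX x k : cn (x ^+ k) = cn x ^+ k.
Proof. by elim: k => [|k IH]; rewrite ?cn1 // !exprS cnM IH. Qed.
Lemma cnJ x : cn (x^*) = cn x.
Proof. by rewrite /cn normcJ. Qed.
Lemma cn_sum (I : Type) (r : seq I) (P : pred I) (F : I -> C) :
  cn (\sum_(i <- r | P i) F i) <= \sum_(i <- r | P i) cn (F i).
Proof.
elim/big_ind2: _ => //; first by rewrite cn0.
by move=> a b c d h1 h2; apply: le_trans (cnD _ _) _; apply: lerD.
Qed.
Lemma cn_real (r : R) : cn r%:C = `|r|.
Proof. by apply: complexI; rewrite -cnE normc_def /= expr0n addr0 sqrtr_sqr. Qed.
Lemma cn_Re x : `|complex.Re x| <= cn x.
Proof. by rewrite -lecR -cnE; exact: normc_ge_Re. Qed.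
Lemma cnE2 x : cn x = Num.sqrt (complex.Re x ^+ 2 + complex.Im x ^+ 2).
Proof. by apply: complexI; rewrite -cnE normc_def. Qed.
Lemma cn_sqr x : cn x ^+ 2 = complex.Re x ^+ 2 + complex.Im x ^+ 2.
Proof. by rewrite cnE2 sqr_sqrtr // addr_ge0 ?sqr_ge0. Qed.
Lemma cn_Im x : `|complex.Im x| <= cn x.
Proof. by rewrite cnE2 -sqrtr_sqr ler_sqrt ?addr_ge0 ?sqr_ge0 // lerDr sqr_ge0. Qed.
Lemma cn_ReIm x : cn x <= `|complex.Re x| + `|complex.Im x|.
Proof.
have h : 0 <= `|complex.Re x| + `|complex.Im x| by rewrite addr_ge0.
rewrite -(ler_pXn2r (_ : 0 < 2)%N) ?nnegrE ?cn_ge0 // cn_sqr sqrrD !real_normK ?num_real //.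
by rewrite addrAC lerDl mulrn_wge0 // mulr_ge0.
Qed.
Lemma conjc_mul x : x * x^* = (cn x ^+ 2)%:C.
Proof. by rewrite -sqr_normc cnE rmorphXn. Qed.
Lemma cn_sign k : cn ((-1) ^+ k) = 1.
Proof. by rewrite cnX cnN cn1 expr1n. Qed.
Lemma cn_nat k : cn k%:R = k%:R.
Proof.
by rewrite -[k%:R in LHS](rmorph_nat (@real_complex R)) cn_real ger0_norm.
Qed.
Lemma cn_imC : cn (imC : C) = 1.
Proof. by rewrite cnE2 /= expr0n /= add0r expr1n sqrtr1. Qed.

End ComplexNorm.

Section ExtNorm.
Context {R : realType}.
Local Notation C := R[i].
Variable (G : finType).
Implicit Types (a b : @ext R G).

(** The l1 norm of the coefficients is submultiplicative for the exterior product with constant 1,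
    which keeps the bounds for long products of forms free of combinatorial factors. *)
Definition en a : R := \sum_S cn (a S).

Lemma en_ge0 a : 0 <= en a.
Proof. by apply: sumr_ge0 => S _; exact: cn_ge0. Qed.
Lemma en0 : en 0 = 0.
Proof. by rewrite /en big1 // => S _; rewrite ext0E cn0. Qed.
Lemma enD a b : en (a + b) <= en a + en b.
Proof. by rewrite -big_split /=; apply: ler_sum => S _; rewrite extDE cnD. Qed.
Lemma enN a : en (- a) = en a.
Proof. by apply: eq_bigr => S _; rewrite extNE cnN. Qed.
Lemma enB a b : en (a - b) <= en a + en b.
Proof. by rewrite (le_trans (enD _ _)) // enN. Qed.
Lemma enZ c a : en (c *: a) = cn c * en a.
Proof. by rewrite mulr_sumr; apply: eq_bigr => S _; rewrite extZE cnM. Qed.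
Lemma en_sum (I : Type) (r : seq I) (P : pred I) (F : I -> @ext R G) :
  en (\sum_(i <- r | P i) F i) <= \sum_(i <- r | P i) en (F i).
Proof.
elim/big_ind2: _ => //; first by rewrite en0.
by move=> a b c d h1 h2; apply: le_trans (enD _ _) _; apply: lerD.
Qed.
Lemma cn_le_en a S : cn (a S) <= en a.
Proof. by rewrite /en (bigD1 S) //= lerDl sumr_ge0 // => T _; exact: cn_ge0. Qed.
Lemma en_monom S : en (monom S : @ext R G) = 1.
Proof.
rewrite /en (bigD1 S) //= ffunE eqxx cn1 big1 ?addr0 // => T TS.
by rewrite ffunE (negbTE TS) cn0.
Qed.
Lemma en1 : en 1 = 1. Proof. exact: en_monom. Qed.
Lemma en_gen g : en (gen g : @ext R G) = 1. Proof. exact: en_monom. Qed.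
Lemma en_eq0 a : en a = 0 -> a = 0.
Proof.
move=> h; apply/ffunP => S; apply/eqP; rewrite ext0E -cn_eq0 eq_le cn_ge0 andbT.
by rewrite -h cn_le_en.
Qed.

Lemma cn_shuffle (A B : {set G}) : cn (shuffle_sign A B : C) = 1.
Proof. exact: cn_sign. Qed.

Lemma enM a b : en (a * b) <= en a * en b.
Proof.
rewrite {1}(ext_monomsE a) {1}(ext_monomsE b) mulr_suml.
rewrite (le_trans (en_sum _ _ _)) // {2}/en mulr_suml; apply: ler_sum => A _.
rewrite mulr_sumr (le_trans (en_sum _ _ _)) // mulr_sumr; apply: ler_sum => B _.
rewrite -scalerAl -scalerAr !enZ mulrA ler_piMr ?mulr_ge0 ?cn_ge0 //.
rewrite -wedgeE wedge_monom; case: ifP => _; last by rewrite en0.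
by rewrite enZ en_monom cn_shuffle mulr1.
Qed.

Lemma enX a k : en (a ^+ k) <= en a ^+ k.
Proof.
elim: k => [|k IH]; first by rewrite !expr0 en1.
by rewrite !exprS (le_trans (enM _ _)) // ler_wpM2l ?en_ge0.
Qed.

Lemma en_prod (I : Type) (r : seq I) (F : I -> @ext R G) :
  en (\prod_(i <- r) F i) <= \prod_(i <- r) en (F i).
Proof.
elim: r => [|i r IH]; first by rewrite !big_nil en1.
by rewrite !big_cons (le_trans (enM _ _)) // ler_wpM2l ?en_ge0.
Qed.

End ExtNorm.

Lemma en_subst (R : realType) (G G' : finType) (M : G -> @ext R G') (B : R) (a : @ext R G) :
  1 <= B -> (forall g, en (M g) <= B) -> en (subst M a) <= B ^+ #|G| * en a.
Proof.
move=> B1 hM; rewrite (ext_monomsE a) (subst_sum M) (le_trans (en_sum _ _ _)) //.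
rewrite -(ext_monomsE a) [X in _ * X]/en mulr_sumr; apply: ler_sum => S _.
rewrite substZ enZ mulrC ler_wpM2r ?cn_ge0 // subst_monom.
rewrite (le_trans (en_prod _ _)) //.
have B0 : 0 <= B by rewrite (le_trans ler01).
apply: (@le_trans _ _ (B ^+ size (enum S))).
  elim: (enum S) => [|g l IH]; first by rewrite big_nil.
  by rewrite big_cons exprS ler_pM ?en_ge0 // prodr_ge0 // => i _; exact: en_ge0.
by rewrite ler_weXn2l // -cardE max_card.
Qed.

Definition adjm (R : realType) m k (A : 'M[R[i]]_(m, k)) := (map_mx conjc A)^T.

Section Adjoint.
Context {R : realType}.
Local Notation C := R[i].

Lemma adjmE m k (A : 'M[C]_(m, k)) i j : adjm A i j = (A j i)^*.
Proof. by rewrite !mxE. Qed.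
Lemma adjmK m k (A : 'M[C]_(m, k)) : adjm (adjm A) = A.
Proof. by apply/matrixP => i j; rewrite !adjmE conjcK. Qed.
Lemma adjmM m k l (A : 'M[C]_(m, k)) (B : 'M[C]_(k, l)) : adjm (A *m B) = adjm B *m adjm A.
Proof. by rewrite /adjm map_mxM trmx_mul. Qed.
Lemma adjm0 m k : adjm (0 : 'M[C]_(m, k)) = 0.
Proof. by rewrite /adjm map_mx0 trmx0. Qed.
Lemma mul_adjm_eq0 m k (A : 'M[C]_(m, k)) : A *m adjm A = 0 -> A = 0.
Proof.
move=> h; apply/matrixP => i j; rewrite [RHS]mxE; apply/eqP.
have /eqP := congr1 (fun B : 'M[C]_m => B i i) h; rewrite !mxE.
under eq_bigr do rewrite adjmE conjc_mul.
rewrite -rmorph_sum /= (inj_eq (@complexI R)) psumr_eq0 => [|l _]; last exact: sqr_ge0.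
by move=> /allP/(_ j (mem_index_enum _)) /=; rewrite sqrf_eq0 cn_eq0.
Qed.

(** A row killed by the Gram matrix gives a combination of the rows of [A] of norm 0, hence equal to
    0, and these rows are independent. *)
Lemma gram_unit m k (A : 'M[C]_(m, k)) : \rank A = m -> A *m adjm A \in unitmx.
Proof.
move=> rA; rewrite -row_free_unit -kermx_eq0; apply/eqP.
set K := kermx _; have : (K *m A) *m adjm (K *m A) = 0.
  by rewrite adjmM -mulmxA (mulmxA A) (mulmxA K) mulmx_ker mul0mx.
move/mul_adjm_eq0 => /eqP.
have fA : row_free A by rewrite /row_free rA.
by rewrite mulmx_free_eq0 // => /eqP.
Qed.

End Adjoint.

Lemma mulmx1C_eq (K : fieldType) (m k : nat) (A : 'M[K]_(m, k)) (B : 'M[K]_(k, m)) :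
  k = m -> A *m B = 1%:M -> B *m A = 1%:M.
Proof. by move=> e; case: _ / (esym e) A B => A B; exact: mulmx1C. Qed.

Section Frames.
Context {R : realType} (N nu n : nat).
Local Notation C := R[i].
Variable f : 'I_nu -> mpoly N C.
Hypothesis HN : N = (n + nu)%N.
Local Notation point := 'rV[C]_N.

Definition is_frame (z : point) (A : 'M[C]_(n, N)) :=
  A *m (jac f z)^T = 0 /\ A *m adjm A = 1%:M.

(** Gram-Schmidt on a basis of the kernel of the Jacobian, whose dimension is N - nu = n. It rules
    out that the choice in [frame] returns its default value 0. *)
Lemma frame_exists z : \rank (jac f z) = nu -> exists A, is_frame z A.
Proof.
move=> rJ; set K := kermx (jac f z)^T.
have rK : \rank K = n by rewrite mxrank_ker mxrank_tr rJ HN addnK.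
exists (castmx (rK, erefl) (schmidt (row_base K))).
have rKN : (\rank K <= N)%N by exact: rank_leq_col.
split.
  have : (schmidt (row_base K) <= K)%MS.
    by rewrite eqmx_schmidt_free ?row_base_free // eq_row_base.
  move/sub_kermxP; set B := schmidt _; rewrite -/K => h.
  by case: _ / rK B h => B h; rewrite castmx_id.
have /unitarymxP := schmidt_unitarymx (row_base K) rKN.
set B := schmidt _; clearbody B.
by case: _ / rK B => B h; rewrite castmx_id /adjm map_trmx; exact: h.
Qed.

Lemma frameP z : regcone f z -> is_frame z (frame n f z).
Proof.
move=> [_ rJ]; rewrite /frame; case: xgetP => [A _ //|no].
by have [A hA] := frame_exists rJ; have := no A.
Qed.

(** The orthogonal projection of row vectors onto T_z X, expressed by the Gram matrix of the
    Jacobian. Its entries are rational in the coordinates and their conjugates, hence Borel, whereas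
    nothing is known about how [frame] depends on z. *)
Definition tproj (z : point) : 'M[C]_N :=
  1%:M - (jac f z)^T *m invmx (adjm (jac f z)^T *m (jac f z)^T) *m adjm (jac f z)^T.

Lemma jac_gram_unit z : \rank (jac f z) = nu ->
  adjm (jac f z)^T *m (jac f z)^T \in unitmx.
Proof.
move=> rJ; set B := (jac f z)^T.
have := @gram_unit _ _ _ (adjm B); rewrite adjmK; apply.
by rewrite /adjm mxrank_tr mxrank_map mxrank_tr.
Qed.

(** The rows of [W] are the frame and the conjugate gradients, tangent and normal directions, so [W]
    is invertible. Both sides fix the former and kill the latter. *)
Lemma tprojE z : regcone f z -> adjm (frame n f z) *m frame n f z = tproj z.
Proof.
move=> rz; have [FJ FF] := frameP rz; have [_ rJ] := rz.
have uG := jac_gram_unit rJ.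
set F := frame n f z in FJ FF *; set B := (jac f z)^T in FJ uG *.
pose W := col_mx F (adjm B).
have BF : adjm B *m adjm F = 0 by rewrite -adjmM FJ adjm0.
have uW : W *m row_mx (adjm F) (B *m invmx (adjm B *m B)) = 1%:M.
  rewrite mul_col_row FF BF mulmxA FJ mul0mx mulmxA mulmxV //.
  by rewrite scalar_mx_block.
have WL : row_mx (adjm F) (B *m invmx (adjm B *m B)) *m W = 1%:M.
  exact: (mulmx1C_eq HN uW).
have h : W *m (adjm F *m F) = W *m tproj z.
  rewrite /W !mul_col_mx !mulmxA FF mul1mx BF mul0mx /tproj -/B !mulmxBr !mulmx1.
  rewrite !mulmxA FJ !mul0mx subr0; congr col_mx.
  by rewrite mulmxV // mul1mx subrr.
by rewrite -[LHS]mul1mx -[RHS]mul1mx -WL -!mulmxA h.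
Qed.

Lemma frame_le1 z k j : regcone f z -> cn (frame n f z k j) <= 1.
Proof.
move=> rz; have [_ FF] := frameP rz.
have := congr1 (fun B : 'M[C]_n => B k k) FF; rewrite !mxE eqxx /=.
under eq_bigr do rewrite adjmE conjc_mul.
rewrite -rmorph_sum /= => /(@complexI R) h.
rewrite -(ler_pXn2r (_ : 0 < 2)%N) ?nnegrE ?cn_ge0 // expr1n -h (bigD1 j) //= lerDl.
by apply: sumr_ge0 => i _; rewrite sqr_ge0.
Qed.

End Frames.

Section Forms.
Context {R : realType} (N nu n : nat).
Local Notation C := R[i].
Variable f : 'I_nu -> mpoly N C.
Hypothesis HN : N = (n + nu)%N.
Local Notation point := 'rV[C]_N.
Local Notation frame := (frame n f).
Local Notation tproj := (tproj f).
Local Notation restr := (restr n f).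

Lemma hdeg_lincomb (G : finType) (I : Type) (r : seq I) (c : I -> C) (g : I -> G) :
  hdeg 1 (\sum_(i <- r) c i *: gen (g i) : @ext R G).
Proof. by apply: hdeg_sum => i _; apply: hdegZ; exact: hdeg_gen. Qed.

Definition restr_gen (z : point) (j : 'I_N) : @ext R 'I_n := \sum_(k < n) (frame z k j)^* *: gen k.
Definition pgen (z : point) (j : 'I_N) : @ext R 'I_N := \sum_(l < N) tproj z j l *: gen l.
Definition lgen (z : point) (k : 'I_n) : @ext R 'I_N := \sum_(l < N) frame z k l *: gen l.

Lemma restrE z : restr z = subst (restr_gen z). Proof. by []. Qed.
Lemma restr_gen1 z j : hdeg 1 (restr_gen z j). Proof. exact: hdeg_lincomb. Qed.
Lemma pgen1 z j : hdeg 1 (pgen z j). Proof. exact: hdeg_lincomb. Qed.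
Lemma lgen1 z j : hdeg 1 (lgen z j). Proof. exact: hdeg_lincomb. Qed.

Lemma restrD z a b : restr z (a + b) = restr z a + restr z b.
Proof. by rewrite restrE substD. Qed.
Lemma restrN z a : restr z (- a) = - restr z a.
Proof. by rewrite restrE substN. Qed.
Lemma restrB z a b : restr z (a - b) = restr z a - restr z b.
Proof. by rewrite restrD restrN. Qed.
Lemma restrZ z c a : restr z (c *: a) = c *: restr z a.
Proof. by rewrite restrE substZ. Qed.
Lemma restr0 z : restr z 0 = 0.
Proof. by rewrite restrE subst0. Qed.
Lemma restrM z a b : restr z (a * b) = restr z a * restr z b.
Proof. by rewrite restrE substM //; exact: restr_gen1. Qed.

Definition pform (z : point) (a : @ext R 'I_N) : @ext R 'I_N := subst (pgen z) a.

Lemma subst_lincomb (G G' I : finType) (M : G -> @ext R G') (c : I -> C) (g : I -> G) :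
  (forall g, hdeg 1 (M g)) ->
  subst M (\sum_i c i *: gen (g i)) = \sum_i c i *: M (g i).
Proof. by move=> M1; rewrite (subst_sum M); apply: eq_bigr => i _; rewrite (substZ M) subst_gen. Qed.

Lemma tproj_entry z j l : regcone f z -> tproj z j l = \sum_(k < n) (frame z k j)^* * frame z k l.
Proof.
move=> rz; rewrite -(tprojE HN rz) mxE; apply: eq_bigr => k _.
by rewrite adjmE.
Qed.

(** Restriction followed by the lift along the same frame is the orthogonal projection, whatever
    frame was chosen. So [pform] depends on the restriction only, and its formula contains no
    choice. *)
Lemma pformE z a : regcone f z -> pform z a = subst (lgen z) (restr z a).
Proof.
move=> rz; rewrite restrE subst_comp; [|exact: restr_gen1|exact: lgen1].
apply: eq_subst => j; rewrite /restr_gen subst_lincomb; last exact: lgen1.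
under [RHS]eq_bigr do rewrite scaler_sumr.
rewrite exchange_big; apply: eq_bigr => l _ /=.
rewrite tproj_entry // scaler_suml; apply: eq_bigr => k _.
by rewrite scalerA.
Qed.

Lemma restr_pform z a : regcone f z -> restr z (pform z a) = restr z a.
Proof.
move=> rz; rewrite !restrE /pform subst_comp; [|exact: pgen1|exact: restr_gen1].
apply: eq_subst => j; rewrite /pgen subst_lincomb; last exact: restr_gen1.
under eq_bigr do rewrite scaler_sumr.
rewrite exchange_big; apply: eq_bigr => k _ /=.
have [_ FF] := frameP HN rz.
have e : \sum_l tproj z j l * (frame z k l)^* = (frame z k j)^*.
  have : tproj z *m adjm (frame z) = adjm (frame z).
    by rewrite -(tprojE HN rz) -mulmxA FF mulmx1.
  move/matrixP/(_ j k); rewrite mxE adjmE => <-.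
  by apply: eq_bigr => l _; rewrite adjmE.
transitivity ((\sum_l tproj z j l * (frame z k l)^*) *: gen k : @ext R 'I_n).
  by rewrite scaler_suml; apply: eq_bigr => l _; rewrite scalerA.
by congr (_ *: _); exact: e.
Qed.

(** Stands in for [fnorm] in all estimates: the two are comparable on the regular part, and the
    gauge is Borel in z as soon as the coefficients are, while the measurability of [fnorm] is
    hidden behind the choice of frames. *)
Definition gauge (z : point) (a : @ext R 'I_N) : R := en (pform z a).

Lemma gauge_ge0 z a : 0 <= gauge z a. Proof. exact: en_ge0. Qed.
Lemma gauge0 z : gauge z 0 = 0.
Proof. by rewrite /gauge /pform subst0 en0. Qed.
Lemma gaugeD z a b : gauge z (a + b) <= gauge z a + gauge z b.
Proof. by rewrite /gauge /pform substD enD. Qed.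
Lemma gaugeN z a : gauge z (- a) = gauge z a.
Proof. by rewrite /gauge /pform substN enN. Qed.
Lemma gaugeZ z c a : gauge z (c *: a) = cn c * gauge z a.
Proof. by rewrite /gauge /pform substZ enZ. Qed.
Lemma gaugeM z a b : gauge z (a * b) <= gauge z a * gauge z b.
Proof. by rewrite /gauge /pform substM ?enM //; exact: pgen1. Qed.
Lemma gauge_restr z a b : regcone f z -> restr z a = restr z b -> gauge z a = gauge z b.
Proof. by move=> rz e; rewrite /gauge !pformE // e. Qed.

Lemma en_lincomb (G I : finType) (c : I -> C) (g : I -> G) :
  (forall i, cn (c i) <= 1) -> en (\sum_i c i *: gen (g i) : @ext R G) <= #|I|%:R.
Proof.
move=> h; rewrite (le_trans (en_sum _ _ _)) // -sum1_card natr_sum; apply: ler_sum => i _.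
by rewrite enZ en_gen mulr1.
Qed.

(** Dominates both (n+1)^N and (N+1)^n, the bounds of [en_subst] for the restriction and for the
    lift, whose coefficients have modulus at most 1 because the frame is orthonormal. *)
Definition gcst : R := (N.+1 + n)%:R ^+ (N + n).

Lemma gcst_ge1 : 1 <= gcst. Proof. by rewrite exprn_ege1 // ler1n addSn. Qed.
Lemma gcst_ge0 : 0 <= gcst. Proof. exact: le_trans ler01 gcst_ge1. Qed.
Lemma en_restr_le z a : regcone f z -> en (restr z a) <= gcst * en a.
Proof.
move=> rz; rewrite restrE (le_trans (@en_subst _ _ _ _ n.+1%:R _ _ _)) ?ler1n // => [j|].
  rewrite (le_trans (en_lincomb _ _)) ?card_ord ?ler_nat // => k.
  by rewrite cnJ frame_le1.
rewrite ler_wpM2r ?en_ge0 // card_ord /gcst.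
apply: (@le_trans _ _ ((N.+1 + n)%:R ^+ N)).
  by rewrite lerXn2r ?nnegrE ?ler0n // ler_nat addSn ltnS leq_addl.
by rewrite ler_weXn2l ?leq_addr // ler1n addSn.
Qed.

Lemma gauge_le_restr z a : regcone f z -> gauge z a <= gcst * en (restr z a).
Proof.
move=> rz; rewrite /gauge pformE // (le_trans (@en_subst _ _ _ _ N.+1%:R _ _ _)) ?ler1n // => [j|].
  rewrite (le_trans (en_lincomb _ _)) ?card_ord ?ler_nat // => k.
  by rewrite frame_le1.
rewrite ler_wpM2r ?en_ge0 // card_ord /gcst.
apply: (@le_trans _ _ ((N.+1 + n)%:R ^+ n)).
  by rewrite lerXn2r ?nnegrE ?ler0n // ler_nat leq_addr.
by rewrite ler_weXn2l ?leq_addl // ler1n addSn.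
Qed.

Lemma restr_le_gauge z a : regcone f z -> en (restr z a) <= gcst * gauge z a.
Proof. by move=> rz; rewrite -restr_pform // en_restr_le. Qed.

Lemma gauge_le_en z a : regcone f z -> gauge z a <= gcst ^+ 2 * en a.
Proof.
move=> rz; rewrite (le_trans (gauge_le_restr _ _)) // expr2 -mulrA ler_wpM2l ?gcst_ge0 //.
exact: en_restr_le.
Qed.

Lemma fnormE z a : fnorm n f z a = Num.sqrt (\sum_(S : {set 'I_n}) cn (restr z a S) ^+ 2).
Proof. by rewrite /fnorm; congr Num.sqrt; apply: eq_bigr => S _; rewrite cn_sqr. Qed.

Lemma fnorm_ge0 z a : 0 <= fnorm n f z a. Proof. exact: sqrtr_ge0. Qed.

Lemma fnorm_le_restr z a : fnorm n f z a <= en (restr z a).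
Proof.
have h0 S : 0 <= cn (restr z a S) by exact: cn_ge0.
rewrite fnormE -[leRHS](ger0_norm (en_ge0 _)) -sqrtr_sqr ler_sqrt; last exact: sqr_ge0.
rewrite expr2 {1}/en mulr_suml; apply: ler_sum => S _.
by rewrite expr2 ler_wpM2l // cn_le_en.
Qed.

Lemma restr_le_fnorm z a : en (restr z a) <= #|{set 'I_n}|%:R * fnorm n f z a.
Proof.
rewrite /en -sum1_card natr_sum mulr_suml; apply: ler_sum => S _; rewrite mul1r.
rewrite fnormE -[leLHS](ger0_norm (cn_ge0 _)) -sqrtr_sqr ler_sqrt ?sumr_ge0 //.
  by rewrite (bigD1 S) //= lerDl sumr_ge0 // => T _; exact: sqr_ge0.
by move=> T _; exact: sqr_ge0.
Qed.

Definition fcst : R := gcst * #|{set 'I_n}|%:R.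
Lemma fcst_ge1 : 1 <= fcst.
Proof.
by rewrite -[1]mulr1 ler_pM // ?gcst_ge1 // ler1n; apply/card_gt0P; exists finset.set0.
Qed.
Lemma fcst_gt0 : 0 < fcst. Proof. exact: lt_le_trans ltr01 fcst_ge1. Qed.

Lemma gauge_le_fnorm z a : regcone f z -> gauge z a <= fcst * fnorm n f z a.
Proof.
move=> rz; rewrite (le_trans (gauge_le_restr _ rz)) // /fcst -mulrA ler_wpM2l ?gcst_ge0 //.
exact: restr_le_fnorm.
Qed.

Lemma fnorm_le_gauge z a : regcone f z -> fnorm n f z a <= fcst * gauge z a.
Proof.
move=> rz; rewrite (le_trans (fnorm_le_restr _ _)) // (le_trans (restr_le_gauge _ rz)) //.
rewrite ler_wpM2r ?gauge_ge0 // /fcst ler_peMr ?gcst_ge0 // ler1n.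
by apply/card_gt0P; exists finset.set0.
Qed.

Local Notation kgen := (kgen N).
Local Notation wgen := (wgen N n).

Lemma krestr1 (A : 'M[C]_(n, N)) (g : kgen) : hdeg 1 (krestr A g).
Proof. by case: g => [[j|j]|[j|j]] /=; [exact: hdeg0|exact: hdeg_lincomb|exact: hdeg_lincomb|exact: hdeg_gen]. Qed.

Definition zrestr z (a : @ext R kgen) : @ext R wgen := subst (krestr (frame z)) a.

Lemma zrestrM z a b : zrestr z (a * b) = zrestr z a * zrestr z b.
Proof. by rewrite /zrestr substM //; exact: krestr1. Qed.

Lemma in_zetabE (a : @ext R 'I_N) : in_zetab a = subst (fun j => gen (dzetab j)) a.
Proof. by []. Qed.

Lemma zrestr_in_zetab z a : zrestr z (in_zetab a) = subst (fun k => gen (inl (inr k) : wgen)) (restr z a).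
Proof.
rewrite /zrestr in_zetabE restrE !subst_comp; [|exact: restr_gen1|by move=> k; exact: hdeg_gen|by move=> k; exact: hdeg_gen|exact: krestr1].
apply: eq_subst => j; rewrite subst_gen /restr_gen subst_lincomb //.
by move=> k; exact: hdeg_gen.
Qed.

Definition topset (L : {set 'I_N}) : {set wgen} :=
  ([set inl g | g : 'I_n + 'I_n] :|: [set inr j | j in L])%SET.

Definition dcst : C := (-1) ^+ 'C(n, 2) * (- 2%:R * imC) ^+ n.

Lemma densityE z L a : density n f z L a = dcst * zrestr z a (topset L).
Proof. by []. Qed.

Lemma density_restr z L a b b' : restr z b = restr z b' ->
  density n f z L (a * in_zetab b) = density n f z L (a * in_zetab b').
Proof. by move=> e; rewrite !densityE !zrestrM !zrestr_in_zetab e. Qed.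

Lemma density_restr_l z L a b b' : restr z b = restr z b' ->
  density n f z L (in_zetab b * a) = density n f z L (in_zetab b' * a).
Proof. by move=> e; rewrite !densityE !zrestrM !zrestr_in_zetab e. Qed.

Lemma densityD z L a b : density n f z L (a + b) = density n f z L a + density n f z L b.
Proof. by rewrite !densityE /zrestr substD extDE mulrDr. Qed.
Lemma densityN z L a : density n f z L (- a) = - density n f z L a.
Proof. by rewrite !densityE /zrestr substN extNE mulrN. Qed.
Lemma density0 z L : density n f z L 0 = 0.
Proof. by rewrite !densityE /zrestr subst0 ext0E mulr0. Qed.

Definition kcst : R := cn dcst * n.+1%:R ^+ #|kgen|.

Lemma density_le z L a : regcone f z -> cn (density n f z L a) <= kcst * en a.
Proof.
move=> rz; rewrite densityE cnM /kcst -mulrA ler_wpM2l ?cn_ge0 //.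
rewrite (le_trans (cn_le_en _ _)) // (le_trans (@en_subst _ _ _ _ n.+1%:R _ _ _)) ?ler1n // => g.
case: g => [[j|j]|[j|j]] /=; rewrite ?en0 ?en_gen ?ler0n ?ler1n //.
  by rewrite (le_trans (en_lincomb _ _)) ?card_ord ?ler_nat // => k; rewrite frame_le1.
by rewrite (le_trans (en_lincomb _ _)) ?card_ord ?ler_nat // => k; rewrite cnJ frame_le1.
Qed.

Lemma kcst_ge0 : 0 <= kcst. Proof. by rewrite mulr_ge0 ?cn_ge0 ?exprn_ge0. Qed.

Lemma en_in_zetab a : en (in_zetab a : @ext R kgen) <= en a.
Proof.
rewrite (le_trans (@en_subst _ _ _ _ 1 _ (lexx _) _)) ?expr1n ?mul1r // => g.
by rewrite en_gen.
Qed.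

Lemma hdeg_in_zetab k a : hdeg k a -> hdeg k (in_zetab a : @ext R kgen).
Proof. by apply: hdeg_subst => j; exact: hdeg_gen. Qed.

End Forms.

(** * The volume density without frames *)

Section SquareZero.
Variables (A : nzRingType) (I : eqType) (x : I -> A).
Hypothesis x_comm : forall i j, x i * x j = x j * x i.
Hypothesis x_sqr : forall i, x i * x i = 0.

Lemma exprD_sqr0 (a b : A) k : a * b = b * a -> a * a = 0 ->
  (a + b) ^+ k.+1 = b ^+ k.+1 + (a * b ^+ k) *+ k.+1.
Proof.
move=> ab aa; elim: k => [|k IH]; first by rewrite !expr1 expr0 mulr1 mulr1n addrC.
rewrite exprS IH mulrDr !mulrDl mulrnAr mulrA aa mul0r mul0rn add0r.
rewrite mulrnAr (mulrA b) -ab -mulrA -!exprS [in RHS]mulrS.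
by rewrite -addrA addrCA.
Qed.

(** The vanishing of the next power is carried along for the induction: it kills the term of the
    binomial expansion in which the new element is absent. *)
Lemma sum_sqr0_expr (l : seq I) :
  (\sum_(i <- l) x i) ^+ size l = (\prod_(i <- l) x i) *+ (size l)`! /\
  (\sum_(i <- l) x i) ^+ (size l).+1 = 0.
Proof.
elim: l => [|i l [IH1 IH2]]; first by rewrite !big_nil expr0 expr1.
rewrite !big_cons /=.
have ab : x i * (\sum_(i <- l) x i) = (\sum_(i <- l) x i) * x i.
  by rewrite mulr_sumr mulr_suml; apply: eq_bigr => j _.
rewrite !exprD_sqr0 // IH2 IH1 [_ ^+ (size l).+2]exprS IH2 !mulr0 mul0rn !add0r; split=> //.
by rewrite mulrnAr -mulrnA factS mulnC.
Qed.
End SquareZero.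

Section Density.
Context {R : realType}.
Local Notation C := R[i].

Lemma prod_gen_monom (G : finType) (l : seq G) : uniq l ->
  exists2 e : C, e != 0 & \prod_(g <- l) gen g = e *: monom [set g in l]%SET.
Proof.
elim: l => [|g l IH]; first exists 1; rewrite ?oner_neq0 //.
  rewrite big_nil scale1r -ext1_1 ext1E; congr monom; apply/setP => g; by rewrite !inE.
move=> /= /andP[gl /IH[e e0 eE]].
rewrite big_cons eE -scalerAr -wedgeE wedge_monom disjoints1 inE gl scalerA.
exists (e * shuffle_sign [set g]%SET [set g in l]%SET).
  by rewrite mulf_neq0 // -cn_eq0 cn_shuffle oner_neq0.
by congr (_ *: monom _); apply/setP => h; rewrite !inE.
Qed.

Definition hpart (G : finType) (k : nat) (a : @ext R G) : @ext R G :=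
  [ffun S : {set G} => if #|S| == k then a S else 0].

Lemma hpartE (G : finType) k (a : @ext R G) : hpart k a = \sum_(S : {set G} | #|S| == k) a S *: monom S.
Proof.
apply/ffunP => T; rewrite ext_sumE ffunE; case: ifP => [cT|cT].
  rewrite (bigD1 T) //= big1 ?addr0 ?ffunE ?eqxx ?mulr1 // => S /andP[_ ST].
  by rewrite !ffunE eq_sym (negbTE ST) mulr0.
rewrite big1 // => S cS; rewrite !ffunE; case: eqP => [eS|]; last by rewrite mulr0.
by rewrite eS cS in cT.
Qed.

Lemma hpart_subst (G G' : finType) (M : G -> @ext R G') k (a : @ext R G) :
  (forall g, hdeg 1 (M g)) -> hpart k (subst M a) = subst M (hpart k a).
Proof.
move=> M1; apply/ffunP => T; rewrite ffunE.
have hS (S : {set G}) := hdeg_subst M1 (@hdeg_monom R G S).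
rewrite {1}(ext_monomsE a) (hpartE k a) !(subst_sum M) !ext_sumE.
case: ifP => cT.
  rewrite [LHS](bigID (fun S : {set G} => #|S| == k)) /= [X in _ + X]big1 ?addr0 // => S cS.
  by rewrite (substZ M) extZE hS ?mulr0 // (eqP cT) eq_sym.
rewrite big1 // => S cS.
by rewrite (substZ M) extZE hS ?mulr0 // (eqP cS) cT.
Qed.

Section F.
Variables (N nu n : nat) (f : 'I_nu -> mpoly N C).
Hypothesis HN : N = (n + nu)%N.
Local Notation point := 'rV[C]_N.
Local Notation frame := (frame n f).
Local Notation tproj := (tproj f).
Local Notation kgen := (kgen N).
Local Notation wgen := (wgen N n).
Local Notation wz k := (inl (inl k) : wgen).
Local Notation wb k := (inl (inr k) : wgen).
Local Notation wd j := (inr j : wgen).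

Definition kahler : @ext R wgen := \sum_(k < n) gen (wz k) * gen (wb k).
Definition zbar_top : @ext R wgen := \prod_(j < N) gen (wd j).

(** The 2-forms dw_k dwbar_k commute and have square zero, so the n-th power of their sum is n!
    times their product. Only [e != 0] is recorded, as its value is absorbed by the constant of
    [density_dtop]. *)
Lemma kahler_top : exists2 e : C, e != 0 & kahler ^+ n * zbar_top = e *: monom [set: wgen]%SET.
Proof.
pose x (k : 'I_n) : @ext R wgen := gen (wz k) * gen (wb k).
have xc i j : x i * x j = x j * x i.
  rewrite /x -!mulrA (mulrA (gen (wb i))) (gen_anticomm (wb i)) mulNr mulrN !mulrA.
  rewrite (gen_anticomm (wz i)) -!mulrA (gen_anticomm (wb i)) !mulrN !mulNr !opprK !mulrA.
  by rewrite -(mulrA (gen (wz j)) (gen (wz i))) (gen_anticomm (wz i)) mulrN mulNr opprK mulrA.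
have xx i : x i * x i = 0.
  by rewrite /x mulrA -(mulrA _ _ (gen (wz i))) gen_anticomm mulrN mulrA gen_sqr mul0r oppr0 mul0r.
have [+ _] := sum_sqr0_expr xc xx (index_enum 'I_n).
have -> : size (index_enum 'I_n) = n by rewrite [index_enum _]unlock -enumT size_enum_ord.
rewrite -/kahler => ->.
pose l : seq wgen := flatten [seq [:: wz k; wb k] | k <- index_enum 'I_n] ++ [seq wd j | j <- index_enum 'I_N].
have ul : uniq l.
  rewrite cat_uniq map_inj_uniq ?index_enum_uniq ?andbT; last by move=> a b [].
  apply/andP; split; last first.
    apply/hasPn => _ /mapP[j _ ->]; apply/flattenP => -[_ /mapP[k _ ->]].
    by rewrite !inE.
  elim: (index_enum 'I_n) (index_enum_uniq 'I_n) => [//|k s IH] /= /andP[ks us].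
  rewrite IH // andbT in_cons negb_or; apply/andP; split; [apply/andP; split=> //|]; apply/flattenP => -[_ /mapP[j js ->]].
    by rewrite !inE => /orP[/eqP[e]|//]; rewrite e js in ks.
  by rewrite !inE => /orP[//|/eqP[e]]; rewrite e js in ks.
have [e e0 he] := prod_gen_monom ul.
exists (n`!%:R * e); first by rewrite mulf_neq0 // pnatr_eq0 -lt0n fact_gt0.
have -> : [set: wgen]%SET = [set g in l]%SET.
  apply/setP => g; rewrite !inE mem_cat; apply/esym/orP.
  case: g => [[k|k]|j]; [left|left|right].
  - by apply/flattenP; exists [:: wz k; wb k]; rewrite ?mem_head // map_f // mem_index_enum.
  - by apply/flattenP; exists [:: wz k; wb k]; rewrite ?inE ?eqxx ?orbT // map_f // mem_index_enum.
  - by rewrite map_f // mem_index_enum.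
rewrite -scalerA -he /l big_cat big_flatten /= !big_map mulrnAl -scaler_nat; congr (_ *: (_ * _)).
by apply: eq_bigr => k _; rewrite !big_cons big_nil mulr1.
Qed.

(* The orthogonal lift, a right inverse of restriction to T_z X. *)
Definition wlift (z : point) (g : wgen) : @ext R kgen :=
  match g with
  | inl (inl k) => \sum_(j < N) (frame z k j)^* *: gen (dzeta j)
  | inl (inr k) => \sum_(j < N) frame z k j *: gen (dzetab j)
  | inr j => gen (dzb j)
  end.

(** Restriction in zeta followed by the lift [wlift], with the frame eliminated. The projection
    appears transposed for d zeta_j as compared with the conjugate generator, since the frame enters
    conjugated in one of the two; the d eta_j go to 0 as under [krestr]. *)
Definition kpgen (z : point) (g : kgen) : @ext R kgen :=
  match g with
  | inl (inl j) => 0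
  | inl (inr j) => \sum_(l < N) tproj z l j *: gen (dzeta l)
  | inr (inl j) => \sum_(l < N) tproj z j l *: gen (dzetab l)
  | inr (inr j) => gen (dzb j)
  end.

Lemma wlift1 z g : hdeg 1 (wlift z g).
Proof. by case: g => [[k|k]|j] /=; [exact: hdeg_lincomb|exact: hdeg_lincomb|exact: hdeg_gen]. Qed.

Lemma scale_lincombs (G I J : finType) (c : I -> C) (d : I -> J -> C) (g : J -> @ext R G) :
  \sum_i c i *: (\sum_j d i j *: g j) = \sum_j (\sum_i c i * d i j) *: g j.
Proof.
transitivity (\sum_i \sum_j (c i * d i j) *: g j).
  by apply: eq_bigr => i _; rewrite scaler_sumr; apply: eq_bigr => j _; rewrite scalerA.
by rewrite exchange_big; apply: eq_bigr => j _; rewrite scaler_suml.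
Qed.

Lemma wlift_zrestr z a : regcone f z -> subst (wlift z) (zrestr n f z a) = subst (kpgen z) a.
Proof.
move=> rz; rewrite /zrestr subst_comp; [|exact: krestr1|exact: wlift1].
apply: eq_subst => -[[j|j]|[j|j]] /=.
- by rewrite subst0.
- rewrite subst_lincomb; last exact: wlift1.
  rewrite [LHS](@scale_lincombs _ _ _ (fun i => frame z i j) (fun i l => (frame z i l)^*)).
  apply: eq_bigr => l _; congr (_ *: _); rewrite (tproj_entry HN) //.
  by apply: eq_bigr => k _; rewrite mulrC.
- rewrite subst_lincomb; last exact: wlift1.
  rewrite [LHS](@scale_lincombs _ _ _ (fun i => (frame z i j)^*) (fun i l => frame z i l)).
  by apply: eq_bigr => l _; congr (_ *: _); rewrite (tproj_entry HN).
- by rewrite subst_gen.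
Qed.

Lemma zrestr_wlift z a : regcone f z -> zrestr n f z (subst (wlift z) a) = a.
Proof.
move=> rz; rewrite /zrestr subst_comp; [|exact: wlift1|exact: krestr1].
rewrite -[RHS]subst_id; apply: eq_subst => g; have [_ FF] := frameP HN rz.
have FE k l : \sum_j frame z k j * (frame z l j)^* = (k == l)%:R.
  by have := congr1 (fun B : 'M[C]_n => B k l) FF; rewrite !mxE => <-; apply: eq_bigr => j _; rewrite adjmE.
case: g => [[k|k]|j] /=; last by rewrite subst_gen.
- rewrite subst_lincomb; last exact: krestr1.
  under eq_bigr do rewrite /= scaler_sumr.
  rewrite exchange_big (bigD1 k) //= [X in _ + X]big1 ?addr0 => [|l lk].
    under eq_bigr do rewrite ?escaleE scalerA mulrC.
    by rewrite -scaler_suml FE eqxx scale1r.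
  under eq_bigr do rewrite ?escaleE scalerA mulrC.
  by rewrite -scaler_suml FE (negbTE lk) scale0r.
- rewrite subst_lincomb; last exact: krestr1.
  under eq_bigr do rewrite /= scaler_sumr.
  rewrite exchange_big (bigD1 k) //= [X in _ + X]big1 ?addr0 => [|l lk].
    under eq_bigr do rewrite ?escaleE scalerA.
    by rewrite -scaler_suml FE eqxx scale1r.
  under eq_bigr do rewrite ?escaleE scalerA.
  by rewrite -scaler_suml FE eq_sym (negbTE lk) scale0r.
Qed.

(* Pointwise frame-free volume form: Psi = (sum_jl P_jl dzeta_j dzetab_l)^n /\ dzb_top is, up to a
   constant, the lift of the top form. *)
Definition kvol (z : point) : @ext R kgen :=
  (\sum_(j < N) \sum_(l < N) tproj z j l *: (gen (dzeta j) * gen (dzetab l))) ^+ n *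
  \prod_(j < N) gen (dzb j).

Lemma kvolE z : regcone f z -> kvol z = subst (wlift z) (kahler ^+ n * zbar_top).
Proof.
move=> rz; have w1 := wlift1 z; rewrite substM // /kvol; congr (_ * _); last first.
  by rewrite subst_prod //; apply: eq_bigr => j _; rewrite subst_gen.
have substX k (a : @ext R wgen) : subst (wlift z) (a ^+ k) = subst (wlift z) a ^+ k.
  by elim: k => [|k IH]; rewrite ?expr0 ?subst1 // !exprS substM // IH.
rewrite substX; congr (_ ^+ _); rewrite /kahler (subst_sum (wlift z)).
transitivity (\sum_(j < N) \sum_(l < N) \sum_(k < n) ((frame z k j)^* * frame z k l) *: (gen (dzeta j) * gen (dzetab l)) : @ext R kgen).
  apply: eq_bigr => j _; apply: eq_bigr => l _.
  by rewrite (tproj_entry HN) // scaler_suml.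
under eq_bigr do rewrite exchange_big /=.
rewrite exchange_big; apply: eq_bigr => k _ /=.
rewrite substM // !subst_gen /= mulr_suml; apply: eq_bigr => j _.
rewrite mulr_sumr; apply: eq_bigr => l _.
by rewrite -scalerAl -scalerAr scalerA.
Qed.

Definition dzb_prod (L : {set 'I_N}) : @ext R kgen := \prod_(j <- enum L) gen (dzb j).

(** Multiplication by the conjugate dz_j with j outside [L] turns the coefficient sought into that
    of the top form, and [hpart] discards the other degrees. What is left, lifted, is a multiple of
    [kvol], and the Hermitian product with [kvol] recovers the multiple. *)
Definition dtop (z : point) (L : {set 'I_N}) (a : @ext R kgen) : C :=
  (\sum_S (kvol z S)^* * hpart #|wgen| (subst (kpgen z) a * dzb_prod (~: L)%SET) S) /
  \sum_S (kvol z S)^* * kvol z S.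

Lemma mul_monom_setT (G : finType) (a : @ext R G) (B : {set G}) :
  (a * monom B) [set: G]%SET = shuffle_sign (~: B)%SET B * a (~: B)%SET.
Proof.
rewrite -wedgeE ffunE (bigD1 (~: B)%SET) ?finset.subsetT //= big1 => [|A /andP[_ AB]].
  by rewrite ffunE finset.setTD finset.setCK eqxx mulr1 addr0.
rewrite !ffunE finset.setTD; case: eqP => [e|]; last by rewrite mulr0.
by rewrite -e finset.setCK eqxx in AB.
Qed.

Lemma hpart_top (G : finType) (a : @ext R G) : hpart #|G| a = a [set: G]%SET *: monom [set: G]%SET.
Proof.
rewrite hpartE (big_pred1 [set: G]%SET) // => S /=.
by rewrite eqEcard finset.subsetT cardsT /= eqn_leq -cardsT subset_leq_card ?finset.subsetT.
Qed.

(** The constant is independent of z and of the form, so [density], defined through an arbitrary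
    frame, agrees on the regular part with an expression in Borel functions. All measurability in
    zeta of the integral operator rests on this. *)
Lemma density_dtop (L : {set 'I_N}) : exists c : C, forall z a, regcone f z ->
  density n f z L a = c * dtop z L a.
Proof.
have [e' e'0 e'E] := kahler_top.
pose B := [set g in [seq wd j | j <- enum (~: L)%SET]]%SET.
have ul : uniq [seq wd j | j <- enum (~: L)%SET] by rewrite map_inj_uniq ?enum_uniq // => i j [].
have [e e0 eE] := prod_gen_monom ul; rewrite big_map -/B in eE.
have BE : (~: B)%SET = topset n L.
  apply/setP => g; rewrite !inE; case: g => [g|j].
    rewrite imset_f // ; apply/negP => /mapP[j _]; by [].
  rewrite mem_map ?mem_enum; last by move=> i i' [].
  rewrite inE negbK; apply/idP/orP => [jL|[/imsetP[]//|/imsetP[i iL [->//]]]].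
  by right; apply: imset_f.
pose sg : C := shuffle_sign (~: B)%SET B.
have sg0 : sg != 0 by rewrite -cn_eq0 cn_shuffle oner_neq0.
exists (dcst n * (e' / (e * sg))) => z a rz; rewrite densityE.
have w1 := wlift1 z.
pose V := subst (wlift z) (monom [set: wgen]%SET).
have kV : kvol z = e' *: V by rewrite kvolE // e'E substZ.
set al := zrestr n f z a (topset n L).
have hE : hpart #|wgen| (subst (kpgen z) a * dzb_prod (~: L)%SET) = (e * sg * al) *: V.
  have -> : subst (kpgen z) a * dzb_prod (~: L)%SET =
      subst (wlift z) (zrestr n f z a * \prod_(j <- enum (~: L)%SET) gen (wd j)).
    rewrite substM // wlift_zrestr // subst_prod //; congr (_ * _).
    by apply: eq_bigr => j _; rewrite subst_gen.
  rewrite hpart_subst // eE -scalerAr hpart_top extZE mul_monom_setT BE substZ.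
  by rewrite mulrA /sg BE.
(* [zrestr] is a left inverse of the lift, so the lifted top form cannot vanish. *)
have V0 : V != 0.
  apply/eqP => V0; have := zrestr_wlift (monom [set: wgen]%SET) rz; rewrite -/V V0 /zrestr subst0.
  move/esym/ffunP/(_ [set: wgen]%SET); rewrite !ffunE eqxx => /eqP; by rewrite oner_eq0.
pose D := \sum_S (V S)^* * V S.
have D0 : D != 0.
  apply: contra V0 => /eqP h; apply/eqP/ffunP => S; apply/eqP; rewrite ext0E -cn_eq0.
  have : \sum_S (cn (V S) ^+ 2) = 0.
    apply: (@complexI R); rewrite [RHS]/= -[RHS]h rmorph_sum /D /=; apply: eq_bigr => T _.
    by rewrite mulrC conjc_mul.
  move/eqP; rewrite psumr_eq0 => [|T _]; last exact: sqr_ge0.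
  by move/allP/(_ S (mem_index_enum _)); rewrite sqrf_eq0.
have -> : dtop z L a = (e * sg / e') * al.
  rewrite /dtop hE kV.
  have -> : \sum_S ((e' *: V) S)^* * ((e * sg * al) *: V) S = e'^* * (e * sg * al) * D.
    by rewrite mulr_sumr; apply: eq_bigr => S _; rewrite !extZE rmorphM /=; ring.
  have -> : \sum_S ((e' *: V) S)^* * (e' *: V) S = e'^* * e' * D.
    by rewrite mulr_sumr; apply: eq_bigr => S _; rewrite !extZE rmorphM /=; ring.
  have e'c : e'^* != 0 by rewrite conjc_eq0.
  by field; rewrite e'0 e'c D0.
by field; rewrite e'0 e0 sg0.
Qed.

End F.
End Density.

(** * Calculus on complex vectors *)

Section VectorNorm.
Context {R : realType}.
Local Notation C := R[i].
Variable M : nat.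
Implicit Types (x y : 'rV[C]_M).

(** The sum norm in place of the Euclidean one: all estimates are up to constants, and it splits
    over blocks of coordinates. *)
Definition nm x : R := \sum_(j < M) cn (x 0 j).

Lemma nm_ge0 x : 0 <= nm x. Proof. by apply: sumr_ge0 => j _; exact: cn_ge0. Qed.
Lemma nm0 : nm 0 = 0. Proof. by rewrite /nm big1 // => j _; rewrite mxE cn0. Qed.
Lemma nmD x y : nm (x + y) <= nm x + nm y.
Proof. by rewrite -big_split; apply: ler_sum => j _; rewrite mxE cnD. Qed.
Lemma nmN x : nm (- x) = nm x.
Proof. by apply: eq_bigr => j _; rewrite mxE cnN. Qed.
Lemma nmB x y : nm (x - y) <= nm x + nm y.
Proof. by rewrite (le_trans (nmD _ _)) // nmN. Qed.
Lemma nmBC x y : nm (x - y) = nm (y - x). Proof. by rewrite -nmN opprB. Qed.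
Lemma nmZ c x : nm (c *: x) = cn c * nm x.
Proof. by rewrite mulr_sumr; apply: eq_bigr => j _; rewrite mxE cnM. Qed.
Lemma cn_le_nm x j : cn (x 0 j) <= nm x.
Proof. by rewrite /nm (bigD1 j) //= lerDl sumr_ge0 // => i _; exact: cn_ge0. Qed.
Lemma nm_eq0 x : nm x = 0 -> x = 0.
Proof.
move=> h; apply/rowP => j; apply/eqP; rewrite mxE -cn_eq0 eq_le cn_ge0 andbT -h.
exact: cn_le_nm.
Qed.
Lemma nm_gt0 x : (0 < nm x) = (x != 0).
Proof.
rewrite lt_neqAle nm_ge0 andbT eq_sym; congr (~~ _); apply/eqP/eqP => [/nm_eq0//|->].
exact: nm0.
Qed.
Lemma nm_le x e : (forall j, cn (x 0 j) <= e) -> nm x <= M%:R * e.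
Proof.
move=> h; rewrite (le_trans (ler_sum _ (fun j _ => h j))) // sumr_const card_ord.
by rewrite mulr_natl.
Qed.
Lemma nm_triB x y z : nm (x - z) <= nm (x - y) + nm (y - z).
Proof. by rewrite (_ : x - z = (x - y) + (y - z)) ?nmD // addrA subrK. Qed.
Lemma ler_nmB x y : nm x - nm y <= nm (x - y).
Proof. by rewrite lerBlDr -{1}(subrK y x) nmD. Qed.

Lemma gt0_ReC (e : C) : 0 < e -> 0 < complex.Re e /\ e = (complex.Re e)%:C.
Proof. by case: e => a b; rewrite ltcE /= => /andP[/eqP-> ->]. Qed.

Lemma nbhs_nmP x (U : set 'rV[C]_M) :
  nbhs x U <-> exists2 r : R, 0 < r & forall y, nm (y - x) < r -> U y.
Proof.
split=> [/(@nbhs_ballP C 'rV[C]_M)[e /= /gt0_ReC[r0 eE] h]|[r r0 h]].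
  exists (complex.Re e) => // y yr; apply: h; split; first by rewrite eE ltcR.
  move=> i j; rewrite (ord1 i) /ball /= eE cnE ltcR; apply: le_lt_trans yr.
  by rewrite cnBC (le_trans _ (cn_le_nm _ j)) // !mxE.
apply/(@nbhs_ballP C 'rV[C]_M); exists (r / M.+1%:R)%:C => /=; first by rewrite ltcR divr_gt0.
move=> y [_ hy]; apply: h; apply: (@le_lt_trans _ _ (M%:R * (r / M.+1%:R))).
  apply: nm_le => j; have := hy 0 j; rewrite /ball /= cnE ltcR => /ltW.
  by rewrite cnBC !mxE.
by rewrite mulrCA -[ltRHS]mulr1 ltr_pM2l // ltr_pdivrMr // mul1r ltr_nat.
Qed.

Lemma open_nmP (U : set 'rV[C]_M) :
  open U <-> forall x, U x -> exists2 r : R, 0 < r & forall y, nm (y - x) < r -> U y.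
Proof.
split=> [oU x Ux|h]; first by apply/nbhs_nmP; apply: open_nbhs_nbhs.
by rewrite openE => x /h h'; apply/nbhs_nmP.
Qed.

Lemma open_nm_ball x r : open [set y | nm (y - x) < r].
Proof.
apply/open_nmP => y /= yr; exists (r - nm (y - x)); first by rewrite subr_gt0.
move=> w; rewrite ltrBrDr; apply: le_lt_trans; exact: nm_triB.
Qed.

Lemma closure_nmP (A : set 'rV[C]_M) x :
  closure A x <-> forall r : R, 0 < r -> exists2 y, A y & nm (y - x) < r.
Proof.
split=> [cA r r0|h U /nbhs_nmP[r r0 hU]].
  have [|y [Ay ry]] := cA [set y | nm (y - x) < r]; first by apply/nbhs_nmP; exists r.
  by exists y.
by have [y Ay yr] := h r r0; exists y; split => //; exact: hU.
Qed.

(** Continuity with real radii and moduli; the radii of the topology of [R[i]] are themselves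
    complex numbers. *)
Definition ctsat (h : 'rV[C]_M -> C) x : Prop :=
  forall e : R, 0 < e -> exists2 r, 0 < r & forall y, nm (y - x) < r -> cn (h y - h x) < e.

Lemma ctsP (h : 'rV[C]_M -> C) x : {for x, continuous h} <-> ctsat h x.
Proof.
split=> [ch e e0|H].
  apply/(nbhs_nmP x (fun y => cn (h y - h x) < e)).
  have /(@cvgrPdist_lt R[i] R[i]^o _ (nbhs x) _ h)/(_ e%:C) := ch.
  rewrite ltcR => /(_ e0); apply: filterS => y; rewrite cnE ltcR.
  by rewrite cnBC.
apply/(@cvgrPdist_lt R[i] R[i]^o _ (nbhs x) _ h) => e /gt0_ReC[e0 ->].
have /(nbhs_nmP x (fun y => cn (h y - h x) < _)) := H _ e0.
by apply: filterS => y; rewrite cnE ltcR cnBC.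
Qed.

End VectorNorm.

Section Continuity.
Context {R : realType}.
Local Notation C := R[i].
Variable M : nat.
Implicit Types (x y : 'rV[C]_M) (h g : 'rV[C]_M -> C).

Lemma cts_cst (c : C) x : ctsat (fun _ : 'rV[C]_M => c) x.
Proof. by move=> e e0; exists 1 => // y _; rewrite subrr cn0. Qed.
Lemma cts_coord j x : ctsat (fun y : 'rV[C]_M => y 0 j) x.
Proof.
move=> e e0; exists e => // y; apply: le_lt_trans.
by rewrite (le_trans _ (cn_le_nm _ j)) // !mxE.
Qed.
Lemma ctsD h g x : ctsat h x -> ctsat g x -> ctsat (fun y => h y + g y) x.
Proof.
move=> ch cg e e0; have e20 : 0 < e / 2 by rewrite divr_gt0.
have [r r0 hr] := ch _ e20; have [s s0 hs] := cg _ e20.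
exists (Num.min r s); first by rewrite lt_min r0.
move=> y; rewrite lt_min => /andP[/hr h1 /hs h2].
rewrite opprD addrACA (le_lt_trans (cnD _ _)) // (splitr e); exact: ltrD.
Qed.
Lemma ctsM h g x : ctsat h x -> ctsat g x -> ctsat (fun y => h y * g y) x.
Proof.
move=> ch cg e e0.
pose A := cn (h x) + 1; pose B := cn (g x) + 1.
have A0 : 0 < A by rewrite ltr_wpDl ?cn_ge0.
have B0 : 0 < B by rewrite ltr_wpDl ?cn_ge0.
have [|r r0 hr] := ch (e / 2 / B); first by rewrite !divr_gt0.
have [|s s0 hs] := cg (Num.min 1 (e / 2 / A)); first by rewrite lt_min ltr01 !divr_gt0.
exists (Num.min r s); first by rewrite lt_min r0.
move=> y; rewrite lt_min => /andP[/hr h1 /hs].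
rewrite lt_min => /andP[h2 h3].
rewrite (_ : _ - _ = (h y - h x) * g y + h x * (g y - g x)); last by ring.
rewrite (le_lt_trans (cnD _ _)) // !cnM (splitr e).
have gB : cn (g y) <= B.
  by rewrite -(subrK (g x) (g y)) (le_trans (cnD _ _)) // addrC lerD2l ltW.
apply: ltr_leD.
  rewrite ltr_pdivlMr // in h1; apply: le_lt_trans h1.
  by rewrite ler_wpM2l ?cn_ge0.
rewrite ltr_pdivlMr // in h3; rewrite (le_trans _ (ltW h3)) // mulrC ler_wpM2l ?cn_ge0 //.
by rewrite lerDl.
Qed.
Lemma ctsZ c h x : ctsat h x -> ctsat (fun y => c * h y) x.
Proof. by move=> ch; apply: ctsM => //; exact: cts_cst. Qed.
Lemma ctsN h x : ctsat h x -> ctsat (fun y => - h y) x.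
Proof. by move=> ch e /ch[r r0 hr]; exists r => // y /hr; rewrite -opprD cnN. Qed.
Lemma ctsB h g x : ctsat h x -> ctsat g x -> ctsat (fun y => h y - g y) x.
Proof. by move=> ch cg; apply: ctsD => //; exact: ctsN. Qed.
Lemma ctsV h x : ctsat h x -> h x != 0 -> ctsat (fun y => (h y)^-1) x.
Proof.
move=> ch h0 e e0; have a0 : 0 < cn (h x) by rewrite cn_gt0.
pose a := cn (h x); have [|r r0 hr] := ch (Num.min (a / 2) (e * (a * a / 2))).
  by rewrite lt_min !divr_gt0 ?mulr_gt0 // divr_gt0 ?mulr_gt0.
exists r => // y /hr; rewrite lt_min => /andP[h1 h2].
have ay : a / 2 < cn (h y).
  have := cnD (h y) (h x - h y); rewrite addrC subrK cnBC -/a => h3.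
  by rewrite -(ltrD2r (a / 2)) -splitr (le_lt_trans h3) // ltrD2l.
have y0 : 0 < cn (h y) by rewrite (lt_trans _ ay) ?divr_gt0.
have hy0 : h y != 0 by rewrite -cn_gt0.
rewrite (_ : _ - _ = (h x - h y) / (h x * h y)); last by field; rewrite h0 hy0.
rewrite cnM cnV cnM cnBC ltr_pdivrMr ?mulr_gt0 // (lt_le_trans h2) //.
by rewrite -mulrA ler_wpM2l ?(ltW e0) // ler_wpM2l ?(ltW a0) // ltW.
Qed.
Lemma ctsJ h x : ctsat h x -> ctsat (fun y => (h y)^*) x.
Proof.
by move=> ch e /ch[r r0 hr]; exists r => // y /hr; rewrite -rmorphB cnJ.
Qed.
Lemma cts_eq h g x : h =1 g -> ctsat h x -> ctsat g x.
Proof. by move=> /funext->. Qed.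
Lemma cts_sum (I : Type) (r : seq I) (P : pred I) (F : I -> 'rV[C]_M -> C) x :
  (forall i, P i -> ctsat (F i) x) ->
  ctsat (fun y => \sum_(i <- r | P i) F i y) x.
Proof.
move=> hF; elim: r => [|i r IH].
  by apply: (@cts_eq (fun=> 0)) (cts_cst _ _) => y; rewrite big_nil.
have [Pi|nPi] := boolP (P i).
  by apply: cts_eq (ctsD (hF i Pi) IH) => y; rewrite big_cons Pi.
by apply: cts_eq IH => y; rewrite big_cons (negbTE nPi).
Qed.
Lemma cts_prod (I : Type) (r : seq I) (P : pred I) (F : I -> 'rV[C]_M -> C) x :
  (forall i, P i -> ctsat (F i) x) ->
  ctsat (fun y => \prod_(i <- r | P i) F i y) x.
Proof.
move=> hF; elim: r => [|i r IH].
  by apply: (@cts_eq (fun=> 1)) (cts_cst _ _) => y; rewrite big_nil.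
have [Pi|nPi] := boolP (P i).
  by apply: cts_eq (ctsM (hF i Pi) IH) => y; rewrite big_cons Pi.
by apply: cts_eq IH => y; rewrite big_cons (negbTE nPi).
Qed.
Lemma cts_exp h x k : ctsat h x -> ctsat (fun y => h y ^+ k) x.
Proof.
move=> ch; elim: k => [|k IH].
  by apply: (@cts_eq (fun=> 1)) (cts_cst _ _) => y; rewrite expr0.
by apply: cts_eq (ctsM ch IH) => y; rewrite exprS.
Qed.
Lemma cts_local h g x (U : set 'rV[C]_M) : open U -> U x -> (forall y, U y -> h y = g y) ->
  ctsat h x -> ctsat g x.
Proof.
move=> /open_nmP/(_ x) oU Ux e ch d /ch[r r0 hr].
have [s s0 hs] := oU Ux; exists (Num.min r s); first by rewrite lt_min r0.
by move=> y; rewrite lt_min => /andP[/hr + /hs Uy]; rewrite !e.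
Qed.

Lemma cts_mpoly k (p : mpoly k C) (F : 'I_k -> 'rV[C]_M -> C) x :
  (forall i, ctsat (F i) x) -> ctsat (fun y => meval (fun i => F i y) p) x.
Proof.
move=> cF; apply: (@cts_eq (fun y => \sum_(m <- msupp p) mcoeff m p * \prod_i F i y ^+ m i)).
  by move=> y; rewrite mevalE.
apply: cts_sum => m _; apply: ctsZ.
by apply: cts_prod => i _; exact: cts_exp.
Qed.

Lemma cts_det k (A : 'rV[C]_M -> 'M[C]_k) x :
  (forall i j, ctsat (fun y => A y i j) x) -> ctsat (fun y => \det (A y)) x.
Proof.
move=> cA; apply: cts_sum => s _; apply: ctsZ.
by apply: cts_prod => i _; exact: cA.
Qed.

Lemma cts_bound h x : ctsat h x -> exists2 r, 0 < r & forall y, nm (y - x) < r -> cn (h y) <= cn (h x) + 1.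
Proof.
move=> /(_ 1 ltr01)[r r0 hr]; exists r => // y /hr h1.
by rewrite -{1}(subrK (h x) (h y)) (le_trans (cnD _ _)) // addrC lerD2l ltW.
Qed.

Lemma cts_neq0 h x : ctsat h x -> h x != 0 -> exists2 r, 0 < r & forall y, nm (y - x) < r -> h y != 0.
Proof.
move=> ch h0; have a0 : 0 < cn (h x) by rewrite cn_gt0.
have [r r0 hr] := ch _ a0; exists r => // y /hr h1; apply: contraTneq h1 => ->.
by rewrite sub0r cnN ltxx.
Qed.

End Continuity.

Section Compactness.
Context {R : realType}.
Local Notation C := R[i].

Lemma compact_box M (r : R) : compact [set x : 'rV[C]_M | forall j, `|complex.Re (x 0 j)| <= r /\ `|complex.Im (x 0 j)| <= r].
Proof.
pose D := (fun u : R * R => (u.1 +i* u.2 : C)) @` (`[(- r), r]%classic `*` `[(- r), r]%classic).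
have cD : compact D.
  apply: continuous_compact; last by apply: compact_setX; exact: segment_compact.
  apply: continuous_subspaceT => u.
  apply/(@cvgrPdist_lt R[i] R[i]^o _ (nbhs u)) => e /gt0_ReC[e0 ->].
  have e20 : 0 < complex.Re e / 2 by rewrite divr_gt0.
  exists (ball u.1 (complex.Re e / 2), ball u.2 (complex.Re e / 2)) => /=.
    by split; exact: nbhsx_ballx.
  move=> [a b] [/= ha hb]; rewrite cnE ltcR (le_lt_trans (cn_ReIm _)) //=.
  rewrite (splitr (complex.Re e)); exact: ltrD.
have := @rV_compact C M (fun=> D) (fun _ => cD).
congr compact; apply/seteqP; split=> x /= hx j.
  have [[a b] [/= + + <-]] := hx j.
  by rewrite !in_itv /= -!ler_norml.
have [h1 h2] := hx j; exists (complex.Re (x 0 j), complex.Im (x 0 j)) => /=.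
  by split; rewrite /= in_itv /= -ler_norml.
by case: (x _ _).
Qed.

Lemma compact_nm M (A : set 'rV[C]_M) (r : R) : closed A -> (forall x, A x -> nm x <= r) -> compact A.
Proof.
move=> cA hA; apply: (subclosed_compact cA (@compact_box M r)) => x Ax j.
by split; rewrite (le_trans _ (hA x Ax)) // (le_trans _ (cn_le_nm _ j)) // ?cn_Re ?cn_Im.
Qed.

Lemma compact_bounded M (A : set 'rV[C]_M) : compact A -> exists2 r : R, 0 < r & forall x, A x -> nm x <= r.
Proof.
rewrite compact_cover => /(_ nat setT (fun k => [set x | nm (x - 0) < k%:R])) [k _|x Ax|D _ hD].
- exact: open_nm_ball.
- have [k hk] : exists k : nat, nm x < k%:R.
    by exists (Num.truncn (nm x)).+1; exact: truncnS_gt.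
  by exists k => //=; rewrite subr0.
exists (1 + \sum_(k <- finmap.enum_fset D) k%:R); first by rewrite ltr_pwDl ?sumr_ge0.
move=> x /hD[k /= kD]; rewrite subr0 => /ltW /le_trans; apply.
rewrite (big_rem k) //= addrCA lerDl addr_ge0 ?sumr_ge0 //.
Qed.

Lemma compact_local_bound M (A : set 'rV[C]_M) (g : 'rV[C]_M -> R) : compact A ->
  (forall x, A x -> exists B r : R, 0 < r /\ forall y, A y -> nm (y - x) < r -> g y <= B) ->
  exists2 B : R, 0 < B & forall x, A x -> g x <= B.
Proof.
move=> cA /= hA.
have hA' x : exists Br : R * R, A x -> 0 < Br.2 /\ forall y, A y -> nm (y - x) < Br.2 -> g y <= Br.1.
  have [Ax|nAx] := pselect (A x); last by exists (0, 0).
  by have [B [r h]] := hA x Ax; exists (B, r).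
have [F hF] := choice hA'.
move: cA; rewrite compact_cover => /(_ _ A (fun x => [set y | nm (y - x) < (F x).2])) [x _|x Ax|D DA hD].
- exact: open_nm_ball.
- by exists x => //=; rewrite subrr nm0; have [] := hF x Ax.
exists (1 + \sum_(x <- finmap.enum_fset D) `|(F x).1|); first by rewrite ltr_pwDl ?sumr_ge0.
move=> x Ax; have [y /= yD xy] := hD x Ax.
have Ay : A y by apply/set_mem/DA.
have [_ /(_ x Ax xy)] := hF y Ay => /le_trans; apply.
rewrite (big_rem y) //= addrCA (le_trans (ler_norm _)) // lerDl addr_ge0 ?sumr_ge0 //.
Qed.

Lemma compact_cts_bound M (A : set 'rV[C]_M) (h : 'rV[C]_M -> C) : compact A ->
  (forall x, A x -> ctsat h x) -> exists2 B : R, 0 < B & forall x, A x -> cn (h x) <= B.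
Proof.
move=> cA ch; apply: compact_local_bound => // x /ch /cts_bound[r r0 hr].
by exists (cn (h x) + 1), r; split=> // y _; exact: hr.
Qed.

Lemma compact_cts_min M (A : set 'rV[C]_M) (h : 'rV[C]_M -> C) : compact A ->
  (forall x, A x -> ctsat h x) -> (forall x, A x -> h x != 0) ->
  exists2 B : R, 0 < B & forall x, A x -> B <= cn (h x).
Proof.
move=> cA ch h0; have [x Ax|B B0 hB] := @compact_cts_bound M A (fun x => (h x)^-1) cA.
  by apply: ctsV; [exact: ch|exact: h0].
exists B^-1 => [|x Ax]; first by rewrite invr_gt0.
have := hB x Ax; rewrite cnV => h1; rewrite -[leRHS]invrK lef_pV2 ?posrE ?invr_gt0 ?cn_gt0 ?h0 //.
Qed.

End Compactness.

(** * Directional derivatives and classes C^k *)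

Section RealDerivative.
Context {R : realType}.
Implicit Types (g : R -> R).

Definition rder g (l : R) :=
  forall e, 0 < e -> exists2 d, 0 < d & forall t, t != 0 -> `|t| < d -> `|(g t - g 0) / t - l| < e.

Lemma rder_cvg g l : rder g l <-> (fun h => h^-1 *: ((g \o shift 0) (h *: 1) - g 0)) @ 0^' --> l.
Proof.
split=> [h|/(@cvgrPdist_lt R R^o _ _ _ _) h e e0].
  apply/(@cvgrPdist_lt R R^o _ _ _ _) => e e0; have [d d0 hd] := h e e0.
  rewrite /nbhs /= /dnbhs /within /=; apply/nbhs_ballP; exists d => //= t.
  rewrite /ball /= sub0r normrN => td t0; rewrite distrC.
  have := hd t t0 td; rewrite /= /shift /= addr0 /GRing.scale /= mulr1.
  by rewrite [_^-1 * _]mulrC.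
have := h e e0; rewrite /nbhs /= /dnbhs /within /= => /nbhs_ballP[d /= d0 hd].
exists d => // t t0 td; have := hd t; rewrite /ball /= sub0r normrN => /(_ td t0).
by rewrite distrC /shift /= addr0 /GRing.scale /= mulr1 [_^-1 * _]mulrC.
Qed.

Lemma rderP g l : rder g l <-> derivable g 0 1 /\ derive1 g 0 = l.
Proof.
rewrite rder_cvg derive1E /derivable /derive; split=> [h|[h <-]]; last exact: h.
split; first by apply/cvg_ex; exists l.
exact: cvg_lim h.
Qed.

End RealDerivative.

Section Dirder.
Context {R : realType}.
Local Notation C := R[i].
Variable M : nat.
Implicit Types (x y v : 'rV[C]_M) (h g : 'rV[C]_M -> C).

(* The difference quotient, completed at t = 0, so that differentiability becomes continuity. *)
Definition dq v h x (l : C) (w : 'rV[C]_1) : C :=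
  let t := complex.Re (w 0 0) in if t == 0 then l else (h (x + t%:C *: v) - h x) / t%:C.

Definition isdd v h x l := ctsat (dq v h x l) 0.

Lemma isdd_lim v h x l : isdd v h x l <->
  forall e, 0 < e -> exists2 d, 0 < d & forall t : R, t != 0 -> `|t| < d ->
    cn ((h (x + t%:C *: v) - h x) / t%:C - l) < e.
Proof.
have q0 : dq v h x l 0 = l by rewrite /dq mxE eqxx.
split=> H e e0; have [d d0 hd] := H e e0; exists d => //.
  move=> t t0 td; have := hd (const_mx t%:C); rewrite q0 /dq mxE /= (negbTE t0); apply.
  by rewrite subr0 /nm big_ord1 mxE cn_real.
move=> w; rewrite subr0 q0 /dq => wd; case: eqP => [_|/eqP t0]; first by rewrite subrr cn0.
apply: hd => //; apply: le_lt_trans wd; rewrite (le_trans (cn_Re _)) //; exact: cn_le_nm.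
Qed.

Lemma isddP v h x l : isdd v h x l <-> dirderivable v h x /\ dirder v h x = l.
Proof.
have ReC (c : C) (t : R) : complex.Re (c / t%:C) = complex.Re c / t.
  rewrite -fmorphV /=; case: c => a b /=; by rewrite mulr0 subr0.
have ImC (c : C) (t : R) : complex.Im (c / t%:C) = complex.Im c / t.
  rewrite -fmorphV /=; case: c => a b /=; by rewrite mulr0 add0r.
have x0 : x + (0 : R)%:C *: v = x by rewrite scale0r addr0.
split=> [/isdd_lim H|[[h1 h2] dE]].
  have h1 : rder (fun t : R => complex.Re (h (x + t%:C *: v))) (complex.Re l).
    move=> e /H[d d0 hd]; exists d => // t t0 td; rewrite x0.
    rewrite -(raddfB (@complex.Re R)) /= -ReC -(raddfB (@complex.Re R)) /=.
    exact: le_lt_trans (cn_Re _) (hd t t0 td).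
  have h2 : rder (fun t : R => complex.Im (h (x + t%:C *: v))) (complex.Im l).
    move=> e /H[d d0 hd]; exists d => // t t0 td; rewrite x0.
    rewrite -(raddfB (@complex.Im R)) /= -ImC -(raddfB (@complex.Im R)) /=.
    exact: le_lt_trans (cn_Im _) (hd t t0 td).
  have [h1' e1] := (rderP _ _).1 h1; have [h2' e2] := (rderP _ _).1 h2.
  split=> //; rewrite /dirder e1 e2; by case: (l).
have r1 := (rderP _ _).2 (conj h1 (erefl _)); have r2 := (rderP _ _).2 (conj h2 (erefl _)).
apply/isdd_lim => e e0; have e20 : 0 < e / 2 by rewrite divr_gt0.
have [d d0 hd] := r1 _ e20; have [d' d'0 hd'] := r2 _ e20.
exists (Num.min d d'); first by rewrite lt_min d0.
move=> t t0; rewrite lt_min => /andP[td td'].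
rewrite (le_lt_trans (cn_ReIm _)) // (splitr e) -dE /dirder.
rewrite (raddfB (@complex.Re R)) (raddfB (@complex.Im R)) /= ReC ImC.
rewrite (raddfB (@complex.Re R)) (raddfB (@complex.Im R)) /=.
have := hd t t0 td; have := hd' t t0 td'; rewrite x0 => a b; exact: ltrD.
Qed.

Lemma isdd_dirder v h x l : isdd v h x l -> dirder v h x = l.
Proof. by move=> /isddP[]. Qed.

Lemma dirderivable_isdd v h x : dirderivable v h x -> isdd v h x (dirder v h x).
Proof. by move=> H; apply/isddP. Qed.

(** A directional derivative yields continuity along the line only, and this is all that the product
    and quotient rules need. *)
Lemma isdd_path v h x l : isdd v h x l ->
  ctsat (fun w : 'rV[C]_1 => h (x + (complex.Re (w 0 0))%:C *: v)) 0.
Proof.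
move=> H; apply: (@cts_eq _ _ (fun w : 'rV[C]_1 => h x + (complex.Re (w 0 0))%:C * dq v h x l w)).
  move=> w; rewrite /dq; case: eqP => [->|/eqP t0]; first by rewrite mul0r addr0 scale0r addr0.
  rewrite mulrC divfK; first by rewrite addrC subrK.
  by rewrite (inj_eq (@complexI R)).
apply: ctsD; first exact: cts_cst.
apply: ctsM => // e e0; exists e => // y; apply: le_lt_trans.
rewrite -rmorphB cn_real mxE /= subr0 (le_trans (cn_Re _)) //.
by rewrite subr0 cn_le_nm.
Qed.

Lemma isdd_eq v h g x l : h =1 g -> isdd v h x l -> isdd v g x l.
Proof. by move=> /funext->. Qed.

Lemma isdd_cst v (c : C) x : isdd v (fun=> c) x 0.
Proof.
apply: (@cts_eq _ _ (fun=> 0)) (cts_cst _ _) => w.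
by rewrite /dq subrr mul0r if_same.
Qed.

Lemma isddD v h g x l m : isdd v h x l -> isdd v g x m -> isdd v (fun y => h y + g y) x (l + m).
Proof.
move=> a b; apply: cts_eq (ctsD a b) => w; rewrite /dq; case: ifP => // _.
by rewrite -mulrDl; congr (_ / _); rewrite opprD addrACA.
Qed.

Lemma isddM v h g x l m : isdd v h x l -> isdd v g x m ->
  isdd v (fun y => h y * g y) x (l * g x + h x * m).
Proof.
move=> a b; apply: cts_eq (ctsD (ctsM a (isdd_path b)) (ctsZ (h x) b)) => w; rewrite /dq.
case: ifP => [/eqP->|_]; first by rewrite scale0r addr0.
by rewrite (mulrAC _ _^-1) (mulrA (h x)) -mulrDl; congr (_ / _); ring.
Qed.

Lemma isddZ v (c : C) h x l : isdd v h x l -> isdd v (fun y => c * h y) x (c * l).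
Proof. by move=> a; have := isddM (isdd_cst v c x) a; rewrite mul0r add0r. Qed.

Lemma isddN v h x l : isdd v h x l -> isdd v (fun y => - h y) x (- l).
Proof.
by move=> a; have := isddZ (-1) a; rewrite mulN1r; apply: isdd_eq => y; rewrite mulN1r.
Qed.

Lemma isdd_conj v h x l : isdd v h x l -> isdd v (fun y => (h y)^*) x (l^*).
Proof.
move=> a; apply: cts_eq (ctsJ a) => w; rewrite /dq; case: ifP => // _.
by rewrite rmorphM fmorphV rmorphB /= oppr0.
Qed.

Lemma isddV v h x l : isdd v h x l -> h x != 0 -> isdd v (fun y => (h y)^-1) x (- l / h x ^+ 2).
Proof.
move=> a h0.
have cp := isdd_path a.
have p0 : h (x + (complex.Re ((0 : 'rV[C]_1) 0 0))%:C *: v) = h x by rewrite mxE scale0r addr0.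
have [|r r0 hr] := cts_neq0 cp; first by rewrite p0.
apply: (@cts_local _ _ (fun w => - (dq v h x l w / (h (x + (complex.Re (w 0 0))%:C *: v) * h x))) _ _
  [set w | nm (w - 0) < r]); first exact: open_nm_ball.
- by rewrite /= subrr nm0.
- move=> w /hr hw; rewrite /dq; case: ifP => [/eqP->|/negbT t0].
    by rewrite scale0r addr0 expr2 mulNr.
  by field; rewrite h0 hw (inj_eq (@complexI R)) t0.
- apply: ctsN; apply: ctsM => //; apply: ctsV; last by rewrite p0 mulf_neq0.
  apply: ctsM => //; exact: cts_cst.
Qed.

Lemma isdd_coord v j x : isdd v (fun y => y 0 j) x (v 0 j).
Proof.
apply: (@cts_eq _ _ (fun=> v 0 j)) (cts_cst _ _) => w; rewrite /dq; case: eqP => // /eqP t0.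
rewrite !mxE (addrC (x 0 j)) addrK mulrC mulKf //.
by rewrite (inj_eq (@complexI R)).
Qed.

Lemma isdd_local v h g x l (U : set 'rV[C]_M) : open U -> U x -> (forall y, U y -> h y = g y) ->
  isdd v h x l -> isdd v g x l.
Proof.
move=> /open_nmP/(_ x) oU Ux e /isdd_lim H; apply/isdd_lim => d /H[r r0 hr].
have [s s0 hs] := oU Ux; pose k := 1 + nm v.
have k0 : 0 < k by rewrite ltr_pwDl ?nm_ge0.
exists (Num.min r (s / k)); first by rewrite lt_min r0 divr_gt0.
move=> t t0; rewrite lt_min => /andP[tr ts]; rewrite -!e //; first exact: hr.
apply: hs; rewrite addrAC subrr add0r nmZ cn_real.
rewrite ltr_pdivlMr // in ts; apply: le_lt_trans ts.
by rewrite ler_wpM2l // lerDr.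
Qed.

Lemma dirderivable_local v h g x (U : set 'rV[C]_M) : open U -> U x -> (forall y, U y -> h y = g y) ->
  dirderivable v h x -> dirderivable v g x.
Proof.
by move=> oU Ux e /dirderivable_isdd/(isdd_local oU Ux e)/isddP[].
Qed.

Lemma dirder_local v h g x (U : set 'rV[C]_M) : open U -> U x -> (forall y, U y -> h y = g y) ->
  dirderivable v h x -> dirder v h x = dirder v g x.
Proof.
by move=> oU Ux e /dirderivable_isdd/(isdd_local oU Ux e)/isdd_dirder.
Qed.

(** Recursive form of [Ck_on]: the derivative applied first is peeled off, so that closure
    properties follow by induction on k. *)
Fixpoint CK (k : nat) (U : set 'rV[C]_M) h : Prop :=
  (forall x, U x -> ctsat h x) /\
  match k with
  | 0 => True
  | k'.+1 => (forall x v, U x -> dirderivable v h x) /\ forall v, CK k' U (dirder v h)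
  end.

Lemma CK_cts k U h x : CK k U h -> U x -> ctsat h x.
Proof. by case: k => [|k] /= [+ _]; apply. Qed.

Lemma CK_sub k U V h : V `<=` U -> CK k U h -> CK k V h.
Proof.
move=> VU; elim: k h => [|k IH] h /= [c H]; split=> //; first by move=> x /VU; exact: c.
  by move=> x /VU; exact: c.
case: H => H1 H2; split=> [x v /VU|v]; first exact: H1.
exact: IH.
Qed.

Lemma Ck_onP k U h : Ck_on k U h <-> CK k U h.
Proof.
elim: k h => [|k IH] h; split.
- move=> H; split=> // x Ux; apply/ctsP; exact: (H x Ux [::]).1.
- move=> /= [c _] x Ux [|v vs] //=; split=> // _; exact/ctsP/c.
- move=> H; split; first by move=> x Ux; apply/ctsP; exact: (H x Ux [::]).1.
  split=> [x v Ux|v]; first exact: (H x Ux [::]).2.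
  apply/IH => x Ux vs; have := H x Ux (rcons vs v).
  by rewrite size_rcons !ltnS /iterder foldr_rcons.
- move=> [c [H1 H2]] x Ux vs; case: (lastP vs) => [|ws v] /=.
    by split=> [_|_ v]; [exact/ctsP/c|exact: H1].
  rewrite size_rcons !ltnS /iterder foldr_rcons.
  exact: ((IH _).2 (H2 v) x Ux ws).
Qed.

Lemma CK_leS k U h : CK k.+1 U h -> CK k U h.
Proof.
elim: k h => [|k IH] h; first by move=> [c _]; split.
move=> [c [H1 H2]]; split=> //; split=> // v; exact/IH/H2.
Qed.

Lemma CK_eq k U h g : open U -> (forall y, U y -> h y = g y) -> CK k U h -> CK k U g.
Proof.
move=> oU; elim: k h g => [|k IH] h g e /= [c H].
  by split=> // x Ux; apply: (cts_local oU Ux e); exact: c.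
case: H => H1 H2; split; first by move=> x Ux; apply: (cts_local oU Ux e); exact: c.
split=> [x v Ux|v]; first exact: dirderivable_local oU Ux e (H1 _ _ Ux).
apply: IH (H2 v) => y Uy; exact: dirder_local oU Uy e (H1 _ _ Uy).
Qed.

(** The way in which smoothness is established throughout: an explicit formula [D] for the
    derivative is exhibited and shown to be of one class less. Values outside [U] do not matter
    because [U] is open. *)
Lemma CK_isdd k U h : open U -> (forall x, U x -> ctsat h x) -> forall D : 'rV[C]_M -> 'rV[C]_M -> C,
  (forall x v, U x -> isdd v h x (D v x)) -> (forall v, CK k U (D v)) -> CK k.+1 U h.
Proof.
move=> oU c D H1 H2; split=> //; split=> [x v Ux|v]; first by have /isddP[] := H1 x v Ux.
by apply: (CK_eq oU) (H2 v) => y Uy; rewrite (isdd_dirder (H1 y v Uy)).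
Qed.

Lemma CK_der k U h v x : CK k.+1 U h -> U x -> isdd v h x (dirder v h x).
Proof. by move=> [_ [H _]] Ux; apply/dirderivable_isdd/H. Qed.

Lemma CK_dirder k U h v : CK k.+1 U h -> CK k U (dirder v h).
Proof. by move=> [_ [_ H]]; exact: H. Qed.

Lemma CK_cst k U (c : C) : open U -> CK k U (fun=> c).
Proof.
move=> oU; elim: k c => [|k IH] c; first by split=> // x _; exact: cts_cst.
apply: (CK_isdd oU (fun x _ => cts_cst _ _) (D := fun _ _ => 0)) => // x v _; exact: isdd_cst.
Qed.

Lemma CKD k U h g : open U -> CK k U h -> CK k U g -> CK k U (fun y => h y + g y).
Proof.
move=> oU; elim: k h g => [|k IH] h g ch cg.
  by split=> // x Ux; apply: ctsD; [exact: CK_cts ch Ux|exact: CK_cts cg Ux].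
apply: (CK_isdd oU _ (D := fun v y => dirder v h y + dirder v g y)) => [x Ux|x v Ux|v].
- by apply: ctsD; [exact: CK_cts ch Ux|exact: CK_cts cg Ux].
- by apply: isddD; [exact: CK_der ch Ux|exact: CK_der cg Ux].
- by apply: IH; [exact: CK_dirder ch|exact: CK_dirder cg].
Qed.

Lemma CKM k U h g : open U -> CK k U h -> CK k U g -> CK k U (fun y => h y * g y).
Proof.
move=> oU; elim: k h g => [|k IH] h g ch cg.
  by split=> // x Ux; apply: ctsM; [exact: CK_cts ch Ux|exact: CK_cts cg Ux].
apply: (CK_isdd oU _ (D := fun v y => dirder v h y * g y + h y * dirder v g y)) => [x Ux|x v Ux|v].
- by apply: ctsM; [exact: CK_cts ch Ux|exact: CK_cts cg Ux].
- by apply: isddM; [exact: CK_der ch Ux|exact: CK_der cg Ux].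
- apply: CKD => //; apply: IH; [exact: CK_dirder ch|exact: CK_leS|exact: CK_leS|exact: CK_dirder cg].
Qed.

Lemma CKZ k U (c : C) h : open U -> CK k U h -> CK k U (fun y => c * h y).
Proof. by move=> oU ch; apply: CKM => //; exact: CK_cst. Qed.

Lemma CKN k U h : open U -> CK k U h -> CK k U (fun y => - h y).
Proof. by move=> oU ch; apply: (CK_eq oU) (CKZ (-1) oU ch) => y _; rewrite mulN1r. Qed.

Lemma CKV k U h : open U -> (forall x, U x -> h x != 0) -> CK k U h -> CK k U (fun y => (h y)^-1).
Proof.
move=> oU h0; elim: k => [|k IH] ch.
  by split=> // x Ux; apply: ctsV; [exact: CK_cts ch Ux|exact: h0].
apply: (CK_isdd oU _ (D := fun v y => - dirder v h y * ((h y)^-1 * (h y)^-1))) => [x Ux|x v Ux|v].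
- by apply: ctsV; [exact: CK_cts ch Ux|exact: h0].
- have := isddV (CK_der v ch Ux) (h0 x Ux); by rewrite expr2 invfM.
- apply: CKM => //; first by apply: CKN => //; exact: CK_dirder ch.
  by apply: CKM => //; apply: IH; exact: CK_leS.
Qed.

Lemma CK_sum k U (I : Type) (r : seq I) (P : pred I) (F : I -> 'rV[C]_M -> C) : open U ->
  (forall i, P i -> CK k U (F i)) -> CK k U (fun y => \sum_(i <- r | P i) F i y).
Proof.
move=> oU hF; elim: r => [|i r IH].
  by apply: (CK_eq oU (h := fun=> 0)) (CK_cst _ _ oU) => y _; rewrite big_nil.
have [Pi|nPi] := boolP (P i).
  by apply: (CK_eq oU) (CKD oU (hF i Pi) IH) => y _; rewrite big_cons Pi.
by apply: (CK_eq oU) IH => y _; rewrite big_cons (negbTE nPi).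
Qed.

Lemma CK_prod k U (I : Type) (r : seq I) (P : pred I) (F : I -> 'rV[C]_M -> C) : open U ->
  (forall i, P i -> CK k U (F i)) -> CK k U (fun y => \prod_(i <- r | P i) F i y).
Proof.
move=> oU hF; elim: r => [|i r IH].
  by apply: (CK_eq oU (h := fun=> 1)) (CK_cst _ _ oU) => y _; rewrite big_nil.
have [Pi|nPi] := boolP (P i).
  by apply: (CK_eq oU) (CKM oU (hF i Pi) IH) => y _; rewrite big_cons Pi.
by apply: (CK_eq oU) IH => y _; rewrite big_cons (negbTE nPi).
Qed.

Lemma CK_exp k U h m : open U -> CK k U h -> CK k U (fun y => h y ^+ m).
Proof.
move=> oU ch; elim: m => [|m IH].
  by apply: (CK_eq oU (h := fun=> 1)) (CK_cst _ _ oU) => y _; rewrite expr0.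
by apply: (CK_eq oU) (CKM oU ch IH) => y _; rewrite exprS.
Qed.

Lemma CK_mpoly k U m (p : mpoly m C) (F : 'I_m -> 'rV[C]_M -> C) : open U ->
  (forall i, CK k U (F i)) -> CK k U (fun y => meval (fun i => F i y) p).
Proof.
move=> oU cF; apply: (@CK_eq _ _ (fun y => \sum_(mm <- msupp p) mcoeff mm p * \prod_i F i y ^+ mm i) _ oU).
  by move=> y _; rewrite mevalE.
apply: CK_sum => // mm _; apply: CKZ => //.
by apply: CK_prod => // i _; exact: CK_exp.
Qed.

Lemma CK_det k U m (A : 'rV[C]_M -> 'M[C]_m) : open U ->
  (forall i j, CK k U (fun y => A y i j)) -> CK k U (fun y => \det (A y)).
Proof.
move=> oU cA; apply: CK_sum => // s _; apply: CKZ => //.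
by apply: CK_prod => // i _; exact: cA.
Qed.

Lemma smooth_onP U h : smooth_on U h <-> forall k, CK k U h.
Proof. by split=> H k; apply/Ck_onP/H. Qed.

End Dirder.

Section Polynomials.
Context {R : realType}.
Local Notation C := R[i].
Variable M : nat.
Implicit Types (p q : mpoly M C) (x : 'rV[C]_M).

Let derivable_poly p := forall x j, isdd (delta_mx 0 j) (peval p) x (peval (mderiv j p) x).

(** Sums, products and scalar multiples inherit the property, so that it remains to treat constants
    and variables. *)
Lemma isdd_peval p x j : isdd (delta_mx 0 j) (peval p) x (peval (mderiv j p) x).
Proof.
have dD q r : derivable_poly q -> derivable_poly r -> derivable_poly (q + r).
  move=> hq hr y k; rewrite mderivD /peval mevalD.
  by apply: isdd_eq (isddD (hq y k) (hr y k)) => w; rewrite /peval mevalD.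
have dM q r : derivable_poly q -> derivable_poly r -> derivable_poly (q * r).
  move=> hq hr y k; rewrite mderivM /peval mevalD !mevalM.
  by apply: isdd_eq (isddM (hq y k) (hr y k)) => w; rewrite /peval mevalM.
have d0 : derivable_poly 0.
  move=> y k; rewrite mderiv0 /peval meval0.
  by apply: isdd_eq (isdd_cst _ 0 _) => w; rewrite meval0.
have d1 : derivable_poly 1.
  move=> y k; rewrite -mpolyC1 mderivC /peval meval0.
  by apply: isdd_eq (isdd_cst _ 1 _) => w; rewrite mevalC.
have dZ c q : derivable_poly q -> derivable_poly (c *: q).
  move=> hq y k; rewrite mderivZ /peval mevalZ.
  by apply: isdd_eq (isddZ c (hq y k)) => w; rewrite /peval mevalZ.
have dX i : derivable_poly (mpolyX C (mnm1 i)).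
  move=> y k; rewrite mderivX /peval mevalZ.
  have -> : (mnm1 i k)%:R * meval (fun j0 => y 0 j0) (mpolyX C (mnm_sub (mnm1 i) (mnm1 k))) =
      (delta_mx 0 k : 'rV[C]_M) 0 i.
    rewrite mnm1E mxE eqxx /=; case: eqVneq => [->|ik]; last by rewrite mul0r.
    rewrite mul1r (_ : mnm_sub _ _ = mnm0) ?mpolyX0 ?meval1 //.
    by apply/mnmP => l; rewrite mnmBE mnm0E subnn.
  by apply: isdd_eq (isdd_coord _ i _) => w; rewrite mevalXU.
suff : derivable_poly p by apply.
rewrite (mpolyE p); apply: (big_ind derivable_poly d0 dD) => m _; apply: dZ; rewrite mpolyXE_id.
apply: (big_ind derivable_poly d1 dM) => i _; elim: (m i) => [|k IH]; first by rewrite expr0.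
by rewrite exprS; exact: (dM _ _ (dX _) IH).
Qed.

Lemma homog_scale dd p (c : C) x : p \is ishomog1 dd (@mdeg M) ->
  peval p (c *: x) = c ^+ dd * peval p x.
Proof.
move=> /allP hp; rewrite /peval !mevalE mulr_sumr; apply: eq_big_seq => m /hp /= /eqP <-.
under eq_bigr do rewrite mxE exprMn.
by rewrite big_split /= prodrXr mdegE mulrCA.
Qed.

Lemma cts_peval p x : ctsat (peval p) x.
Proof. by apply: cts_mpoly => i; exact: cts_coord. Qed.

Lemma homog_bound dd p : p \is ishomog1 dd (@mdeg M) ->
  exists2 B : R, 0 < B & forall x, cn (peval p x) <= B * nm x ^+ dd.
Proof.
move=> /allP hp; exists (1 + \sum_(m <- msupp p) cn (mcoeff m p)).
  by rewrite ltr_pwDl ?sumr_ge0 // => m _; exact: cn_ge0.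
move=> x; rewrite mulrDl mul1r (@le_trans _ _ ((\sum_(m <- msupp p) cn (mcoeff m p)) * nm x ^+ dd)) //; last first.
  by rewrite lerDr exprn_ge0 // nm_ge0.
rewrite /peval mevalE (le_trans (cn_sum _ _ _)) // mulr_suml big_seq [leRHS]big_seq.
apply: ler_sum => m /hp /= /eqP <-; rewrite cnM ler_wpM2l ?cn_ge0 //.
rewrite mdegE -prodrXr; elim/big_ind2: _ => [|a b c e ab ce|i _].
- by rewrite cn1.
- rewrite cnM ler_pM ?cn_ge0 //.
- by rewrite cnX lerXn2r ?nnegrE ?cn_ge0 ?nm_ge0 ?cn_le_nm.
Qed.

Lemma isdd_scale (h : 'rV[C]_M -> C) (c : R) v x l : isdd (c%:C *: v) h x l -> c != 0 -> isdd v h x (l / c%:C).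
Proof.
move=> /isdd_lim H c0; apply/isdd_lim => e e0.
have [|d d0 hd] := H (e * `|c|); first by rewrite mulr_gt0 ?normr_gt0.
exists (d * `|c|); first by rewrite mulr_gt0 ?normr_gt0.
move=> t t0 td; have c0' : c%:C != 0 :> C by rewrite (inj_eq (@complexI R)).
have t0' : t%:C != 0 :> C by rewrite (inj_eq (@complexI R)).
have := hd (t / c); rewrite mulf_neq0 ?invr_eq0 // normrM normrV ?unitfE // ltr_pdivrMr ?normr_gt0 // => /(_ isT td).
rewrite scalerA -rmorphM /= divfK // => h1.
rewrite -(ltr_pM2r (_ : 0 < `|c|)) ?normr_gt0 // -cn_real -cnM.
rewrite -cn_real in h1; apply: le_lt_trans h1; rewrite le_eqVlt; apply/orP; left; apply/eqP; congr cn.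
by rewrite rmorphM fmorphV /=; field; rewrite c0' t0'.
Qed.

End Polynomials.

Section MatrixNorm.
Context {R : realType}.
Local Notation C := R[i].

Definition mm a b (A : 'M[C]_(a, b)) : R := \sum_i \sum_j cn (A i j).

Lemma mm_ge0 a b (A : 'M[C]_(a, b)) : 0 <= mm A.
Proof. by apply: sumr_ge0 => i _; apply: sumr_ge0 => j _; exact: cn_ge0. Qed.

Lemma nm_mul a b (x : 'rV[C]_a) (A : 'M[C]_(a, b)) : nm (x *m A) <= nm x * mm A.
Proof.
rewrite /nm /mm mulr_suml.
apply: (@le_trans _ _ (\sum_(j < b) \sum_i cn (x 0 i) * cn (A i j))).
  apply: ler_sum => j _; rewrite mxE (le_trans (cn_sum _ _ _)) //.
  by apply: ler_sum => i _; rewrite cnM.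
rewrite exchange_big; apply: ler_sum => i _; rewrite -mulr_sumr ler_wpM2l ?cn_ge0 //.
by rewrite [leRHS](bigD1 i) //= lerDl sumr_ge0 // => k _; apply: sumr_ge0 => j _; exact: cn_ge0.
Qed.

Lemma cn_le_mm a b (A : 'M[C]_(a, b)) i j : cn (A i j) <= mm A.
Proof.
rewrite /mm (bigD1 i) //= (bigD1 j) //= -addrA lerDl addr_ge0 // sumr_ge0 // => k _.
  exact: cn_ge0.
by apply: sumr_ge0 => l _; exact: cn_ge0.
Qed.

Lemma nm_row_mx0 a b (x : 'rV[C]_a) : nm (row_mx x (0 : 'rV[C]_b)) = nm x.
Proof.
rewrite /nm big_split_ord /= [X in _ + X]big1 ?addr0 => [|i _]; last by rewrite row_mxEr mxE cn0.
by apply: eq_bigr => i _; rewrite row_mxEl.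
Qed.

Lemma cn_det k (A : 'M[C]_k) B : (forall i j, cn (A i j) <= B) -> cn (\det A) <= (k`!)%:R * B ^+ k.
Proof.
move=> hA; rewrite (le_trans (cn_sum _ _ _)) //.
rewrite (le_trans (@ler_sum _ _ _ _ _ (fun=> B ^+ k) _)) //.
  move=> s _; rewrite cnM cn_sign mul1r.
  apply: (@le_trans _ _ (\prod_(i < k) B)); last by rewrite prodr_const card_ord.
  elim: (index_enum _) => [|i r IH]; first by rewrite !big_nil cn1.
  by rewrite !big_cons cnM ler_pM ?cn_ge0.
by rewrite sumr_const perm.card_Sn mulr_natl.
Qed.

Lemma cts_sumR M a b (A : 'rV[C]_M -> 'M[C]_(a, b)) x :
  (forall i j, ctsat (fun y => A y i j) x) ->
  forall e, 0 < e -> exists2 r, 0 < r & forall y, nm (y - x) < r -> mm (A y - A x) < e.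
Proof.
move=> cA e e0.
have H (i : 'I_a) (j : 'I_b) : ctsat (fun y => ((cn (A y i j - A x i j))%:C : C)) x.
  move=> d /(cA i j)[r r0 hr]; exists r => // y /hr; rewrite subrr cn0 subr0.
  by rewrite cn_real ger0_norm ?cn_ge0.
have : ctsat (fun y => \sum_i \sum_j ((cn (A y i j - A x i j))%:C : C)) x.
  by apply: cts_sum => i _; apply: cts_sum => j _; exact: H.
move=> /(_ e e0)[r r0 hr]; exists r => // y /hr; apply: le_lt_trans.
have s0 : \sum_i \sum_j ((cn (A x i j - A x i j))%:C : C) = 0.
  by rewrite big1 // => i _; rewrite big1 // => j _; rewrite subrr cn0.
rewrite s0 subr0 (_ : \sum_i _ = (mm (A y - A x))%:C) ?cn_real ?ler_norm //.
rewrite rmorph_sum; apply: eq_bigr => i _; rewrite rmorph_sum; apply: eq_bigr => j _.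
by rewrite !mxE.
Qed.

Lemma cts_invmx M k (A : 'rV[C]_M -> 'M[C]_k) x i j :
  (forall i j, ctsat (fun y => A y i j) x) -> \det (A x) != 0 ->
  ctsat (fun y => ((\det (A y))^-1 *: \adj (A y)) i j) x.
Proof.
move=> cA dA; apply: (@cts_eq _ _ (fun y => (\det (A y))^-1 * \adj (A y) i j)).
  by move=> y; rewrite [RHS]mxE.
apply: ctsM; first by apply: ctsV => //; exact: cts_det.
apply: (@cts_eq _ _ (fun y => (-1) ^+ (j + i) * \det (row' j (col' i (A y))))).
  by move=> y; rewrite [RHS]mxE.
apply: ctsZ; apply: cts_det => a b.
by apply: cts_eq (cA (lift j a) (lift i b)) => y; rewrite !mxE.
Qed.

Lemma CK_invmx M k c (U : set 'rV[C]_M) (A : 'rV[C]_M -> 'M[C]_k) i j : open U ->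
  (forall i j, CK c U (fun y => A y i j)) -> (forall y, U y -> \det (A y) != 0) ->
  CK c U (fun y => ((\det (A y))^-1 *: \adj (A y)) i j).
Proof.
move=> oU cA dA; apply: (@CK_eq _ _ _ _ (fun y => (\det (A y))^-1 * \adj (A y) i j)) => //.
  by move=> y _; rewrite [RHS]mxE.
apply: CKM => //; first by apply: CKV => //; exact: CK_det.
apply: (@CK_eq _ _ _ _ (fun y => (-1) ^+ (j + i) * \det (row' j (col' i (A y))))) => //.
  by move=> y _; rewrite [RHS]mxE.
apply: CKZ => //; apply: CK_det => // a b.
by apply: CK_eq (cA (lift j a) (lift i b)) => // y; rewrite !mxE.
Qed.

Lemma invmx_adj k (A : 'M[C]_k) : \det A != 0 -> invmx A = (\det A)^-1 *: \adj A.
Proof. by move=> dA; rewrite /invmx unitmxE unitfE dA. Qed.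

End MatrixNorm.

Section AbsContinuity.
Context {R : realType}.
Local Notation C := R[i].

Lemma cn_dist (x y : C) : `|cn x - cn y| <= cn (x - y).
Proof.
rewrite ler_norml; apply/andP; split; last by rewrite lerBlDr -{1}(subrK y x) cnD.
by rewrite lerNl opprB lerBlDr cnBC -{1}(subrK x y) cnD.
Qed.

Lemma cts_cn M (g : 'rV[C]_M -> C) x : ctsat g x -> ctsat (fun y => (cn (g y))%:C) x.
Proof.
move=> cg e /cg[r r0 hr]; exists r => // y /hr; apply: le_lt_trans.
by rewrite -rmorphB cn_real cn_dist.
Qed.
End AbsContinuity.

(** * Charts of the cone *)

Section Charts.
Context {R : realType} (n nu : nat).
Local Notation C := R[i].
Local Notation N := (n + nu)%N.
Local Notation point := 'rV[C]_N.
Variables (f : 'I_nu -> mpoly N C) (d : 'I_nu -> nat).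
Variable h : 'I_nu -> 'I_N -> mpoly (N + N) C.
Hypothesis f_ci : smooth_complete_intersection f d.
Hypothesis h_hefer : is_hefer f d h.

Definition fvec (z : point) : 'rV[C]_nu := \row_i peval (f i) z.
Definition hmat (x : 'rV[C]_(N + N)) : 'M[C]_(N, nu) := \matrix_(j, i) (twopii * peval (h i j) x).

Lemma hmatE (zeta z : point) : (zeta - z) *m hmat (row_mx zeta z) = fvec zeta - fvec z.
Proof.
apply/rowP => i; have [_ /(_ i zeta z) hE] := h_hefer; rewrite !mxE -hE mulr_sumr.
by apply: eq_bigr => j _; rewrite !mxE mulrCA.
Qed.

Lemma fvec0P z : fvec z = 0 <-> cone f z.
Proof.
split=> [/rowP H i|H]; first by have := H i; rewrite !mxE.
by apply/rowP => i; rewrite !mxE; exact: H.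
Qed.

Lemma cts_row_mx M a b (F : 'rV[C]_M -> 'rV[C]_a) (G : 'rV[C]_M -> 'rV[C]_b) x (i : 'I_(a + b)) :
  (forall j, ctsat (fun y => F y 0 j) x) -> (forall j, ctsat (fun y => G y 0 j) x) ->
  ctsat (fun y => row_mx (F y) (G y) 0 i) x.
Proof.
move=> cF cG; case E : (fintype.split i) => [j|j].
  by apply: (cts_eq _ (cF j)) => y; rewrite mxE E.
by apply: (cts_eq _ (cG j)) => y; rewrite mxE E.
Qed.

Lemma CK_row_mx M a b k U (F : 'rV[C]_M -> 'rV[C]_a) (G : 'rV[C]_M -> 'rV[C]_b) (i : 'I_(a + b)) : open U ->
  (forall j, CK k U (fun y => F y 0 j)) -> (forall j, CK k U (fun y => G y 0 j)) ->
  CK k U (fun y => row_mx (F y) (G y) 0 i).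
Proof.
move=> oU cF cG; case E : (fintype.split i) => [j|j].
  by apply: (CK_eq oU _ (cF j)) => y _; rewrite mxE E.
by apply: (CK_eq oU _ (cG j)) => y _; rewrite mxE E.
Qed.

(** The difference quotient of f_i at z along e_j equals the Hefer coefficient at (z + t e_j, z),
    which is continuous in t; its limit is the partial derivative. *)
Lemma hmat_diag z : hmat (row_mx z z) = (jac f z)^T.
Proof.
apply/matrixP => j i; rewrite !mxE.
have [_ hE] := h_hefer.
suff : isdd (delta_mx 0 j) (peval (f i)) z (twopii * peval (h i j) (row_mx z z)).
  by move/isdd_dirder <-; apply: isdd_dirder; exact: isdd_peval.
apply: (@cts_eq _ _ (fun w : 'rV[C]_1 => twopii * meval (fun k =>
   row_mx (z + (complex.Re (w 0 0))%:C *: delta_mx 0 j) z 0 k) (h i j))).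
  move=> w; rewrite /dq; case: eqP => [->|/eqP t0]; first by rewrite scale0r addr0.
  have t0' : (complex.Re (w 0 0))%:C != 0 :> C by rewrite (inj_eq (@complexI R)).
  rewrite -hE (bigD1 j) //= big1 => [|k kj].
    rewrite !mxE !eqxx addr0 mulr1 (addrC (z 0 j)) addrK mulrA -mulrA.
    by rewrite -mulrA; congr (_ * _); rewrite mulrCA divff // mulr1.
  by rewrite !mxE (negbTE kj) andbF mulr0 addr0 subrr mul0r.
apply: ctsZ; apply: cts_mpoly => k; apply: cts_row_mx => l; last exact: cts_cst.
apply: (@cts_eq _ _ (fun w : 'rV[C]_1 => z 0 l + (complex.Re (w 0 0))%:C * (delta_mx 0 j : point) 0 l)).
  by move=> w; rewrite !mxE.
apply: ctsD; first exact: cts_cst.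
apply: ctsM; last exact: cts_cst.
move=> e e0; exists e => // y; apply: le_lt_trans.
by rewrite -rmorphB cn_real mxE /= subr0 (le_trans (cn_Re _)) // subr0 cn_le_nm.
Qed.

(** Differentiating f_i(c z) = c^(d_i) f_i(z) multiplies the i-th row by c^(d_i - 1), so dilations
    preserve the rank of the Jacobian. *)
Lemma jac_scale (c : R) z : c != 0 ->
  jac f (c%:C *: z) = diag_mx (\row_i (c%:C ^+ d i / c%:C)) *m jac f z.
Proof.
move=> c0; apply/matrixP => i j; rewrite mul_diag_mx !mxE.
have [/(_ i)[d0 hd] _] := f_ci.
have hs : isdd (c%:C *: delta_mx 0 j) (peval (f i)) (c%:C *: z) (c%:C ^+ d i * peval (mderiv j (f i)) z).
  apply: (@cts_eq _ _ (dq (delta_mx 0 j) (fun y => c%:C ^+ d i * peval (f i) y) z (c%:C ^+ d i * peval (mderiv j (f i)) z))).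
    by move=> w; rewrite /dq; case: ifP => // _; rewrite scalerA [_ * c%:C]mulrC -scalerA -scalerDr !(homog_scale _ _ hd).
  exact: (isddZ _ (isdd_peval (f i) z j)).
have := isdd_scale hs c0; move/isdd_dirder.
by rewrite (isdd_dirder (isdd_peval _ _ _)) => ->; rewrite mulrAC.
Qed.

Lemma regcone_scale (c : R) z : c != 0 -> regcone f z -> regcone f (c%:C *: z).
Proof.
move=> c0 [cz rz]; split.
  by move=> i; have [/(_ i)[_ hd] _] := f_ci; rewrite (homog_scale _ _ hd) cz mulr0.
set D : 'M[C]_nu := diag_mx (\row_i (c%:C ^+ d i / c%:C)).
suff F : row_full D by rewrite jac_scale // -/D (eqmxMfull _ F).
rewrite row_full_unit unitmxE det_diag unitfE; apply/prodf_neq0 => i _.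
by rewrite mxE mulf_neq0 ?invr_eq0 ?expf_neq0 // (inj_eq (@complexI R)).
Qed.

Section At.
Variable z0 : point.
Hypothesis rz0 : regcone f z0.

Definition emat : 'M[C]_(N, n) := adjm (frame n f z0).
(** The difference quotient of f completed by the tangential coordinates at [z0] to a square matrix.
    On the diagonal at [z0] it is invertible, because tangent and conormal directions together
    span. *)
Definition gmat (x : 'rV[C]_(N + N)) : 'M[C]_N := row_mx emat (hmat x).

Lemma gmat_unit0 : gmat (row_mx z0 z0) \in unitmx.
Proof.
have [FJ FF] := frameP (erefl _) rz0; have [_ rJ] := rz0.
have uG := jac_gram_unit rJ.
set F := frame n f z0 in FJ FF; set B := (jac f z0)^T in FJ uG.
have BF : adjm B *m adjm F = 0 by rewrite -adjmM FJ adjm0.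
have : col_mx F (invmx (adjm B *m B) *m adjm B) *m gmat (row_mx z0 z0) = 1%:M.
  rewrite /gmat hmat_diag -/B mul_col_row /emat -/F FF FJ -!mulmxA BF mulmx0 mulVmx //.
  by rewrite -scalar_mx_block.
by move/mulmx1_unit => [].
Qed.

Lemma cts_gmat M (F : 'rV[C]_M -> 'rV[C]_(N + N)) x i j :
  (forall k, ctsat (fun y => F y 0 k) x) -> ctsat (fun y => gmat (F y) i j) x.
Proof.
move=> cF; case E : (fintype.split j) => [k|k].
  by apply: (@cts_eq _ _ (fun=> emat i k)) (cts_cst _ _) => y; rewrite /gmat [RHS]mxE E.
apply: (@cts_eq _ _ (fun y => twopii * meval (fun k => F y 0 k) (h k i))).
  by move=> y; rewrite /gmat mxE E mxE.
by apply: ctsZ; exact: cts_mpoly.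
Qed.

Lemma CK_gmat M k U (F : 'rV[C]_M -> 'rV[C]_(N + N)) i j : open U ->
  (forall k', CK k U (fun y => F y 0 k')) -> CK k U (fun y => gmat (F y) i j).
Proof.
move=> oU cF; case E : (fintype.split j) => [l|l].
  by apply: (CK_eq oU (h := fun=> emat i l)) (CK_cst _ _ oU) => y _; rewrite /gmat [RHS]mxE E.
apply: (CK_eq oU (h := fun y => twopii * meval (fun k => F y 0 k) (h l i))).
  by move=> y _; rewrite /gmat mxE E mxE.
by apply: CKZ => //; exact: CK_mpoly.
Qed.

(** Vanishes exactly when z lies on the cone and has tangential coordinates w. Solving this equation
    for z is the implicit function theorem for the chart. *)
Definition gnew (w : 'rV[C]_n) (z : point) : 'rV[C]_N := row_mx (z *m emat - w) (fvec z).

Lemma gnewB w w' z z' : gnew w z - gnew w' z' = (z - z') *m gmat (row_mx z z') - row_mx (w - w') 0.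
Proof.
rewrite /gnew /gmat mul_mx_row hmatE mulmxBl.
rewrite !opp_row_mx !add_row_mx subr0; congr (row_mx _ _).
by rewrite !opprD !opprK addrACA.
Qed.

Lemma good_radius : exists r B : R, [/\ 0 < r, 0 < B &
  forall z z' : point, nm (z - z0) < r -> nm (z' - z0) < r ->
    [/\ \det (gmat (row_mx z z')) != 0, mm (invmx (gmat (row_mx z z'))) <= B &
        mm (1%:M - gmat (row_mx z z') *m invmx (gmat (row_mx z0 z0))) <= 2^-1]].
Proof.
set x0 : 'rV[C]_(N + N) := row_mx z0 z0.
have cG i j : ctsat (fun x => gmat x i j) x0 by apply: cts_gmat => k; exact: cts_coord.
have d0 : \det (gmat x0) != 0 by rewrite -unitfE -unitmxE gmat_unit0.
have [r1 r10 h1] := cts_neq0 (cts_det cG) d0.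
have cI : forall e : R, 0 < e -> exists2 r, 0 < r & forall y, nm (y - x0) < r ->
    mm ((\det (gmat y))^-1 *: \adj (gmat y) - (\det (gmat x0))^-1 *: \adj (gmat x0)) < e.
  exact: (@cts_sumR _ _ _ _ (fun y => (\det (gmat y))^-1 *: \adj (gmat y)) x0 (fun i j => cts_invmx i j cG d0)).
have [r2 r20 h2] := cI 1 ltr01.
have cP i j : ctsat (fun y => (1%:M - gmat y *m invmx (gmat x0)) i j) x0.
  apply: (@cts_eq _ _ (fun y => (1%:M : 'M[C]_N) i j - \sum_k gmat y i k * invmx (gmat x0) k j)).
    by move=> y; rewrite !mxE.
  apply: ctsB; first exact: cts_cst.
  by apply: cts_sum => k _; apply: ctsM => //; exact: cts_cst.
have [r3 r30 h3] := cts_sumR cP (e := 2^-1) ltac:(by rewrite invr_gt0).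
(* Halved because the distance of (z, z') from (z0, z0) in [nm] is the sum of the two distances. *)
pose r := Num.min r1 (Num.min r2 r3) / 2.
have mmD a b (A A' : 'M[C]_(a, b)) : mm A <= mm (A - A') + mm A'.
  rewrite /mm -big_split; apply: ler_sum => i _; rewrite -big_split; apply: ler_sum => j _ /=.
  by rewrite !mxE -{1}(subrK (A' i j) (A i j)) cnD.
exists r, (1 + mm ((\det (gmat x0))^-1 *: \adj (gmat x0))); split.
- by rewrite /r divr_gt0 // !lt_min r10 r20.
- by rewrite ltr_pwDl ?mm_ge0.
move=> z z' hz hz'.
have : nm (row_mx z z' - x0) < Num.min r1 (Num.min r2 r3).
  rewrite /x0 opp_row_mx add_row_mx /nm big_split_ord /= (splitr (Num.min _ _)).
  apply: ltrD.
    by under eq_bigr do rewrite row_mxEl; exact: hz.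
  by under eq_bigr do rewrite row_mxEr; exact: hz'.
rewrite !lt_min => /and3P[/h1 k1 /h2 k2 /h3 k3]; split => //.
  rewrite invmx_adj // (le_trans (mmD _ _ _ ((\det (gmat x0))^-1 *: \adj (gmat x0)))) // lerD2r.
  exact: ltW.
have -> : 1%:M - gmat (row_mx z z') *m invmx (gmat x0) =
   1%:M - gmat (row_mx z z') *m invmx (gmat x0) - (1%:M - gmat x0 *m invmx (gmat x0)).
  by rewrite mulmxV ?gmat_unit0 // subrr subr0.
exact: ltW.
Qed.

Local Notation V0 := (invmx (gmat (row_mx z0 z0))).
(* By the Hefer forms, differences of gnew are linear in z - z', so that this map
   contracts. *)
Definition newton (w : 'rV[C]_n) (z : point) : point := z - gnew w z *m V0.

Lemma newtonB w z z' : newton w z - newton w z' =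
  (z - z') *m (1%:M - gmat (row_mx z z') *m V0).
Proof.
have e : (z - z') *m gmat (row_mx z z') = gnew w z - gnew w z'.
  by rewrite gnewB subrr row_mx0 subr0.
rewrite /newton !opprD !opprK addrACA mulmxBr mulmx1 mulmxA e mulmxBl opprB.
by rewrite [- _ + _]addrC.
Qed.

Lemma gnew_fix w z : newton w z = z -> gnew w z = 0.
Proof.
move=> /eqP; rewrite /newton subr_eq addrC -subr_eq subrr => /eqP/esym h0.
by rewrite -[LHS]mulmx1 -(mulVmx gmat_unit0) mulmxA h0 mul0mx.
Qed.

(** [newton w] maps the closed ball of radius [rho] to itself and halves distances there. Instead of
    the limit of a Cauchy sequence, compactness is used: without a fixed point the displacement
    would have a positive minimum on the ball, but it tends to 0 along the iterates. *)
Lemma newton_solve (r B rho : R) : 0 < rho -> rho < r ->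
  (forall z z' : point, nm (z - z0) < r -> nm (z' - z0) < r ->
    [/\ \det (gmat (row_mx z z')) != 0, mm (invmx (gmat (row_mx z z'))) <= B &
        mm (1%:M - gmat (row_mx z z') *m V0) <= 2^-1]) ->
  exists2 s : R, 0 < s & forall w, nm (w - z0 *m emat) < s ->
    exists2 z, nm (z - z0) <= rho & gnew w z = 0.
Proof.
move=> rho0 rhor H; have V1 : 0 < 1 + mm V0 by rewrite ltr_pwDl ?mm_ge0.
(* With this radius [newton w] moves [z0] by at most rho/2; the contraction by 1/2 accounts for the
   other half. The summand 1 only keeps the denominator positive. *)
exists (rho / 2 / (1 + mm V0)); first by rewrite !divr_gt0.
move=> w hw.
have half z z' : nm (z - z0) <= rho -> nm (z' - z0) <= rho ->
    nm (newton w z - newton w z') <= nm (z - z') / 2.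
  move=> hz hz'; have [_ _ h3] := H z z' (le_lt_trans hz rhor) (le_lt_trans hz' rhor).
  by rewrite newtonB (le_trans (nm_mul _ _)) // ler_wpM2l ?nm_ge0.
have T0 : nm (newton w z0 - z0) <= rho / 2.
  rewrite /newton addrAC subrr add0r nmN (le_trans (nm_mul _ _)) //.
  have -> : gnew w z0 = - row_mx (w - z0 *m emat) 0.
    by rewrite /gnew (fvec0P z0).2 ?opp_row_mx ?oppr0 ?opprB //; case: rz0.
  rewrite nmN nm_row_mx0 (le_trans _ (ltW (_ : nm (w - z0 *m emat) * (1 + mm V0) < _))) //.
    by rewrite ler_wpM2l ?nm_ge0 // lerDr.
  by rewrite -ltr_pdivlMr.
have TB z : nm (z - z0) <= rho -> nm (newton w z - z0) <= rho.
  move=> hz; rewrite (le_trans (nm_triB _ (newton w z0) _)) // (splitr rho) lerD //.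
  rewrite (le_trans (half _ _ hz _)) ?subrr ?nm0 ?(ltW rho0) //.
  by rewrite ler_wpM2r.
pose A := [set z : point | nm (z - z0) <= rho].
have cA : compact A.
  apply: (@compact_nm _ _ _ (rho + nm z0)); last first.
    by move=> z /= hz; rewrite -lerBlDr (le_trans (ler_nmB _ _)).
  move=> z /closure_nmP hz; change (nm (z - z0) <= rho); rewrite leNgt; apply/negP => lz.
  have [|y /= Ay yz] := hz (nm (z - z0) - rho); first by rewrite subr_gt0.
  have := nm_triB z y z0; rewrite leNgt => /negP; apply.
  by rewrite nmBC -(subrK rho (nm (z - z0))) ltr_leD.
pose gap z : R := nm (newton w z - z).
apply: contrapT => nofix.
have g0 z : A z -> gap z != 0.
  move=> Az; apply/eqP => /nm_eq0/eqP; rewrite subr_eq0 => /eqP/gnew_fix e.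
  by apply: nofix; exists z.
have gc z : A z -> ctsat (fun y => (gap y)%:C) z.
  move=> Az e e0; have cN : ctsat (fun y => \sum_j ((cn ((newton w y - y) 0 j))%:C : C)) z.
    apply: cts_sum => j _.
    have cj : ctsat (fun y => (newton w y - y) 0 j) z.
      apply: (@cts_eq _ _ (fun y => - \sum_k gnew w y 0 k * V0 k j)).
        by move=> y; rewrite /newton addrAC subrr add0r !mxE.
      apply: ctsN; apply: cts_sum => k _; apply: ctsM; last exact: cts_cst.
      case E : (fintype.split k) => [l|l].
        apply: (@cts_eq _ _ (fun y => \sum_m y 0 m * emat m l - w 0 l)).
          by move=> y; rewrite /gnew mxE E !mxE.
        apply: ctsB; last exact: cts_cst.
        by apply: cts_sum => m _; apply: ctsM; [exact: cts_coord|exact: cts_cst].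
      apply: (@cts_eq _ _ (fun y => peval (f l) y)); last exact: cts_peval.
      by move=> y; rewrite /gnew mxE E !mxE.
    exact: cts_cn.
  have [r' r'0 hr'] := cN e e0; exists r' => // y /hr'.
  by rewrite /gap /nm !rmorph_sum.
have [b b0 hb] := compact_cts_min cA gc (fun z Az => eq_ind_r (fun b => ~~ b) (g0 z Az) (inj_eq (@complexI R) _ _)).
pose it k := iter k (newton w) z0.
have Ait k : A (it k).
  by elim: k => [|k IH]; rewrite /A /= ?subrr ?nm0 ?(ltW rho0) //; exact: TB.
have git k : gap (it k) <= gap z0 / 2 ^+ k.
  elim: k => [|k IH]; first by rewrite expr0 divr1.
  rewrite /gap /= (le_trans (half _ _ _ _)) //; [exact: TB (Ait k)|exact: Ait|].
  by rewrite exprSr invfM mulrA ler_wpM2r // ?invr_ge0.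
pose k := (Num.truncn (gap z0 / b)).+1.
have : gap z0 / b < 2 ^+ k.
  apply: (lt_trans (truncnS_gt _)); rewrite -natrX ltr_nat.
  exact: ltn_expl.
rewrite ltr_pdivrMr // => lk.
have := hb _ (Ait k); rewrite cn_real ger0_norm ?nm_ge0 // leNgt => /negP; apply.
by rewrite (le_lt_trans (git k)) // ltr_pdivrMr ?exprn_gt0 // mulrC.
Qed.

Section Psi.
Variables (r0 B s : R).
Hypothesis hr0 : 0 < r0.
Hypothesis B0 : 0 < B.
Hypothesis hG : forall z z' : point, nm (z - z0) < r0 -> nm (z' - z0) < r0 ->
    \det (gmat (row_mx z z')) != 0 /\ mm (invmx (gmat (row_mx z z'))) <= B.
Hypothesis s0 : 0 < s.
Hypothesis hs : forall w, nm (w - z0 *m emat) < s -> exists2 z, nm (z - z0) < r0 & gnew w z = 0.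

Definition psi (w : 'rV[C]_n) : point := xget z0 [set z | nm (z - z0) < r0 /\ gnew w z = 0].
Definition psi_dom : set 'rV[C]_n := [set w | nm (w - z0 *m emat) < s].

Lemma psi_dom_open : open psi_dom. Proof. exact: open_nm_ball. Qed.

Lemma psiP w : psi_dom w -> nm (psi w - z0) < r0 /\ gnew w (psi w) = 0.
Proof.
move=> Uw; rewrite /psi; case: xgetP => [z -> //|no].
by have [z h1 h2] := hs Uw; case: (no z).
Qed.

Lemma psi_cone w : psi_dom w -> cone f (psi w) /\ psi w *m emat = w.
Proof.
move=> /psiP[_ /eqP]; rewrite /gnew row_mx_eq0 => /andP[/eqP h1 /eqP/fvec0P h2].
by split=> //; apply/eqP; rewrite -subr_eq0 h1.
Qed.

(** Both points solve their equations, so the exact linearity of differences of [gnew] gives the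
    difference of [psi] by an inverse matrix. The Lipschitz bound, the derivative and the holomorphy
    of the chart are all read off from this identity. *)
Lemma psiB w w' : psi_dom w -> psi_dom w' ->
  psi w - psi w' = row_mx (w - w') 0 *m invmx (gmat (row_mx (psi w) (psi w'))).
Proof.
move=> Uw Uw'; have [h1 e1] := psiP Uw; have [h2 e2] := psiP Uw'.
have [dG _] := hG h1 h2.
have uG : gmat (row_mx (psi w) (psi w')) \in unitmx by rewrite unitmxE unitfE.
have := gnewB w w' (psi w) (psi w'); rewrite e1 e2 subrr => /esym/eqP; rewrite subr_eq0 => /eqP <-.
by rewrite -mulmxA mulmxV // mulmx1.
Qed.

Lemma psi_uniq w z : psi_dom w -> nm (z - z0) < r0 -> gnew w z = 0 -> z = psi w.
Proof.
move=> Uw hz ez; have [h1 e1] := psiP Uw; have [dG _] := hG hz h1.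
have uG : gmat (row_mx z (psi w)) \in unitmx by rewrite unitmxE unitfE.
have := gnewB w w z (psi w); rewrite e1 ez !subrr row_mx0 subr0 => /esym hh.
by apply/eqP; rewrite -subr_eq0 -[z - _]mulmx1 -(mulmxV uG) mulmxA hh mul0mx.
Qed.

Lemma psi_lip w w' : psi_dom w -> psi_dom w' -> nm (psi w - psi w') <= nm (w - w') * B.
Proof.
move=> Uw Uw'; have [h1 e1] := psiP Uw; have [h2 e2] := psiP Uw'.
rewrite psiB // (le_trans (nm_mul _ _)) // nm_row_mx0 ler_wpM2l ?nm_ge0 //.
by have [_] := hG h1 h2.
Qed.

Lemma psi_cts w j : psi_dom w -> ctsat (fun y => psi y 0 j) w.
Proof.
move=> Uw e e0; have /open_nmP/(_ w Uw)[t t0 ht] := psi_dom_open.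
exists (Num.min t (e / B)); first by rewrite lt_min t0 divr_gt0.
move=> y; rewrite lt_min => /andP[/ht Uy yw].
have -> : psi y 0 j - psi w 0 j = (psi y - psi w) 0 j by rewrite !mxE.
rewrite (le_lt_trans (cn_le_nm _ _)) // (le_lt_trans (psi_lip Uy Uw)) //.
by rewrite -ltr_pdivlMr.
Qed.

Definition ginv (w w' : 'rV[C]_n) : 'M[C]_N :=
  let G := gmat (row_mx (psi w) (psi w')) in (\det G)^-1 *: \adj G.

Definition psider (v w : 'rV[C]_n) (j : 'I_N) : C := \sum_k v 0 k * ginv w w (lshift nu k) j.

Lemma psiBE w w' j : psi_dom w -> psi_dom w' ->
  (psi w - psi w') 0 j = \sum_k (w - w') 0 k * ginv w w' (lshift nu k) j.
Proof.
move=> Uw Uw'; have [h1 e1] := psiP Uw; have [h2 e2] := psiP Uw'.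
rewrite psiB // invmx_adj; last by have [] := hG h1 h2.
rewrite -/(ginv w w') mxE big_split_ord /= [X in _ + X]big1 ?addr0 => [|k _]; last first.
  by rewrite row_mxEr mxE mul0r.
by apply: eq_bigr => k _; rewrite row_mxEl.
Qed.

Lemma psi_isdd v w j : psi_dom w -> isdd v (fun y => psi y 0 j) w (psider v w j).
Proof.
move=> Uw; have [h1 e1] := psiP Uw.
have cA : ctsat (fun y => \sum_k v 0 k * ginv y w (lshift nu k) j) w.
  apply: cts_sum => k _; apply: ctsZ.
  apply: (@cts_invmx _ _ _ (fun y => gmat (row_mx (psi y) (psi w)))) => [a b|]; last by have [] := hG h1 h1.
  apply: (@cts_gmat _ (fun y => row_mx (psi y) (psi w))) => l.
  by apply: cts_row_mx => m; [exact: psi_cts|exact: cts_cst].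
apply/isdd_lim => e /cA[t t0 ht].
have /open_nmP/(_ w Uw)[t' t'0 ht'] := psi_dom_open.
pose k := 1 + nm v; have k0 : 0 < k by rewrite ltr_pwDl ?nm_ge0.
exists (Num.min t t' / k); first by rewrite divr_gt0 // lt_min t0.
move=> x x0; rewrite ltr_pdivlMr // => hx.
have : nm (w + x%:C *: v - w) < Num.min t t'.
  rewrite addrAC subrr add0r nmZ cn_real; apply: le_lt_trans hx.
  by rewrite ler_wpM2l // lerDr.
rewrite lt_min => /andP[/ht hx1 /ht' hx2].
have -> : psi (w + x%:C *: v) 0 j - psi w 0 j = (psi (w + x%:C *: v) - psi w) 0 j by rewrite !mxE.
rewrite psiBE // (_ : (\sum_k0 _) / _ = \sum_k v 0 k * ginv (w + x%:C *: v) w (lshift nu k) j) //.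
rewrite mulr_suml; apply: eq_bigr => l _; rewrite addrAC subrr add0r !mxE.
have x0' : x%:C != 0 :> C by rewrite (inj_eq (@complexI R)).
by rewrite mulrAC [x%:C * _]mulrC mulfK.
Qed.

(** Bootstrapping: the derivative of [psi] is a rational expression in [psi] itself, so class C^k
    implies class C^(k+1). *)
Lemma psi_CK k j : CK k psi_dom (fun y => psi y 0 j).
Proof.
have oU := psi_dom_open.
elim: k j => [|k IH] j; first by split=> // w Uw; exact: psi_cts.
apply: (CK_isdd oU _ (D := fun v w => psider v w j)) => [w Uw|w v Uw|v].
- exact: psi_cts.
- exact: psi_isdd.
- apply: CK_sum => // l _; apply: CKZ => //.
  apply: (@CK_invmx _ _ _ _ _ (fun y => gmat (row_mx (psi y) (psi y)))) => // [a b|y Uy].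
    apply: (@CK_gmat _ _ _ (fun y => row_mx (psi y) (psi y))) => // m.
    by apply: CK_row_mx => // i; exact: IH.
  by have [h1 e1] := psiP Uy; have [] := hG h1 h1.
Qed.

Lemma psider_imC w k j : psider (imC *: delta_mx 0 k) w j = imC * psider (delta_mx 0 k) w j.
Proof. by rewrite mulr_sumr; apply: eq_bigr => l _; rewrite mxE mulrA. Qed.

Lemma imC_sqr : imC * imC = -1 :> C.
Proof. by rewrite /imC; simpc. Qed.

(** [psider] is complex linear in the direction, which is the Cauchy-Riemann equation. *)
Lemma psi_wirt w k j : psi_dom w ->
  wirt k (fun y => psi y 0 j) w = ginv w w (lshift nu k) j /\
  wirtbar k (fun y => psi y 0 j) w = 0.
Proof.
move=> Uw; rewrite /wirt /wirtbar !(isdd_dirder (psi_isdd _ _ Uw)) psider_imC.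
rewrite !mulrA imC_sqr mulN1r opprK subrr mul0r; split=> //.
rewrite -mulr2n -[_ *+ 2]mulr_natr mulfK ?pnatr_eq0 // /psider (bigD1 k) //= big1 ?addr0 => [|l lk].
  by rewrite mxE !eqxx mul1r.
by rewrite mxE (negbTE lk) andbF mul0r.
Qed.

Lemma psi_jacE w : psi_dom w -> psi_jac psi w = usubmx (invmx (gmat (row_mx (psi w) (psi w)))).
Proof.
move=> Uw; have [h1 e1] := psiP Uw; have [dG _] := hG h1 h1.
apply/matrixP => k j; rewrite !mxE (psi_wirt _ _ Uw).1 invmx_adj //.
Qed.

Lemma psi_inv w : psi_dom w -> let G := gmat (row_mx (psi w) (psi w)) in
  usubmx (invmx G) *m emat = 1%:M /\ dsubmx (invmx G) *m (jac f (psi w))^T = 1%:M.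
Proof.
move=> Uw G; have [h1 e1] := psiP Uw; have [dG _] := hG h1 h1.
have uG : G \in unitmx by rewrite unitmxE unitfE.
have E : G = row_mx emat (jac f (psi w))^T by rewrite /G /gmat hmat_diag.
have := mulVmx uG; rewrite -{1}(vsubmxK (invmx G)) {3}E mul_col_row.
by rewrite scalar_mx_block => /eq_block_mx[-> _ _ ->].
Qed.

Lemma psi_regcone w : psi_dom w -> regcone f (psi w).
Proof.
move=> Uw; split; first by have [] := psi_cone Uw.
apply/eqP; rewrite -mxrank_tr; change (row_full (jac f (psi w))^T); apply/row_fullP.
by exists (dsubmx (invmx (gmat (row_mx (psi w) (psi w))))); have [] := psi_inv Uw.
Qed.

Lemma scaled_isdd (c : R) v w j : psi_dom w ->
  isdd v (fun y => (c%:C *: psi y) 0 j) w (c%:C * psider v w j).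
Proof.
by move=> Uw; apply: isdd_eq (isddZ c%:C (psi_isdd v j Uw)) => y; rewrite mxE.
Qed.

Lemma scaled_wirt (c : R) w k j : psi_dom w ->
  wirt k (fun y => (c%:C *: psi y) 0 j) w = c%:C * wirt k (fun y => psi y 0 j) w /\
  wirtbar k (fun y => (c%:C *: psi y) 0 j) w = c%:C * wirtbar k (fun y => psi y 0 j) w.
Proof.
move=> Uw; rewrite /wirt /wirtbar !(isdd_dirder (psi_isdd _ _ Uw)) !(isdd_dirder (scaled_isdd _ _ _ Uw)).
by rewrite !mulrA -!mulrA; split; ring.
Qed.

Lemma scaled_jac (c : R) w : psi_dom w ->
  psi_jac (fun w => c%:C *: psi w) w = c%:C *: usubmx (invmx (gmat (row_mx (psi w) (psi w)))).
Proof.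
move=> Uw; rewrite -psi_jacE //; apply/matrixP => k j; rewrite [RHS]mxE !mxE.
exact: (scaled_wirt _ _ _ Uw).1.
Qed.

(** The dilation by [c] is built in because one chart, found at a point of the annulus, is
    transported to all scales of the cone. *)
Lemma psi_parametrization (c : R) : c != 0 ->
  is_parametrization f psi_dom (fun w => c%:C *: psi w).
Proof.
move=> c0; have c0' : c%:C != 0 :> C by rewrite (inj_eq (@complexI R)).
split.
- exact: psi_dom_open.
- move=> j; apply/smooth_onP => k.
  apply: (@CK_eq _ _ _ _ (fun y => c%:C * psi y 0 j)) => [|y _|]; first exact: psi_dom_open.
    by rewrite mxE.
  by apply: CKZ; [exact: psi_dom_open|exact: psi_CK].
- by move=> j k w Uw; rewrite (scaled_wirt _ _ _ Uw).2 (psi_wirt _ _ Uw).2 mulr0.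
- move=> w Uw; split; first by apply: regcone_scale => //; exact: psi_regcone.
  rewrite scaled_jac // mxrank_scale_nz //.
  apply/eqP; change (row_free (usubmx (invmx (gmat (row_mx (psi w) (psi w)))))); apply/row_freeP.
  by exists emat; have [] := psi_inv Uw.
- move=> w w' /set_mem Uw /set_mem Uw' /(scalerI c0') e.
  by rewrite -(psi_cone Uw).2 -(psi_cone Uw').2 e.
Qed.

Lemma psi_density (c : R) w : psi_dom w ->
  cn (\det (psi_jac (fun w => c%:C *: psi w) w *m (map_mx conjc (psi_jac (fun w => c%:C *: psi w) w))^T))
  <= n`!%:R * (N%:R * (`|c| * B) ^+ 2) ^+ n.
Proof.
move=> Uw; have [h1 e1] := psiP Uw; have [_ hB] := hG h1 h1.
have le1 k j : cn (psi_jac (fun w => c%:C *: psi w) w k j) <= `|c| * B.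
  rewrite scaled_jac // mxE cnM cn_real ler_wpM2l // mxE (le_trans _ hB) //; exact: cn_le_mm.
apply: cn_det => k l; rewrite mxE (le_trans (cn_sum _ _ _)) //.
apply: (@le_trans _ _ (\sum_(j < N) (`|c| * B) ^+ 2)).
  by apply: ler_sum => j _; rewrite !mxE cnM cnJ expr2 ler_pM ?cn_ge0 // -?[psi_jac _ _ _ _]mxE; have := le1; rewrite /psi_jac; [move/(_ k j)|move/(_ l j)]; rewrite mxE.
by rewrite sumr_const card_ord mulr_natl.
Qed.

End Psi.

End At.

End Charts.

(** * Measurability *)

Section Monotone.
Context d (T : measurableType d) (R : realType) (mu : {measure set T -> \bar R}).

(* No measurability is required: the integral of a nonnegative function is a supremum over simple functions. *)
Lemma mono_integral (D : set T) (f1 f2 : T -> \bar R) :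
  (forall x, D x -> (f1 x <= f2 x)%E) ->
  (\int[mu]_(x in D) f1 x <= \int[mu]_(x in D) f2 x)%E.
Proof.
move=> f12.
have h x : ((f1 \_ D) x <= (f2 \_ D) x)%E.
  by rewrite /patch; case: ifPn => // /set_mem; exact: f12.
rewrite /integral; apply: leeB.
  apply: le_ereal_sup => _ [g hg <-]; exists g => // x; apply: le_trans (hg x) _.
  by rewrite !unlock ge_max !le_max h /= lexx orbT.
apply: le_ereal_sup => _ [g hg <-]; exists g => // x; apply: le_trans (hg x) _.
by rewrite !unlock ge_max !le_max leeN2 h /= lexx orbT.
Qed.

End Monotone.

Section ComplexMeasurable.
Context {R : realType}.
Local Notation C := R[i].
Context d (T : measurableType d).
Implicit Types (f g : T -> C).

Definition cmeas f := measurable_fun setT (fun x => complex.Re (f x)) /\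
  measurable_fun setT (fun x => complex.Im (f x)).

Lemma cmeas_cst (c : C) : cmeas (fun=> c).
Proof. by split; exact: measurable_cst. Qed.
Lemma cmeas_eq f g : f =1 g -> cmeas f -> cmeas g.
Proof. by move=> /funext->. Qed.
Lemma cmeas_real (r : T -> R) : measurable_fun setT r -> cmeas (fun x => (r x)%:C).
Proof. by move=> mr; split => //=; exact: measurable_cst. Qed.
Lemma cmeasD f g : cmeas f -> cmeas g -> cmeas (fun x => f x + g x).
Proof.
move=> [f1 f2] [g1 g2]; split.
  by under eq_fun do rewrite (raddfD (@complex.Re R)) /=; exact: measurable_funD.
by under eq_fun do rewrite (raddfD (@complex.Im R)) /=; exact: measurable_funD.
Qed.
Lemma cmeasN f : cmeas f -> cmeas (fun x => - f x).
Proof.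
move=> [f1 f2]; split.
  by under eq_fun do rewrite (raddfN (@complex.Re R)) /=; exact: measurable_funN.
by under eq_fun do rewrite (raddfN (@complex.Im R)) /=; exact: measurable_funN.
Qed.
Lemma cmeasB f g : cmeas f -> cmeas g -> cmeas (fun x => f x - g x).
Proof. by move=> mf mg; apply: cmeasD => //; exact: cmeasN. Qed.
Lemma ReM (x y : C) : complex.Re (x * y) = complex.Re x * complex.Re y - complex.Im x * complex.Im y.
Proof. by case: x => a b; case: y. Qed.
Lemma ImM (x y : C) : complex.Im (x * y) = complex.Re x * complex.Im y + complex.Im x * complex.Re y.
Proof. by case: x => a b; case: y. Qed.
Lemma cmeasM f g : cmeas f -> cmeas g -> cmeas (fun x => f x * g x).
Proof.
move=> [f1 f2] [g1 g2]; split.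
  under eq_fun do rewrite ReM.
  by apply: measurable_funB; apply: measurable_funM.
under eq_fun do rewrite ImM.
by apply: measurable_funD; apply: measurable_funM.
Qed.
Lemma cmeasZ (c : C) f : cmeas f -> cmeas (fun x => c * f x).
Proof. by move=> mf; apply: cmeasM => //; exact: cmeas_cst. Qed.
Lemma cmeasJ f : cmeas f -> cmeas (fun x => (f x)^*).
Proof.
move=> [f1 f2]; split.
  by rewrite (_ : (fun _ => _) = fun x => complex.Re (f x)) //; apply/funext => x; case: (f x).
rewrite (_ : (fun _ => _) = fun x => - complex.Im (f x)); first exact: measurable_funN.
by apply/funext => x; case: (f x).
Qed.
Lemma meas_cn f : cmeas f -> measurable_fun setT (fun x => cn (f x)).
Proof.
move=> [f1 f2].
under eq_fun do rewrite cnE2 -powR12_sqrt ?addr_ge0 ?sqr_ge0 //.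
apply: (@measurableT_comp _ _ _ _ _ _ (fun y : R => y `^ 2^-1)); first exact: measurable_powR.
by apply: measurable_funD; apply: measurable_funX.
Qed.
(** Reduced to the measurability of powers by 1/r = r / r^2, where r^(-2) is a [powR] of |r|. The
    formula also holds at r = 0 with the default value of the inverse. *)
Lemma measV (r : T -> R) : measurable_fun setT r -> measurable_fun setT (fun x => (r x)^-1).
Proof.
move=> mr.
have mp : measurable_fun setT (fun x => r x / (r x ^+ 2)).
  rewrite (_ : (fun _ => _) = fun x => r x * (`|r x| `^ (-2))).
    apply: measurable_funM => //.
    apply: (@measurableT_comp _ _ _ _ _ _ (fun y : R => y `^ (- 2))); first exact: measurable_powR.
    exact: measurableT_comp.
  apply/funext => x; congr (_ * _); rewrite powRN; congr _^-1.
  by rewrite -[2]/(2%:R) powR_mulrn // -normrX ger0_norm ?sqr_ge0.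
rewrite (_ : (fun _ => _) = fun x => r x / (r x ^+ 2)) //.
apply/funext => x; have [->|r0] := eqVneq (r x) 0; first by rewrite invr0 mul0r.
by rewrite expr2 invfM mulrA divff // mul1r.
Qed.
Lemma cmeasV f : cmeas f -> cmeas (fun x => (f x)^-1).
Proof.
move=> mf; have mc := meas_cn mf.
apply: (@cmeas_eq (fun x => (((cn (f x)) ^+ 2)^-1)%:C * (f x)^*)); last first.
  apply: cmeasM; last exact: cmeasJ.
  by apply: cmeas_real; apply: measV; exact: measurable_funX.
move=> x; have [->|f0] := eqVneq (f x) 0; first by rewrite rmorph0 invr0 mulr0.
have -> : (cn (f x) ^- 2)%:C = (f x * (f x)^*)^-1 :> C by rewrite conjc_mul fmorphV.
by rewrite invfM -mulrA mulVf ?mulr1 // conjc_eq0.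
Qed.
Lemma cmeas_sum (I : Type) (r : seq I) (P : pred I) (F : I -> T -> C) :
  (forall i, P i -> cmeas (F i)) -> cmeas (fun x => \sum_(i <- r | P i) F i x).
Proof.
move=> hF; elim: r => [|i r IH].
  by apply: (@cmeas_eq (fun=> 0)) (cmeas_cst _) => y; rewrite big_nil.
have [Pi|nPi] := boolP (P i).
  by apply: cmeas_eq (cmeasD (hF i Pi) IH) => y; rewrite big_cons Pi.
by apply: cmeas_eq IH => y; rewrite big_cons (negbTE nPi).
Qed.
Lemma cmeas_prod (I : Type) (r : seq I) (P : pred I) (F : I -> T -> C) :
  (forall i, P i -> cmeas (F i)) -> cmeas (fun x => \prod_(i <- r | P i) F i x).
Proof.
move=> hF; elim: r => [|i r IH].
  by apply: (@cmeas_eq (fun=> 1)) (cmeas_cst _) => y; rewrite big_nil.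
have [Pi|nPi] := boolP (P i).
  by apply: cmeas_eq (cmeasM (hF i Pi) IH) => y; rewrite big_cons Pi.
by apply: cmeas_eq IH => y; rewrite big_cons (negbTE nPi).
Qed.
Lemma cmeasX f k : cmeas f -> cmeas (fun x => f x ^+ k).
Proof.
move=> mf; elim: k => [|k IH]; first by apply: (@cmeas_eq (fun=> 1)) (cmeas_cst _) => y; rewrite expr0.
by apply: cmeas_eq (cmeasM mf IH) => y; rewrite exprS.
Qed.
Lemma cmeas_mpoly m (p : mpoly m C) (F : 'I_m -> T -> C) :
  (forall i, cmeas (F i)) -> cmeas (fun y => meval (fun i => F i y) p).
Proof.
move=> cF; apply: (@cmeas_eq (fun y => \sum_(mm <- msupp p) mcoeff mm p * \prod_i F i y ^+ mm i)).
  by move=> y; rewrite mevalE.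
apply: cmeas_sum => mm _; apply: cmeasZ.
by apply: cmeas_prod => i _; exact: cmeasX.
Qed.
Lemma cmeas_det k (A : T -> 'M[C]_k) : (forall i j, cmeas (fun y => A y i j)) -> cmeas (fun y => \det (A y)).
Proof.
move=> cA; apply: cmeas_sum => s _; apply: cmeasZ.
by apply: cmeas_prod => i _; exact: cA.
Qed.
Lemma cmeas_invmx k (A : T -> 'M[C]_k) i j : (forall i j, cmeas (fun y => A y i j)) ->
  cmeas (fun y => ((\det (A y))^-1 *: \adj (A y)) i j).
Proof.
move=> cA; apply: (@cmeas_eq (fun y => (\det (A y))^-1 * \adj (A y) i j)).
  by move=> y; rewrite [RHS]mxE.
apply: cmeasM; first by apply: cmeasV; exact: cmeas_det.
apply: (@cmeas_eq (fun y => (-1) ^+ (j + i) * \det (row' j (col' i (A y))))).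
  by move=> y; rewrite [RHS]mxE.
apply: cmeasZ; apply: cmeas_det => a b.
by apply: cmeas_eq (cA (lift j a) (lift i b)) => y; rewrite !mxE.
Qed.
Lemma cmeas_if (A : set T) f : measurable A -> cmeas f -> cmeas (fun x => if x \in A then f x else 0).
Proof.
move=> mA mf; apply: (@cmeas_eq (fun x => (\1_A x)%:C * f x)).
  by move=> x; rewrite indicE; case: (x \in A); rewrite ?mul1r ?mul0r.
by apply: cmeasM => //; apply: cmeas_real; exact: measurable_indic.
Qed.
Lemma cmeas_zero_set f : cmeas f -> measurable [set x | f x = 0].
Proof.
move=> mf; rewrite (_ : [set x | f x = 0] = (fun x => cn (f x)) @^-1` [set 0]).
  rewrite -[X in measurable X]setTI; apply: (meas_cn mf) => //; exact: measurable_set1.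
by apply/seteqP; split => x /= => [->|/eqP]; rewrite ?cn0 // cn_eq0 => /eqP.
Qed.
Definition emeas (G : finType) (a : T -> @ext R G) := forall S : {set G}, cmeas (fun x => a x S).

Section E.
Variable G : finType.
Implicit Types a b : T -> @ext R G.
Lemma emeas_cst (c : @ext R G) : emeas (fun=> c). Proof. by move=> S; exact: cmeas_cst. Qed.
Lemma emeasD a b : emeas a -> emeas b -> emeas (fun x => a x + b x).
Proof. by move=> ma mb S; apply: cmeas_eq (cmeasD (ma S) (mb S)) => x; rewrite extDE. Qed.
Lemma emeasN a : emeas a -> emeas (fun x => - a x).
Proof. by move=> ma S; apply: cmeas_eq (cmeasN (ma S)) => x; rewrite extNE. Qed.
Lemma emeasB a b : emeas a -> emeas b -> emeas (fun x => a x - b x).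
Proof. by move=> ma mb; apply: emeasD => //; exact: emeasN. Qed.
Lemma emeasZ f a : cmeas f -> emeas a -> emeas (fun x => f x *: a x).
Proof. by move=> mf ma S; apply: cmeas_eq (cmeasM mf (ma S)) => x; rewrite extZE. Qed.
Lemma emeasM a b : emeas a -> emeas b -> emeas (fun x => a x * b x).
Proof.
move=> ma mb S; apply: (@cmeas_eq (fun x => \sum_(A : {set G} | A \subset S)
     shuffle_sign A (S :\: A)%SET * a x A * b x (S :\: A)%SET)).
  by move=> x; rewrite -wedgeE ffunE.
by apply: cmeas_sum => A _; apply: cmeasM => //; apply: cmeasZ.
Qed.
Lemma emeas_sum (I : Type) (r : seq I) (P : pred I) (F : I -> T -> @ext R G) :
  (forall i, P i -> emeas (F i)) -> emeas (fun x => \sum_(i <- r | P i) F i x).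
Proof.
move=> hF S; apply: (@cmeas_eq (fun x => \sum_(i <- r | P i) F i x S)).
  by move=> x; rewrite ext_sumE.
by apply: cmeas_sum => i Pi; exact: hF.
Qed.
Lemma emeas_eq a b : a =1 b -> emeas a -> emeas b.
Proof. by move=> /funext->. Qed.
Lemma emeas_prod (I : Type) (r : seq I) (F : I -> T -> @ext R G) :
  (forall i, emeas (F i)) -> emeas (fun x => \prod_(i <- r) F i x).
Proof.
move=> hF; elim: r => [|i r IH].
  by apply: (@emeas_eq (fun=> 1)) (emeas_cst _) => x; rewrite big_nil.
by apply: emeas_eq (emeasM (hF i) IH) => x; rewrite big_cons.
Qed.
Lemma emeasX a k : emeas a -> emeas (fun x => a x ^+ k).
Proof.
move=> ma; elim: k => [|k IH].
  by apply: (@emeas_eq (fun=> 1)) (emeas_cst _) => x; rewrite expr0.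
by apply: emeas_eq (emeasM ma IH) => x; rewrite exprS.
Qed.
Lemma emeas_if (A : set T) a : measurable A -> emeas a -> emeas (fun x => if x \in A then a x else 0).
Proof.
move=> mA ma S; apply: cmeas_eq (cmeas_if mA (ma S)) => x; case: ifP => //; by rewrite ext0E.
Qed.
Lemma meas_en a : emeas a -> measurable_fun setT (fun x => en (a x)).
Proof.
move=> ma; rewrite /en; apply: measurable_sum => S; exact: meas_cn.
Qed.
End E.

Lemma emeas_subst (G G' : finType) (M : T -> G -> @ext R G') (a : T -> @ext R G) :
  (forall k : G, emeas (fun x => M x k)) -> emeas a -> emeas (fun x => subst (M x) (a x)).
Proof.
move=> mM ma; apply: (@emeas_eq _ (fun x => \sum_(S : {set G}) a x S *: \prod_(g <- enum S) M x g)).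
  move=> x; rewrite [in RHS](ext_monomsE (a x)) (subst_sum (M x)); apply: eq_bigr => S _.
  by rewrite substZ subst_monom.
apply: emeas_sum => S _; apply: emeasZ => //.
by apply: emeas_prod.
Qed.

End ComplexMeasurable.

Section BorelVectors.
Context {R : realType}.
Local Notation C := R[i].

Lemma borel_open M (U : set 'rV[C]_M) : open U -> measurable (U : set (Borel R M)).
Proof. by move=> oU; exact: sub_sigma_algebra. Qed.

Lemma borel_closed M (U : set 'rV[C]_M) : closed U -> measurable (U : set (Borel R M)).
Proof.
by move=> cU; rewrite -(setCK U); apply: measurableC; apply: borel_open; exact: closed_openC.
Qed.

Lemma meas_open_gt M (g : 'rV[C]_M -> R) : (forall a : R, open [set x | a < g x]) ->
  measurable_fun setT (g : Borel R M -> R).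
Proof.
move=> og; apply: (measurability _ (RGenOInfty.measurableE R)) => //.
move=> _ [_ [a ->] <-]; rewrite setTI; apply: borel_open.
rewrite (_ : _ @^-1` _ = [set x | a < g x]) //.
by apply/seteqP; split=> x /=; rewrite in_itv /= andbT.
Qed.

Lemma cmeas_coord M (j : 'I_M) : cmeas (fun x : Borel R M => (x : 'rV[C]_M) 0 j).
Proof.
split; apply: meas_open_gt => a; apply/open_nmP => x /= ax.
  exists (complex.Re (x 0 j) - a); first by rewrite subr_gt0.
  move=> y yx; have : `|complex.Re (y 0 j) - complex.Re (x 0 j)| < complex.Re (x 0 j) - a.
    apply: le_lt_trans yx; rewrite -(raddfB (@complex.Re R)) (le_trans (cn_Re _)) //.
    by rewrite (le_trans _ (cn_le_nm _ j)) // !mxE.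
  by rewrite ltr_norml => /andP[+ _]; rewrite opprB ltrD2r.
exists (complex.Im (x 0 j) - a); first by rewrite subr_gt0.
move=> y yx; have : `|complex.Im (y 0 j) - complex.Im (x 0 j)| < complex.Im (x 0 j) - a.
  apply: le_lt_trans yx; rewrite -(raddfB (@complex.Im R)) (le_trans (cn_Im _)) //.
  by rewrite (le_trans _ (cn_le_nm _ j)) // !mxE.
by rewrite ltr_norml => /andP[+ _]; rewrite opprB ltrD2r.
Qed.

(** Boxes with rational centres and radii 1/(k+1) form a countable base. They are needed because the
    Borel structure is generated by open sets, while maps into C^M are known to be measurable
    coordinate by coordinate. *)
Definition ratbox M (c : {ffun 'I_M -> rat * rat} * nat) : set 'rV[C]_M :=
  [set x | forall j, `|complex.Re (x 0 j) - ratr (c.1 j).1| < c.2.+1%:R^-1 /\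
                     `|complex.Im (x 0 j) - ratr (c.1 j).2| < c.2.+1%:R^-1].

Lemma ratbox_nbhs M (x : 'rV[C]_M) (r : R) : 0 < r ->
  exists c, ratbox c x /\ forall y, ratbox c y -> nm (y - x) < r.
Proof.
move=> r0; pose k := Num.truncn (4 * M.+1%:R / r).
pose e : R := k.+1%:R^-1; have e0 : 0 < e by rewrite invr_gt0.
have er : 4 * M.+1%:R * e < r.
  by rewrite /e ltr_pdivrMr // -ltr_pdivrMl // mulrC; exact: truncnS_gt.
have rat_near (a : R) : exists q : rat, `|a - ratr q| < e.
  have [|q /=] := @rat_in_itvoo R (a - e) (a + e); first by rewrite ltrD2l gtrN.
  rewrite in_itv /= => /andP[h1 h2]; exists q; rewrite ltr_norml; apply/andP; split.
    by rewrite ltrBrDr addrC -ltrBrDr opprK.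
  by rewrite ltrBlDr -ltrBlDl.
have H (j : 'I_M) : exists q : rat * rat, `|complex.Re (x 0 j) - ratr q.1| < e /\ `|complex.Im (x 0 j) - ratr q.2| < e.
  have [q1 h1] := rat_near (complex.Re (x 0 j)); have [q2 h2] := rat_near (complex.Im (x 0 j)).
  by exists (q1, q2).
have [F hF] := choice H.
exists ([ffun j => F j], k); split=> [j|y hy]; first by rewrite /= ffunE; exact: hF.
apply: (@le_lt_trans _ _ (M%:R * (4 * e))); last first.
  apply: le_lt_trans er; rewrite -mulrA mulrCA ler_wpM2l // ler_wpM2r ?(ltW e0) //.
  by rewrite ler_nat.
apply: nm_le => j; have [a b] := hy j; have [c d] := hF j; rewrite /= ffunE in a b.
rewrite !mxE (le_trans (cn_ReIm _)) // (raddfB (@complex.Re R)) (raddfB (@complex.Im R)) /=.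
have -> : 4 * e = (e + e) + (e + e) by ring.
apply: lerD.
  by rewrite (le_trans (ler_distD (ratr (F j).1) _ _)) // lerD ?(ltW a) // distrC ltW.
by rewrite (le_trans (ler_distD (ratr (F j).2) _ _)) // lerD ?(ltW b) // distrC ltW.
Qed.

Lemma ratbox_open M c : open (@ratbox M c).
Proof.
have -> : ratbox c = \bigcap_(j in [set: 'I_M]) [set x : 'rV[C]_M |
    `|complex.Re (x 0 j) - ratr (c.1 j).1| < c.2.+1%:R^-1 /\
    `|complex.Im (x 0 j) - ratr (c.1 j).2| < c.2.+1%:R^-1].
  by apply/seteqP; split=> x h j; [move=> _; exact: h|exact: (h j I)].
pose S (j : 'I_M) := [set x : 'rV[C]_M |
    `|complex.Re (x 0 j) - ratr (c.1 j).1| < c.2.+1%:R^-1 /\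
    `|complex.Im (x 0 j) - ratr (c.1 j).2| < c.2.+1%:R^-1].
suff oj (j : 'I_M) : open (S j).
  rewrite openE => x hx.
  have : nbhs x [set y | forall j : 'I_M, S j y].
    by apply: (@filter_forall _ _ S (nbhs x)) => j; exact: (open_nbhs_nbhs (conj (oj j) (hx j I))).
  by apply: filterS => y hy j _; exact: hy.
apply/open_nmP => x /= [h1 h2].
exists (Num.min (c.2.+1%:R^-1 - `|complex.Re (x 0 j) - ratr (c.1 j).1|)
                (c.2.+1%:R^-1 - `|complex.Im (x 0 j) - ratr (c.1 j).2|)).
  by rewrite lt_min !subr_gt0 h1.
move=> y; rewrite lt_min !ltrBrDr => /andP[k1 k2]; split.
  apply: le_lt_trans k1; rewrite (le_trans (ler_distD (complex.Re (x 0 j)) _ _)) // lerD2r.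
  rewrite -(raddfB (@complex.Re R)) (le_trans (cn_Re _)) //.
  by rewrite (le_trans _ (cn_le_nm _ j)) // !mxE.
apply: le_lt_trans k2; rewrite (le_trans (ler_distD (complex.Im (x 0 j)) _ _)) // lerD2r.
rewrite -(raddfB (@complex.Im R)) (le_trans (cn_Im _)) //.
by rewrite (le_trans _ (cn_le_nm _ j)) // !mxE.
Qed.

Lemma open_ratbox M (U : set 'rV[C]_M) : open U ->
  U = \bigcup_(c in [set c | ratbox c `<=` U]) ratbox c.
Proof.
move=> oU; apply/seteqP; split=> [x Ux|x [c /= cU /cU]//].
have /open_nmP/(_ x Ux)[r r0 hr] := oU.
have [c [cx hc]] := ratbox_nbhs x r0; exists c => // y /hc; exact: hr.
Qed.

Lemma countable_bigcup_meas d (T : measurableType d) (I : countType) (P : set I) (F : I -> set T) :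
  (forall i, P i -> measurable (F i)) -> measurable (\bigcup_(i in P) F i).
Proof.
move=> mF; rewrite (_ : \bigcup_(i in P) F i =
  \bigcup_k (if unpickle k is Some i then (if i \in P then F i else set0) else set0)).
  apply: bigcup_measurable => k _; case: unpickle => // i.
  by case: ifPn => // /set_mem; exact: mF.
apply/seteqP; split=> [x [i Pi Fx]|x [k _]].
  by exists (pickle i) => //; rewrite pickleK mem_set.
by case: unpickle => // i; case: ifPn => // /set_mem Pi Fx; exists i.
Qed.

Section Vec.
Context d (T : measurableType d) (M : nat) (g : T -> 'rV[C]_M).
Hypothesis mg : forall j, cmeas (fun x => g x 0 j).

Lemma ratbox_meas c : measurable (g @^-1` ratbox c).
Proof.
have -> : g @^-1` ratbox c = \bigcap_(j in [set: 'I_M])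
   ((fun x => complex.Re (g x 0 j)) @^-1` ball (ratr (c.1 j).1 : R) c.2.+1%:R^-1 `&`
    (fun x => complex.Im (g x 0 j)) @^-1` ball (ratr (c.1 j).2 : R) c.2.+1%:R^-1).
  apply/seteqP; split=> x h j.
    by move=> _; have [] := h j; rewrite /= /ball /= ![`|ratr _ - _|]distrC.
  by have [] := h j I; rewrite /= /ball /= ![`|ratr _ - _|]distrC.
apply: fin_bigcap_measurable => [|j _]; first exact: finite_finset.
have [m1 m2] := mg j.
apply: measurableI.
  by rewrite -[X in measurable X]setTI; apply: m1 => //; exact: measurable_ball.
by rewrite -[X in measurable X]setTI; apply: m2 => //; exact: measurable_ball.
Qed.

Lemma vec_open_meas (U : set 'rV[C]_M) : open U -> measurable (g @^-1` U).
Proof.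
move=> oU; rewrite (open_ratbox oU) preimage_bigcup.
by apply: countable_bigcup_meas => c _; exact: ratbox_meas.
Qed.

Lemma vec_meas : measurable_fun setT (g : T -> Borel R M).
Proof.
apply: (@measurability _ _ _ (Borel R M) _ _ (@open 'rV[C]_M)) => //.
by move=> _ [U oU <-]; rewrite setTI; exact: vec_open_meas.
Qed.

End Vec.

Lemma cts_meas M (U : set 'rV[C]_M) (h : 'rV[C]_M -> C) : open U -> (forall x, U x -> ctsat h x) ->
  cmeas (fun x : Borel R M => if x \in U then h x else 0).
Proof.
move=> oU ch; have mU := borel_open oU.
have key (re : C -> R) : (forall a, `|re a| <= cn a) -> (forall a b, re (a - b) = re a - re b) -> re 0 = 0 ->
    measurable_fun setT (fun x : Borel R M => re (if x \in U then h x else 0)).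
  move=> hre reB re0; apply: (measurability _ (RGenOInfty.measurableE R)) => //.
  move=> _ [_ [a ->] <-]; rewrite setTI.
  have oA : open (U `&` [set x | a < re (h x)]).
    apply/open_nmP => x [Ux /= ax].
    have /open_nmP/(_ x Ux)[r r0 hr] := oU.
    have [|s s0 hs] := ch x Ux (re (h x) - a); first by rewrite subr_gt0.
    exists (Num.min r s); first by rewrite lt_min r0.
    move=> y; rewrite lt_min => /andP[/hr Uy /hs hy]; split=> //=.
    have := le_lt_trans (hre _) hy; rewrite reB ltr_norml => /andP[+ _].
    by rewrite opprB ltrD2r.
  have [a0|a0] := ltP a 0.
    rewrite (_ : _ @^-1` _ = (U `&` [set x | a < re (h x)]) `|` ~` U).
      by apply: measurableU; [exact: borel_open|exact: measurableC].
    apply/seteqP; split=> x /=; rewrite in_itv /= andbT; case: ifPn.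
    - by move=> /set_mem Ux ax; left.
    - by move=> /negP nU _; right => Ux; apply: nU; exact: mem_set.
    - by move=> /set_mem Ux [[]|].
    - by rewrite re0.
  rewrite (_ : _ @^-1` _ = (U `&` [set x | a < re (h x)])); first exact: borel_open.
  apply/seteqP; split=> x /=; rewrite in_itv /= andbT; case: ifPn.
  - by move=> /set_mem Ux ax.
  - by rewrite re0 ltNge a0.
  - by move=> /set_mem Ux [].
  - by move=> /negP nU [Ux]; case: nU; exact: mem_set.
split.
- by apply: (key (@complex.Re R)) => //; [exact: cn_Re|exact: raddfB].
- by apply: (key (@complex.Im R)) => //; [exact: cn_Im|exact: raddfB].
Qed.

Lemma cmeas_comp d d' (T : measurableType d) (T' : measurableType d') (g : T -> T') (h : T' -> C) :
  measurable_fun setT g -> cmeas h -> cmeas (h \o g).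
Proof. by move=> mg [h1 h2]; split; [exact: measurableT_comp h1 mg|exact: measurableT_comp h2 mg]. Qed.

Lemma emeas_comp d d' (T : measurableType d) (T' : measurableType d') (G : finType) (g : T -> T') (h : T' -> @ext R G) :
  measurable_fun setT g -> emeas h -> emeas (h \o g).
Proof. by move=> mg mh S; exact: (cmeas_comp mg (mh S)). Qed.

(* By Lindeloef, countably many of the sets V cover A. *)
Lemma local_meas M (A : set 'rV[C]_M) (h : 'rV[C]_M -> C) : measurable (A : set (Borel R M)) ->
  (forall x, A x -> exists V (g : 'rV[C]_M -> C), [/\ open V, V x, cmeas (g : Borel R M -> C) & forall y, V y -> A y -> h y = g y]) ->
  cmeas (fun x : Borel R M => if x \in A then h x else 0).
Proof.
move=> mA hA.
pose Q c := exists g : 'rV[C]_M -> C, cmeas (g : Borel R M -> C) /\ forall y, ratbox c y -> A y -> h y = g y.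
have cov x : A x -> exists c, Q c /\ ratbox c x.
  move=> Ax; have [V [g [oV Vx mg e]]] := hA x Ax.
  have /open_nmP/(_ x Vx)[r r0 hr] := oV.
  have [c [cx hc]] := ratbox_nbhs x r0; exists c; split=> //.
  by exists g; split=> // y /hc/hr; exact: e.
have key (re : C -> R) : (forall g : Borel R M -> C, cmeas g -> measurable_fun setT (fun x => re (g x))) -> re 0 = 0 ->
    measurable_fun setT (fun x : Borel R M => re (if x \in A then h x else 0)).
  move=> hre re0 _ Y mY; rewrite setTI.
  rewrite (_ : _ @^-1` Y = (A `&` [set x | Y (re (h x))]) `|` (~` A `&` [set x | Y 0])); last first.
    apply/seteqP; split=> x /=; case: ifPn.
    - by move=> /set_mem Ax Yx; left.
    - by move=> /negP nA; rewrite re0 => Y0; right; split=> // Ax; apply: nA; exact: mem_set.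
    - by move=> /set_mem Ax [[]//|[]].
    - by move=> /negP nA; rewrite re0 => -[[Ax]|[]//]; case: nA; exact: mem_set.
  apply: measurableU; last first.
    apply: measurableI; first exact: measurableC.
    have [Y0|Y0] := pselect (Y 0).
      by rewrite (_ : [set x | _] = setT) //; apply/seteqP; split.
    by rewrite (_ : [set x | _] = set0) //; apply/seteqP; split.
  rewrite (_ : A `&` _ = \bigcup_(c in [set c | Q c]) ((A `&` ratbox c) `&` [set x | Y (re (h x))])); last first.
    apply/seteqP; split=> [x [Ax Yx]|x [c _ [[Ax _] Yx]]//].
    by have [c [Qc cx]] := cov x Ax; exists c.
  apply: countable_bigcup_meas => c [g [mg e]].
  rewrite (_ : _ `&` _ = (A `&` ratbox c) `&` (fun x => re (g x)) @^-1` Y).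
    apply: measurableI.
      by apply: measurableI => //; apply: borel_open; exact: ratbox_open.
    by rewrite -[X in measurable X]setTI; exact: hre.
  by apply/seteqP; split=> x [[Ax cx] /=]; rewrite e.
split.
- by apply: (key (@complex.Re R)) => // g [].
- by apply: (key (@complex.Im R)) => // g [].
Qed.

End BorelVectors.

(** * Volume growth of the cone *)

Section LebesgueC.
Context {R : realType}.
Local Notation C := R[i].

Lemma lebesgueC_mono m (F G : 'rV[C]_m -> \bar R) : (forall w, (F w <= G w)%E) ->
  (lebesgueC F <= lebesgueC G)%E.
Proof.
elim: m F G => [|m IH] F G FG /=; first exact: FG.
by apply: mono_integral => x _; apply: mono_integral => y _; apply: IH => w.
Qed.

Lemma lebesgueC0 m : lebesgueC (fun _ : 'rV[C]_m => 0%E) = 0%E.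
Proof.
elim: m => [//|m IH] /=; rewrite integral0_eq // => x _.
by rewrite integral0_eq.
Qed.

Definition inbox m (c : 'rV[C]_m) (a : R) (w : 'rV[C]_m) :=
  forall j, `|complex.Re (w 0 j) - complex.Re (c 0 j)| <= a /\ `|complex.Im (w 0 j) - complex.Im (c 0 j)| <= a.

Lemma integral_box1 (c a K : R) : 0 <= a -> 0 <= K ->
  (\int[@lebesgue_measure R]_x (if (`|(x : R) - c| <= a)%R then K%:E else 0) = (K * (2 * a))%:E)%E.
Proof.
move=> a0 K0; pose J := `[c - a, c + a]%classic.
have mJ : measurable (J : set (measurableTypeR R)) by exact: measurable_itv.
transitivity (\int[@lebesgue_measure R]_(x in J) cst K%:E x)%E.
  rewrite [RHS]integral_mkcond; apply: eq_integral => x _; rewrite /patch.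
  have -> : (x \in J) = (`|x - c| <= a).
    by apply/idP/idP; rewrite ler_distl inE /J /= in_itv.
  by case: ifP.
rewrite integral_cst // EFinM; congr (_ * _)%E.
transitivity (@lebesgue_measure R J); first by [].
rewrite lebesgue_measure_itv /= lte_fin.
case: ltP => [_|h]; first by rewrite -EFinB opprD addrACA subrr add0r opprK mulr2n mulrDl mul1r.
have -> : a = 0 by apply/eqP; rewrite eq_le a0 andbT; lra.
by rewrite mulr0.
Qed.

(** Only monotonicity and integrals over intervals enter, so no measurability of [F] has to be
    known; each of the 2m real variables contributes the length 2a. *)
Lemma lebesgueC_box m (c : 'rV[C]_m) (a K : R) (F : 'rV[C]_m -> \bar R) : 0 <= a -> 0 <= K ->
  (forall w, (F w <= K%:E)%E) -> (forall w, ~ inbox c a w -> (F w <= 0)%E) ->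
  (lebesgueC F <= (K * (2 * a) ^+ (2 * m))%:E)%E.
Proof.
move=> a0 K0; elim: m c F => [|m IH] c F FK F0 /=; first by rewrite expr0 mulr1.
rewrite -/('rV[C]_1) in c F FK F0 *.
pose c' : 'rV[C]_m := \row_j c 0 (lift 0 j).
pose K' := K * (2 * a) ^+ (2 * m).
have K'0 : 0 <= K' by rewrite mulr_ge0 // exprn_ge0 // mulr_ge0.
pose c0 := c 0 0.
apply: (@le_trans _ _ (\int[@lebesgue_measure R]_x (if (`|(x : R) - complex.Re c0| <= a)%R then (K' * (2 * a))%:E else 0))%E); last first.
  rewrite integral_box1 ?mulr_ge0 ?exprn_ge0 ?mulr_ge0 //.
  by rewrite lee_fin mulnS exprD expr2 /K' -!mulrA [(2 * a) ^+ _ * _]mulrC !mulrA.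
apply: mono_integral => x _.
apply: (@le_trans _ _ (\int[@lebesgue_measure R]_y (if (`|x - complex.Re c0| <= a)%R then (if (`|(y : R) - complex.Im c0| <= a)%R then K'%:E else 0) else 0))%E); last first.
  by case: ifP => _; rewrite ?integral_box1 ?integral0_eq.
apply: mono_integral => y _.
have out w : ~ inbox c' a w -> (F (row_mx (const_mx (x +i* y) : 'rV[C]_1) w) <= 0)%E.
  move=> nb; apply: F0 => h; apply: nb => j; have hh := h (lift 0 j).
  have ej : (row_mx (const_mx (x +i* y) : 'rV[C]_1) w : 'rV[C]_(1 + m)) 0 (lift 0 j : 'I_(1 + m)) = w 0 j.
    have -> : (lift 0 j : 'I_(1 + m)) = rshift 1 j by apply: val_inj.
    by rewrite row_mxEr.
  have ec : c' 0 j = c 0 (lift 0 j) by rewrite mxE.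
  by rewrite -ej ec; exact: hh.
have hd (w : 'rV[C]_m) : (row_mx (const_mx (x +i* y) : 'rV[C]_1) w : 'rV[C]_(1 + m)) 0 0 = x +i* y.
  have -> : (0 : 'I_(1 + m)) = lshift m (0 : 'I_1) by apply: val_inj.
  by rewrite row_mxEl mxE.
have hdR w : complex.Re ((row_mx (const_mx (x +i* y) : 'rV[C]_1) w : 'rV[C]_(1 + m)) 0 0) = x by rewrite hd.
have hdI w : complex.Im ((row_mx (const_mx (x +i* y) : 'rV[C]_1) w : 'rV[C]_(1 + m)) 0 0) = y by rewrite hd.
case: ifPn => hx; last first.
  rewrite -(lebesgueC0 m); apply: lebesgueC_mono => w; apply: F0 => /(_ 0)[h1 _].
  by case/negP: hx; rewrite -(hdR w); exact: h1.
case: ifPn => hy; last first.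
  rewrite -(lebesgueC0 m); apply: lebesgueC_mono => w; apply: F0 => /(_ 0)[_ h1].
  by case/negP: hy; rewrite -(hdI w); exact: h1.
by apply: (IH c') => [w|w nb]; [exact: FK|exact: (out w nb)].
Qed.

End LebesgueC.

Section Volume.
Context {R : realType} (n nu : nat).
Local Notation C := R[i].
Local Notation N := (n + nu)%N.
Local Notation point := 'rV[C]_N.
Variables (f : 'I_nu -> mpoly N C) (d : 'I_nu -> nat).
Variable h : 'I_nu -> 'I_N -> mpoly (N + N) C.
Hypothesis f_ci : smooth_complete_intersection f d.
Hypothesis h_hefer : is_hefer f d h.

Definition patch_set (c : R) (A : set point) : set point := [set x | exists2 y, A y & x = c%:C *: y].

Lemma cone_scale (c : R) z : c != 0 -> cone f z -> cone f (c%:C *: z).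
Proof. by move=> c0 cz i; have [/(_ i)[_ hd] _] := f_ci; rewrite (homog_scale _ _ hd) cz mulr0. Qed.

Lemma cone_closed : closed (cone f).
Proof.
rewrite -openC; apply/open_nmP => x nx.
have [i hi] : exists i, peval (f i) x <> 0.
  by apply: contrapT => no; apply: nx => i; apply: contrapT => h0; apply: no; exists i.
have [r r0 hr] := cts_neq0 (cts_peval (f i) x) (introN eqP hi).
by exists r => // y /hr /eqP hy cy; exact: hy (cy i).
Qed.

Lemma scaleVK (c : R) (y : point) : c != 0 -> (c^-1)%:C *: (c%:C *: y) = y.
Proof. by move=> c0; rewrite scalerA -rmorphM /= mulVf // scale1r. Qed.

Lemma scaleKV (c : R) (y : point) : c != 0 -> c%:C *: ((c^-1)%:C *: y) = y.
Proof. by move=> c0; rewrite scalerA -rmorphM /= mulfV // scale1r. Qed.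

(** The constant is uniform in the dilation: [c] multiplies the density of the chart by c^(2n), and
    the set of parameters that reach the ball shrinks by c^(-1) in 2n real directions. *)
Lemma chart_volume z0 : regcone f z0 -> exists r K : R, [/\ 0 < r, 0 <= K &
  forall mu, is_volume n f mu -> forall (c : R) z rho, 0 < c -> 0 < rho ->
  (mu ([set x | (nm (x - z) < rho)%R] `&` patch_set c (cone f `&` [set y | (nm (y - z0) < r)%R])) <= (K * rho ^+ (2 * n))%:E)%E].
Proof.
move=> rz0; have [r0 [B [r0_gt0 B0 H]]] := good_radius h_hefer rz0.
have r20 : 0 < r0 / 2 by rewrite divr_gt0.
have r2r : r0 / 2 < r0 by rewrite ltr_pdivrMr // ltr_pMr // ltr1n.
have [s s0 hs] := newton_solve h_hefer rz0 (rho := r0 / 2) r20 r2r H.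
have hs' w : nm (w - z0 *m emat f z0) < s -> exists2 z, nm (z - z0) < r0 & gnew f z0 w z = 0.
  move=> /hs[z hz ez]; exists z => //; apply: le_lt_trans hz _.
  by rewrite ltr_pdivrMr // ltr_pMr // ltr1n.
have hG z z' : nm (z - z0) < r0 -> nm (z' - z0) < r0 ->
    \det (gmat f h z0 (row_mx z z')) != 0 /\ mm (invmx (gmat f h z0 (row_mx z z'))) <= B.
  by move=> h1 h2; have [] := H z z' h1 h2.
set E := emat f z0 in hs hs'; pose e := 1 + mm E.
have e0 : 0 < e by rewrite ltr_pwDl ?mm_ge0.
(* The bound [r0] places points in the range where the solution is unique, and s/e places their
   tangential coordinates in the domain of the chart. *)
pose r := Num.min r0 (s / e).
have nmE x : nm (x *m E) <= nm x * e.
  by rewrite (le_trans (nm_mul _ _)) // ler_wpM2l ?nm_ge0 // lerDr.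
exists r, (n`!%:R * (N%:R * B ^+ 2) ^+ n * (2 * e) ^+ (2 * n)); split.
- by rewrite lt_min r0_gt0 divr_gt0.
- by rewrite !mulr_ge0 ?exprn_ge0 ?mulr_ge0 ?exprn_ge0 ?(ltW B0) ?(ltW e0).
move=> mu [_ hmu] c z rho c0 rho0.
have c0' : c != 0 by rewrite gt_eqF.
set EE := _ `&` _.
have EEE : EE = [set x | nm (x - z) < rho] `&` ([set x | nm (x - c%:C *: z0) < c * r] `&` cone f).
  apply/seteqP; split=> x [h1].
    move=> [y [cy hy] xE]; split=> //; split; last by rewrite xE; exact: cone_scale.
    by rewrite /= xE -scalerBr nmZ cn_real gtr0_norm // ltr_pM2l.
  move=> [h2 h3]; split=> //; exists ((c^-1)%:C *: x); last by rewrite scaleKV.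
  split; first by apply: cone_scale => //; rewrite invr_eq0.
  rewrite /= -(ltr_pM2l c0); apply: le_lt_trans h2.
  by rewrite -{1}(gtr0_norm c0) -cn_real -nmZ scalerBr scaleKV.
have mEE : measurable (EE : set (Borel R N)).
  rewrite EEE; apply: measurableI; first by apply: borel_open; exact: open_nm_ball.
  apply: measurableI; first by apply: borel_open; exact: open_nm_ball.
  by apply: borel_closed; exact: cone_closed.
pose U := psi_dom f z0 s; pose psi0 := psi f z0 r0.
have pp := psi_parametrization f_ci h_hefer B0 hG hs' c0'.
have sub : EE `<=` (fun w => c%:C *: psi0 w) @` U.
  move=> x [_ [y [cy hy] ->]]; move: hy; rewrite /= lt_min => /andP[hy1 hy2].
  have Uy : U (y *m E).
    rewrite /U /psi_dom /= -mulmxBl; apply: le_lt_trans (nmE _) _.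
    by rewrite -ltr_pdivlMr.
  exists (y *m E) => //; congr (_ *: _); apply/esym.
  apply: (psi_uniq h_hefer hG hs' Uy hy1).
  by rewrite /gnew subrr (fvec0P _ _).2 // row_mx0.
rewrite (hmu _ _ pp _ mEE sub).
(* The tangential coordinates of z/c. Parameters mapped into the ball stay within e rho/c of them,
   since they are the coordinates of their own image. *)
pose w0 := (c^-1)%:C *: z *m E.
have B20 : 0 <= n`!%:R * (N%:R * (c * B) ^+ 2) ^+ n.
  by rewrite mulr_ge0 // exprn_ge0 // mulr_ge0 // exprn_ge0 // mulr_ge0 ?ltW.
apply: le_trans (lebesgueC_box (c := w0) (a := rho / c * e) (K := n`!%:R * (N%:R * (c * B) ^+ 2) ^+ n) _ B20 _ _) _.
- by rewrite mulr_ge0 ?divr_ge0 ?ltW.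
- move=> w; rewrite lee_fin indicE; case: (boolP (w \in _)) => [|_]; last by rewrite mul0r.
  move=> /set_mem[Uw _]; rewrite mul1r (le_trans (ler_norm _)) // (le_trans (cn_Re _)) //.
  have := psi_density h_hefer B0 hG hs' c Uw.
  by rewrite gtr0_norm.
- move=> w nb; rewrite lee_fin indicE; case: (boolP (w \in _)) => [|_]; last by rewrite mul0r.
  move=> /set_mem[Uw [hz _]]; case: nb.
  have wE : psi0 w *m E = w by have [] := psi_cone hs' Uw.
  have le1 : nm (w - w0) <= rho / c * e.
    rewrite -wE /w0 -mulmxBl (le_trans (nmE _)) // ler_wpM2r ?(ltW e0) //.
    rewrite -(ler_pM2l c0) [c * (_ / _)]mulrC divfK // (le_trans _ (ltW hz)) //.
    by rewrite -{1}(gtr0_norm c0) -cn_real -nmZ scalerBr scaleKV.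
  move=> j; rewrite -(raddfB (@complex.Re R)) -(raddfB (@complex.Im R)) /=.
  have := cn_le_nm (w - w0) j; rewrite !mxE => h1.
  by split; rewrite (le_trans _ le1) // (le_trans _ h1) // ?cn_Re ?cn_Im.
rewrite lee_fin le_eqVlt; apply/orP; left; apply/eqP.
rewrite -!mulrA; congr (_ * _); rewrite !exprM -!exprMn; congr (_ ^+ n).
by field.
Qed.

End Volume.

Section VolumeGrowth.
Context {R : realType} (n nu : nat).
Local Notation C := R[i].
Local Notation N := (n + nu)%N.
Local Notation point := 'rV[C]_N.
Variables (f : 'I_nu -> mpoly N C) (d : 'I_nu -> nat).
Variable h : 'I_nu -> 'I_N -> mpoly (N + N) C.
Hypothesis f_ci : smooth_complete_intersection f d.
Hypothesis h_hefer : is_hefer f d h.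
Variable mu : {measure set (Borel R N) -> \bar R}.
Hypothesis mu_vol : is_volume n f mu.
Hypothesis n_gt0 : (0 < n)%N.

Lemma cmeas_mulmx dd (T : measurableType dd) a b c (A : T -> 'M[C]_(a, b)) (B : T -> 'M[C]_(b, c)) i j :
  (forall i j, cmeas (fun x => A x i j)) -> (forall i j, cmeas (fun x => B x i j)) ->
  cmeas (fun x => (A x *m B x) i j).
Proof.
move=> hA hB; apply: (cmeas_eq (f := fun x => \sum_k A x i k * B x k j)) => [x|]; first by rewrite mxE.
by apply: cmeas_sum => k _; exact: cmeasM.
Qed.

Lemma cmeas_jac i j : cmeas (fun z : Borel R N => jac f z i j).
Proof.
apply: (cmeas_eq (f := fun z : Borel R N => meval (fun k => (z : point) 0 k) (mderiv j (f i)))) => [z|].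
  by rewrite mxE.
by apply: cmeas_mpoly => k; exact: cmeas_coord.
Qed.

Lemma cmeas_jac_gram i j : cmeas (fun z : Borel R N => (adjm (jac f z)^T *m (jac f z)^T) i j).
Proof.
apply: cmeas_mulmx => k l.
  apply: (cmeas_eq (f := fun z : Borel R N => (jac f z k l)^*)) => [z|]; first by rewrite adjmE [in RHS]mxE.
  by apply: cmeasJ; exact: cmeas_jac.
by apply: cmeas_eq (cmeas_jac l k) => z; rewrite [in RHS]mxE.
Qed.

(** Full rank of the Jacobian is the nonvanishing of its Gram determinant, a polynomial in z and its
    conjugate. *)
Lemma regcone_meas : measurable (regcone f : set (Borel R N)).
Proof.
have -> : regcone f = cone f `&` ~` [set z | \det (adjm (jac f z)^T *m (jac f z)^T) = 0].
  apply/seteqP; split=> z [cz h1]; split=> //.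
    by move=> e; have := jac_gram_unit h1; rewrite unitmxE unitfE e eqxx.
  apply/eqP; rewrite eqn_leq rank_leq_row /=.
  have : adjm (jac f z)^T *m (jac f z)^T \in unitmx by rewrite unitmxE unitfE; apply/eqP.
  move/mxrank_unit => e; apply: (leq_trans (eq_leq (esym e))).
  by rewrite -(mxrank_tr (jac f z)); exact: mxrankM_maxr.
apply: measurableI; first by apply: borel_closed; exact: cone_closed.
apply: measurableC; apply: cmeas_zero_set; apply: cmeas_det => i j.
exact: cmeas_jac_gram.
Qed.

Lemma patch_meas c (S : set point) : c != 0 ->
  measurable (S : set (Borel R N)) -> measurable (patch_set c S : set (Borel R N)).
Proof.
move=> c0 mS.
have mg j : cmeas (fun x : Borel R N => ((c^-1)%:C *: (x : point)) 0 j).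
  apply: (cmeas_eq (f := fun x : Borel R N => (c^-1)%:C * (x : point) 0 j)) => [x|]; first by rewrite mxE.
  by apply: cmeasZ; exact: cmeas_coord.
suff -> : patch_set c S = setT `&` (fun x : Borel R N => (c^-1)%:C *: (x : point)) @^-1` S.
  exact: (vec_meas mg measurableT mS).
apply/seteqP; split=> x; first by move=> [y Sy ->]; split=> //=; rewrite scaleVK.
by move=> [_ Sx]; exists ((c^-1)%:C *: x) => //; rewrite scaleKV.
Qed.

Lemma closed_nm1 (z : point) : closed [set z].
Proof.
rewrite -openC; apply/open_nmP => x /= /eqP xz; exists (nm (x - z)).
  by rewrite nm_gt0 subr_eq0.
by move=> y /[swap] ->; rewrite nmBC ltxx.
Qed.

(** Growth of order 2n for all dilates of [S] with one constant; it is this uniformity that carries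
    bounds from the annulus to neighbourhoods of the vertex. *)
Definition vol_growth (S : set point) := measurable (S : set (Borel R N)) /\
  exists2 K : R, 0 <= K & forall c z rho, 0 < c -> 0 < rho ->
    (mu ([set x | (nm (x - z) < rho)%R] `&` patch_set c S) <= (K * rho ^+ (2 * n))%:E)%E.

Lemma ball_meas z rho : measurable ([set x : point | nm (x - z) < rho] : set (Borel R N)).
Proof. by apply: borel_open; exact: open_nm_ball. Qed.

Lemma patch_ball_meas c z rho (S : set point) : 0 < c -> measurable (S : set (Borel R N)) ->
  measurable ([set x : point | nm (x - z) < rho] `&` patch_set c S : set (Borel R N)).
Proof. by move=> c0 mS; apply: measurableI; [exact: ball_meas | apply: patch_meas => //; rewrite gt_eqF]. Qed.

Lemma vol_growthU S S' : vol_growth S -> vol_growth S' -> vol_growth (S `|` S').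
Proof.
move=> [mS [K K0 hK]] [mS' [K' K'0 hK']]; split; first exact: measurableU.
exists (K + K') => [|c z rho c0 rho0]; first exact: addr_ge0.
have -> : patch_set c (S `|` S') = patch_set c S `|` patch_set c S'.
  apply/seteqP; split=> x; first by move=> [y [Sy|Sy] ->]; [left|right]; exists y.
  by move=> [[y Sy ->]|[y Sy ->]]; exists y => //; [left|right].
rewrite setIUr (le_trans (measureU2 _ _ _)) //; try exact: patch_ball_meas.
by rewrite mulrDl EFinD leeD ?hK ?hK'.
Qed.

Lemma vol_growthS S S' : measurable (S : set (Borel R N)) -> S `<=` S' -> vol_growth S' -> vol_growth S.
Proof.
move=> mS SS' [mS' [K K0 hK]]; split=> //; exists K => // c z rho c0 rho0.
apply: le_trans (hK c z rho c0 rho0); apply: le_measure; rewrite ?inE; try exact: patch_ball_meas.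
by move=> x [hx [y Sy xE]]; split=> //; exists y => //; exact: SS'.
Qed.

Lemma vol_growth0 : vol_growth set0.
Proof.
split; first exact: measurable0.
exists 0 => // c z rho _ _; rewrite mul0r (_ : patch_set c set0 = set0) ?setI0 ?measure0 //.
by apply/seteqP; split=> x // -[y []].
Qed.

(** The ratio 4 leaves room for both uses: a ball with 2 rho <= |z|, divided by |z|/2, has norms
    between 1 and 3, and a dyadic shell, divided by a quarter of its outer radius, has norms between
    2 and 4. *)
Definition annulus : set point := cone f `&` [set x | (1 <= nm x) && (nm x <= 4)].

Lemma annulus_closed : closed annulus.
Proof.
apply: closedI; first exact: cone_closed.
rewrite -openC; apply/open_nmP => x /= /negP; rewrite negb_and -!ltNge => /orP[] hx.
  exists (1 - nm x); rewrite ?subr_gt0 // => y hy /andP[h1 _].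
  have := ler_nmB y x; lra.
exists (nm x - 4); rewrite ?subr_gt0 // => y hy /andP[_ h1].
have := ler_nmB x y; rewrite nmBC; lra.
Qed.

Lemma annulus_compact : compact annulus.
Proof. by apply: (@compact_nm R N _ 4) => [|x [_ /andP[]]]; [exact: annulus_closed|]. Qed.

Lemma annulus_meas : measurable (annulus : set (Borel R N)).
Proof. by apply: borel_closed; exact: annulus_closed. Qed.

(** Points of the annulus are regular because they are not 0. Each has a chart ball, and finitely
    many of these cover by compactness. *)
Lemma annulus_growth : vol_growth annulus.
Proof.
pose Q (x : point) (r : R) := [/\ 0 < r & vol_growth (cone f `&` [set y | nm (y - x) < r])].
have /choice[r hr] : forall x, exists r, annulus x -> Q x r.
  move=> x; have [[cx hx]|nx] := pselect (annulus x); last by exists 0.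
  have rx : regcone f x.
    split=> //; apply: f_ci.2 => //; rewrite -nm_gt0; move/andP: hx => [hx _].
    exact: lt_le_trans hx.
  have [r [K [r0 K0 hK]]] := chart_volume f_ci h_hefer rx.
  exists r => _; split=> //; split.
    by apply: measurableI; [apply: borel_closed; exact: cone_closed | exact: ball_meas].
  by exists K => // c z rho c0 rho0; exact: hK.
have := annulus_compact; rewrite compact_cover.
move=> /(_ _ annulus (fun x => [set y | nm (y - x) < r x])).
case.
- by move=> x _; exact: open_nm_ball.
- by move=> x Ax; exists x => //=; rewrite subrr nm0; have [] := hr x Ax.
move=> D' D'A; rewrite /cover bigcup_fset => cov.
have {}D'A x : x \in finmap.enum_fset D' -> annulus x.
  by move=> /D'A; rewrite inE.
have [] : vol_growth (cone f `&` \big[setU/set0]_(i <- finmap.enum_fset D') [set y | nm (y - i) < r i]).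
  elim: (finmap.enum_fset D') D'A => [|x s IH] hA; first by rewrite big_nil setI0; exact: vol_growth0.
  rewrite big_cons setIUr; apply: vol_growthU; last by apply: IH => y ys; apply: hA; rewrite inE ys orbT.
  by have [] := hr x (hA x (mem_head _ _)).
move=> m1 g1; apply: (vol_growthS annulus_meas _ (conj m1 g1)) => x Ax; split; [exact: Ax.1|exact: cov].
Qed.

Lemma dyadic (t rho : R) : 0 < t -> t < rho -> exists k, rho / 2 ^+ k.+1 <= t /\ t < rho / 2 ^+ k.
Proof.
move=> t0 tr.
have ex : exists k, rho / 2 ^+ k <= t.
  exists (Num.bound (rho / t)); rewrite ler_pdivrMr ?exprn_gt0 // mulrC -ler_pdivrMr //.
  apply: ltW; apply: lt_le_trans (archi_boundP _) _; first by rewrite divr_ge0 ?ltW // (lt_trans t0).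
  by rewrite -natrX ler_nat ltnW // ltn_expl.
case: (ex_minnP ex) => -[|k]; first by rewrite expr0 divr1 leNgt tr.
by move=> h1 h2; exists k; split=> //; rewrite ltNge; apply/negP => /h2; rewrite ltnn.
Qed.

(** The dyadic shells miss the origin, which may be a regular point when all f_i are linear. In that
    case a chart bounds its mass by K rho^(2n), with n > 0. *)
Lemma origin_null : mu ([set 0] `&` regcone f) = 0%E.
Proof.
have [r0|nr] := pselect (regcone f (0 : point)); last first.
  rewrite (_ : _ `&` _ = set0) ?measure0 //.
  by apply/seteqP; split=> x // -[->].
have [r [K [r_gt0 K0 hK]]] := chart_volume f_ci h_hefer r0.
apply/eqP; rewrite eq_le measure_ge0 andbT; apply/lee_addgt0Pr => e e0; rewrite add0e.
pose rho := Num.min 1 (e / (K + 1)).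
have K1 : 0 < K + 1 by rewrite ltr_wpDl.
have rho0 : 0 < rho by rewrite lt_min ltr01 divr_gt0.
apply: (@le_trans _ _ (K * rho ^+ (2 * n))%:E).
  apply: le_trans (hK mu mu_vol 1 0 rho ltr01 rho0); apply: le_measure; rewrite ?inE.
  - by apply: measurableI; [apply: borel_closed; exact: closed_nm1 | exact: regcone_meas].
  - apply: patch_ball_meas => //; apply: measurableI; last exact: ball_meas.
    by apply: borel_closed; exact: cone_closed.
  - move=> x [-> [c0 _]]; split; first by rewrite /= subr0 nm0.
    by exists 0; rewrite ?scaler0 //; split=> //=; rewrite subr0 nm0.
rewrite lee_fin (@le_trans _ _ (K * rho)) //.
  rewrite ler_wpM2l // -{2}[rho]expr1; apply: ler_wiXn2l; [exact: ltW|by rewrite ge_min lexx|by rewrite muln_gt0].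
rewrite (@le_trans _ _ (K * (e / (K + 1)))) //.
  by rewrite ler_wpM2l // ge_min lexx orbT.
by rewrite mulrCA ger_pMr // ler_pdivrMr // mul1r lerDl.
Qed.

Lemma ball0_growth : exists2 K : R, 0 <= K & forall rho, 0 < rho ->
  (mu ([set x | (nm x < rho)%R] `&` regcone f) <= (K * rho ^+ (2 * n))%:E)%E.
Proof.
have [_ [K K0 hK]] := annulus_growth.
exists (2 * K * 2 ^+ (2 * n)) => [|rho rho0]; first by rewrite !mulr_ge0 // exprn_ge0.
pose c k := rho / 2 ^+ k / 4.
have c0 k : 0 < c k by rewrite !divr_gt0 // exprn_gt0.
pose F k : set point := [set x | nm (x - 0) < 2 * rho / 2 ^+ k] `&` patch_set (c k) annulus.
have mF k : measurable (F k : set (Borel R N)) by apply: patch_ball_meas => //; exact: annulus_meas.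
have m0 : measurable ([set 0] `&` regcone f : set (Borel R N)).
  by apply: measurableI; [apply: borel_closed; exact: closed_nm1 | exact: regcone_meas].
have mU : measurable (\bigcup_k F k : set (Borel R N)) by apply: bigcup_measurable => k _.
have mL : measurable ([set x | nm x < rho] `&` regcone f : set (Borel R N)).
  apply: measurableI regcone_meas.
  rewrite (_ : [set x | _] = [set x : point | nm (x - 0) < rho]); first exact: ball_meas.
  by apply/seteqP; split=> x /=; rewrite subr0.
apply: (@le_trans _ _ (mu (([set 0] `&` regcone f) `|` \bigcup_k F k))).
  apply: le_measure; rewrite ?inE //; first exact: measurableU.
  move=> x [/= hx rx]; have [x0|x0] := eqVneq x 0; first by left; split=> //=.
  right; move: x0; rewrite -nm_gt0 => x0.
  have [k [h1 h2]] := dyadic x0 hx; exists k => //.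
  have p0 : 0 < (2 : R) ^+ k by rewrite exprn_gt0.
  split.
    by rewrite /= subr0 (lt_trans h2) // -mulrA ltr_pMl ?divr_gt0 // ltr1n.
  exists (((c k)^-1)%:C *: x); last by rewrite scaleKV // gt_eqF.
  split; first by apply: (cone_scale f_ci) rx.1; rewrite invr_eq0 gt_eqF.
  have ck : rho / 2 ^+ k = 4 * c k by rewrite /c [4 * _]mulrC divfK.
  have h1' : 2 * c k <= nm x.
    by apply: le_trans h1; rewrite exprS invfM mulrCA ck; lra.
  rewrite ck in h2.
  rewrite /= nmZ cn_real gtr0_norm ?invr_gt0 //; apply/andP; split.
    rewrite mulrC ler_pdivlMr // mul1r; apply: le_trans h1'; rewrite ler_pMl // ler1n //.
  by rewrite mulrC ler_pdivrMr // ltW.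
apply: le_trans (measureU2 _ _ _) _ => //.
rewrite [X in (X + _)%E]origin_null add0e.
have hs : (mu (\bigcup_k F k) <= \sum_(0 <= k <oo) mu (F k))%E by exact: measure_sigma_subadditive.
apply: le_trans hs _.
(* The k-th shell has volume of order (rho / 2^k)^(2n), which is weakened to the factor 2^(-k). The
   leading factor 2 of the constant fits it to the terms with 2^(k+1) in the denominator summed
   here. *)
apply: le_trans (epsilon_trick0 xpredT (_ : 0 <= 2 * K * 2 ^+ (2 * n) * rho ^+ (2 * n))); last first.
  by rewrite !mulr_ge0 // ?exprn_ge0 // ltW.
apply: lee_nneseries => // k _.
have p0 : 0 < (2 : R) ^+ k by rewrite exprn_gt0.
apply: le_trans (hK (c k) 0 (2 * rho / 2 ^+ k) (c0 k) _) _; first by rewrite divr_gt0 // mulr_gt0.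
rewrite lee_fin natrX exprS invfM -!mulrA ![in X in _ <= X]mulrA.
rewrite [X in _ <= X](_ : _ = K * (2 ^+ (2 * n) * rho ^+ (2 * n) * (2 ^+ k)^-1)); last first.
  by field; rewrite gt_eqF.
rewrite ler_wpM2l // mulrA !exprMn ler_wpM2l ?mulr_ge0 ?exprn_ge0 ?(ltW rho0) //.
have q1 : (2 ^- k : R) <= 1 by rewrite invf_le1 // exprn_ege1 // ler1n.
by rewrite -[X in _ <= X]expr1; apply: ler_wiXn2l; rewrite ?muln_gt0 // invr_ge0 ltW.
Qed.

(** A ball with 2 rho <= |z| stays away from the vertex and lies in a dilate of the annulus; any
    other ball lies in the ball of radius 3 rho about 0. *)
Theorem volume_ball : exists2 K : R, 0 <= K & forall z rho, 0 < rho ->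
  (mu ([set x | (nm (x - z) < rho)%R] `&` regcone f) <= (K * rho ^+ (2 * n))%:E)%E.
Proof.
have [_ [K K0 hK]] := annulus_growth; have [K' K'0 hK'] := ball0_growth.
exists (K + K' * 3 ^+ (2 * n)) => [|z rho rho0]; first by rewrite addr_ge0 // mulr_ge0 // exprn_ge0.
have mL : measurable ([set x | nm (x - z) < rho] `&` regcone f : set (Borel R N)).
  by apply: measurableI; [exact: ball_meas|exact: regcone_meas].
have rn0 : 0 <= rho ^+ (2 * n) by rewrite exprn_ge0 // ltW.
have [hz|hz] := leP (2 * rho) (nm z).
  have c0 : 0 < nm z / 2 by rewrite divr_gt0 // (lt_le_trans _ hz) // mulr_gt0.
  apply: (@le_trans _ _ (K * rho ^+ (2 * n))%:E); last first.
    by rewrite lee_fin ler_wpM2r // lerDl mulr_ge0 // exprn_ge0.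
  apply: le_trans (hK (nm z / 2) z rho c0 rho0); apply: le_measure; rewrite ?inE //.
    by apply: patch_ball_meas => //; exact: annulus_meas.
  move=> x [hx rx]; split=> //; exists (((nm z / 2)^-1)%:C *: x); last by rewrite scaleKV // gt_eqF.
  split; first by apply: (cone_scale f_ci) rx.1; rewrite invr_eq0 gt_eqF.
  rewrite /= nmZ cn_real gtr0_norm ?invr_gt0 // mulrC ler_pdivlMr // ler_pdivrMr // mul1r.
  move: hx => /= hx; have := ler_nmB x z; have := ler_nmB z x; rewrite [nm (z - x)]nmBC => e1 e2; apply/andP; split; lra.
apply: (@le_trans _ _ (K' * (3 * rho) ^+ (2 * n))%:E); last first.
  by rewrite lee_fin exprMn mulrA ler_wpM2r // lerDr.
apply: le_trans (hK' (3 * rho) _); last by rewrite mulr_gt0.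
apply: le_measure; rewrite ?inE //.
  apply: measurableI regcone_meas.
  rewrite (_ : [set x | _] = [set x : point | nm (x - 0) < 3 * rho]); first exact: ball_meas.
  by apply/seteqP; split=> x /=; rewrite subr0.
by move=> x [/= hx rx]; split=> //=; have := ler_nmB x z; lra.
Qed.

Lemma geometric_le (c t : R) : 0 <= c -> 0 <= t -> t < 1 ->
  (\sum_(0 <= k <oo) (c * t ^+ k)%:E <= (c / (1 - t))%:E)%E.
Proof.
move=> c0 t0 t1; apply: lime_le.
  by apply: is_cvg_nneseries => k _ _; rewrite lee_fin mulr_ge0 // exprn_ge0.
apply: nearW => m; rewrite sumEFin lee_fin -mulr_sumr ler_wpM2l //.
rewrite -[X in _ <= X]mul1r ler_pdivlMr ?subr_gt0 // big_mkord mulrC.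
have := subrX1 t m; rewrite -opprB -[t - 1]opprB mulNr => /oppr_inj <-.
by rewrite gerBl exprn_ge0.
Qed.

Lemma powR_exp (x r : R) k : 0 <= x -> (x ^+ k) `^ r = (x `^ r) ^+ k.
Proof. by move=> x0; rewrite -(powR_mulrn k x0) -(powR_mulrn k (powR_ge0 x r)) powRAC. Qed.

Variables (D : set (Borel R N)) (R0 : R).
Hypothesis mD : measurable D.
Hypothesis DX : D `<=` regcone f.
Hypothesis R00 : 0 <= R0.
Hypothesis DR : forall x, D x -> nm x <= R0.

Lemma volume_finite : (mu D < +oo)%E.
Proof.
have [K K0 hK] := volume_ball.
have r0 : 0 < R0 + 1 by rewrite ltr_wpDl.
apply: le_lt_trans (ltry (K * (R0 + 1) ^+ (2 * n))); apply: le_trans (hK 0 _ r0).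
apply: le_measure; rewrite ?inE //.
  by apply: measurableI; [exact: ball_meas|exact: regcone_meas].
by move=> x Dx; split; [rewrite /= subr0; have := DR Dx; lra|exact: DX].
Qed.

(** Dyadic shells about z: the k-th has volume of order (rho / 2^k)^(2n) and there the integrand is
    at most (rho / 2^(k+1))^(-g). The series is geometric with ratio 2^g / 2^(2n) < 1, independently
    of z. *)
Theorem radial_integral (g : R) : 0 <= g -> g < (2 * n)%:R ->
  exists2 K : R, 0 <= K & forall z, nm z <= R0 ->
    (\int[mu]_(x in D) (nm (x - z) `^ (- g))%:E <= K%:E)%E.
Proof.
move=> g0 g2n; have [K K0 hK] := volume_ball.
pose rho := R0 + R0 + 1; have rho0 : 0 < rho by rewrite ltr_wpDl // addr_ge0.
pose t : R := 2 `^ g / 2 ^+ (2 * n).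
have t0 : 0 <= t by rewrite divr_ge0 ?powR_ge0 // exprn_ge0.
have t1 : t < 1.
  rewrite ltr_pdivrMr ?exprn_gt0 // mul1r -powR_mulrn // /powR gt_eqF //.
  by rewrite ltr_expR ltr_pM2r // ln_gt0 // ltr1n.
pose c := 2 `^ g / rho `^ g * (K * rho ^+ (2 * n)).
have c0 : 0 <= c by rewrite !mulr_ge0 ?invr_ge0 ?powR_ge0 // exprn_ge0 // ltW.
exists (c / (1 - t)) => [|z hz]; first by rewrite divr_ge0 // subr_ge0 ltW.
pose a k := (rho / 2 ^+ k.+1) `^ (- g).
pose B k : set (Borel R N) := [set x | nm (x - z) < rho / 2 ^+ k].
have mB k : measurable (B k) by exact: ball_meas.
have rk k : 0 < rho / 2 ^+ k by rewrite divr_gt0 // exprn_gt0.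
have a0 k : 0 <= a k by exact: powR_ge0.
pose F k (x : Borel R N) := ((a k)%:E * (\1_(B k) x)%:E)%E.
have F0 k x : (0 <= F k x)%E by rewrite /F -EFinM lee_fin mulr_ge0.
have mI k : measurable_fun D (EFin \o (\1_(B k) : Borel R N -> R)).
  by apply/measurable_EFinP; exact: measurable_indic.
have mF k : measurable_fun D (F k) by exact: measurable_funeM (mI k).
apply: (@le_trans _ _ (\int[mu]_(x in D) \sum_(0 <= k <oo) F k x)%E).
  apply: mono_integral => x Dx.
  have term k : (F k x <= \sum_(0 <= k <oo) F k x)%E.
    apply: le_trans (nneseries_lim_ge k.+1 _) => //.
    by rewrite big_nat_recr //= leeDr // sume_ge0.
  (* At x = z the integrand is a default value of [powR]: 0 for a nonzero exponent, 1 for exponent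
     0. The latter is absorbed by the term k = 0. *)
  have [xz|xz] := eqVneq (nm (x - z)) 0.
    rewrite xz; have [g00|gn0] := eqVneq g 0; last first.
      by rewrite powR0 ?oppr_eq0 // nneseries_ge0.
    apply: le_trans (term 0%N); rewrite /F /a g00 oppr0 !powRr0 mul1e indicE mem_set //.
    by rewrite /B /= xz.
  have x0 : 0 < nm (x - z) by rewrite lt_neqAle eq_sym xz nm_ge0.
  have xr : nm (x - z) < rho by have := nmB x z; have := DR Dx; rewrite /rho; lra.
  have [k [h1 h2]] := dyadic x0 xr; apply: le_trans (term k).
  rewrite /F indicE mem_set // mule1 lee_fin /a !powRN lef_pV2 ?posrE ?powR_gt0 //.
  by apply: ge0_ler_powR; rewrite ?nnegrE ?nm_ge0 // ltW.
rewrite integral_nneseries //.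
apply: le_trans (geometric_le c0 t0 t1); apply: lee_nneseries => [k _ _|k _].
  by apply: integral_ge0 => x _.
have I0 x : D x -> (0 <= (EFin \o (\1_(B k) : Borel R N -> R)) x)%E by move=> _; rewrite lee_fin.
rewrite (ge0_integralZl mu mD (mI k) I0) ?lee_fin //.
rewrite integral_indic //.
have hm : (mu (B k `&` D) <= (K * (rho / 2 ^+ k) ^+ (2 * n))%:E)%E.
  apply: le_trans (hK z _ (rk k)); apply: le_measure; rewrite ?inE.
  - exact: measurableI.
  - by apply: measurableI; [exact: ball_meas|exact: regcone_meas].
  - by move=> x [h1 /DX].
apply: le_trans (lee_wpmul2l _ hm) _; first by rewrite lee_fin.
rewrite -EFinM lee_fin le_eqVlt; apply/orP; left; apply/eqP.
have e1 : rho `^ g = (rho / 2 ^+ k.+1) `^ g * (2 `^ g) ^+ k.+1.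
  by rewrite -powR_exp // -powRM ?divfK ?gt_eqF ?exprn_gt0 ?exprn_ge0 // ltW.
rewrite /a powRN /c e1 /t !exprMn -!exprVn -!exprM [(k * _)%N]mulnC.
have p1 : (rho / 2 ^+ k.+1) `^ g != 0 by rewrite gt_eqF // powR_gt0.
have p2 : (2 : R) `^ g != 0 by rewrite gt_eqF // powR_gt0.
rewrite [(2 `^ g) ^+ k.+1]exprS; field.
by rewrite expf_neq0 // p2 exprVn p1.
Qed.

End VolumeGrowth.

(** * Bounds for the kernel *)

Section KernelForms.
Context {R : realType} (N n : nat).
Local Notation C := R[i].
Local Notation point := 'rV[C]_N.
Local Notation kgen := (kgen N).
Implicit Types (a : @ext R kgen) (x : 'rV[C]_(N + N)).

Lemma en_eta_part m a : en (eta_part m a) <= en a.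
Proof. by apply: ler_sum => S _; rewrite ffunE; case: ifP => _; rewrite ?cn0 ?cn_ge0. Qed.

Lemma en_strip_eta a : en (strip_eta a) <= en a.
Proof.
rewrite /en (eq_bigr (fun S : {set kgen} => if [disjoint S & all_deta N]%B then cn (a (S :|: all_deta N)%SET) else 0)); last first.
  by move=> S _; rewrite ffunE; case: ifP => _; rewrite ?cn0 // cnM cn_shuffle mul1r.
rewrite -big_mkcond /= [leRHS](bigID (fun T : {set kgen} => all_deta N \subset T)) /=.
rewrite [X in _ <= X + _](reindex_onto (fun S => S :|: all_deta N)%SET (fun T => T :\: all_deta N)%SET) /=; last first.
  by move=> T hT; apply/setP => g; rewrite !inE; case: (boolP (g \in all_deta N)) => /= h1; rewrite ?orbF // (fintype.subsetP hT _ h1).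
rewrite (_ : \sum_(j | _ && _) _ = \sum_(j : {set kgen} | [disjoint j & all_deta N]%B) cn (a (j :|: all_deta N)%SET)).
  by rewrite lerDl sumr_ge0 // => S _; exact: cn_ge0.
apply: eq_bigl => S; rewrite finset.subsetUr /= finset.setDUl finset.setDv finset.setU0.
by apply/eqP/finset.setDidPl.
Qed.

Definition kbar (l : 'I_(N + N)) : kgen :=
  match fintype.split l with inl k => dzetab k | inr k => dzb k end.

Lemma kbar_l k : kbar (lshift N k) = dzetab k.
Proof. by rewrite /kbar -[lshift N k]/(unsplit (inl k)) unsplitK. Qed.

(** Together with [dform] and [gsum], a purely algebraic copy of the kernel forms in which
    coefficients and their derivatives are free arguments. Bounds and measurability then apply to
    any Borel functions in these places. *)
Definition eform (b : 'I_N -> C) : @ext R kgen := \sum_j b j *: gen (deta j).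
Definition dform (B : 'I_(N + N) -> 'I_N -> C) : @ext R kgen :=
  \sum_l gen (kbar l) * eform (B l).
Definition gsum (b db : @ext R kgen) : @ext R kgen := \sum_(k < n) b * db ^+ k.

Lemma eta_formE b x : eta_form b x = eform (fun j => b j x).
Proof. by apply: eq_bigr => j _; rewrite escaleE. Qed.

Lemma eformS b (S : {set kgen}) : eform b S = \sum_j b j * (S == [set deta j]%SET)%:R.
Proof. by rewrite ext_sumE; apply: eq_bigr => j _; rewrite extZE ffunE. Qed.

Lemma dirder_cst (M : nat) (v : 'rV[C]_M) c (x : 'rV[C]_M) : dirder v (fun=> c) x = 0.
Proof. exact: isdd_dirder (isdd_cst v c x). Qed.

Lemma wirtbar_cst (M : nat) (l : 'I_M) c (x : 'rV[C]_M) : wirtbar l (fun=> c) x = 0.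
Proof. by rewrite /wirtbar !dirder_cst mulr0 addr0 mul0r. Qed.

Lemma kdbar_eta (b : 'I_N -> 'rV[C]_(N + N) -> C) x :
  kdbar (eta_form b) x = dform (fun l j => wirtbar l (b j) x).
Proof.
apply: eq_bigr => l _; rewrite wedgeE; congr (_ * _); apply/ffunP => S; rewrite ffunE eformS.
case: (pickP (fun j : 'I_N => S == [set deta j]%SET)) => [j /eqP Sj|no].
  have dj (c : 'I_N -> C) : \sum_k c k * (S == [set deta k]%SET)%:R = c j.
    rewrite (bigD1 j) //= Sj eqxx mulr1 big1 ?addr0 // => k kj.
    case: eqP => [e|]; last by rewrite mulr0.
    have : (deta j : kgen) \in [set deta k : kgen]%SET by rewrite -e inE.
    by rewrite inE => /eqP [jk]; rewrite jk eqxx in kj.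
  rewrite dj; congr (wirtbar l _ x); apply/funext => y.
  by rewrite eta_formE eformS dj.
rewrite big1 => [|j _]; last by rewrite no mulr0.
rewrite -(wirtbar_cst l 0 x); congr (wirtbar l _ x); apply/funext => y.
by rewrite eta_formE eformS big1 // => j _; rewrite no mulr0.
Qed.

Lemma geom_sumE (b : 'I_N -> 'rV[C]_(N + N) -> C) x :
  geom_sum n (eta_form b) x = gsum (eform (fun j => b j x)) (dform (fun l j => wirtbar l (b j) x)).
Proof. by apply: eq_bigr => k _; rewrite wedgeE wexpE kdbar_eta eta_formE. Qed.

Lemma dirder_lsub (v : 'rV[C]_(N + N)) (g : point -> C) x :
  dirder v (fun y => g (lsubmx y)) x = dirder (lsubmx v) g (lsubmx x).
Proof.
rewrite /dirder; congr (derive1 _ 0 +i* derive1 _ 0); apply/funext => t;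
  by rewrite linearD linearZ.
Qed.

Lemma wirtbar_lsub_l k (g : point -> C) x :
  wirtbar (lshift N k) (fun y => g (lsubmx y)) x = wirtbar k g (lsubmx x).
Proof.
rewrite /wirtbar !dirder_lsub linearZ /=.
suff -> : lsubmx (delta_mx 0 (lshift N k) : 'rV[C]_(N + N)) = delta_mx 0 k by [].
by apply/rowP => j; rewrite !mxE eq_lshift.
Qed.

Lemma wirtbar_lsub_r k (g : point -> C) x :
  wirtbar (rshift N k) (fun y => g (lsubmx y)) x = 0.
Proof.
rewrite /wirtbar !dirder_lsub linearZ /=.
suff -> : lsubmx (delta_mx 0 (rshift N k) : 'rV[C]_(N + N)) = 0.
  have e : dirder (0 : point) g (lsubmx x) = 0.
    rewrite /dirder -(@dirder_cst N 0 (g (lsubmx x)) 0) /dirder.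
    by congr (derive1 _ 0 +i* derive1 _ 0); apply/funext => t; rewrite scaler0 addr0.
  by rewrite scaler0 e mulr0 addr0 mul0r.
by apply/rowP => j; rewrite !mxE eq_lrshift andbF.
Qed.

Definition dchi (chi : point -> R) (zeta : point) : @ext R kgen :=
  \sum_k wirtbar k (fun y => (chi y)%:C) zeta *: gen (dzetab k).

Lemma weight_formE (chi : point -> R) (s : 'I_N -> 'rV[C]_(N + N) -> C) zeta z :
  let x := row_mx zeta z in
  weight_form n chi s x = (chi zeta)%:C *: 1 -
    dchi chi zeta * gsum (eform (fun j => s j x)) (dform (fun l j => wirtbar l (s j) x)).
Proof.
move=> x; rewrite /weight_form wedgeE geom_sumE escaleE ext1_1 row_mxKl; congr (_ - _ * _).
have coef l : [ffun S : {set kgen} => wirtbar l (fun y => escale (chi (lsubmx y))%:C (ext1 kgen) S) x] =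
    wirtbar l (fun y => (chi (lsubmx y))%:C) x *: (1 : @ext R kgen) :> @ext R kgen.
  apply/ffunP => S; rewrite ffunE extZE -ext1_1 ext1E ffunE; case: eqP => hS.
    rewrite mulr1; congr (wirtbar l _ x); apply/funext => y.
    by rewrite escaleE extZE ffunE hS eqxx mulr1.
  rewrite mulr0 -(wirtbar_cst l 0 x); congr (wirtbar l _ x); apply/funext => y.
  by rewrite escaleE extZE ffunE; case: eqP => //; rewrite mulr0.
rewrite /kdbar /dbarform (eq_bigr (fun l => wirtbar l (fun y => (chi (lsubmx y))%:C) x *: gen (kbar l))); last first.
  by move=> l _; rewrite wedgeE coef -scalerAr mulr1.
rewrite big_split_ord /= [X in _ + X]big1 ?addr0 => [|k _]; last first.
  by rewrite (wirtbar_lsub_r k (fun y => (chi y)%:C)) scale0r.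
by apply: eq_bigr => k _; rewrite kbar_l (wirtbar_lsub_l k (fun y => (chi y)%:C)) row_mxKl.
Qed.

Lemma en_eform b B : (forall j, cn (b j) <= B) -> en (eform b) <= N%:R * B.
Proof.
move=> hb; rewrite (le_trans (en_sum _ _ _)) // (le_trans (y := \sum_(j < N) B)) //.
  by apply: ler_sum => j _; rewrite enZ en_gen mulr1.
by rewrite sumr_const card_ord -[leLHS]mulr_natl.
Qed.

Lemma en_dform b B : (forall l j, cn (b l j) <= B) -> en (dform b) <= (N + N)%:R * (N%:R * B).
Proof.
move=> hb; rewrite (le_trans (en_sum _ _ _)) // (le_trans (y := \sum_(l < N + N) (N%:R * B))) //.
  by apply: ler_sum => l _; rewrite (le_trans (enM _ _)) // en_gen mul1r; exact: en_eform.
by rewrite sumr_const card_ord -[leLHS]mulr_natl.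
Qed.

Lemma en_gsum b db B B' : en b <= B -> en db <= B' ->
  en (gsum b db) <= \sum_(k < n) B * B' ^+ k.
Proof.
move=> hb hdb; rewrite (le_trans (en_sum _ _ _)) //; apply: ler_sum => k _.
rewrite (le_trans (enM _ _)) // ler_pM ?en_ge0 // (le_trans (enX _ _)) //.
by rewrite lerXn2r ?nnegrE ?en_ge0 // (le_trans _ hdb) // en_ge0.
Qed.

Lemma emeas_eform dd (T : measurableType dd) (b : T -> 'I_N -> C) :
  (forall j, cmeas (fun t => b t j)) -> emeas (fun t => eform (b t)).
Proof.
by move=> hb; apply: emeas_sum => j _; apply: emeasZ => //; exact: emeas_cst.
Qed.

Lemma emeas_dform dd (T : measurableType dd) (b : T -> 'I_(N + N) -> 'I_N -> C) :
  (forall l j, cmeas (fun t => b t l j)) -> emeas (fun t => dform (b t)).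
Proof.
move=> hb; apply: emeas_sum => l _; apply: emeasM; first exact: emeas_cst.
by apply: emeas_eform => j; exact: hb.
Qed.

Lemma emeas_gsum dd (T : measurableType dd) (b db : T -> @ext R kgen) :
  emeas b -> emeas db -> emeas (fun t => gsum (b t) (db t)).
Proof. by move=> hb hdb; apply: emeas_sum => k _; apply: emeasM => //; exact: emeasX. Qed.

Lemma emeas_eta_part dd (T : measurableType dd) m (b : T -> @ext R kgen) :
  emeas b -> emeas (fun t => eta_part m (b t)).
Proof.
move=> hb S; case: (boolP (#|S :&: all_deta N|%SET == m)) => h1.
  by apply: cmeas_eq (hb S) => t; rewrite ffunE h1.
by apply: (cmeas_eq (f := fun=> 0)) => [t|]; [rewrite ffunE (negbTE h1)|exact: cmeas_cst].
Qed.

Lemma emeas_strip_eta dd (T : measurableType dd) (b : T -> @ext R kgen) :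
  emeas b -> emeas (fun t => strip_eta (b t)).
Proof.
move=> hb S; case: (boolP [disjoint S & all_deta N]%B) => h1.
  apply: cmeas_eq (cmeasZ (shuffle_sign S (all_deta N)) (hb (S :|: all_deta N)%SET)) => t.
  by rewrite ffunE h1.
by apply: (cmeas_eq (f := fun=> 0)) => [t|]; [rewrite ffunE (negbTE h1)|exact: cmeas_cst].
Qed.

Lemma isdd_sum M (v x : 'rV[C]_M) (I : Type) (r : seq I) (P : pred I) (F : I -> 'rV[C]_M -> C) (l : I -> C) :
  (forall i, P i -> isdd v (F i) x (l i)) ->
  isdd v (fun y => \sum_(i <- r | P i) F i y) x (\sum_(i <- r | P i) l i).
Proof.
move=> hF; elim: r => [|i r IH].
  by rewrite big_nil; apply: isdd_eq (isdd_cst v 0 x) => y; rewrite big_nil.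
rewrite big_cons; case: ifP => Pi; last by apply: isdd_eq IH => y; rewrite big_cons Pi.
by apply: isdd_eq (isddD (hF i Pi) IH) => y; rewrite big_cons Pi.
Qed.

Definition eta2 (e : point) : C := \sum_k e 0 k * (e 0 k)^*.

Lemma eta2E e : eta2 e = (\sum_k cn (e 0 k) ^+ 2)%:C.
Proof. by rewrite raddf_sum /=; apply: eq_bigr => k _; rewrite conjc_mul. Qed.

Lemma nm_sqr_le e : nm e ^+ 2 <= N%:R ^+ 2 * cn (eta2 e).
Proof.
have Q0 : 0 <= \sum_k cn (e 0 k) ^+ 2 by apply: sumr_ge0 => k _; exact: sqr_ge0.
rewrite eta2E cn_real ger0_norm // -[X in _ * X]sqr_sqrtr // -exprMn.
rewrite lerXn2r ?nnegrE ?nm_ge0 // ?mulr_ge0 ?sqrtr_ge0 //; apply: nm_le => j.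
rewrite -[leLHS](ger0_norm (cn_ge0 _)) -sqrtr_sqr ler_wsqrtr // (bigD1 j) //= lerDl.
by apply: sumr_ge0 => k _; exact: sqr_ge0.
Qed.

Lemma eta2_neq0 e : e != 0 -> eta2 e != 0.
Proof.
rewrite -nm_gt0 -cn_gt0 => e0; have := nm_sqr_le e; have : 0 < nm e ^+ 2 by rewrite exprn_gt0.
by move=> h1 h2; have := lt_le_trans h1 h2; apply: contraTT; rewrite -!leNgt => h3; rewrite mulr_ge0_le0 // exprn_ge0.
Qed.

Definition bmc (j : 'I_N) x : C := let e := lsubmx x - rsubmx x : point in twopii^-1 * ((e 0 j)^* / eta2 e).

Lemma bm_formE : @bm_form R N = eta_form bmc. Proof. by []. Qed.

(** The quotient rule for the Bochner-Martinelli coefficients written out. It gives their derivative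
    off the diagonal and is a Borel function everywhere, which [dirder] itself is not known to
    be. *)
Definition bmd (v x : 'rV[C]_(N + N)) (j : 'I_N) : C :=
  let e := lsubmx x - rsubmx x : point in let w := lsubmx v - rsubmx v : point in
  twopii^-1 * ((w 0 j)^* / eta2 e + (e 0 j)^* *
    (- (\sum_k (w 0 k * (e 0 k)^* + e 0 k * (w 0 k)^*)) / eta2 e ^+ 2)).

Lemma bmc_isdd v x j : lsubmx x - rsubmx x != 0 -> isdd v (bmc j) x (bmd v x j).
Proof.
move=> e0; have ec k : isdd v (fun y : 'rV[C]_(N + N) => (lsubmx y - rsubmx y : point) 0 k) x
    ((lsubmx v - rsubmx v : point) 0 k).
  have := isddD (isdd_coord v (lshift N k) x) (isddN (isdd_coord v (rshift N k) x)).
  rewrite (_ : (lsubmx v - rsubmx v : point) 0 k = v 0 (lshift N k) - v 0 (rshift N k)); last by rewrite !mxE.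
  by apply: isdd_eq => y; rewrite !mxE.
apply: isddZ; apply: isddM; first by apply: isdd_conj; exact: ec.
apply: isddV; last exact: eta2_neq0.
by apply: isdd_sum => k _; apply: isddM => //; exact: isdd_conj.
Qed.

End KernelForms.

(** * The structure form *)

Section Minors.
Context {R : realType} (n nu : nat).
Local Notation C := R[i].
Local Notation N := (n + nu)%N.
Local Notation point := 'rV[C]_N.
Local Notation kgen := (kgen N).
Variables (f : 'I_nu -> mpoly N C) (d : 'I_nu -> nat).
Hypothesis f_ci : smooth_complete_intersection f d.

(** Equals d - nu. It is the degree of homogeneity of the maximal minors of the Jacobian and also of
    the Hefer form. *)
Definition mdegree : nat := (\sum_i (d i).-1)%N.

(** Full rank provides independent columns in some order. Listing the same set of columns through
    [enum] makes the indices increase and does not change their span. *)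
Lemma increasing_minor (A : 'M[C]_(nu, N)) : \rank A = nu ->
  exists2 J : {ffun 'I_nu -> 'I_N}, increasing J & \det (colsub J A) != 0.
Proof.
move=> rA; have fA : row_full A^T by rewrite /row_full mxrank_tr rA.
pose I := fullrankfun fA; have Iinj : injective I by exact: fullrankfun_inj.
pose T := [set I k | k : 'I_nu]%SET; have cT : #|T| = nu by rewrite card_imset // card_ord.
have sT : size (enum T) = nu by rewrite -cardE.
pose J := [ffun k : 'I_nu => nth (I k) (enum T) k].
have Jd k l : J k = nth (I l) (enum T) k.
  by rewrite ffunE; apply: set_nth_default; rewrite sT.
exists J.
  apply/forallP => k; apply/forallP => l; apply/implyP => kl.
  rewrite (Jd k l) (Jd l l).
  have := sorted_ltn_nth (@rank_lt_trans _) (I l) (enum_rank_sorted T).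
  move=> /(_ k l); rewrite !inE sT !ltn_ord => /(_ isT isT kl).
  by rewrite /rank_lt !enum_rank_ord.
have sub : (rowsub I A^T <= rowsub J A^T)%MS.
  apply/row_subP => k.
  have : I k \in enum T by rewrite mem_enum; exact: imset_f.
  move=> /(nthP (I k))[l]; rewrite sT => lnu e.
  have -> : row k (rowsub I A^T) = row (Ordinal lnu) (rowsub J A^T).
    by apply/rowP => c; rewrite !mxE (Jd (Ordinal lnu) k) /= e.
  exact: row_sub.
have u : rowsub J A^T \in unitmx.
  rewrite -row_free_unit -row_leq_rank; apply: leq_trans (mxrankS sub).
  by rewrite mxrank_fullrowsub.
rewrite -det_tr (_ : (colsub J A)^T = rowsub J A^T); last by apply/matrixP => i j; rewrite !mxE.
by move: u; rewrite unitmxE unitfE.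
Qed.

Lemma minors_sqnormE z : minors_sqnorm f z = (\sum_(I | increasing I) cn (jac_minor f I z) ^+ 2)%:C.
Proof. by rewrite raddf_sum /=; apply: eq_bigr => I _; rewrite conjc_mul. Qed.

Lemma minor_scale (c : R) I z : c != 0 -> jac_minor f I (c%:C *: z) = c%:C ^+ mdegree * jac_minor f I z.
Proof.
move=> c0; have c0' : c%:C != 0 :> C by rewrite -cn_gt0 cn_real normr_gt0.
rewrite /jac_minor (jac_scale f_ci z c0).
have -> : colsub I (diag_mx (\row_i (c%:C ^+ d i / c%:C)) *m jac f z) =
    diag_mx (\row_i (c%:C ^+ d i / c%:C)) *m colsub I (jac f z).
  apply/matrixP => i j; rewrite [LHS]mxE mul_diag_mx mul_diag_mx.
  by rewrite [LHS]mxE [RHS]mxE; congr (_ * _); rewrite [RHS]mxE.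
rewrite det_mulmx det_diag; congr (_ * _); rewrite -prodrXr; apply: eq_bigr => i _.
have [/(_ i)[di0 _] _] := f_ci; rewrite mxE -{1}(prednK di0) exprS mulrAC mulfV //.
by rewrite mul1r.
Qed.

Lemma cts_minor I z : ctsat (jac_minor f I) z.
Proof.
apply: cts_det => i j; apply: (@cts_eq _ _ (fun y => peval (mderiv (I j) (f i)) y)) (cts_peval _ _) => y.
by rewrite !mxE.
Qed.

Definition link : set point := cone f `&` [set x | nm x = 1].

Lemma link_compact : compact link.
Proof.
apply: (@compact_nm _ _ _ 1); last by move=> x [_ ->].
apply: closedI; first exact: cone_closed.
rewrite -openC; apply/open_nmP => x /= /eqP hx.
exists `|nm x - 1|; first by rewrite normr_gt0 subr_eq0.
move=> y hy e; move: hy; rewrite ltNge => /negP; apply.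
rewrite -e ler_norml; have := ler_nmB x y; have := ler_nmB y x; rewrite [nm (x - y)]nmBC => h1 h2.
apply/andP; split; lra.
Qed.

(** On the compact link the rank condition keeps the sum of squared minors away from 0; homogeneity
    of degree 2 (d - nu) extends the bound to the cone. *)
Lemma minors_lower : exists2 c : R, 0 < c & forall z, cone f z -> z != 0 ->
  c * nm z ^+ (2 * mdegree) <= cn (minors_sqnorm f z).
Proof.
have [|x [cx /= hx]|c c0 hc] := compact_cts_min (h := minors_sqnorm f) link_compact.
- move=> x _; apply: cts_sum => I _; apply: ctsM; first exact: cts_minor.
  by apply: ctsJ; exact: cts_minor.
- have x0 : x != 0 by rewrite -nm_gt0 hx.
  have [J J1 J2] := increasing_minor (f_ci.2 _ cx x0).
  rewrite minors_sqnormE -cn_gt0 cn_real normr_gt0 gt_eqF // (bigD1 J) //=.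
  rewrite ltr_pwDl ?exprn_gt0 ?cn_gt0 //; apply: sumr_ge0 => I _; exact: sqr_ge0.
exists c => // z cz z0; have r0 : 0 < nm z by rewrite nm_gt0.
have r0' : nm z != 0 by rewrite gt_eqF.
pose u := ((nm z)^-1)%:C *: z.
have lu : link u.
  split; first by apply: (cone_scale f_ci) cz; rewrite invr_eq0.
  by rewrite /= nmZ cn_real gtr0_norm ?invr_gt0 // mulVf.
have -> : z = (nm z)%:C *: u by rewrite scaleKV.
have e : minors_sqnorm f ((nm z)%:C *: u) = (nm z ^+ (2 * mdegree))%:C * minors_sqnorm f u.
  rewrite !minors_sqnormE -rmorphM /= mulr_sumr; congr (_%:C); apply: eq_bigr => I _.
  by rewrite minor_scale // cnM cnX cn_real gtr0_norm // exprMn -exprM mulnC.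
rewrite e cnM cn_real ger0_norm ?exprn_ge0 ?(ltW r0) //.
rewrite nmZ cn_real gtr0_norm // lu.2 mulr1 mulrC ler_wpM2l ?exprn_ge0 ?(ltW r0) //.
exact: hc.
Qed.

Lemma omegaXE z : omegaX f z = (twopii ^+ nu) *: (\sum_(I | increasing I)
    ((jac_minor f I z)^* / minors_sqnorm f z *
      shuffle_sign [set I k | k : 'I_nu]%SET (~: [set I k | k : 'I_nu])%SET) *:
    (monom [set dzeta j | j in (~: [set I k | k : 'I_nu])%SET]%SET : @ext R kgen)).
Proof. by rewrite /omegaX escaleE; congr (_ *: _); apply: eq_bigr => I _; rewrite escaleE. Qed.

(** A single minor divided by the squared norm of all of them is at most the inverse of that norm,
    hence of order |z|^(-(d - nu)). *)
Lemma omegaX_bound : exists2 c : R, 0 <= c & forall z, cone f z -> z != 0 ->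
  en (omegaX f z) <= c / nm z ^+ mdegree.
Proof.
have [c c0 hc] := minors_lower.
pose sc := Num.sqrt c; have sc0 : 0 < sc by rewrite sqrtr_gt0.
pose k : R := cn (twopii ^+ nu) * \sum_(I : {ffun 'I_nu -> 'I_N} | increasing I) 1.
have k0 : 0 <= k by rewrite mulr_ge0 ?cn_ge0 // sumr_ge0.
exists (k / sc) => [|z cz z0]; first by rewrite divr_ge0 // ltW.
have r0 : 0 < nm z by rewrite nm_gt0.
have rm0 : 0 < nm z ^+ mdegree by rewrite exprn_gt0.
rewrite omegaXE enZ -mulrA -mulrA ler_wpM2l ?cn_ge0 // mulr_suml.
rewrite (le_trans (en_sum _ _ _)) //; apply: ler_sum => I incI.
rewrite enZ en_monom mulr1 cnM cn_shuffle mulr1 cnM cnJ cnV mul1r -invfM.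
have S0 : 0 < cn (minors_sqnorm f z).
  by apply: lt_le_trans (hc z cz z0); rewrite mulr_gt0 // exprn_gt0.
have h1 : cn (jac_minor f I z) ^+ 2 <= cn (minors_sqnorm f z).
  rewrite minors_sqnormE cn_real ger0_norm; last by apply: sumr_ge0 => J _; exact: sqr_ge0.
  by rewrite (bigD1 I) //= lerDl; apply: sumr_ge0 => J _; exact: sqr_ge0.
have h2 : (sc * nm z ^+ mdegree) ^+ 2 <= cn (minors_sqnorm f z).
  by rewrite exprMn sqr_sqrtr ?(ltW c0) // -exprM mulnC; exact: hc.
rewrite ler_pdivrMr // mulrC ler_pdivlMr ?mulr_gt0 //.
rewrite -(@ler_pXn2r _ 2) ?nnegrE ?mulr_ge0 ?cn_ge0 ?(ltW sc0) ?(ltW rm0) //.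
rewrite exprMn [leRHS]expr2; apply: ler_pM => //; exact: sqr_ge0.
Qed.

Lemma omegaX_meas : emeas (fun z : Borel R N => omegaX f z).
Proof.
have mm I : cmeas (fun z : Borel R N => jac_minor f I z).
  apply: cmeas_det => i j; apply: cmeas_eq (cmeas_jac f i (I j)) => z.
  by rewrite [RHS]mxE.
apply: (emeas_eq (a := fun z : Borel R N => _)) => [z|]; first by rewrite omegaXE.
apply: emeasZ; first exact: cmeas_cst.
apply: emeas_sum => I _; apply: emeasZ; last exact: emeas_cst.
apply: cmeasM; last exact: cmeas_cst.
apply: cmeasM; first exact: cmeasJ.
apply: cmeasV; apply: cmeas_sum => J _; apply: cmeasM => //; exact: cmeasJ.
Qed.

End Minors.

(** * A Borel version of the kernel and its size *)

Section RegularKernel.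
Context {R : realType} (n nu : nat).
Local Notation C := R[i].
Local Notation N := (n + nu)%N.
Local Notation point := 'rV[C]_N.
Local Notation kgen := (kgen N).
Variables (f : 'I_nu -> mpoly N C) (d : 'I_nu -> nat).
Variable h : 'I_nu -> 'I_N -> mpoly (N + N) C.
Variables (Om Om' : set point) (chi : point -> R) (s : 'I_N -> 'rV[C]_(N + N) -> C) (eps : bool).
Variables U V : set point.
Hypothesis n_gt0 : (0 < n)%N.
Hypothesis f_ci : smooth_complete_intersection f d.
Hypothesis h_hefer : is_hefer f d h.
Hypothesis chi_cut : is_cutoff Om Om' chi.
Hypothesis cOm : compact (closure Om).
Let UV := [set x : 'rV[C]_(N + N) | U (lsubmx x) /\ V (rsubmx x)].
Hypotheses (oU : open U) (sU : supp_dbar chi `<=` U) (oV : open V) (sV : closure Om `<=` V).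
Hypothesis s_smooth : forall i, smooth_on UV (s i).
Implicit Types (zeta z : point) (x : 'rV[C]_(N + N)).

Lemma nm_row_mx zeta z : nm (row_mx zeta z) = nm zeta + nm z.
Proof.
by rewrite /nm big_split_ord /=; congr (_ + _); apply: eq_bigr => j _; rewrite ?row_mxEl ?row_mxEr.
Qed.

Lemma nm_lsub x : nm (lsubmx x) <= nm x.
Proof. by rewrite -{2}(hsubmxK x) nm_row_mx lerDl nm_ge0. Qed.

Lemma nm_rsub x : nm (rsubmx x) <= nm x.
Proof. by rewrite -{2}(hsubmxK x) nm_row_mx lerDr nm_ge0. Qed.

Lemma UV_open : open UV.
Proof.
apply/open_nmP => x [Ux Vx].
have [r1 r10 h1] := (open_nmP _).1 oU _ Ux; have [r2 r20 h2] := (open_nmP _).1 oV _ Vx.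
exists (Num.min r1 r2) => [|y]; first by rewrite lt_min r10.
rewrite lt_min => /andP[y1 y2]; split.
  by apply: h1; rewrite -linearB; apply: le_lt_trans (nm_lsub _) y1.
by apply: h2; rewrite -linearB; apply: le_lt_trans (nm_rsub _) y2.
Qed.

Lemma cts_wirtbar M (W : set 'rV[C]_M) (g : 'rV[C]_M -> C) l y : CK 1 W g -> W y -> ctsat (wirtbar l g) y.
Proof.
move=> hg Wy; rewrite /wirtbar.
have hd v : ctsat (dirder v g) y by apply: CK_cts (CK_dirder v hg) Wy.
apply: ctsM; last exact: cts_cst.
by apply: ctsD; [exact: hd | apply: ctsZ; exact: hd].
Qed.

Lemma s_cts j x : UV x -> ctsat (s j) x.
Proof. by move=> hx; apply: (CK_cts (k := 0) (U := UV)) => //; exact: (smooth_onP _ _).1 (s_smooth j) 0%N. Qed.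

Lemma s_wirt_cts l j x : UV x -> ctsat (wirtbar l (s j)) x.
Proof. by move=> hx; apply: cts_wirtbar hx; exact: (smooth_onP _ _).1 (s_smooth j) 1%N. Qed.

(** Outside [UV] nothing is assumed about [s], so 0 is put there to obtain Borel coefficients. For z
    in [V] the weight does not change, because the derivative of chi vanishes for zeta outside
    [U]. *)
Definition sx x j : C := if x \in UV then s j x else 0.
Definition sw x l j : C := if x \in UV then wirtbar l (s j) x else 0.

Definition wt x : @ext R kgen := (chi (lsubmx x))%:C *: 1 -
  dchi chi (lsubmx x) * gsum n (eform (sx x)) (dform (sw x)).

Lemma dchi_out zeta : ~ supp_dbar chi zeta -> dchi chi zeta = 0.
Proof.
move=> hz; rewrite /dchi big1 // => k _.
have [->|e] := eqVneq (wirtbar k (fun y => (chi y)%:C) zeta) 0; first by rewrite scale0r.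
by case: hz; apply: subset_closure; exists k.
Qed.

Lemma wtE zeta z : V z -> weight_form n chi s (row_mx zeta z) = wt (row_mx zeta z).
Proof.
move=> Vz; rewrite weight_formE /wt row_mxKl; congr (_ - _).
have [Uz|nU] := pselect (U zeta); last first.
  by rewrite dchi_out ?mul0r // => /sU.
have xUV : row_mx zeta z \in UV by rewrite inE /UV /= row_mxKl row_mxKr.
congr (_ * gsum n _ _).
  by apply: eq_bigr => j _; rewrite /sx xUV.
by apply: eq_bigr => l _; congr (_ * _); apply: eq_bigr => j _; rewrite /sw xUV.
Qed.

Lemma supp_chi : supp_dbar chi `<=` closure [set z | chi z != 0].
Proof.
rewrite [X in _ `<=` X](_ : _ = closure (closure [set z | chi z != 0])); last first.
  by apply: (closure_id _).1; exact: closed_closure.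
apply: closureS => z [j hj]; apply: contrapT => nz; move: hj; apply/negP; rewrite negbK.
have oW : open (~` closure [set z | chi z != 0]) by rewrite openC; exact: closed_closure.
have hW y : (~` closure [set z | chi z != 0]) y -> (0 : C) = (chi y)%:C.
  move=> ny; have [->//|e] := eqVneq (chi y) 0.
  by case: ny; apply: subset_closure.
have e v : dirder v (fun y => (chi y)%:C) z = 0.
  by apply: isdd_dirder; apply: (isdd_local oW nz hW); exact: isdd_cst.
by rewrite /wirtbar !e mulr0 addr0 mul0r.
Qed.

Lemma supp_dbar_compact : compact (supp_dbar chi).
Proof.
have [_ cc _ _] := chi_cut.
by apply: subclosed_compact cc supp_chi; exact: closed_closure.
Qed.

Lemma chi_bound : exists2 B : R, 0 <= B & forall z, `|chi z| <= B.
Proof.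
have [cs cc _ _] := chi_cut.
have [z _|B B0 hB] := compact_cts_bound (h := fun y => (chi y)%:C) cc.
  by apply: (CK_cts (k := 0) (U := setT)) => //; exact: (smooth_onP _ _).1 cs 0%N.
exists B => [|z]; first exact: ltW.
have [->|e] := eqVneq (chi z) 0; first by rewrite normr0 ltW.
by rewrite -cn_real; apply: hB; exact: subset_closure.
Qed.

Lemma dchi_bound : exists2 B : R, 0 <= B & forall k z, cn (wirtbar k (fun y => (chi y)%:C) z) <= B.
Proof.
have [cs cc _ _] := chi_cut.
have hk k : exists B : R, 0 < B /\ forall z, cn (wirtbar k (fun y => (chi y)%:C) z) <= B.
  have [z _|B B0 hB] := compact_cts_bound (h := wirtbar k (fun y => (chi y)%:C)) supp_dbar_compact.
    by apply: (cts_wirtbar (W := setT)) => //; exact: (smooth_onP _ _).1 cs 1%N.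
  exists B; split=> // z; have [->|e] := eqVneq (wirtbar k (fun y => (chi y)%:C) z) 0.
    by rewrite cn0 ltW.
  by apply: hB; apply: subset_closure; exists k.
have /choice[B hB] := hk; exists (\sum_k B k).
  by apply: sumr_ge0 => k _; have [/ltW] := hB k.
move=> k z; have [_ /(_ z) h1] := hB k; apply: le_trans h1 _.
by rewrite (bigD1 k) //= lerDl; apply: sumr_ge0 => l _; have [/ltW] := hB l.
Qed.

Definition wdom : set 'rV[C]_(N + N) := [set x | supp_dbar chi (lsubmx x) /\ closure Om (rsubmx x)].

Lemma wdom_UV : wdom `<=` UV. Proof. by move=> x [/sU h1 /sV h2]. Qed.

Lemma wdom_compact : compact wdom.
Proof.
have [r1 r10 h1] := compact_bounded supp_dbar_compact.
have [r2 r20 h2] := compact_bounded cOm.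
apply: (@compact_nm _ _ _ (r1 + r2)); last first.
  by move=> x [/h1 e1 /h2 e2]; rewrite -(hsubmxK x) nm_row_mx lerD.
have c1 : closed (supp_dbar chi) by exact: closed_closure.
have c2 : closed (closure Om) by exact: closed_closure.
rewrite -openC; apply/open_nmP => x /= nx.
have [hs|hs] := pselect (supp_dbar chi (lsubmx x)).
  have ho : ~ closure Om (rsubmx x) by move=> ho; apply: nx.
  rewrite -openC in c2; have [r r0 hr] := (open_nmP _).1 c2 _ ho.
  exists r; first exact: r0.
  move=> y hy [_ hy']; apply: (hr (rsubmx y)) hy'.
  by rewrite -linearB; apply: le_lt_trans (nm_rsub _) hy.
rewrite -openC in c1; have [r r0 hr] := (open_nmP _).1 c1 _ hs.
exists r; first exact: r0.
move=> y hy [hy' _]; apply: (hr (lsubmx y)) hy'.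
by rewrite -linearB; apply: le_lt_trans (nm_lsub _) hy.
Qed.

Lemma s_bound : exists2 B : R, 0 <= B & forall x, wdom x ->
  (forall j, cn (sx x j) <= B) /\ (forall l j, cn (sw x l j) <= B).
Proof.
have h1 j : exists B : R, 0 < B /\ forall x, wdom x -> cn (s j x) <= B.
  by have [x /wdom_UV|B B0 hB] := compact_cts_bound (h := s j) wdom_compact; [exact: s_cts|exists B].
have h2 l j : exists B : R, 0 < B /\ forall x, wdom x -> cn (wirtbar l (s j) x) <= B.
  by have [x /wdom_UV|B B0 hB] := compact_cts_bound (h := wirtbar l (s j)) wdom_compact; [exact: s_wirt_cts|exists B].
have /choice[B1 hB1] := h1.
have /choice[B2 hB2] : forall p : 'I_(N + N) * 'I_N, exists B : R, 0 < B /\ forall x, wdom x -> cn (wirtbar p.1 (s p.2) x) <= B.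
  by move=> [l j]; exact: h2.
have p1 : 0 <= \sum_j B1 j by apply: sumr_ge0 => k _; have [/ltW] := hB1 k.
have p2 : 0 <= \sum_p B2 p by apply: sumr_ge0 => k _; have [/ltW] := hB2 k.
exists (\sum_j B1 j + \sum_p B2 p); first exact: addr_ge0.
move=> x hx; have xUV : x \in UV by rewrite inE; exact: wdom_UV.
split=> [j|l j].
  rewrite /sx xUV; have [_ /(_ x hx) e] := hB1 j; apply: le_trans e _; apply: ler_wpDr => //.
  by rewrite (bigD1 j) //= lerDl; apply: sumr_ge0 => k _; have [/ltW] := hB1 k.
rewrite /sw xUV; have [_ /(_ x hx) e] := hB2 (l, j); apply: le_trans e _; apply: ler_wpDl => //.
by rewrite (bigD1 (l, j)) //= lerDl; apply: sumr_ge0 => k _; have [/ltW] := hB2 k.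
Qed.

Lemma wt_bound : exists2 B : R, 0 <= B & forall zeta z, closure Om z -> en (wt (row_mx zeta z)) <= B.
Proof.
have [Bc Bc0 hc] := chi_bound; have [Bd Bd0 hd] := dchi_bound; have [B B0 hB] := s_bound.
pose G := \sum_(k < n) (N%:R * B) * ((N + N)%:R * (N%:R * B)) ^+ k.
have G0 : 0 <= G by apply: sumr_ge0 => k _; rewrite !mulr_ge0 ?exprn_ge0 ?mulr_ge0.
exists (Bc + (N%:R * Bd) * G) => [|zeta z hz]; first by rewrite addr_ge0 // !mulr_ge0.
rewrite /wt row_mxKl (le_trans (enB _ _)) // lerD //.
  by rewrite enZ en1 mulr1 cn_real.
rewrite (le_trans (enM _ _)) //.
have [hs|hs] := pselect (supp_dbar chi zeta); last first.
  by rewrite (dchi_out hs) en0 mul0r; exact: mulr_ge0 (mulr_ge0 (ler0n _ _) Bd0) G0.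
have wx : wdom (row_mx zeta z) by rewrite /wdom /= row_mxKl row_mxKr.
have [e1 e2] := hB _ wx.
apply: ler_pM; rewrite ?en_ge0 //.
  rewrite /dchi (le_trans (en_sum _ _ _)) // (le_trans (y := \sum_(j < N) Bd)) //.
    by apply: ler_sum => k _; rewrite enZ en_gen mulr1.
  by rewrite sumr_const card_ord mulr_natl.
by apply: en_gsum; [exact: en_eform|exact: en_dform].
Qed.

Lemma en_eform_sum (b : 'I_N -> C) : en (eform b) <= \sum_j cn (b j).
Proof. by rewrite (le_trans (en_sum _ _ _)) //; apply: ler_sum => j _; rewrite enZ en_gen mulr1. Qed.

Lemma hefer_formE x : hefer_form h x = \prod_(i < nu) eform (fun j => peval (h i j) x).
Proof.
by rewrite /hefer_form big_wedge; apply: eq_bigr => i _; apply: eq_bigr => j _; rewrite escaleE.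
Qed.

Lemma hefer_bound : exists2 B : R, 0 <= B & forall x, en (hefer_form h x) <= B * nm x ^+ mdegree d.
Proof.
have hi i : exists B : R, 0 <= B /\ forall x, en (eform (fun j => peval (h i j) x)) <= B * nm x ^+ (d i).-1.
  have /choice[B hB] : forall j, exists B : R, 0 < B /\ forall x, cn (peval (h i j) x) <= B * nm x ^+ (d i).-1.
    by move=> j; have [B B0 hB] := homog_bound (h_hefer.1 i j); exists B.
  exists (\sum_j B j); split; first by apply: sumr_ge0 => j _; have [/ltW] := hB j.
  move=> x; rewrite (le_trans (en_eform_sum _)) // mulr_suml; apply: ler_sum => j _.
  by have [_] := hB j.
have /choice[B hB] := hi; exists (\prod_i B i).
  by apply: prodr_ge0 => i _; have [] := hB i.
move=> x; rewrite hefer_formE (le_trans (en_prod _ _)) // /mdegree -prodrXr -big_split /=.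
by apply: ler_prod => i _; rewrite en_ge0 /=; have [_] := hB i.
Qed.

Definition bmw x l j : C := (bmd (delta_mx 0 l) x j + imC * bmd (imC *: delta_mx 0 l) x j) / 2%:R.

Lemma bmw_wirtbar x l j : lsubmx x - rsubmx x != 0 -> wirtbar l (bmc j) x = bmw x l j.
Proof. by move=> e0; rewrite /wirtbar !(isdd_dirder (bmc_isdd _ _ e0)). Qed.

Definition bmg x : @ext R kgen := gsum n (eform (fun j => bmc j x)) (dform (bmw x)).

Lemma bmgE x : lsubmx x - rsubmx x != 0 -> geom_sum n (@bm_form R N) x = bmg x.
Proof.
move=> e0; rewrite bm_formE geom_sumE /bmg; congr (gsum n _ _).
by apply: eq_bigr => l _; congr (_ * _); apply: eq_bigr => j _; rewrite bmw_wirtbar.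
Qed.

Lemma eta2_inv (e : point) : e != 0 -> (cn (eta2 e))^-1 <= N%:R ^+ 2 / nm e ^+ 2.
Proof.
move=> e0; have p0 : 0 < nm e ^+ 2 by rewrite exprn_gt0 // nm_gt0.
have q0 : 0 < cn (eta2 e) by rewrite cn_gt0; exact: eta2_neq0.
by rewrite ler_pdivlMr // mulrC ler_pdivrMr //; exact: nm_sqr_le.
Qed.

Lemma bmc_bound x j : let e := lsubmx x - rsubmx x : point in e != 0 ->
  cn (bmc j x) <= cn (twopii^-1 : C) * N%:R ^+ 2 / nm e.
Proof.
move=> e e0; have p0 : 0 < nm e by rewrite nm_gt0.
rewrite /bmc cnM -mulrA ler_wpM2l ?cn_ge0 // cnM cnJ cnV -/e.
apply: le_trans (ler_pM (cn_ge0 _) _ (cn_le_nm e j) (eta2_inv e0)) _; first by rewrite invr_ge0 cn_ge0.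
by rewrite le_eqVlt; apply/orP; left; apply/eqP; field; rewrite gt_eqF.
Qed.

Lemma bmd_bound v x j : let e := lsubmx x - rsubmx x : point in e != 0 -> nm v <= 1 ->
  cn (bmd v x j) <= cn (twopii^-1 : C) * (N%:R ^+ 2 + 2 * N%:R ^+ 4) / nm e ^+ 2.
Proof.
move=> e e0 v1; have p0 : 0 < nm e by rewrite nm_gt0.
have p1 : nm e != 0 by rewrite gt_eqF.
rewrite /bmd -/e; set w : point := lsubmx v - rsubmx v.
have w1 : nm w <= 1.
  by apply: le_trans v1; rewrite (le_trans (nmB _ _)) // -{3}(hsubmxK v) nm_row_mx.
rewrite cnM -mulrA ler_wpM2l ?cn_ge0 // (le_trans (cnD _ _)) // mulrDl lerD //.
  rewrite cnM cnJ cnV -[leRHS]mul1r ler_pM ?cn_ge0 ?invr_ge0 ?cn_ge0 ?eta2_inv //.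
  by rewrite (le_trans (cn_le_nm _ _)).
rewrite cnM cnM cnJ cnN cnV cnX.
have hS : cn (\sum_k (w 0 k * (e 0 k)^* + e 0 k * (w 0 k)^*)) <= 2 * nm e.
  rewrite (le_trans (cn_sum _ _ _)) // /nm mulr_sumr; apply: ler_sum => k _.
  rewrite (le_trans (cnD _ _)) // !cnM !cnJ mulrC -mulrDl -mulr2n -[_ *+ 2]mulr_natl -mulrA ler_wpM2l //.
  by rewrite mulrC -[leRHS]mul1r; apply: ler_pM; rewrite ?cn_ge0 // (le_trans (cn_le_nm _ _)).
rewrite -exprVn.
apply: (@le_trans _ _ (nm e * (2 * nm e * (N%:R ^+ 2 / nm e ^+ 2) ^+ 2))).
  apply: ler_pM; rewrite ?cn_ge0 ?mulr_ge0 ?cn_ge0 ?exprn_ge0 ?invr_ge0 ?cn_ge0 ?cn_le_nm //.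
  apply: ler_pM; rewrite ?cn_ge0 ?exprn_ge0 ?invr_ge0 ?cn_ge0 //.
  by rewrite lerXn2r ?nnegrE ?invr_ge0 ?cn_ge0 ?mulr_ge0 ?exprn_ge0 ?invr_ge0 ?nm_ge0 ?eta2_inv ?exprn_ge0 ?nm_ge0.
rewrite le_eqVlt; apply/orP; left; apply/eqP; field; exact: p1.
Qed.

Lemma bmw_bound x l j : let e := lsubmx x - rsubmx x : point in e != 0 ->
  cn (bmw x l j) <= cn (twopii^-1 : C) * (N%:R ^+ 2 + 2 * N%:R ^+ 4) / nm e ^+ 2.
Proof.
move=> e e0.
have nd : nm (delta_mx 0 l : 'rV[C]_(N + N)) <= 1.
  rewrite /nm (bigD1 l) //= mxE !eqxx cn1 big1 ?addr0 // => k kl.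
  by rewrite mxE (negbTE kl) andbF cn0.
have b1 := bmd_bound j e0 nd.
have b2 : cn (bmd (imC *: delta_mx 0 l) x j) <= cn (twopii^-1 : C) * (N%:R ^+ 2 + 2 * N%:R ^+ 4) / nm e ^+ 2.
  by apply: bmd_bound => //; rewrite nmZ cn_imC mul1r.
rewrite /bmw cnM cnV (cn_nat 2) ler_pdivrMr // (le_trans (cnD _ _)) // cnM cn_imC mul1r.
by move: b1 b2; rewrite -/e => b1 b2; rewrite mulrDr mulr1 lerD.
Qed.

(** The k-th summand of the Bochner-Martinelli form has size |eta|^(-(2k+1)). The last one, k = n-1,
    dominates; the others are compared with it through |eta| <= T, hence the power of T in the
    constant. *)
Lemma bmg_bound (T : R) : 1 <= T -> exists2 B : R, 0 <= B & forall x,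
  let e := lsubmx x - rsubmx x : point in e != 0 -> nm e <= T ->
  en (bmg x) <= B / nm e ^+ (2 * n).-1.
Proof.
move=> T1; have T0 : 0 <= T by apply: le_trans T1.
pose b1 := N%:R * (cn (twopii^-1 : C) * N%:R ^+ 2).
pose b2 := (N + N)%:R * (N%:R * (cn (twopii^-1 : C) * (N%:R ^+ 2 + 2 * N%:R ^+ 4))) : R.
have b10 : 0 <= b1 by rewrite !mulr_ge0 ?cn_ge0 ?exprn_ge0.
have b20 : 0 <= b2 by rewrite !mulr_ge0 ?addr_ge0 ?cn_ge0 ?mulr_ge0 ?exprn_ge0.
exists (\sum_(k < n) b1 * b2 ^+ k * T ^+ (2 * n)).
  by apply: sumr_ge0 => k _; exact: mulr_ge0 (mulr_ge0 b10 (exprn_ge0 _ b20)) (exprn_ge0 _ T0).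
move=> x e e0 eT; have p0 : 0 < nm e by rewrite nm_gt0.
have h1 : en (eform (fun j => bmc j x)) <= b1 / nm e.
  by rewrite /b1 -mulrA; apply: en_eform => j; exact: (bmc_bound j e0).
have h2 : en (dform (bmw x)) <= b2 / nm e ^+ 2.
  by rewrite /b2 -!mulrA; apply: en_dform => l j; rewrite mulrA; exact: bmw_bound.
apply: le_trans (en_gsum n h1 h2) _; rewrite mulr_suml; apply: ler_sum => k _.
have kn : (2 * n).-1 = (2 * (n - k.+1) + (2 * k).+1)%N by have := ltn_ord k; lia.
have e1 : b1 / nm e * (b2 / nm e ^+ 2) ^+ k =
    b1 * b2 ^+ k * (nm e ^+ (2 * (n - k.+1)) / nm e ^+ (2 * n).-1).
  rewrite kn exprD expr_div_n -exprM exprS.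
  have q1 : nm e ^+ (2 * (n - k.+1)) != 0 by rewrite gt_eqF // exprn_gt0.
  have q2 : nm e ^+ (2 * k) != 0 by rewrite gt_eqF // exprn_gt0.
  move: q1 q2; set A := nm e ^+ (2 * (n - _)); set A' := nm e ^+ (2 * k) => q1 q2.
  by field; rewrite q1 q2 gt_eqF.
rewrite e1 -[leRHS]mulrA; apply: ler_wpM2l; first exact: mulr_ge0 b10 (exprn_ge0 _ b20).
rewrite ler_wpM2r ?invr_ge0 ?exprn_ge0 ?nm_ge0 //.
apply: (@le_trans _ _ (T ^+ (2 * (n - k.+1)))).
  by rewrite lerXn2r ?nnegrE ?nm_ge0.
by apply: ler_weXn2l => //; lia.
Qed.

(** Replaces [Kker]: derivatives are replaced by their formulas and [s] by its extension by zero, so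
    that joint measurability in (zeta, z) can be proved. The two kernels agree off the diagonal for
    z in [V]. *)
Definition Kg zeta z : @ext R kgen := let x := row_mx zeta z in
  ((-1) ^+ eps) *: (omegaX f zeta * strip_eta (hefer_form h x * eta_part n (wt x * bmg x))).

Lemma KgE zeta z : zeta != z -> V z -> Kker n f eps h chi s zeta z = Kg zeta z.
Proof.
move=> zz Vz; rewrite /Kker /Ktilde escaleE wedgeE /Kg; congr (_ *: (_ * strip_eta _)).
by rewrite !wedgeE wtE // bmgE // row_mxKl row_mxKr subr_eq0.
Qed.

(** The three factors come from the Hefer form, the structure form and the Bochner-Martinelli form,
    in this order; the weight is bounded because zeta and z range over compact sets. *)
Theorem Kg_bound (T : R) : 0 <= T -> exists2 B : R, 0 <= B & forall zeta z,
  cone f zeta -> zeta != 0 -> zeta != z -> closure Om z -> nm zeta <= T -> nm z <= T ->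
  en (Kg zeta z) <= B * ((nm zeta + nm z) ^+ mdegree d / nm zeta ^+ mdegree d / nm (zeta - z) ^+ (2 * n).-1).
Proof.
move=> T0; have T1 : 1 <= T + T + 1 by rewrite lerDr addr_ge0.
have [B1 B10 h1] := omegaX_bound f_ci; have [B2 B20 h2] := hefer_bound.
have [B3 B30 h3] := wt_bound; have [B4 B40 h4] := bmg_bound T1.
exists (B1 * B2 * B3 * B4) => [|zeta z cz z0 zz hz zT zT']; first by rewrite !mulr_ge0.
set x := row_mx zeta z.
have ex : lsubmx x - rsubmx x = zeta - z by rewrite row_mxKl row_mxKr.
have e0 : lsubmx x - rsubmx x != 0 by rewrite ex subr_eq0.
have eT : nm (lsubmx x - rsubmx x) <= T + T + 1 by rewrite ex; have := nmB zeta z; lra.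
have := h4 x e0 eT; rewrite ex => {}h4.
rewrite /Kg enZ cn_sign mul1r (le_trans (enM _ _)) //.
have h5 : en (strip_eta (hefer_form h x * eta_part n (wt x * bmg x))) <=
    B2 * nm x ^+ mdegree d * (B3 * (B4 / nm (zeta - z) ^+ (2 * n).-1)).
  rewrite (le_trans (en_strip_eta _)) // (le_trans (enM _ _)) // ler_pM ?en_ge0 //.
  rewrite (le_trans (en_eta_part _ _)) // (le_trans (enM _ _)) // ler_pM ?en_ge0 //.
  exact: h3.
apply: le_trans (ler_pM (en_ge0 _) (en_ge0 _) (h1 _ cz z0) h5) _.
rewrite nm_row_mx le_eqVlt; apply/orP; left; apply/eqP; field.
by rewrite !expf_neq0 // gt_eqF // nm_gt0 // subr_eq0.
Qed.

Lemma row_mx_meas : measurable_fun setT (fun p : Borel R N * Borel R N => row_mx (p.1 : point) (p.2 : point) : Borel R (N + N)).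
Proof.
apply: vec_meas => j; case: (split_ordP j) => k ->.
  apply: (cmeas_eq (f := (fun y : Borel R N => (y : point) 0 k) \o fst)) => [p /=|]; first by rewrite row_mxEl.
  by apply: cmeas_comp; [exact: measurable_fst|exact: cmeas_coord].
apply: (cmeas_eq (f := (fun y : Borel R N => (y : point) 0 k) \o snd)) => [p /=|]; first by rewrite row_mxEr.
by apply: cmeas_comp; [exact: measurable_snd|exact: cmeas_coord].
Qed.

Lemma lsub_meas : measurable_fun setT (fun x : Borel R (N + N) => lsubmx (x : 'rV[C]_(N + N)) : Borel R N).
Proof.
apply: vec_meas => j; apply: cmeas_eq (cmeas_coord (lshift N j)) => x.
by rewrite mxE.
Qed.

Lemma cts_cmeas M (g : 'rV[C]_M -> C) : (forall y, ctsat g y) -> cmeas (g : Borel R M -> C).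
Proof.
move=> hg; apply: (cmeas_eq (f := fun x : Borel R M => if (x : 'rV[C]_M) \in setT then g x else 0)) => [x|].
  by rewrite in_setT.
exact: (cts_meas openT (fun y _ => hg y)).
Qed.

Lemma cmeas_etacoord k : cmeas (fun x : Borel R (N + N) => (lsubmx (x : 'rV[C]_(N + N)) - rsubmx (x : 'rV[C]_(N + N)) : point) 0 k).
Proof.
apply: (cmeas_eq (f := fun x : Borel R (N + N) => (x : 'rV[C]_(N + N)) 0 (lshift N k) - (x : 'rV[C]_(N + N)) 0 (rshift N k))) => [x|].
  by rewrite !mxE.
by apply: cmeasB; exact: cmeas_coord.
Qed.

Lemma bmg_meas : emeas (fun x : Borel R (N + N) => bmg x).
Proof.
have m2 : cmeas (fun x : Borel R (N + N) => eta2 (lsubmx (x : 'rV[C]_(N + N)) - rsubmx (x : 'rV[C]_(N + N)) : point)).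
  by apply: cmeas_sum => k _; apply: cmeasM; [|apply: cmeasJ]; exact: cmeas_etacoord.
have mV := cmeasV m2.
apply: emeas_gsum.
  apply: emeas_eform => j; apply: cmeasZ; apply: cmeasM => //.
  by apply: cmeasJ; exact: cmeas_etacoord.
have md v j : cmeas (fun x : Borel R (N + N) => bmd v x j).
  apply: cmeasZ; apply: cmeasD; first by apply: cmeasM => //; exact: cmeas_cst.
  apply: cmeasM; first by apply: cmeasJ; exact: cmeas_etacoord.
  apply: cmeasM; last by apply: cmeasV; exact: cmeasX.
  apply: cmeasN; apply: cmeas_sum => k _; apply: cmeasD; apply: cmeasM; try exact: cmeas_cst; try exact: cmeas_etacoord.
  by apply: cmeasJ; exact: cmeas_etacoord.
apply: emeas_dform => l j; apply: cmeasM; last exact: cmeas_cst.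
by apply: cmeasD => //; exact: cmeasZ.
Qed.

Lemma wt_meas : emeas (fun x : Borel R (N + N) => wt x).
Proof.
have [cs _ _ _] := chi_cut.
apply: emeasB.
  apply: emeasZ; last exact: emeas_cst.
  apply: (cmeas_comp (h := fun z : Borel R N => (chi z)%:C) lsub_meas).
  by apply: cts_cmeas => z; apply: (CK_cts (k := 0) (U := setT)) => //; exact: (smooth_onP _ _).1 cs 0%N.
apply: emeasM.
  apply: (emeas_comp (h := fun z : Borel R N => dchi chi z) lsub_meas).
  apply: emeas_sum => k _; apply: emeasZ; last exact: emeas_cst.
  by apply: cts_cmeas => z; apply: (cts_wirtbar (W := setT)) => //; exact: (smooth_onP _ _).1 cs 1%N.
apply: emeas_gsum.
  by apply: emeas_eform => j; apply: (cts_meas UV_open) => x; exact: s_cts.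
by apply: emeas_dform => l j; apply: (cts_meas UV_open) => x; exact: s_wirt_cts.
Qed.

Lemma hefer_meas : emeas (fun x : Borel R (N + N) => hefer_form h x).
Proof.
apply: (emeas_eq (a := fun x : Borel R (N + N) => \prod_(i < nu) eform (fun j => peval (h i j) x))) => [x|].
  by rewrite hefer_formE.
apply: emeas_prod => i; apply: emeas_eform => j; apply: cmeas_mpoly => k; exact: cmeas_coord.
Qed.

Theorem Kg_meas : emeas (fun p : Borel R N * Borel R N => Kg p.1 p.2).
Proof.
apply: emeasZ; first exact: cmeas_cst.
apply: emeasM.
  by apply: (emeas_comp (h := fun z : Borel R N => omegaX f z) measurable_fst); exact: omegaX_meas.
apply: (emeas_comp (h := fun x : Borel R (N + N) => strip_eta (hefer_form h x * eta_part n (wt x * bmg x))) row_mx_meas).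
apply: emeas_strip_eta; apply: emeasM; first exact: hefer_meas.
by apply: emeas_eta_part; apply: emeasM; [exact: wt_meas|exact: bmg_meas].
Qed.

End RegularKernel.

(** * Schur's test *)

Section RealEstimates.
Context {R : realType}.
Implicit Types (p u v t : R).

Lemma powR_natV (x : R) k : 0 <= x -> x `^ (- k%:R) = (x ^+ k)^-1.
Proof. by move=> x0; rewrite powRN powR_mulrn. Qed.

Lemma ler_powRN (x y r : R) : 0 <= r -> 0 < x -> x <= y -> y `^ (- r) <= x `^ (- r).
Proof.
move=> r0 x0 xy; rewrite !powRN lef_pV2 ?posrE ?powR_gt0 ?(lt_le_trans x0 xy) //.
by apply: ge0_ler_powR; rewrite ?nnegrE ?(ltW x0) // (le_trans (ltW x0)).
Qed.

(** Here u = |zeta|, v = |z| and t = |zeta - z|. If v <= 2u, the quotient of m-th powers is at most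
    3^m and only the diagonal singularity is left. Otherwise t >= v/2, and the kernel is of order
    v^(-a) u^(-m) with a = 2n-1-m; since u < v, a power v^(-s) may be replaced by u^(-s). *)
Lemma kernel_split (n m : nat) p : (0 < n)%N -> (m < (2 * n).-1)%N ->
  (2 * n)%:R / ((2 * n)%:R - m%:R) < p -> p <= (2 * n)%:R -> 1 < p /\
  exists al be B : R, [/\ 0 <= al, al * p < (2 * n)%:R, 0 <= be, be * (p / (p - 1)) < (2 * n)%:R &
    0 <= B /\ forall u v t, 0 < u -> 0 <= v -> 0 < t -> v - u <= t ->
    (u + v) ^+ m / u ^+ m / t ^+ (2 * n).-1 <=
      B * (t `^ (- (2 * n).-1%:R) + v `^ (- al) * u `^ (- be))].
Proof.
move=> n0 mn; set nn := (2 * n)%:R : R => hp p2n.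
have mnn : (m%:R : R) + 1 < nn by rewrite /nn natr1 ltr_nat; lia.
have m0 : (0 : R) <= m%:R by [].
have nm0 : 0 < nn - m%:R by lra.
have p1 : 1 < p.
  by apply: le_lt_trans hp; rewrite ler_pdivlMr // mul1r; lra.
have p0 : 0 < p by lra.
split=> //.
have hq : nn / p < nn - m%:R by rewrite ltr_pdivrMr // mulrC -ltr_pdivrMr.
have hq1 : 1 <= nn / p by rewrite ler_pdivlMr // mul1r.
(* The shift makes a - s at most 2n/p - 1/2, so that [al * p < 2n]; a - s is nonnegative because p
   <= 2n. The condition on [be] is m + s < 2n - 2n/p: for s = 0 this is the lower bound on p, and
   otherwise it holds with margin 1/2. *)
pose a : R := nn - 1 - m%:R; pose s := Num.max 0 (a - nn / p + 1 / 2).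
have s0 : 0 <= s by rewrite le_max lexx.
have aE : (((2 * n).-1 - m)%N)%:R = a.
  rewrite natrB; last by lia. by rewrite /a -subn1 natrB //; lia.
have sal : a - s = Num.min a (nn / p - 1 / 2).
  rewrite /s; have [h1|h1] := leP 0 (a - nn / p + 1 / 2).
    by rewrite min_r; lra.
  by rewrite min_l; lra.
have al0 : 0 <= a - s by rewrite sal le_min; apply/andP; split; rewrite /a; lra.
exists (a - s), (m%:R + s), (3 ^+ m + 2 ^+ (m + (2 * n).-1)); split=> //.
- apply: (@le_lt_trans _ _ ((nn / p - 1 / 2) * p)).
    by rewrite ler_pM2r // sal ge_min lexx orbT.
  by rewrite mulrBl divfK ?gt_eqF //; lra.
- by rewrite addr_ge0.
- rewrite mulrA ltr_pdivrMr; last by lra.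
  have -> : nn * (p - 1) = (nn - nn / p) * p by field; rewrite gt_eqF.
  rewrite ltr_pM2r // /s; 
  have [h1|h1] := leP 0 (a - nn / p + 1 / 2); rewrite ?addr0 /a; lra.
split; first by rewrite addr_ge0 ?exprn_ge0.
move=> u v t u0 v0 t0 tuv; have um0 : 0 < u ^+ m by rewrite exprn_gt0.
have tm0 : 0 < t ^+ (2 * n).-1 by rewrite exprn_gt0.
have P1 : 0 <= v `^ (- (a - s)) * u `^ (- (m%:R + s)) by rewrite mulr_ge0 ?powR_ge0.
have P2 : 0 <= t `^ (- (2 * n).-1%:R) by rewrite powR_ge0.
have [vu|uv] := leP v (2 * u).
  rewrite (@le_trans _ _ (3 ^+ m * t `^ (- (2 * n).-1%:R))) //.
    rewrite powR_natV ?(ltW t0) // ler_pM2r ?invr_gt0 //.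
    rewrite ler_pdivrMr // -exprMn lerXn2r ?nnegrE //; lra.
  by rewrite ler_pM ?exprn_ge0 // ?lerDl ?exprn_ge0.
have v0' : 0 < v by lra.
rewrite (@le_trans _ _ (2 ^+ (m + (2 * n).-1) * (v `^ (- (a - s)) * u `^ (- (m%:R + s))))) //; last first.
  by rewrite ler_pM ?exprn_ge0 // ?lerDr ?exprn_ge0.
have h1 : (u + v) ^+ m / u ^+ m <= 2 ^+ m * v ^+ m / u ^+ m.
  by rewrite ler_pM2r ?invr_gt0 // -exprMn lerXn2r ?nnegrE //; lra.
have h2 : (t ^+ (2 * n).-1)^-1 <= 2 ^+ (2 * n).-1 / v ^+ (2 * n).-1.
  rewrite ler_pdivlMr ?exprn_gt0 // mulrC ler_pdivrMr // -exprMn lerXn2r ?nnegrE ?mulr_ge0 ?(ltW t0) //; lra.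
have d0 : 0 <= (u + v) ^+ m / u ^+ m by rewrite divr_ge0 ?exprn_ge0 ?(ltW um0) //; lra.
apply: le_trans (ler_pM d0 _ h1 h2) _; first by rewrite invr_ge0 ltW.
have -> : 2 ^+ m * v ^+ m / u ^+ m * (2 ^+ (2 * n).-1 / v ^+ (2 * n).-1) =
   2 ^+ (m + (2 * n).-1) * ((v ^+ ((2 * n).-1 - m))^-1 * (u ^+ m)^-1).
  have ev : v ^+ (2 * n).-1 = v ^+ ((2 * n).-1 - m) * v ^+ m by rewrite -exprD subnK // ltnW.
  rewrite ev exprD.
  have q1 : v ^+ ((2 * n).-1 - m) != 0 by rewrite gt_eqF // exprn_gt0.
  have q2 : v ^+ m != 0 by rewrite gt_eqF // exprn_gt0.
  move: q1 q2; set A := v ^+ (_ - m); set A' := v ^+ m => q1 q2.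
  by field; rewrite q1 q2 gt_eqF.
rewrite ler_wpM2l ?exprn_ge0 //.
rewrite -(powR_natV _ v0) -(powR_natV _ (ltW u0)) aE.
have -> : v `^ (- a) = v `^ (- (a - s)) * v `^ (- s).
  by rewrite -powRD ?(gt_eqF v0') ?implybT //; congr (_ `^ _); lra.
have -> : u `^ (- (m%:R + s)) = u `^ (- s) * u `^ (- m%:R).
  by rewrite -powRD ?(gt_eqF u0) ?implybT //; congr (_ `^ _); lra.
rewrite -!mulrA ler_wpM2l ?powR_ge0 // ler_wpM2r ?powR_ge0 //.
by apply: ler_powRN => //; lra.
Qed.

(** If g > l, then g = g^(1-p) g^p <= l^(1-p) g^p. With the parameter l free, this takes the place
    of the inequality of Hoelder. *)
Lemma young_split (g l p : R) : 0 <= g -> 0 < l -> 1 <= p -> g <= l + l `^ (1 - p) * g `^ p.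
Proof.
move=> g0 l0 p1; have [gl|lg] := leP g l.
  by rewrite (le_trans gl) // lerDl mulr_ge0 ?powR_ge0.
have gp : 0 < g by exact: lt_trans lg.
have e : g = g `^ (1 - p) * g `^ p.
  rewrite -powRD; last by rewrite (gt_eqF gp) implybT.
  by rewrite subrK powRr1.
rewrite {1}e (@le_trans _ _ (l `^ (1 - p) * g `^ p)) //; last by rewrite lerDr ltW.
rewrite ler_wpM2r ?powR_ge0 //.
by rewrite -[1 - p]opprB; apply: ler_powRN; rewrite ?subr_ge0 // ltW.
Qed.

Lemma powR_add_le (a b p : R) : 0 <= a -> 0 <= b -> 0 <= p -> (a + b) `^ p <= 2 `^ p * (a `^ p + b `^ p).
Proof.
move=> a0 b0 p0.
have m0 : 0 <= Num.max a b by rewrite le_max a0.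
apply: (@le_trans _ _ ((2 * Num.max a b) `^ p)).
  apply: ge0_ler_powR => //; rewrite ?nnegrE ?addr_ge0 ?mulr_ge0 //.
  by rewrite mulr2n mulrDl !mul1r lerD // le_max lexx ?orbT.
rewrite powRM // ler_wpM2l ?powR_ge0 //.
by case: (leP a b) => _; rewrite ?lerDl ?lerDr powR_ge0.
Qed.

End RealEstimates.

Section Jensen.
Context {d : measure_display} {T : measurableType d} {R : realType}.
Variables (mu : {measure set T -> \bar R}) (D : set T).
Hypothesis mD : measurable D.
Local Open Scope ereal_scope.

Lemma meas_powR (g : T -> R) (p : R) : measurable_fun D g -> measurable_fun D (fun x => (g x `^ p)%R).
Proof. by move=> mg; exact: (measurableT_comp (measurable_powR p) mg). Qed.

(** Integrating [young_split] against the weight and optimizing over l gives the convexity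
    inequality up to the factor 2^p. Finiteness of the left integral, obtained from l = 1, is part
    of the conclusion. *)
Lemma jensen (w g : T -> R) (A p : R) : (0 < A)%R -> (1 < p)%R ->
  measurable_fun D w -> measurable_fun D g -> (forall x, 0 <= w x)%R -> (forall x, 0 <= g x)%R ->
  \int[mu]_(x in D) (w x)%:E <= A%:E ->
  \int[mu]_(x in D) (w x * g x `^ p)%:E < +oo ->
  \int[mu]_(x in D) (w x * g x)%:E < +oo /\
  ((fine (\int[mu]_(x in D) (w x * g x)%:E) `^ p)%:E <=
    (2 `^ p * A `^ (p - 1))%:E * \int[mu]_(x in D) (w x * g x `^ p)%:E).
Proof.
move=> A0 p1 mw mg w0 g0 hA hM.
have mgp : measurable_fun D (fun x => (g x `^ p)%R) by exact: meas_powR.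
have i0 (k : T -> R) : (forall x, 0 <= k x)%R -> 0 <= \int[mu]_(x in D) (k x)%:E.
  by move=> k0; apply: integral_ge0 => x _; rewrite lee_fin.
have M0 := i0 _ (fun x => mulr_ge0 (w0 x) (powR_ge0 (g x) p)).
have I0 := i0 _ (fun x => mulr_ge0 (w0 x) (g0 x)).
have key l : (0 < l)%R -> \int[mu]_(x in D) (w x * g x)%:E <=
    (l * A)%:E + (l `^ (1 - p))%:E * \int[mu]_(x in D) (w x * g x `^ p)%:E.
  move=> l0; apply: (@le_trans _ _ (\int[mu]_(x in D) (l%:E * (w x)%:E + (l `^ (1 - p))%:E * (w x * g x `^ p)%:E))).
    apply: mono_integral => x _; rewrite -!EFinM -EFinD lee_fin.
    have := ler_wpM2l (w0 x) (young_split (g0 x) l0 (ltW p1)).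
    by rewrite mulrDr [(w x * l)%R]mulrC mulrCA.
  have m1 : measurable_fun D (fun x => (w x)%:E) by exact/measurable_EFinP.
  have m2 : measurable_fun D (fun x => (w x * g x `^ p)%:E).
    by apply/measurable_EFinP; exact: measurable_funM.
  rewrite ge0_integralD //; last first.
  - exact: measurable_funeM.
  - by move=> x _; rewrite -EFinM lee_fin !mulr_ge0 ?powR_ge0.
  - exact: measurable_funeM.
  - by move=> x _; rewrite -EFinM lee_fin mulr_ge0 // ltW.
  rewrite ge0_integralZl //; last 2 first.
  - by move=> x _; rewrite lee_fin.
  - by rewrite lee_fin ltW.
  rewrite ge0_integralZl //; last 2 first.
  - by move=> x _; rewrite lee_fin mulr_ge0 ?powR_ge0.
  - by rewrite lee_fin powR_ge0.
  apply: leeD => //; rewrite EFinM; apply: lee_pmul => //; rewrite ?lee_fin ?(ltW l0) //.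
  exact: i0.
move: hM M0 key; set M := \int[mu]_(x in D) (w x * g x `^ p)%:E => hM M0 key.
have Mf : M = (fine M)%:E by rewrite fineK // ge0_fin_numE.
move: Mf M0 hM key; set m := fine M => -> ; rewrite lee_fin => m0 _ key.
have fI : \int[mu]_(x in D) (w x * g x)%:E < +oo.
  by apply: le_lt_trans (key 1%R _) _ => //; rewrite -EFinM -EFinD ltry.
split=> //; move: I0 fI key; set I := \int[mu]_(x in D) (w x * g x)%:E => I0 fI key.
have If : I = (fine I)%:E by rewrite fineK // ge0_fin_numE.
move: If I0 fI key; set i := fine I => -> ; rewrite lee_fin => i0' _ key.
rewrite -EFinM lee_fin.
have {}key l : (0 < l)%R -> (i <= l * A + l `^ (1 - p) * m)%R.
  by move=> /key; rewrite -EFinM -EFinD lee_fin.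
have p0 : (0 < p)%R by lra.
have [m00|mpos] := eqVneq m 0%R.
  suff -> : i = 0%R by rewrite powR0 ?gt_eqF // m00 mulr0.
  apply/eqP; rewrite eq_le i0' andbT; apply/ler_addgt0Pr => e e0; rewrite add0r.
  have := key (e / A)%R; rewrite m00 mulr0 addr0 divfK ?gt_eqF //; apply; exact: divr_gt0.
have mp : (0 < m)%R by rewrite lt_neqAle eq_sym mpos.
(* The choice that makes the two terms l A and l^(1-p) m equal. For m = 0 it degenerates, whence the
   separate case before. *)
pose l := ((m / A) `^ p^-1)%R.
have l0 : (0 < l)%R by rewrite powR_gt0 // divr_gt0.
have lp : (l `^ p = m / A)%R by rewrite /l -powRrM mulVf ?gt_eqF // powRr1 // divr_ge0 // ltW.
have e2 : (l `^ (1 - p) * m = l * A)%R.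
  rewrite powRB ?(gt_eqF l0) ?implybT // powRr1 ?(ltW l0) // lp invf_div.
  by field; rewrite !gt_eqF.
have h := key l l0; rewrite e2 -mulr2n -mulr_natl in h.
apply: (@le_trans _ _ ((2 * (l * A)) `^ p)%R).
  apply: ge0_ler_powR; rewrite ?nnegrE ?(ltW p0) //.
  by rewrite !mulr_ge0 ?(ltW l0) ?(ltW A0).
rewrite !powRM ?mulr_ge0 ?(ltW l0) ?(ltW A0) // lp -!mulrA ler_wpM2l ?powR_ge0 //.
rewrite -(mulr_powRB1 (ltW A0) p0) le_eqVlt; apply/orP; left; apply/eqP.
by field; rewrite gt_eqF.
Qed.

End Jensen.

Section SigmaFiniteAlias.
Context {d : measure_display} {T : measurableType d} {R : realType}.

(** The measure [mu] carries no structure of sigma-finite measure. The alias has the proof as an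
    argument, so that this structure can be attached to it and the Tonelli theorem applied. *)
Definition sf_alias (mu : {measure set T -> \bar R}) of sigma_finite setT mu : set T -> \bar R := mu.

Variables (mu : {measure set T -> \bar R}) (sf : sigma_finite setT mu).

HB.instance Definition _ := measure_function.isMeasure.Build d T R (sf_alias sf)
  (measure0 mu) (measure_ge0 mu) (@measure_semi_sigma_additive _ _ _ mu).
HB.instance Definition _ := Measure_isSigmaFinite.Build d T R (sf_alias sf) sf.

End SigmaFiniteAlias.

Section Tonelli.
Context {d : measure_display} {T : measurableType d} {R : realType}.
Variable mu : {measure set T -> \bar R}.
Hypothesis sf : sigma_finite setT mu.
Variables D E : set T.
Hypotheses (mD : measurable D) (mE : measurable E).
Local Open Scope ereal_scope.
Variable F : T * T -> \bar R.
Hypothesis mF : measurable_fun setT F.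
Hypothesis F0 : forall x, 0 <= F x.

Let sfmu : {sigma_finite_measure set T -> \bar R} := sf_alias sf.

Let G := F \_ (D `*` E).

Let mG : measurable_fun setT G.
Proof. by apply/(measurable_restrictT _ _).1 => //; [exact: measurableX | exact: measurable_funTS]. Qed.

Let G0 x : 0 <= G x.
Proof. by rewrite /G /patch; case: ifP. Qed.

Let inner y : E y -> \int[mu]_(x in D) F (x, y) = \int[mu]_x G (x, y).
Proof.
move=> Ey; rewrite integral_mkcond; apply: eq_integral => x _; rewrite /G /patch.
by rewrite in_setX /= (mem_set Ey) andbT.
Qed.

Let inner' x : D x -> \int[mu]_(y in E) F (x, y) = \int[mu]_y G (x, y).
Proof.
move=> Dx; rewrite integral_mkcond; apply: eq_integral => y _; rewrite /G /patch.
by rewrite in_setX /= (mem_set Dx).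
Qed.

Lemma tonelli_on : \int[mu]_(y in E) \int[mu]_(x in D) F (x, y) =
  \int[mu]_(x in D) \int[mu]_(y in E) F (x, y).
Proof.
transitivity (\int[mu]_y \int[mu]_x G (x, y)).
  rewrite integral_mkcond; apply: eq_integral => y _; rewrite /patch.
  case: ifPn => [/set_mem Ey|/negP nE]; first exact: inner.
  rewrite integral0_eq // => x _; rewrite /G /patch in_setX /=.
  by case: (y \in E) nE => // _; rewrite andbF.
have := @fubini_tonelli _ _ T T R sfmu sfmu G mG G0.
move=> /esym ->.
apply/esym; rewrite [LHS]integral_mkcond; apply: eq_integral => x _; rewrite /patch.
case: ifPn => [/set_mem Dx|/negP nD]; first exact: inner'.
rewrite integral0_eq // => y _; rewrite /G /patch in_setX /=.
by case: (x \in D) nD.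
Qed.

Lemma tonelli_meas : measurable_fun E (fun y => \int[mu]_(x in D) F (x, y)).
Proof.
have := @measurable_fun_fubini_tonelli_G _ _ T T R sfmu G mG G0.
move=> h; have h' : measurable_fun E (fun y => \int[mu]_x G (x, y)) by exact: measurable_funTS h.
by apply: eq_measurable_fun h' => y /set_mem Ey; rewrite inner.
Qed.

End Tonelli.

Section WeightIdentities.
Context {R : realType}.

(** For q the conjugate exponent, |zeta|^(-b) is split into the integrable weight |zeta|^(-bq) and a
    power to be absorbed by the function. The identity also holds at 0, by the default values of
    [powR]. *)
Lemma powR_weight (x b q : R) : 0 <= x -> 0 <= b -> 1 < q ->
  x `^ (- (b * q)) * x `^ (b * q - b) = x `^ (- b).
Proof.
move=> x0 b0 q1; have [->|xn] := eqVneq x 0; last first.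
  by rewrite -powRD ?xn ?implybT //; congr (_ `^ _); lra.
have [->|bn] := eqVneq b 0; first by rewrite mul0r subrr oppr0 !powRr0 mulr1.
have q10 : q - 1 != 0 by rewrite gt_eqF // subr_gt0.
have e1 : b * q != 0 by rewrite mulf_neq0 // gt_eqF // (lt_trans ltr01 q1).
have e2 : b * q - b != 0 by rewrite -[X in _ - X]mulr1 -mulrBr mulf_neq0.
by rewrite !powR0 ?oppr_eq0 // mul0r.
Qed.

Lemma powR_weight_le (x b g p : R) : 0 <= x -> 0 <= b -> 0 <= g -> 1 < p ->
  x `^ (- (b * (p / (p - 1)))) * (g * x `^ (b * (p / (p - 1)) - b)) `^ p <= g `^ p.
Proof.
move=> x0 b0 g0 p1; have p10 : p - 1 != 0 by rewrite gt_eqF //; lra.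
rewrite powRM ?powR_ge0 // mulrCA -[leRHS]mulr1 ler_wpM2l ?powR_ge0 // -powRrM.
have [->|xn] := eqVneq x 0; last first.
  rewrite -powRD ?xn ?implybT // (_ : _ + _ = 0) ?powRr0 //.
  by field.
have at0 (y : R) : 0 `^ y <= 1.
  by have [->|y0] := eqVneq y 0; rewrite ?powRr0 // powR0.
by apply: mulr_ile1; rewrite ?powR_ge0.
Qed.

End WeightIdentities.

Section Schur.
Context {R : realType} (n nu : nat).
Local Notation C := R[i].
Local Notation N := (n + nu)%N.
Local Notation point := 'rV[C]_N.
Variables (f : 'I_nu -> mpoly N C) (d : 'I_nu -> nat).
Variable h : 'I_nu -> 'I_N -> mpoly (N + N) C.
Hypothesis f_ci : smooth_complete_intersection f d.
Hypothesis h_hefer : is_hefer f d h.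
Variable mu : {measure set (Borel R N) -> \bar R}.
Hypothesis mu_vol : is_volume n f mu.
Hypothesis n_gt0 : (0 < n)%N.

Lemma mu_ball_le : exists2 K : R, 0 <= K & forall z rho, 0 < rho ->
  (mu [set x | (nm (x - z) < rho)%R] <= (K * rho ^+ (2 * n))%:E)%E.
Proof.
have [K K0 hK] := volume_ball f_ci h_hefer mu_vol n_gt0; exists K => // z rho rho0.
have mX := regcone_meas f.
have mB := ball_meas (n := n) (nu := nu) z rho.
rewrite (_ : [set x | _] = ([set x : point | nm (x - z) < rho] `&` regcone f) `|` ([set x : point | nm (x - z) < rho] `&` ~` regcone f)); last first.
  by rewrite -setIUr setUv setIT.
have mX' : measurable (~` regcone f : set (Borel R N)) by exact: measurableC.
apply: le_trans (measureU2 mu (measurableI _ _ mB mX) (measurableI _ _ mB mX')) _.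
have h0 : (mu ([set x : point | (nm (x - z) < rho)%R] `&` ~` regcone f) = 0)%E.
  apply/eqP; rewrite eq_le measure_ge0 andbT -mu_vol.1; apply: le_measure; rewrite ?inE //.
  exact: measurableI.
have := hK z rho rho0; rewrite -[X in (X <= _)%E -> _]adde0 -h0; exact.
Qed.

Lemma mu_sigma_finite : sigma_finite setT mu.
Proof.
have [K K0 hK] := mu_ball_le.
exists (fun k => [set x : point | (nm (x - 0) < k.+1%:R)%R]).
  apply/seteqP; split=> // x _; exists (Num.bound (nm x)) => //=.
  rewrite subr0 (lt_le_trans (archi_boundP (nm_ge0 x))) // ler_nat.
  exact: leqnSn.
move=> k; split; first exact: ball_meas.
by apply: le_lt_trans (hK 0 k.+1%:R _) (ltry _).
Qed.

Lemma point_null z : (mu [set z] = 0)%E.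
Proof.
have [K K0 hK] := mu_ball_le.
apply/eqP; rewrite eq_le measure_ge0 andbT; apply/lee_addgt0Pr => e e0; rewrite add0e.
pose rho := Num.min 1 (e / (K + 1)).
have K1 : 0 < K + 1 by rewrite ltr_wpDl.
have rho0 : 0 < rho by rewrite lt_min ltr01 divr_gt0.
apply: (@le_trans _ _ (K * rho ^+ (2 * n))%:E).
  apply: le_trans (hK z rho rho0); apply: le_measure; rewrite ?inE.
  - by apply: borel_closed; exact: closed_nm1.
  - exact: ball_meas.
  - by move=> x ->; rewrite /= subrr nm0.
rewrite lee_fin (@le_trans _ _ (K * rho)) //.
  rewrite ler_wpM2l // -[leRHS]expr1; apply: ler_wiXn2l; [exact: ltW|by rewrite ge_min lexx|by rewrite muln_gt0].
rewrite (@le_trans _ _ (K * (e / (K + 1)))) //.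
  by rewrite ler_wpM2l // ge_min lexx orbT.
by rewrite mulrCA ger_pMr // ler_pdivrMr // mul1r lerDl.
Qed.

Lemma meas_nm_sub : measurable_fun setT (fun q : Borel R N * Borel R N => nm ((q.1 : point) - (q.2 : point))).
Proof.
apply: measurable_sum => j; apply: meas_cn.
apply: (cmeas_eq (f := fun q : Borel R N * Borel R N => (q.1 : point) 0 j - (q.2 : point) 0 j)) => [q|].
  by rewrite !mxE.
apply: cmeasB.
  exact: (cmeas_comp (h := fun x : Borel R N => (x : point) 0 j) measurable_fst (cmeas_coord j)).
exact: (cmeas_comp (h := fun x : Borel R N => (x : point) 0 j) measurable_snd (cmeas_coord j)).
Qed.

Lemma meas_nm_subr (z : point) : measurable_fun setT (fun x : Borel R N => nm ((x : point) - z)).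
Proof.
apply: measurable_sum => j; apply: meas_cn.
apply: (cmeas_eq (f := fun x : Borel R N => (x : point) 0 j - z 0 j)) => [q|]; first by rewrite !mxE.
by apply: cmeasB; [exact: cmeas_coord|exact: cmeas_cst].
Qed.

Variables (D E : set (Borel R N)) (T : R).
Hypotheses (mD : measurable D) (mE : measurable E).
Hypotheses (DX : D `<=` regcone f) (EX : E `<=` regcone f).
Hypotheses (DT : forall x, D x -> nm x <= T) (ET : forall x, E x -> nm x <= T).
Hypothesis T0 : 0 <= T.
Variables (p al be : R).
Hypotheses (p1 : 1 < p) (al0 : 0 <= al) (alp : al * p < (2 * n)%:R).
Hypotheses (be0 : 0 <= be) (bep : be * (p / (p - 1)) < (2 * n)%:R).

Definition kb (zeta z : point) : R :=
  nm (zeta - z) `^ (- (2 * n).-1%:R) + nm z `^ (- al) * nm zeta `^ (- be).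

Lemma kb_ge0 zeta z : 0 <= kb zeta z.
Proof. by rewrite addr_ge0 ?mulr_ge0 ?powR_ge0. Qed.

(** For the diagonal term, [jensen] is applied with weight |zeta - z|^(1-2n), whose mass is bounded
    in either variable, and Tonelli integrates over z. The other term is a product: [be] times the
    conjugate exponent below 2n controls zeta, and [al * p < 2n] controls z. The majorant [Phi] is
    part of the conclusion because the integral over zeta is known to converge only where [Phi] is
    finite. *)
Theorem schur : exists2 K : R, 0 <= K & forall g : Borel R N -> R,
  measurable_fun setT g -> (forall x, 0 <= g x) ->
  (\int[mu]_(x in D) (g x `^ p)%:E < +oo)%E ->
  exists Phi : Borel R N -> \bar R, [/\ measurable_fun E Phi, forall z, (0 <= Phi z)%E,
    (\int[mu]_(z in E) Phi z <= K%:E * \int[mu]_(x in D) (g x `^ p)%:E)%E &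
    forall z, E z -> (Phi z < +oo)%E ->
      (\int[mu]_(x in D) (kb x z * g x)%:E < +oo)%E /\
      ((fine (\int[mu]_(x in D) (kb x z * g x)%:E) `^ p)%:E <= Phi z)%E].
Proof.
have p0 : 0 < p by exact: lt_trans ltr01 p1.
have p10 : 0 < p - 1 by rewrite subr_gt0.
pose q := p / (p - 1); have q1 : 1 < q by rewrite ltr_pdivlMr // mul1r gtrBl.
have q0 : 0 <= q by exact: ltW (lt_trans ltr01 q1).
pose ga : R := (2 * n).-1%:R; have ga0 : 0 <= ga by [].
have gan : ga < (2 * n)%:R by rewrite ltr_nat prednK // muln_gt0.
have nm00 : nm (0 : point) <= T by rewrite nm0.
have [A1 A10 hA1] := radial_integral f_ci h_hefer mu_vol n_gt0 mD DX T0 DT ga0 gan.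
have [A1E A1E0 hA1E] := radial_integral f_ci h_hefer mu_vol n_gt0 mE EX T0 ET ga0 gan.
have [A2 A20 hA2] := radial_integral f_ci h_hefer mu_vol n_gt0 mD DX T0 DT (mulr_ge0 be0 q0) bep.
have [A3 A30 hA3] := radial_integral f_ci h_hefer mu_vol n_gt0 mE EX T0 ET (mulr_ge0 al0 (ltW p0)) alp.
pose c1 := 2 `^ p * (2 `^ p * (A1 + 1) `^ (p - 1)).
pose c2 := 2 `^ p * (2 `^ p * (A2 + 1) `^ (p - 1)).
have B1 : 0 < A1 + 1 by rewrite ltr_wpDl.
have B2 : 0 < A2 + 1 by rewrite ltr_wpDl.
have c10 : 0 < c1 by rewrite !mulr_gt0 ?powR_gt0.
have c20 : 0 < c2 by rewrite !mulr_gt0 ?powR_gt0.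
exists (c1 * A1E + c2 * A3) => [|g mg g0 hG]; first by rewrite addr_ge0 // mulr_ge0 // ltW.
have mgp : measurable_fun setT (fun x => g x `^ p) by exact: meas_powR.
pose w1 (z x : Borel R N) : R := nm ((x : point) - (z : point)) `^ (- ga).
have mw1j : measurable_fun setT (fun y : Borel R N * Borel R N => w1 y.2 y.1).
  by apply: meas_powR; exact: meas_nm_sub.
have mw1 z : measurable_fun setT (w1 z) by apply: meas_powR; exact: meas_nm_subr.
pose w2 (x : Borel R N) : R := nm (x : point) `^ (- (be * q)).
have mnm : measurable_fun setT (fun x : Borel R N => nm (x : point)).
  by apply: eq_measurable_fun (meas_nm_subr 0) => x _; rewrite subr0.
have mw2 : measurable_fun setT w2 by exact: meas_powR.
pose g2 (x : Borel R N) := g x * nm (x : point) `^ (be * q - be).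
have mg2 : measurable_fun setT g2 by apply: measurable_funM => //; exact: meas_powR.
pose M1 z := (\int[mu]_(x in D) (w1 z x * g x `^ p)%:E)%E.
have M10 z : (0 <= M1 z)%E by apply: integral_ge0 => x _; rewrite lee_fin mulr_ge0 ?powR_ge0.
set G := (\int[mu]_(x in D) (g x `^ p)%:E)%E in hG *.
have G0 : (0 <= G)%E by apply: integral_ge0 => x _; rewrite lee_fin powR_ge0.
pose gG := fine G; have GE : G = gG%:E by rewrite fineK // ge0_fin_numE.
have gG0 : 0 <= gG by rewrite fine_ge0.
pose Phi z := (c1%:E * M1 z + (c2 * gG * nm (z : point) `^ (- (al * p)))%:E)%E.
have mF : measurable_fun setT (fun y : Borel R N * Borel R N => (w1 y.2 y.1 * g y.1 `^ p)%:E).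
  apply/measurable_EFinP; apply: measurable_funM => //.
  exact: (measurableT_comp mgp measurable_fst).
have F0 (y : Borel R N * Borel R N) : (0 <= (w1 y.2 y.1 * g y.1 `^ p)%:E)%E.
  by rewrite lee_fin mulr_ge0 ?powR_ge0.
have sf := mu_sigma_finite.
have mM1 : measurable_fun E M1 by exact: (tonelli_meas sf mD mE mF F0).
have mv : measurable_fun E (fun z : Borel R N => (nm (z : point) `^ (- (al * p)))%:E).
  by apply/measurable_EFinP; apply: measurable_funTS; exact: meas_powR.
have mS : measurable_fun E (fun z : Borel R N => (c2 * gG * nm (z : point) `^ (- (al * p)))%:E).
  apply/measurable_EFinP; apply: measurable_funM; first exact: measurable_cst.
  by apply: measurable_funTS; exact: meas_powR.
exists Phi; split.
- by apply: emeasurable_funD => //; exact: measurable_funeM.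
- move=> z; apply: adde_ge0; first by apply: mule_ge0 => //; rewrite lee_fin ltW.
  by rewrite lee_fin !mulr_ge0 ?powR_ge0 // ltW.
- rewrite ge0_integralD //; first last.
  + by move=> z _; rewrite lee_fin !mulr_ge0 ?powR_ge0 // ltW.
  + exact: measurable_funeM.
  + by move=> z _; apply: mule_ge0 => //; rewrite lee_fin ltW.
  rewrite (ge0_integralZl mu mE mM1 (fun z _ => M10 z)); last by rewrite lee_fin ltW.
  have h1 : (\int[mu]_(z in E) M1 z <= (A1E * gG)%:E)%E.
    rewrite (tonelli_on sf mD mE mF F0) /=.
    apply: (@le_trans _ _ (\int[mu]_(x in D) (A1E%:E * (g x `^ p)%:E))%E).
      apply: mono_integral => x Dx.
      under eq_integral do rewrite EFinM muleC.
      rewrite ge0_integralZl //; first last.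
      + by rewrite lee_fin powR_ge0.
      + by move=> y _; rewrite lee_fin powR_ge0.
      + apply/measurable_EFinP; apply: measurable_funTS; apply: meas_powR.
        by apply: eq_measurable_fun (meas_nm_subr x) => y _; rewrite nmBC.
      rewrite muleC; apply: lee_wpmul2r; first by rewrite lee_fin powR_ge0.
      apply: le_trans (hA1E x (DT Dx)).
      by apply: mono_integral => y _; rewrite /w1 nmBC.
    rewrite ge0_integralZl //; last first.
    + by move=> x _; rewrite lee_fin powR_ge0.
    + by apply/measurable_EFinP; exact: measurable_funTS.
    by rewrite -/G GE -EFinM.
  have h2 : (\int[mu]_(z in E) (c2 * gG * nm (z : point) `^ (- (al * p)))%:E <= (c2 * gG * A3)%:E)%E.
    under eq_integral do rewrite EFinM.
    have k0 : 0 <= c2 * gG by rewrite mulr_ge0 // ltW.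
    rewrite ge0_integralZl //; last by move=> z _; rewrite lee_fin powR_ge0.
    rewrite [leRHS]EFinM; apply: lee_wpmul2l; first by rewrite lee_fin.
    apply: le_trans (hA3 0 nm00); apply: mono_integral => z _; by rewrite subr0.
  apply: (@le_trans _ _ (c1%:E * (A1E * gG)%:E + (c2 * gG * A3)%:E)%E).
    apply: leeD => //; apply: lee_wpmul2l => //; by rewrite lee_fin ltW.
  rewrite GE -!EFinM -EFinD lee_fin le_eqVlt; apply/orP; left; apply/eqP; ring.
move=> z Ez Pz.
have M1f : (M1 z < +oo)%E.
  rewrite ltNge; apply/negP; rewrite leye_eq => /eqP e; move: Pz.
  by rewrite /Phi e gt0_muley ?lte_fin // addye // ltNge leey.
have hA11 : (A1%:E <= (A1 + 1)%:E)%E by rewrite lee_fin lerDl.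
have [i1 j1] := jensen mD B1 p1 (measurable_funTS (mw1 z)) (measurable_funTS mg) (fun x => powR_ge0 _ _) g0
   (le_trans (hA1 z (ET Ez)) hA11) M1f.
have hw2 : (\int[mu]_(x in D) (w2 x * g2 x `^ p)%:E <= G)%E.
  by apply: mono_integral => x _; rewrite lee_fin; apply: powR_weight_le => //; exact: nm_ge0.
have hA22 : (A2%:E <= (A2 + 1)%:E)%E by rewrite lee_fin lerDl.
have hA2' : (\int[mu]_(x in D) (w2 x)%:E <= (A2 + 1)%:E)%E.
  apply: le_trans (le_trans (hA2 0 nm00) hA22).
  by apply: mono_integral => x _; rewrite subr0.
have [i2 j2] := jensen mD B2 p1 (measurable_funTS mw2) (measurable_funTS mg2) (fun x => powR_ge0 _ _)
   (fun x => mulr_ge0 (g0 x) (powR_ge0 _ _)) hA2' (le_lt_trans hw2 hG).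
have dec : (\int[mu]_(x in D) (kb x z * g x)%:E =
   \int[mu]_(x in D) (w1 z x * g x)%:E + (nm (z : point) `^ (- al))%:E * \int[mu]_(x in D) (w2 x * g2 x)%:E)%E.
  have m1 : measurable_fun D (fun x => (w1 z x * g x)%:E).
    by apply/measurable_EFinP; apply: measurable_funTS; exact: measurable_funM.
  have m2 : measurable_fun D (fun x => (w2 x * g2 x)%:E).
    by apply/measurable_EFinP; apply: measurable_funTS; exact: measurable_funM.
  have n1 x : D x -> (0 <= (w1 z x * g x)%:E)%E by move=> _; rewrite lee_fin mulr_ge0 ?powR_ge0.
  have n2 x : D x -> (0 <= (w2 x * g2 x)%:E)%E by move=> _; rewrite lee_fin !mulr_ge0 ?powR_ge0.
  rewrite -(ge0_integralZl mu mD m2 n2) ?lee_fin ?powR_ge0 //.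
  rewrite -ge0_integralD //.
  + apply: eq_integral => x _; rewrite -EFinM -EFinD; congr EFin.
    rewrite /kb mulrDl /w2 /g2; congr (_ + _).
    by rewrite -(powR_weight (nm_ge0 x) be0 q1) -!mulrA; congr (_ * (_ * _)); rewrite mulrC.
  + by move=> x _; rewrite -EFinM lee_fin !mulr_ge0 ?powR_ge0.
  + exact: measurable_funeM.
have I10 : (0 <= \int[mu]_(x in D) (w1 z x * g x)%:E)%E.
  by apply: integral_ge0 => x _; rewrite lee_fin mulr_ge0 ?powR_ge0.
have I20 : (0 <= \int[mu]_(x in D) (w2 x * g2 x)%:E)%E.
  by apply: integral_ge0 => x _; rewrite lee_fin !mulr_ge0 ?powR_ge0.
rewrite dec; move: i1 j1 i2 j2 I10 I20.
set I1 := (\int[mu]_(x in D) (w1 z x * g x)%:E)%E; set I2 := (\int[mu]_(x in D) (w2 x * g2 x)%:E)%E.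
move=> i1 j1 i2 j2 I10 I20.
have e1 : I1 = (fine I1)%:E by rewrite fineK // ge0_fin_numE.
have e2 : I2 = (fine I2)%:E by rewrite fineK // ge0_fin_numE.
have f10 : 0 <= fine I1 by rewrite fine_ge0.
have f20 : 0 <= fine I2 by rewrite fine_ge0.
rewrite {1 2}e1 {1 2}e2 -EFinM -EFinD; split; first exact: ltry.
rewrite /=; apply: (@le_trans _ _ ((2 `^ p)%:E * ((fine I1 `^ p)%:E + ((nm (z : point) `^ (- al)) `^ p)%:E * (fine I2 `^ p)%:E))%E).
  rewrite -(EFinM ((nm (z : point) `^ (- al)) `^ p)) -EFinD -EFinM lee_fin -powRM ?powR_ge0 //.
  by apply: powR_add_le => //; rewrite ?mulr_ge0 ?powR_ge0 // ltW.
have nz0 : 0 <= (nm (z : point) `^ (- al)) `^ p by exact: powR_ge0.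
have k2 : (((nm (z : point) `^ (- al)) `^ p)%:E * (fine I2 `^ p)%:E <=
    (nm (z : point) `^ (- (al * p)) * (2 `^ p * (A2 + 1) `^ (p - 1)) * gG)%:E)%E.
  rewrite -powRrM mulNr -mulrA [leRHS]EFinM; apply: lee_wpmul2l; first by rewrite lee_fin powR_ge0.
  apply: le_trans j2 _; rewrite [leRHS]EFinM; apply: lee_wpmul2l; first by rewrite lee_fin mulr_ge0 ?powR_ge0.
  by rewrite -GE.
apply: (@le_trans _ _ ((2 `^ p)%:E * ((2 `^ p * (A1 + 1) `^ (p - 1))%:E * M1 z +
   (nm (z : point) `^ (- (al * p)) * (2 `^ p * (A2 + 1) `^ (p - 1)) * gG)%:E))%E).
  apply: lee_wpmul2l; first by rewrite lee_fin powR_ge0.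
  exact: (leeD j1 k2).
rewrite /Phi ge0_muleDr; last 2 first.
- by apply: mule_ge0 => //; rewrite lee_fin mulr_ge0 ?powR_ge0.
- by rewrite lee_fin !mulr_ge0 ?powR_ge0.
rewrite muleA -!EFinM; apply: leeD; [exact: lexx|]; rewrite lee_fin /c2 le_eqVlt; apply/orP; left; apply/eqP; ring.
Qed.

End Schur.

(** * The integral operator *)

Section MeasurableForms.
Context {R : realType} (n nu : nat).
Local Notation C := R[i].
Local Notation N := (n + nu)%N.
Local Notation point := 'rV[C]_N.
Local Notation kgen := (kgen N).
Variables (f : 'I_nu -> mpoly N C).

(** [invmx] returns the matrix itself when it is singular, so the entries are glued along the Borel
    set where the determinant vanishes. *)
Lemma cmeas_inverse dd (T : measurableType dd) k (A : T -> 'M[C]_k) i j :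
  (forall i j, cmeas (fun t => A t i j)) -> cmeas (fun t => invmx (A t) i j).
Proof.
move=> mA; pose Z := [set t | \det (A t) = 0].
have mZ : measurable Z by apply: cmeas_zero_set; exact: cmeas_det.
apply: (cmeas_eq (f := fun t => (if t \in ~` Z then ((\det (A t))^-1 *: \adj (A t)) i j else 0) +
   (if t \in Z then A t i j else 0))) => [t|]; last first.
  apply: cmeasD; apply: cmeas_if => //; first exact: measurableC.
  exact: cmeas_invmx.
rewrite in_setC; case: (boolP (t \in Z)) => [/set_mem|/negP] hZ /=.
  rewrite add0r /invmx unitmxE unitfE.
  by move: hZ; rewrite /Z /= => ->; rewrite eqxx.
rewrite addr0 invmx_adj //; apply/eqP => e; apply: hZ.
by rewrite inE.
Qed.

Lemma cmeas_tproj i j : cmeas (fun z : Borel R N => tproj f z i j).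
Proof.
have mJT k l : cmeas (fun z : Borel R N => (jac f z)^T k l).
  by apply: cmeas_eq (cmeas_jac f l k) => z; rewrite [in RHS]mxE.
have mJ k l : cmeas (fun z : Borel R N => adjm (jac f z)^T k l).
  apply: (cmeas_eq (f := fun z : Borel R N => (jac f z k l)^*)) => [z|]; first by rewrite adjmE [in RHS]mxE.
  by apply: cmeasJ; exact: cmeas_jac.
apply: (cmeas_eq (f := fun z : Borel R N => (1%:M : 'M[C]_N) i j -
  ((jac f z)^T *m invmx (adjm (jac f z)^T *m (jac f z)^T) *m adjm (jac f z)^T) i j)) => [z|].
  by rewrite /tproj [RHS]mxE; congr (_ + _); rewrite [RHS]mxE.
apply: cmeasB; first exact: cmeas_cst.
apply: cmeas_mulmx => // k l; apply: cmeas_mulmx => // a b.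
by apply: cmeas_inverse => a' b'; exact: cmeas_mulmx.
Qed.

Lemma cmeas_tproj_comp dd (T : measurableType dd) (zt : T -> Borel R N) i j :
  measurable_fun setT zt -> cmeas (fun t => tproj f (zt t) i j).
Proof. by move=> mz; exact: (cmeas_comp mz (cmeas_tproj i j)). Qed.

Lemma emeas_pform (Phi : Borel R N -> @ext R 'I_N) : emeas Phi -> emeas (fun z : Borel R N => pform f z (Phi z)).
Proof.
move=> mP; apply: emeas_subst => // j; apply: emeas_sum => l _.
by apply: emeasZ; [exact: cmeas_tproj|exact: emeas_cst].
Qed.

Lemma emeas_hpart dd (T : measurableType dd) (G : finType) k (a : T -> @ext R G) :
  emeas a -> emeas (fun t => hpart k (a t)).
Proof.
move=> ma S; case: (boolP (#|S| == k)) => hS.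
  by apply: cmeas_eq (ma S) => t; rewrite ffunE hS.
by apply: (cmeas_eq (f := fun=> 0)) => [t|]; [rewrite ffunE (negbTE hS)|exact: cmeas_cst].
Qed.

Lemma cmeas_dtop dd (T : measurableType dd) (zt : T -> Borel R N) L (a : T -> @ext R kgen) :
  measurable_fun setT zt -> emeas a -> cmeas (fun t => dtop n f (zt t) L (a t)).
Proof.
move=> mz ma.
have mtp i j : cmeas (fun t => tproj f (zt t) i j) by exact: cmeas_tproj_comp.
have mV : emeas (fun t => kvol n f (zt t)).
  apply: emeasM; last exact: emeas_cst.
  apply: emeasX; apply: emeas_sum => j _; apply: emeas_sum => l _.
  by apply: emeasZ => //; exact: emeas_cst.
apply: cmeasM; last first.
  by apply: cmeasV; apply: cmeas_sum => S _; apply: cmeasM; [apply: cmeasJ|]; exact: mV.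
apply: cmeas_sum => S _; apply: cmeasM; first by apply: cmeasJ; exact: mV.
suff : emeas (fun t => hpart #|wgen N n| (subst (kpgen f (zt t)) (a t) * dzb_prod (~: L)%SET)) by apply.
apply: emeas_hpart; apply: emeasM; last exact: emeas_cst.
apply: emeas_subst => // -[[j|j]|[j|j]] /=; try exact: emeas_cst.
  by apply: emeas_sum => l _; apply: emeasZ => //; exact: emeas_cst.
by apply: emeas_sum => l _; apply: emeasZ => //; exact: emeas_cst.
Qed.

Lemma emeas_in_zetab dd (T : measurableType dd) (a : T -> @ext R 'I_N) :
  emeas a -> emeas (fun t => in_zetab (a t) : @ext R kgen).
Proof.
by move=> ma; apply: (emeas_subst (M := fun=> _)) => // j; exact: emeas_cst.
Qed.

(* The point 0 is removed: it is regular when all f_i are linear, and the bound for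
   the kernel degenerates there. *)
Definition proj_rep (W : set point) (u : @formX R N) (z : point) : @ext R 'I_N :=
  if z \in (W `&` regcone f) `\ 0 then pform f z (u z) else 0.

Lemma proj_repB W u v z : proj_rep W (fun z => u z - v z) z = proj_rep W u z - proj_rep W v z.
Proof.
rewrite /proj_rep; case: ifP => _; last by rewrite subr0.
by rewrite /pform (substD (pgen f z)) (substN (pgen f z)).
Qed.

Lemma proj_rep_meas W u Phi : measurable (W : set (Borel R N)) -> eq_on n f W u Phi ->
  emeas (Phi : Borel R N -> _) -> emeas (proj_rep W u : Borel R N -> _).
Proof.
move=> mW e mP.
have mX : measurable ((W `&` regcone f) `\ 0 : set (Borel R N)).
  apply: measurableD; first by apply: measurableI => //; exact: regcone_meas.
  by apply: borel_closed; exact: closed_nm1.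
apply: (emeas_eq (a := fun z : Borel R N => if z \in ((W `&` regcone f) `\ 0 : set (Borel R N)) then pform f z (Phi z) else 0)).
  move=> z; rewrite /proj_rep; case: ifP => // /set_mem[[Wz rz] _].
  by rewrite !(pformE erefl _ rz) e.
by apply: emeas_if => //; exact: emeas_pform.
Qed.

Lemma en_proj_rep_le W u z : en (proj_rep W u z) <= gauge f z (u z).
Proof. by rewrite /proj_rep; case: ifP => // _; rewrite en0 gauge_ge0. Qed.

Lemma proj_repE W u z : W z -> regcone f z -> z != 0 -> proj_rep W u z = pform f z (u z).
Proof.
move=> Wz rz /eqP z0; rewrite /proj_rep mem_set //.
Qed.

End MeasurableForms.

Section AeIntegral.
Context {R : realType} (n nu : nat).
Local Notation C := R[i].
Local Notation N := (n + nu)%N.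
Local Notation point := 'rV[C]_N.
Variable mu : {measure set (Borel R N) -> \bar R}.
Hypothesis null1 : forall z : point, mu [set z] = 0%E.
Variable D : set (Borel R N).
Hypothesis mD : measurable D.

(** [F] is not known to be measurable. [G] is corrected at the two exceptional points to a
    measurable function equal to [F] on all of [D]; only the correction is then discarded as
    null. *)
Let Rint_ae (F G : Borel R N -> R) (a b : point) : measurable_fun setT G ->
  (forall x, D x -> x <> a -> x <> b -> F x = G x) -> Rintegral mu D F = Rintegral mu D G.
Proof.
move=> mG e.
have ma z : measurable ([set z] : set (Borel R N)) by apply: borel_closed; exact: closed_nm1.
have mab : measurable ([set a] `|` [set b] : set (Borel R N)) by exact: measurableU.
pose F' (x : Borel R N) := G x + (F a - G a) * \1_[set a] x + (F b - G b) * \1_([set b] `\ a) x.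
have mF' : measurable_fun setT F'.
  apply: measurable_funD; last first.
    by apply: measurable_funM; [exact: measurable_cst|apply: measurable_indic; exact: measurableD].
  by apply: measurable_funD => //; apply: measurable_funM; [exact: measurable_cst|exact: measurable_indic].
have FF' x : D x -> F x = F' x.
  move=> Dx; rewrite /F' !indicE.
  have [xa|xa] := pselect (x = a).
    rewrite xa mem_set // memNset; last by move=> [_]; apply.
    by rewrite mulr1 mulr0 addr0 addrC subrK.
  rewrite memNset //; have [xb|xb] := pselect (x = b).
    by rewrite xb mem_set; [rewrite mulr0 mulr1 addr0 addrC subrK|split=> //; rewrite -xb].
  by rewrite memNset; [rewrite !mulr0 !addr0; exact: e|move=> [/xb]].
transitivity (Rintegral mu D F'); first by apply: eq_Rintegral => x /set_mem; exact: FF'.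
rewrite /Rintegral; congr fine; apply: ae_eq_integral => //.
- by apply/measurable_EFinP; exact: measurable_funTS.
- by apply/measurable_EFinP; exact: measurable_funTS.
exists ([set a] `|` [set b]); split => //.
  apply/eqP; rewrite eq_le measure_ge0 andbT.
  have e1 : (mu ([set a] `|` [set b]) <= mu [set a] + mu [set b])%E by exact: measureU2.
  by apply: le_trans e1 _; rewrite !null1 adde0.
move=> x /= nx; apply: contrapT => nab; apply: nx => Dx.
congr EFin; rewrite /F' !indicE memNset; last by move=> xa; apply: nab; left.
by rewrite memNset ?mulr0 ?addr0 // => -[xb _]; apply: nab; right.
Qed.

Lemma cintegral_ae (F G : point -> C) (a b : point) : cmeas (G : Borel R N -> C) ->
  (forall x, D x -> x <> a -> x <> b -> F x = G x) -> cintegral mu D F = cintegral mu D G.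
Proof.
move=> [mR mI] e; rewrite /cintegral; congr (_ +i* _).
  by apply: (Rint_ae (a := a) (b := b)) => // x h1 h2 h3; rewrite (e x).
by apply: (Rint_ae (a := a) (b := b)) => // x h1 h2 h3; rewrite (e x).
Qed.

Lemma eq_cintegral (F G : point -> C) : (forall x, D x -> F x = G x) -> cintegral mu D F = cintegral mu D G.
Proof.
by move=> e; rewrite /cintegral; congr (_ +i* _); apply: eq_Rintegral => x /set_mem Dx; rewrite e.
Qed.

Lemma integrable_bound (F : Borel R N -> R) (k : Borel R N -> R) :
  measurable_fun setT F -> measurable_fun setT k -> (forall x, D x -> `|F x| <= k x) ->
  (\int[mu]_(x in D) (k x)%:E < +oo)%E -> mu.-integrable D (EFin \o F).
Proof.
move=> mF mk Fk hk.
have ik : mu.-integrable D (EFin \o k).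
  apply/integrableP; split; first by apply/measurable_EFinP; exact: measurable_funTS.
  apply: le_lt_trans hk; apply: mono_integral => x Dx /=.
  by rewrite lee_fin ger0_norm // (le_trans _ (Fk x Dx)).
apply: (le_integrable mD _ _ ik); first by apply/measurable_EFinP; exact: measurable_funTS.
move=> x Dx /=; rewrite lee_fin (le_trans (Fk x Dx)) // ler_norm //.
Qed.

Lemma cintegral_le (F : Borel R N -> C) (k : Borel R N -> R) :
  cmeas F -> measurable_fun setT k -> (forall x, D x -> cn (F x) <= k x) ->
  (\int[mu]_(x in D) (k x)%:E < +oo)%E ->
  cn (cintegral mu D F) <= 2 * fine (\int[mu]_(x in D) (k x)%:E)%E.
Proof.
move=> [mR mI] mk Fk hk.
have one (G : Borel R N -> R) : measurable_fun setT G -> (forall x, D x -> `|G x| <= k x) ->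
    `|Rintegral mu D G| <= fine (\int[mu]_(x in D) (k x)%:E)%E.
  move=> mG Gk; have iG := integrable_bound mG mk Gk hk.
  apply: le_trans (le_normr_Rintegral mD iG) _; rewrite /Rintegral.
  have k0 x : D x -> 0 <= k x by move=> Dx; apply: le_trans (Gk x Dx).
  have kk : (\int[mu]_(x in D) (k x)%:E)%E \is a fin_num.
    by rewrite ge0_fin_numE //; apply: integral_ge0 => x Dx; rewrite lee_fin k0.
  have le1 : (\int[mu]_(x in D) (`|G x|%R)%:E <= \int[mu]_(x in D) (k x)%:E)%E.
    by apply: mono_integral => x Dx; rewrite lee_fin Gk.
  apply: fine_le => //; rewrite ge0_fin_numE; last by apply: integral_ge0 => x Dx; rewrite lee_fin.
  exact: le_lt_trans le1 hk.
rewrite (le_trans (cn_ReIm _)) // mulr2n mulrDl mul1r lerD // /=; apply: one => // x Dx.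
  exact: le_trans (cn_Re _) (Fk x Dx).
exact: le_trans (cn_Im _) (Fk x Dx).
Qed.

Lemma cintegralB (F G : Borel R N -> C) (k l : Borel R N -> R) :
  cmeas F -> measurable_fun setT k -> (forall x, D x -> cn (F x) <= k x) ->
  (\int[mu]_(x in D) (k x)%:E < +oo)%E ->
  cmeas G -> measurable_fun setT l -> (forall x, D x -> cn (G x) <= l x) ->
  (\int[mu]_(x in D) (l x)%:E < +oo)%E ->
  cintegral mu D F - cintegral mu D G = cintegral mu D (fun x => F x - G x).
Proof.
move=> [mFR mFI] mk Fk hk [mGR mGI] ml Gl hl.
have i1 : mu.-integrable D (EFin \o (fun x => complex.Re (F x))).
  by apply: (integrable_bound mFR mk _ hk) => x Dx; exact: le_trans (cn_Re _) (Fk x Dx).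
have i2 : mu.-integrable D (EFin \o (fun x => complex.Im (F x))).
  by apply: (integrable_bound mFI mk _ hk) => x Dx; exact: le_trans (cn_Im _) (Fk x Dx).
have i3 : mu.-integrable D (EFin \o (fun x => complex.Re (G x))).
  by apply: (integrable_bound mGR ml _ hl) => x Dx; exact: le_trans (cn_Re _) (Gl x Dx).
have i4 : mu.-integrable D (EFin \o (fun x => complex.Im (G x))).
  by apply: (integrable_bound mGI ml _ hl) => x Dx; exact: le_trans (cn_Im _) (Gl x Dx).
apply/eqP; rewrite eq_complex /=; apply/andP; split; apply/eqP.
  rewrite -(RintegralB mD i1 i3); apply: eq_Rintegral => x _; exact/esym/(raddfB (@complex.Re R)).
rewrite -(RintegralB mD i2 i4); apply: eq_Rintegral => x _; exact/esym/(raddfB (@complex.Im R)).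
Qed.

Hypothesis sf : sigma_finite setT mu.

Lemma cmeas_cintegral (H : Borel R N * Borel R N -> C) : cmeas H ->
  cmeas (fun z : Borel R N => cintegral mu D (fun x => H (x, z))).
Proof.
move=> [mR mI].
have one (G : Borel R N * Borel R N -> R) : measurable_fun setT G ->
    measurable_fun setT (fun z => Rintegral mu D (fun x => G (x, z))).
  move=> mG; rewrite /Rintegral.
  have mGE : measurable_fun setT (EFin \o G) by exact/measurable_EFinP.
  have hp := tonelli_meas sf mD measurableT (measurable_funepos mGE) (funepos_ge0 _).
  have hn := tonelli_meas sf mD measurableT (measurable_funeneg mGE) (funeneg_ge0 _).
  have : measurable_fun setT (fine \o (fun z => (\int[mu]_(x in D) (EFin \o G)^\+ (x, z) - \int[mu]_(x in D) (EFin \o G)^\- (x, z))%E)).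
    apply: measurableT_comp; first exact: fine_measurable.
    exact: emeasurable_funB.
  apply: eq_measurable_fun => z _ /=; congr fine; rewrite [RHS]integralE.
  congr (_ - _)%E; apply: eq_integral => x _; rewrite ?funeposE ?funenegE //.
by split; [exact: (one _ mR)|exact: (one _ mI)].
Qed.

End AeIntegral.

Lemma fineK_lty (R : realType) (x : \bar R) : (0 <= x)%E -> (x < +oo)%E -> x = (fine x)%:E.
Proof. by move=> x0 xo; rewrite fineK // ge0_fin_numE. Qed.

Section Operator.
Context {R : realType} (n nu : nat).
Local Notation C := R[i].
Local Notation N := (n + nu)%N.
Local Notation point := 'rV[C]_N.
Local Notation kgen := (kgen N).
Variables (f : 'I_nu -> mpoly N C) (d : 'I_nu -> nat).
Variable h : 'I_nu -> 'I_N -> mpoly (N + N) C.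
Hypothesis f_ci : smooth_complete_intersection f d.
Hypothesis h_hefer : is_hefer f d h.
Variable mu : {measure set (Borel R N) -> \bar R}.
Hypothesis mu_vol : is_volume n f mu.
Hypothesis n_gt0 : (0 < n)%N.
Variables (Om Om' : set point) (T : R).
Hypotheses (oOm : open Om) (oOm' : open Om') (T0 : 0 <= T).
Hypotheses (OmT : forall x, Om x -> nm x <= T) (Om'T : forall x, Om' x -> nm x <= T).

Definition domX (W : set point) : set (Borel R N) := W `&` regcone f.
Local Notation D := (domX Om').
Local Notation E := (domX Om).

Lemma domX_meas W : open W -> measurable (domX W).
Proof. by move=> oW; apply: measurableI; [exact: borel_open|exact: regcone_meas]. Qed.

Variables (p al be : R).
Hypotheses (p1 : 1 < p) (al0 : 0 <= al) (alp : al * p < (2 * n)%:R).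
Hypotheses (be0 : 0 <= be) (bep : be * (p / (p - 1)) < (2 * n)%:R).
(* Kr stands for the kernel, Kk for a Borel form equal to it off the diagonal, a null
   set for each z. *)
Variables (Kr Kk : point -> point -> @ext R kgen) (Bk : R).
Hypothesis Kk_meas : emeas (fun q : Borel R N * Borel R N => Kk q.1 q.2).
Hypothesis KrE : forall zeta z, Om z -> zeta != z -> Kr zeta z = Kk zeta z.
Hypothesis Bk0 : 0 <= Bk.
Hypothesis Kk_bound : forall zeta z, D zeta -> E z -> zeta != 0 -> en (Kk zeta z) <= Bk * kb al be zeta z.

Definition KO (u : @formX R N) : @formX R N :=
  fun z => fiber_integral n f mu Om' (fun zeta => wedge (Kr zeta z) (in_zetab (u zeta))).

Local Notation pr := (proj_rep f Om').

Lemma in_zetabB (a b : @ext R 'I_N) : in_zetab (a - b) = in_zetab a - in_zetab b :> @ext R kgen.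
Proof. by rewrite !in_zetabE (substD _) (substN _). Qed.

Definition Hd (u : @formX R N) L z zeta : C := density n f zeta L (Kk zeta z * in_zetab (pr u zeta)).

Lemma Hd_meas u L : emeas (pr u : Borel R N -> _) -> exists Hm : Borel R N * Borel R N -> C,
  cmeas Hm /\ forall zeta z, regcone f zeta -> Hm (zeta, z) = Hd u L z zeta.
Proof.
move=> mu_; have [c hc] := density_dtop (n := n) f erefl L.
exists (fun q => c * dtop n f q.1 L (Kk q.1 q.2 * in_zetab (pr u q.1))); split; last first.
  by move=> zeta z rz; rewrite /= -hc.
apply: cmeasZ; apply: cmeas_dtop; first exact: measurable_fst.
apply: emeasM => //; apply: emeas_in_zetab.
exact: (@emeas_comp R _ _ (Borel R N * Borel R N)%type (Borel R N) _ fst (pr u) measurable_fst mu_).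
Qed.

Lemma section_meas (Hm : Borel R N * Borel R N -> C) z : cmeas Hm -> cmeas (fun x => Hm (x, z)).
Proof. by move=> mH; apply: (cmeas_comp (h := Hm)) => //; exact: measurable_pair2. Qed.

(** The exceptional points are zeta = z, where the given kernel has a default value, and zeta = 0.
    Elsewhere [density] sees only the restriction of u, so the projection may be put in its
    place. *)
Lemma KOE u z L : emeas (pr u : Borel R N -> _) -> Om z ->
  KO u z L = cintegral mu D (Hd u L z).
Proof.
move=> mu_ Oz; have [Hm [mH eH]] := Hd_meas L mu_.
rewrite /KO /fiber_integral ffunE.
have null1 := point_null f_ci h_hefer mu_vol n_gt0.
transitivity (cintegral mu D (fun x => Hm (x, z))); last first.
  by apply: eq_cintegral => x [_ rx]; rewrite eH.
apply: (cintegral_ae null1 (domX_meas oOm') (a := z) (b := 0)); first exact: section_meas.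
move=> x [Ox rx] /eqP xz /eqP x0; rewrite eH // wedgeE KrE //.
by apply: density_restr; rewrite proj_repE // restr_pform.
Qed.

Lemma KO_rep u : emeas (pr u : Borel R N -> _) ->
  exists Psi : Borel R N -> @ext R 'I_N, emeas Psi /\ forall z, Om z -> KO u z = Psi z.
Proof.
move=> mu_; have /choice[Hm hHm] := fun L => Hd_meas L mu_.
have sf := mu_sigma_finite f_ci h_hefer mu_vol n_gt0.
exists (fun z => [ffun L => cintegral mu D (fun x => Hm L (x, z))]); split.
  move=> L; have [mH _] := hHm L.
  by apply: cmeas_eq (cmeas_cintegral (domX_meas oOm') sf mH) => z; rewrite ffunE.
move=> z Oz; apply/ffunP => L; rewrite [RHS]ffunE KOE //.
by apply: eq_cintegral => x [_ rx]; have [_ ->] := hHm L.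
Qed.

Lemma Hd_bound u L z zeta : D zeta -> E z ->
  cn (Hd u L z zeta) <= @kcst R N n * Bk * (kb al be zeta z * en (pr u zeta)).
Proof.
move=> Dx Ez; have [-> | x0] := eqVneq zeta 0.
  rewrite /Hd /proj_rep memNset; last by move=> [_]; apply.
  have -> : in_zetab (0 : @ext R 'I_N) = 0 :> @ext R kgen by rewrite in_zetabE (subst0 _).
  by rewrite mulr0 density0 cn0 en0 !mulr0.
rewrite (le_trans (density_le erefl _ _ Dx.2)) // -mulrA ler_wpM2l ?kcst_ge0 //.
rewrite (le_trans (enM _ _)) // mulrA ler_pM ?en_ge0 ?en_in_zetab //.
exact: Kk_bound.
Qed.

Lemma meas_kb z : measurable_fun setT (fun x : Borel R N => kb al be x z).
Proof.
apply: measurable_funD; first by apply: meas_powR; exact: meas_nm_subr.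
apply: measurable_funM; first exact: measurable_cst.
by apply: meas_powR; apply: eq_measurable_fun (meas_nm_subr 0) => x _; rewrite subr0.
Qed.

Lemma Lp_proj_le u : (\int[mu]_(x in D) (en (pr u x) `^ p)%:E <= \int[mu]_(x in D) (gauge f x (u x) `^ p)%:E)%E.
Proof.
apply: mono_integral => x _; rewrite lee_fin.
apply: ge0_ler_powR; rewrite ?nnegrE ?en_ge0 ?gauge_ge0 ?en_proj_rep_le //.
exact: ltW (lt_trans ltr01 p1).
Qed.

Definition opcst : R := @gcst R N n ^+ 2 * (#|{set 'I_N}|%:R * (2 * (@kcst R N n * Bk))).

Lemma opcst_ge0 : 0 <= opcst.
Proof.
apply: mulr_ge0; first by rewrite exprn_ge0 ?gcst_ge0.
do 2 (apply: mulr_ge0; first exact: ler0n).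
by apply: mulr_ge0; [exact: kcst_ge0|exact: Bk0].
Qed.

(** Differences are estimated directly: the operator is defined by integrals with default values, so
    it is additive only at points z where the integrals converge. *)
Lemma KO_pointwise u v z : E z -> emeas (pr u : Borel R N -> _) -> emeas (pr v : Borel R N -> _) ->
  (\int[mu]_(x in D) (kb al be x z * en (pr u x))%:E < +oo)%E ->
  (\int[mu]_(x in D) (kb al be x z * en (pr v x))%:E < +oo)%E ->
  (\int[mu]_(x in D) (kb al be x z * en (pr u x - pr v x))%:E < +oo)%E ->
  gauge f z (KO u z - KO v z) <=
  opcst * fine (\int[mu]_(x in D) (kb al be x z * en (pr u x - pr v x))%:E)%E.
Proof.
move=> Ez mu_ mv iu iv iuv; have [Oz rz] := Ez.
have mD := domX_meas oOm'.
pose cc := @kcst R N n * Bk; have cc0 : 0 <= cc by rewrite mulr_ge0 ?kcst_ge0.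
have mk (w : Borel R N -> @ext R 'I_N) : emeas w -> measurable_fun setT (fun x : Borel R N => cc * (kb al be x z * en (w x))).
  move=> mw; apply: measurable_funM; first exact: measurable_cst.
  by apply: measurable_funM; [exact: meas_kb|exact: meas_en].
have ik (w : Borel R N -> @ext R 'I_N) : emeas w -> (\int[mu]_(x in D) (cc * (kb al be x z * en (w x)))%:E =
    cc%:E * \int[mu]_(x in D) (kb al be x z * en (w x))%:E)%E.
  move=> mw; under eq_integral do rewrite EFinM.
  rewrite ge0_integralZl ?lee_fin //; last by move=> x _; rewrite lee_fin mulr_ge0 ?kb_ge0 ?en_ge0.
  apply/measurable_EFinP; apply: measurable_funTS; apply: measurable_funM; first exact: meas_kb.
  exact: meas_en.
have fin (w : Borel R N -> @ext R 'I_N) : emeas w -> (\int[mu]_(x in D) (kb al be x z * en (w x))%:E < +oo)%E ->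
   (\int[mu]_(x in D) (cc * (kb al be x z * en (w x)))%:E < +oo)%E.
  move=> mw hw; rewrite ik // lte_mul_pinfty ?lee_fin //.
have muv : emeas (fun x : Borel R N => pr u x - pr v x) by exact: emeasB.
rewrite (le_trans (gauge_le_en (n := n) erefl _ rz)) // /opcst -mulrA ler_wpM2l ?exprn_ge0 ?gcst_ge0 //.
have cof L : cn ((KO u z - KO v z) L) <= 2 * (cc * fine (\int[mu]_(x in D) (kb al be x z * en (pr u x - pr v x))%:E)%E).
  rewrite extBE !KOE //.
  have [Hu [mHu eHu]] := Hd_meas L mu_; have [Hv [mHv eHv]] := Hd_meas L mv.
  have -> : cintegral mu D (Hd u L z) = cintegral mu D (fun x => Hu (x, z)).
    by apply: eq_cintegral => x [_ rx]; rewrite eHu.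
  have -> : cintegral mu D (Hd v L z) = cintegral mu D (fun x => Hv (x, z)).
    by apply: eq_cintegral => x [_ rx]; rewrite eHv.
  have bu x : D x -> cn (Hu (x, z)) <= cc * (kb al be x z * en (pr u x)).
    by move=> Dx; rewrite (eHu _ _ Dx.2); exact: Hd_bound.
  have bv x : D x -> cn (Hv (x, z)) <= cc * (kb al be x z * en (pr v x)).
    by move=> Dx; rewrite (eHv _ _ Dx.2); exact: Hd_bound.
  rewrite (cintegralB mD (section_meas _ mHu) (mk _ mu_) bu (fin _ mu_ iu)
     (section_meas _ mHv) (mk _ mv) bv (fin _ mv iv)).
  have bb x : D x -> cn (Hu (x, z) - Hv (x, z)) <= cc * (kb al be x z * en (pr u x - pr v x)).
    move=> Dx; rewrite (eHu _ _ Dx.2) (eHv _ _ Dx.2).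
    have -> : Hd u L z x - Hd v L z x = Hd (fun y => u y - v y) L z x.
      by rewrite /Hd proj_repB in_zetabB mulrDr mulrN densityD densityN.
    by rewrite -(proj_repB _ _ u v); exact: Hd_bound.
  apply: le_trans (cintegral_le mD (cmeasB (section_meas _ mHu) (section_meas _ mHv)) (mk _ muv) bb (fin _ muv iuv)) _.
  by rewrite ik // fineM // ge0_fin_numE //; apply: integral_ge0 => x _; rewrite lee_fin mulr_ge0 ?kb_ge0 ?en_ge0.
rewrite /en (le_trans (ler_sum _ (fun L _ => cof L))) // sumr_const -[leLHS]mulr_natl.
by rewrite -/cc !mulrA.
Qed.

Theorem KO_bound : exists2 K : R, 0 <= K & forall u v : @formX R N,
  emeas (pr u : Borel R N -> _) -> emeas (pr v : Borel R N -> _) ->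
  (\int[mu]_(x in D) (gauge f x (u x) `^ p)%:E < +oo)%E ->
  (\int[mu]_(x in D) (gauge f x (v x) `^ p)%:E < +oo)%E ->
  (\int[mu]_(z in E) (gauge f z (KO u z - KO v z) `^ p)%:E <=
    K%:E * \int[mu]_(x in D) (gauge f x (u x - v x) `^ p)%:E)%E.
Proof.
have p0 : 0 <= p by exact: ltW (lt_trans ltr01 p1).
have mD := domX_meas oOm'; have mE := domX_meas oOm.
have [K0 K00 hS] := schur f_ci h_hefer mu_vol n_gt0 mD mE (fun x h => h.2) (fun x h => h.2)
  (fun x h => Om'T h.1) (fun x h => OmT h.1) T0 p1 al0 alp be0 bep.
pose oc := opcst + 1; have ocn : 0 < oc by rewrite ltr_wpDl ?opcst_ge0.
exists (oc `^ p * K0) => [|u v mu_ mv hu hv]; first by rewrite mulr_ge0 ?powR_ge0.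
pose gu (x : Borel R N) := en (pr u x); pose gv (x : Borel R N) := en (pr v x).
pose gw (x : Borel R N) := en (pr u x - pr v x).
have mgu : measurable_fun setT gu by exact: meas_en.
have mgv : measurable_fun setT gv by exact: meas_en.
have mgw : measurable_fun setT gw by apply: meas_en; exact: emeasB.
have iu := le_lt_trans (Lp_proj_le u) hu.
have iv := le_lt_trans (Lp_proj_le v) hv.
have iw : (\int[mu]_(x in D) (gw x `^ p)%:E < +oo)%E.
  apply: (@le_lt_trans _ _ (\int[mu]_(x in D) ((2 `^ p)%:E * ((gu x `^ p)%:E + (gv x `^ p)%:E)))%E).
    apply: mono_integral => x _; rewrite -EFinD -EFinM lee_fin.
    apply: le_trans (powR_add_le (en_ge0 _) (en_ge0 _) p0).
    by apply: ge0_ler_powR; rewrite ?nnegrE ?en_ge0 ?addr_ge0 ?en_ge0 ?enB.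
  have mup : measurable_fun D (fun x => (gu x `^ p)%:E).
    by apply/measurable_EFinP; apply: measurable_funTS; exact: meas_powR.
  have mvp : measurable_fun D (fun x => (gv x `^ p)%:E).
    by apply/measurable_EFinP; apply: measurable_funTS; exact: meas_powR.
  have nu' x : D x -> (0 <= (gu x `^ p)%:E)%E by move=> _; rewrite lee_fin powR_ge0.
  have nv' x : D x -> (0 <= (gv x `^ p)%:E)%E by move=> _; rewrite lee_fin powR_ge0.
  have ms : measurable_fun D (fun x => (gu x `^ p)%:E + (gv x `^ p)%:E)%E by exact: (emeasurable_funD mup mvp).
  have ns x : D x -> (0 <= (gu x `^ p)%:E + (gv x `^ p)%:E)%E.
    by move=> Dx; exact: adde_ge0 (nu' x Dx) (nv' x Dx).
  have t0 : (0 <= (2 `^ p)%:E :> \bar R)%E by rewrite lee_fin powR_ge0.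
  rewrite (ge0_integralZl mu mD ms ns t0) (ge0_integralD mu mD nu' mup nv' mvp).
  by apply: lte_mul_pinfty; [exact: t0|by []|exact: (lte_add_pinfty iu iv)].
have [Pu [mPu Pu0 iPu hPu]] := hS gu mgu (fun x => en_ge0 _) iu.
have [Pv [mPv Pv0 iPv hPv]] := hS gv mgv (fun x => en_ge0 _) iv.
have [Pw [mPw Pw0 iPw hPw]] := hS gw mgw (fun x => en_ge0 _) iw.
have oc0 : 0 <= oc by exact: ltW.
(* Where the majorant for u or v is infinite, nothing is known about K u - K v. The term e (Pu + Pv)
   is infinite at such points, has integral of order e, and disappears as e tends to 0; so no set of
   measure zero has to be split off. *)
have key e z : 0 < e -> E z -> ((gauge f z (KO u z - KO v z) `^ p)%:E <=
    (oc `^ p)%:E * Pw z + e%:E * (Pu z + Pv z))%E.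
  move=> e0 Ez.
  have op0 : (0 <= (oc `^ p)%:E * Pw z)%E by apply: mule_ge0; rewrite ?lee_fin ?powR_ge0.
  have e00 : (0 <= e%:E :> \bar R)%E by rewrite lee_fin ltW.
  have [fu|] := ltP (Pu z) +oo%E; last first.
    rewrite leye_eq => /eqP ->; rewrite addye; last by rewrite -ltNye (lt_le_trans (ltNyr 0)).
    by rewrite gt0_muley ?lte_fin // addey ?leey // -ltNye (lt_le_trans (ltNyr 0)).
  have [fv|] := ltP (Pv z) +oo%E; last first.
    rewrite leye_eq => /eqP ->; rewrite addey; last by rewrite -ltNye (lt_le_trans (ltNyr 0)).
    by rewrite gt0_muley ?lte_fin // addey ?leey // -ltNye (lt_le_trans (ltNyr 0)).
  have epos : (0 <= e%:E * (Pu z + Pv z))%E by rewrite mule_ge0 // adde_ge0.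
  have [fw|] := ltP (Pw z) +oo%E; last first.
    rewrite leye_eq => /eqP ->; rewrite gt0_muley; last first.
      by rewrite lte_fin powR_gt0.
    by rewrite addye ?leey // -ltNye (lt_le_trans (ltNyr 0)).
  have [ku ju] := hPu z Ez fu; have [kv jv] := hPv z Ez fv; have [kw jw] := hPw z Ez fw.
  have := KO_pointwise Ez mu_ mv ku kv kw; set F := fine _ => hF.
  have F0 : 0 <= F by rewrite fine_ge0 // integral_ge0 // => x _; rewrite lee_fin mulr_ge0 ?kb_ge0 ?en_ge0.
  apply: (@le_trans _ _ ((oc * F) `^ p)%:E).
    rewrite lee_fin; apply: ge0_ler_powR; rewrite ?nnegrE ?gauge_ge0 ?mulr_ge0 //.
    by rewrite (le_trans hF) // ler_wpM2r // lerDl.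
  rewrite powRM // EFinM; apply: (@le_trans _ _ ((oc `^ p)%:E * Pw z)%E); last by rewrite leeDl.
  by apply: lee_wpmul2l; rewrite ?lee_fin ?powR_ge0.
apply/lee_addgt0Pr => eps eps0.
pose Gu := fine (\int[mu]_(x in D) (gu x `^ p)%:E)%E.
pose Gv := fine (\int[mu]_(x in D) (gv x `^ p)%:E)%E.
have ge00 (g : Borel R N -> R) : (0 <= \int[mu]_(x in D) (g x `^ p)%:E)%E.
  by apply: integral_ge0 => x _; rewrite lee_fin powR_ge0.
have Gu0 : 0 <= Gu by exact: (fine_ge0 (ge00 gu)).
have Gv0 : 0 <= Gv by exact: (fine_ge0 (ge00 gv)).
have GuE : (\int[mu]_(x in D) (gu x `^ p)%:E)%E = Gu%:E by exact: (fineK_lty (ge00 gu) iu).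
have GvE : (\int[mu]_(x in D) (gv x `^ p)%:E)%E = Gv%:E by exact: (fineK_lty (ge00 gv) iv).
pose M := K0 * (Gu + Gv) + 1.
have M0 : 0 < M by apply: ltr_wpDl; [exact: (mulr_ge0 K00 (addr_ge0 Gu0 Gv0))|exact: ltr01].
pose e := eps / M; have e0 : 0 < e by exact: (divr_gt0 eps0 M0).
apply: (@le_trans _ _ (\int[mu]_(z in E) ((oc `^ p)%:E * Pw z + e%:E * (Pu z + Pv z)))%E).
  by apply: mono_integral => z Ez; exact: key.
have n1 z : E z -> (0 <= (oc `^ p)%:E * Pw z)%E by move=> _; apply: mule_ge0; rewrite ?lee_fin ?powR_ge0.
have n2 z : E z -> (0 <= e%:E * (Pu z + Pv z))%E.
  by move=> _; apply: mule_ge0; [rewrite lee_fin ltW|exact: adde_ge0].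
have m1 : measurable_fun E (fun z => (oc `^ p)%:E * Pw z)%E by exact: measurable_funeM.
have m3 : measurable_fun E (fun z => Pu z + Pv z)%E by exact: emeasurable_funD.
have m2 : measurable_fun E (fun z => e%:E * (Pu z + Pv z))%E by exact: measurable_funeM.
rewrite (ge0_integralD mu mE n1 m1 n2 m2).
rewrite (ge0_integralZl mu mE mPw (fun z _ => Pw0 z)) ?lee_fin ?powR_ge0 //.
rewrite (ge0_integralZl mu mE m3 (fun z _ => adde_ge0 (Pu0 z) (Pv0 z))) ?lee_fin ?(ltW e0) //.
rewrite (ge0_integralD mu mE (fun z _ => Pu0 z) mPu (fun z _ => Pv0 z) mPv).
apply: leeD.
  rewrite EFinM -muleA; apply: lee_wpmul2l; first by rewrite lee_fin powR_ge0.
  apply: le_trans iPw _; apply: lee_wpmul2l; first by rewrite lee_fin.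
  have -> : (\int[mu]_(x in D) (gw x `^ p)%:E = \int[mu]_(x in D) (en (pr (fun y => u y - v y) x) `^ p)%:E)%E.
    by apply: eq_integral => x _; rewrite proj_repB.
  exact: Lp_proj_le.
apply: (@le_trans _ _ (e%:E * (K0%:E * Gu%:E + K0%:E * Gv%:E))%E).
  apply: lee_wpmul2l; first by rewrite lee_fin (ltW e0).
  rewrite GuE in iPu; rewrite GvE in iPv; exact: (leeD iPu iPv).
have -> : (e%:E * (K0%:E * Gu%:E + K0%:E * Gv%:E))%E = (e * (K0 * (Gu + Gv)))%:E by rewrite mulrDr.
rewrite lee_fin /e mulrAC (ler_pdivrMr _ _ M0); apply: ler_wpM2l; first exact: (ltW eps0).
by rewrite lerDl ler01.
Qed.

Hypothesis Kk_away : forall r : R, 0 < r -> exists2 B : R, 0 <= B & forall zeta z,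
  D zeta -> E z -> r <= nm zeta -> nm z < r / 2 -> en (Kk zeta z) <= B.

(** For |z| < r/2 only |zeta| >= r contributes, where the kernel is bounded, and u is integrable
    because g <= 1 + g^p and the volume is finite. *)
Lemma KO_bounded u r : 0 < r -> emeas (pr u : Borel R N -> _) ->
  (\int[mu]_(x in D) (gauge f x (u x) `^ p)%:E < +oo)%E ->
  (forall x, D x -> nm x < r -> gauge f x (u x) = 0) ->
  exists2 B : R, 0 <= B & forall z, E z -> nm z < r / 2 -> gauge f z (KO u z) <= B.
Proof.
move=> r0 mu_ hu u0; have [B B0 hB] := Kk_away r0.
have p0 : 0 <= p by exact: ltW (lt_trans ltr01 p1).
have mD := domX_meas oOm'.
pose g (x : Borel R N) := en (pr u x).
have mg : measurable_fun setT g by exact: meas_en.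
pose cc := @kcst R N n * B; have cc0 : 0 <= cc by rewrite mulr_ge0 ?kcst_ge0.
have ig : (\int[mu]_(x in D) (g x)%:E < +oo)%E.
  apply: (@le_lt_trans _ _ (\int[mu]_(x in D) (1%:E + (g x `^ p)%:E))%E).
    apply: mono_integral => x _; rewrite -EFinD lee_fin.
    have := young_split (en_ge0 (pr u x)) (ltr01 : 0 < 1 :> R) (ltW p1).
    by rewrite powR1 mul1r.
  have n1 x : D x -> (0 <= (1%:E : \bar R))%E by move=> _; rewrite lee_fin.
  have n2 x : D x -> (0 <= (g x `^ p)%:E)%E by move=> _; rewrite lee_fin powR_ge0.
  have m1 : measurable_fun D (fun _ : Borel R N => 1%:E : \bar R) by exact: measurable_cst.
  have m2 : measurable_fun D (fun x => (g x `^ p)%:E).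
    by apply/measurable_EFinP; apply: measurable_funTS; exact: meas_powR.
  rewrite (ge0_integralD mu mD n1 m1 n2 m2) (integral_cst mu mD) mul1e.
  apply: lte_add_pinfty.
    exact: (volume_finite f_ci h_hefer mu_vol n_gt0 mD (fun x h => h.2) T0 (fun x h => Om'T h.1)).
  exact: le_lt_trans (Lp_proj_le u) hu.
have mk : measurable_fun setT (fun x => cc * g x) by apply: measurable_funM => //; exact: measurable_cst.
have ik : (\int[mu]_(x in D) (cc * g x)%:E < +oo)%E.
  under eq_integral do rewrite EFinM.
  rewrite ge0_integralZl ?lee_fin //; first by rewrite lte_mul_pinfty ?lee_fin.
    by apply/measurable_EFinP; exact: measurable_funTS.
  by move=> x _; rewrite lee_fin en_ge0.
pose I := fine (\int[mu]_(x in D) (cc * g x)%:E)%E.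
have I0 : 0 <= I by rewrite fine_ge0 // integral_ge0 // => x _; rewrite lee_fin mulr_ge0 ?en_ge0.
exists (@gcst R N n ^+ 2 * (#|{set 'I_N}|%:R * (2 * I))).
  by rewrite !mulr_ge0 ?exprn_ge0 ?gcst_ge0.
move=> z Ez hz; rewrite (le_trans (gauge_le_en (n := n) erefl _ Ez.2)) // ler_wpM2l ?exprn_ge0 ?gcst_ge0 //.
have cof L : cn (KO u z L) <= 2 * I.
  rewrite KOE //; last exact: Ez.1.
  have [Hu [mHu eHu]] := Hd_meas L mu_.
  have -> : cintegral mu D (Hd u L z) = cintegral mu D (fun x => Hu (x, z)).
    by apply: eq_cintegral => x [_ rx]; rewrite eHu.
  apply: (cintegral_le mD (section_meas _ mHu) mk _ ik) => x Dx.
  rewrite (eHu _ _ Dx.2) (le_trans (density_le erefl _ _ Dx.2)) // /cc -mulrA ler_wpM2l ?kcst_ge0 //.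
  have [xr|rx] := ltP (nm x) r.
    have e0 : pr u x = 0.
      apply: en_eq0; apply/eqP; rewrite eq_le en_ge0 andbT.
      by rewrite -(u0 _ Dx xr); exact: en_proj_rep_le.
    rewrite e0 in_zetabE (subst0 _) mulr0 en0 mulr_ge0 ?en_ge0 //.
  rewrite (le_trans (enM _ _)) // ler_pM ?en_ge0 ?en_in_zetab //.
  exact: hB.
rewrite /en (le_trans (ler_sum _ (fun L _ => cof L))) // sumr_const -[leLHS]mulr_natl //.
Qed.

End Operator.

(** * Degree of the kernel and of the forms K u *)

Section KernelDegree.
Context {R : realType}.
Local Notation C := R[i].

Definition wdeg (G : finType) (w : G -> int) (k : int) (a : @ext R G) :=
  forall S : {set G}, \sum_(g in S) w g != k -> a S = 0.

Lemma wdegM (G : finType) (w : G -> int) j k (a b : @ext R G) :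
  wdeg w j a -> wdeg w k b -> wdeg w (j + k) (a * b).
Proof.
move=> ha hb S hS; rewrite -wedgeE ffunE big1 // => T TS.
have [e|ne] := eqVneq (\sum_(g in T) w g) j; last by rewrite ha // mulr0 mul0r.
rewrite hb ?mulr0 //; apply: contra hS => /eqP hb'.
rewrite (big_setID T) /= (finset.setIidPr TS) e hb' //.
Qed.

Lemma wdegMN1 (G : finType) (w : G -> int) (a b : @ext R G) :
  wdeg w (-1) a -> wdeg w 1 b -> wdeg w 0 (a * b).
Proof. by move=> ha hb; have := wdegM ha hb; rewrite addNr. Qed.

Lemma wdegD (G : finType) (w : G -> int) k (a b : @ext R G) : wdeg w k a -> wdeg w k b -> wdeg w k (a + b).
Proof. by move=> ha hb S hS; rewrite extDE ha // hb // addr0. Qed.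

Lemma wdegN (G : finType) (w : G -> int) k (a : @ext R G) : wdeg w k a -> wdeg w k (- a).
Proof. by move=> ha S hS; rewrite extNE ha // oppr0. Qed.

Lemma wdegZ (G : finType) (w : G -> int) k c (a : @ext R G) : wdeg w k a -> wdeg w k (c *: a).
Proof. by move=> ha S hS; rewrite extZE ha // mulr0. Qed.

Lemma wdeg_sum (G : finType) (w : G -> int) k (I : Type) (r : seq I) (P : pred I) (F : I -> @ext R G) :
  (forall i, P i -> wdeg w k (F i)) -> wdeg w k (\sum_(i <- r | P i) F i).
Proof. by move=> hF S hS; rewrite ext_sumE big1 // => i Pi; exact: hF. Qed.

Lemma wdeg1 (G : finType) (w : G -> int) : wdeg w 0 (1 : @ext R G).
Proof.
move=> S hS; rewrite -ext1_1 ext1E ffunE; case: eqP => // e.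
by move: hS; rewrite e big_set0 eqxx.
Qed.

Lemma wdeg_gen (G : finType) (w : G -> int) (g : G) : wdeg w (w g) (gen g : @ext R G).
Proof. by move=> S hS; rewrite ffunE; case: eqP => // e; move: hS; rewrite e big_set1 eqxx. Qed.

Lemma wdegX0 (G : finType) (w : G -> int) (a : @ext R G) k : wdeg w 0 a -> wdeg w 0 (a ^+ k).
Proof.
move=> ha; elim: k => [|k IH]; first by rewrite expr0; exact: wdeg1.
by rewrite exprS -[0 : int]addr0; exact: wdegM.
Qed.

Variables (n nu : nat).
Local Notation N := (n + nu)%N.
Local Notation point := 'rV[C]_N.
Local Notation kgen := (kgen N).

(** The grading that controls the degree: the derivatives of s and b have weight 0, the geometric
    sums weight 1, and the weight form weight 0. The product of weight form and Bochner-Martinelli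
    form thus has one more d eta_j than other generators in each monomial. *)
Definition eta_sign (g : kgen) : int := if g \in all_deta N then 1 else -1.

Lemma eta_sign_deta j : eta_sign (deta j) = 1.
Proof. by rewrite /eta_sign imset_f. Qed.

Lemma eta_sign_kbar l : eta_sign (kbar l) = -1.
Proof.
by rewrite /eta_sign /kbar; case: (fintype.split l) => k; case: imsetP => // -[j _].
Qed.

Lemma eta_sign_dzetab j : eta_sign (dzetab j) = -1.
Proof. by rewrite /eta_sign; case: imsetP => // -[k _]. Qed.

Lemma wdeg_eform (b : 'I_N -> C) : wdeg eta_sign 1 (eform b).
Proof. by apply: wdeg_sum => j _; apply: wdegZ; rewrite -(eta_sign_deta j); exact: wdeg_gen. Qed.

Lemma wdeg_dform (b : 'I_(N + N) -> 'I_N -> C) : wdeg eta_sign 0 (dform b).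
Proof.
apply: wdeg_sum => l _; apply: wdegMN1; last exact: wdeg_eform.
by rewrite -(eta_sign_kbar l); exact: wdeg_gen.
Qed.

Lemma wdeg_gsum m b db : wdeg eta_sign 1 b -> wdeg eta_sign 0 db -> wdeg eta_sign 1 (gsum (N := N) m b db).
Proof.
move=> hb hdb; apply: wdeg_sum => k _; rewrite -[1 : int]addr0; apply: wdegM => //.
exact: wdegX0.
Qed.

Lemma card_deta : #|all_deta N| = N.
Proof. by rewrite card_imset ?card_ord // => i j []. Qed.

Lemma eta_sign_sum (S : {set kgen}) :
  \sum_(g in S) eta_sign g = #|S :&: all_deta N|%:Z - #|S :\: all_deta N|%:Z.
Proof.
rewrite (big_setID (all_deta N)) /=; congr (_ + _).
  rewrite (eq_bigr (fun=> 1)) => [|g]; first by rewrite sumr_const -mulr_natr mul1r natz.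
  by rewrite inE /eta_sign => /andP[_ ->].
rewrite (eq_bigr (fun=> -1)) => [|g]; first by rewrite sumr_const mulNrn natz.
by rewrite inE /eta_sign => /andP[/negbTE ->].
Qed.

(** Weight 1 together with m generators d eta_j leaves m - 1 others. For m = 0 the part vanishes,
    since weight 1 then cannot occur. *)
Lemma hdeg_eta_part m (a : @ext R kgen) : wdeg eta_sign 1 a -> hdeg (m + m).-1 (eta_part m a).
Proof.
move=> ha S hS; rewrite ffunE; case: eqP => // cS; apply: ha; rewrite eta_sign_sum cS.
apply: contra hS => /eqP e; rewrite -(cardsID (all_deta N) S) cS; apply/eqP.
move: e; case: m cS => [|m] cS; first by lia.
move=> e; have : #|S :\: all_deta N| = m by lia.
by move=> ->; lia.
Qed.

Lemma hdeg_strip m (a : @ext R kgen) : hdeg (m + N) a -> hdeg m (strip_eta a).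
Proof.
move=> ha S hS; rewrite ffunE; case: ifP => // dS; rewrite ha ?mulr0 //.
apply: contra hS => /eqP e; apply/eqP/(@addIn N).
by rewrite -e cardsU card_deta disjoint_setI0 // cards0 subn0.
Qed.

Lemma hdeg_prod (G : finType) m k (F : 'I_k -> @ext R G) :
  (forall i, hdeg m (F i)) -> hdeg (m * k) (\prod_(i < k) F i).
Proof.
elim: k F => [|k IH] F hF; first by rewrite big_ord0 muln0; exact: hdeg1.
by rewrite big_ord_recl mulnS; apply: hdegM => //; exact: IH.
Qed.

Variables (f : 'I_nu -> mpoly N C) (h : 'I_nu -> 'I_N -> mpoly (N + N) C).
Variables (chi : point -> R) (s : 'I_N -> 'rV[C]_(N + N) -> C) (eps : bool).
Hypothesis n_gt0 : (0 < n)%N.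

Lemma hdeg_eform (b : 'I_N -> C) : hdeg 1 (eform b).
Proof. exact: hdeg_lincomb. Qed.

Lemma hdeg_hefer x : hdeg nu (hefer_form h x).
Proof.
have := hdeg_prod (fun i => hdeg_eform (fun j => peval (h i j) x)).
by rewrite mul1n hefer_formE.
Qed.

Lemma hdeg_Ktilde zeta z : hdeg n.-1 (Ktilde n h chi s (row_mx zeta z)).
Proof.
apply: hdeg_strip.
have -> : (n.-1 + N = nu + (n + n).-1)%N by lia.
rewrite wedgeE; apply: hdegM; first exact: hdeg_hefer.
apply: hdeg_eta_part; rewrite wedgeE -[1 : int]add0r; apply: wdegM.
  rewrite weight_formE; apply: wdegD; first by apply: wdegZ; exact: wdeg1.
  apply: wdegN; apply: wdegMN1.
    by apply: wdeg_sum => k _; apply: wdegZ; rewrite -(eta_sign_dzetab k); exact: wdeg_gen.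
  by apply: wdeg_gsum; [exact: wdeg_eform|exact: wdeg_dform].
by rewrite bm_formE geom_sumE; apply: wdeg_gsum; [exact: wdeg_eform|exact: wdeg_dform].
Qed.

Lemma increasing_inj (I : {ffun 'I_nu -> 'I_N}) : increasing I -> injective I.
Proof.
move=> inc k l e; case: (ltngtP k l) => [kl|lk|]; last by move/val_inj.
  by have /forallP/(_ k)/forallP/(_ l)/implyP/(_ kl) := inc; rewrite e ltnn.
by have /forallP/(_ l)/forallP/(_ k)/implyP/(_ lk) := inc; rewrite e ltnn.
Qed.

Lemma hdeg_omegaX z : hdeg n (omegaX f z).
Proof.
rewrite omegaXE; apply: hdegZ; apply: hdeg_sum => I inc; apply: hdegZ.
have e : #|[set (dzeta j : kgen) | j in (~: [set I k | k : 'I_nu])%SET]%SET| = n.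
  rewrite card_imset; last by move=> i j [].
  by rewrite cardsCs finset.setCK card_imset ?card_ord ?addnK //; exact: increasing_inj.
by have := @hdeg_monom R _ [set (dzeta j : kgen) | j in (~: [set I k | k : 'I_nu])%SET]%SET; rewrite e.
Qed.

Lemma hdeg_Kker zeta z : hdeg (n + n.-1) (Kker n f eps h chi s zeta z).
Proof.
by rewrite /Kker escaleE wedgeE; apply: hdegZ; apply: hdegM; [exact: hdeg_omegaX|exact: hdeg_Ktilde].
Qed.

Lemma density_degree m z (L : {set 'I_N}) (a : @ext R kgen) : hdeg m a -> (2 * n + #|L| != m)%N -> density n f z L a = 0.
Proof.
move=> ha hL; rewrite densityE (hdeg_subst (fun g => krestr1 _ g) ha) ?mulr0 //.
rewrite /topset cardsU (_ : _ :&: _ = finset.set0) ?cards0 ?subn0; last first.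
  apply/setP => g; rewrite !inE; apply/negP => /andP[/imsetP[x _ ->] /imsetP[y _]] //.
rewrite !card_imset; try by move=> x y [].
by rewrite card_sum card_ord; apply: contra hL => /eqP <-; apply/eqP; lia.
Qed.

(** The integrand has total degree (2n - 1) + q, and integration over zeta consumes 2n, so only sets
    [L] with q - 1 elements survive. *)
Lemma Kop_degree mu Om' q u : (0 < q)%N -> of_degree q u ->
  of_degree q.-1 (Kop n f mu Om' eps h chi s u).
Proof.
move=> q0 hu z L hL; rewrite /Kop /fiber_integral ffunE.
have z0 zeta : density n f zeta L (wedge (Kker n f eps h chi s zeta z) (in_zetab (u zeta))) = 0.
  apply: (@density_degree (n + n.-1 + q)).
    rewrite wedgeE; apply: hdegM; first exact: hdeg_Kker.
    by apply: hdeg_in_zetab => S; exact: hu.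
  by apply: contra hL => /eqP e; apply/eqP; lia.
rewrite /cintegral /Rintegral.
by rewrite !integral0_eq // => x _; rewrite z0.
Qed.

End KernelDegree.

(** * Logarithmic cut-off functions *)

Section AffineCalculus.
Context {R : realType} (M : nat).
Local Notation C := R[i].
Implicit Types (x v c : 'rV[C]_M) (g : 'rV[C]_M -> C).

Lemma isdd_affine (lam : R) c v x g l : lam != 0 -> isdd v g (c + lam%:C *: x) l ->
  isdd v (fun y => g (c + lam%:C *: y)) x (lam%:C * l).
Proof.
move=> lam0 /isdd_lim hg; apply/isdd_lim => e e0.
have al : 0 < `|lam| by rewrite normr_gt0.
have [r r0 hr] := hg (e / `|lam|) (divr_gt0 e0 al).
exists (r / `|lam|); first exact: divr_gt0.
move=> t t0 ht; have lt0 : lam * t != 0 by rewrite mulf_neq0.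
have hlt : `|lam * t| < r by rewrite normrM mulrC -ltr_pdivlMr.
have := hr _ lt0 hlt.
have -> : c + lam%:C *: (x + t%:C *: v) = c + lam%:C *: x + (lam * t)%:C *: v.
  by rewrite scalerDr scalerA -rmorphM addrA.
move=> h1; set X := g _ - g _.
have lC : lam%:C != 0 :> C by rewrite -cn_gt0 cn_real normr_gt0.
have tC : t%:C != 0 :> C by rewrite -cn_gt0 cn_real normr_gt0.
have -> : X / t%:C - lam%:C * l = lam%:C * (X / (lam * t)%:C - l).
  by rewrite rmorphM /=; field; rewrite lC tC.
by rewrite cnM cn_real mulrC -ltr_pdivlMr.
Qed.

Lemma CK_affine k (lam : R) c g : lam != 0 -> CK k setT g -> CK k setT (fun y => g (c + lam%:C *: y)).
Proof.
move=> lam0; have al : 0 < `|lam| by rewrite normr_gt0.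
have hc h : (forall y, ctsat h y) -> forall x, ctsat (fun y => h (c + lam%:C *: y)) x.
  move=> hh x e e0; have [r r0 hr] := hh (c + lam%:C *: x) e e0.
  exists (r / `|lam|) => [|y hy]; first exact: divr_gt0.
  by apply: hr; rewrite opprD addrACA subrr add0r -scalerBr nmZ cn_real mulrC -ltr_pdivlMr.
elim: k g => [|k IH] g hg.
  by split=> // x _; apply: hc => y; exact: (CK_cts hg).
apply: (@CK_isdd _ _ _ _ _ openT _ (fun v x => lam%:C * dirder v g (c + lam%:C *: x))).
- by move=> x _; apply: hc => y; exact: (CK_cts hg).
- by move=> x v _; apply: isdd_affine => //; exact: (CK_der v hg).
- by move=> v; apply: CKZ => //; [exact: openT|apply: IH; exact: CK_dirder].
Qed.

Lemma wirtbar_isdd j g x (D : 'rV[C]_M -> C) : (forall v, isdd v g x (D v)) ->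
  wirtbar j g x = (D (delta_mx 0 j) + imC * D (imC *: delta_mx 0 j)) / 2%:R.
Proof. by move=> hD; rewrite /wirtbar !(isdd_dirder (hD _)). Qed.

Lemma wirtbar_const j g x (U : set 'rV[C]_M) a : open U -> U x -> (forall y, U y -> g y = a) -> wirtbar j g x = 0.
Proof.
move=> oU Ux hU; rewrite (@wirtbar_isdd j g x (fun=> 0)) ?mulr0 ?addr0 ?mul0r // => v.
apply: (isdd_local oU Ux (h := fun=> a)); first by move=> y /hU ->.
exact: isdd_cst.
Qed.

Lemma wirtbarM j g k x : (forall v, dirderivable v g x) -> (forall v, dirderivable v k x) ->
  wirtbar j (fun y => g y * k y) x = wirtbar j g x * k x + g x * wirtbar j k x.
Proof.
move=> hg hk.
rewrite (wirtbar_isdd j (fun v => isddM (dirderivable_isdd (hg v)) (dirderivable_isdd (hk v)))).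
rewrite /wirtbar; move: (dirder _ g x) (dirder _ g x) (dirder _ k x) (dirder _ k x) (g x) (k x) => a b a' b' u w.
by field.
Qed.

End AffineCalculus.

Section Cutoffs.
Context {R : realType} (n nu : nat).
Local Notation C := R[i].
Local Notation N := (n + nu)%N.
Local Notation point := 'rV[C]_N.
Variables (f : 'I_nu -> mpoly N C) (d : 'I_nu -> nat).
Variable h : 'I_nu -> 'I_N -> mpoly (N + N) C.
Hypothesis f_ci : smooth_complete_intersection f d.
Hypothesis h_hefer : is_hefer f d h.
Variable mu : {measure set (Borel R N) -> \bar R}.
Hypothesis mu_vol : is_volume n f mu.
Hypothesis n_gt0 : (0 < n)%N.
Variables (Om Om' : set point) (chi : point -> R) (T : R) (c0 : point).
Hypothesis chi_cut : is_cutoff Om Om' chi.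
Hypotheses (Om'T : forall x, Om' x -> nm x <= T) (Omc : Om c0).
Variables (p : R) (E : set (Borel R N)).
Hypotheses (p1 : 1 < p) (p2n : p <= (2 * n)%:R) (mE : measurable E).

Definition dmu (g : point -> R) (z : point) : @ext R 'I_N :=
  \sum_j wirtbar j (fun y => (g y)%:C) z *: gen j.

Let chiC (y : point) : C := (chi y)%:C.

Lemma chi_CK k : CK k setT chiC.
Proof. by have [cs _ _ _] := chi_cut; exact: (smooth_onP _ _).1 cs k. Qed.

Lemma chi_far w : T < nm w -> chi w = 0.
Proof.
move=> hw; apply/eqP; apply: contraTT hw => e; rewrite -leNgt.
by have [_ _ sub _] := chi_cut; apply: Om'T; apply: sub; exact: subset_closure.
Qed.

Lemma wirtbar_far j w : T < nm w -> wirtbar j chiC w = 0.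
Proof.
move=> hw; apply: (@wirtbar_const _ _ j _ _ [set y | T < nm y] 0) => //.
  apply/open_nmP => x /= hx; exists (nm x - T); first by rewrite subr_gt0.
  by move=> y hy; have := ler_nmB x y; rewrite nmBC; lra.
by move=> y /= hy; rewrite /chiC chi_far.
Qed.

Lemma chi_near : exists2 r : R, 0 < r & forall w, nm (w - c0) < r -> chi w = 1 /\ forall j, wirtbar j chiC w = 0.
Proof.
have [_ _ _ [W [oW sW hW]]] := chi_cut.
have Wc : W c0 by apply: sW; exact: subset_closure.
have [r r0 hr] := (open_nmP _).1 oW _ Wc; exists r => // w hw.
split; first by apply: hW; exact: hr.
move=> j; apply: (@wirtbar_const _ _ j _ _ W 1 oW); first exact: hr.
by move=> y Wy; rewrite /chiC hW.
Qed.

(** All cut-offs are made from dilates of the given chi about a point [c0] of Omega, where chi is 1;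
    so [kap] is 0 near the origin and 1 far out, on a scale of order 1/lam. *)
Definition kap (lam : R) (z : point) : R := 1 - chi (c0 + lam%:C *: z).

(* The gradients of the summands live on disjoint annuli if L is large, so that the
   integral of |dbar logcut|^p is of order (k+1)^(1-p) for p <= 2n. *)
Definition logcut (L : R) (k : nat) (z : point) : R :=
  k.+1%:R^-1 * \sum_(i < k.+1) kap (L ^+ (k + i)) z.

Lemma kap_CK m lam : lam != 0 -> CK m setT (fun z => (kap lam z)%:C).
Proof.
move=> l0; apply: (CK_eq (h := fun z => 1 + - chiC (c0 + lam%:C *: z)) openT).
  by move=> y _; rewrite /kap rmorphB rmorph1.
apply: CKD; [exact: openT|apply: CK_cst; exact: openT|apply: CKN; first exact: openT].
by apply: CK_affine => //; exact: chi_CK.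
Qed.

Lemma logcut_CK m L k : 0 < L -> CK m setT (fun z => (logcut L k z)%:C).
Proof.
move=> L0; apply: (CK_eq (h := fun z => (k.+1%:R^-1 : R)%:C * \sum_(i < k.+1) (kap (L ^+ (k + i)) z)%:C) openT).
  by move=> y _; rewrite /logcut rmorphM /= rmorph_sum.
apply: CKZ; first exact: openT.
apply: CK_sum; first exact: openT.
by move=> i _; apply: kap_CK; rewrite gt_eqF // exprn_gt0.
Qed.

Lemma kap_isdd lam v z : lam != 0 ->
  isdd v (fun z => (kap lam z)%:C) z (- (lam%:C * dirder v chiC (c0 + lam%:C *: z))).
Proof.
move=> l0; have h1 : isdd v (fun y => chiC (c0 + lam%:C *: y)) z (lam%:C * dirder v chiC (c0 + lam%:C *: z)).
  by apply: isdd_affine => //; exact: (CK_der v (chi_CK 1)).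
have := isddD (isdd_cst v 1 z) (isddN h1); rewrite add0r.
by apply: isdd_eq => y; rewrite /kap rmorphB rmorph1.
Qed.

Lemma logcut_wirtbar L k j z : 0 < L -> wirtbar j (fun z => (logcut L k z)%:C) z =
  (k.+1%:R^-1 : R)%:C * \sum_(i < k.+1) - ((L ^+ (k + i))%:C * wirtbar j chiC (c0 + (L ^+ (k + i))%:C *: z)).
Proof.
move=> L0; have l0 i : L ^+ (k + i) != 0 by rewrite gt_eqF // exprn_gt0.
have hD v : isdd v (fun z => (logcut L k z)%:C) z
    ((k.+1%:R^-1 : R)%:C * \sum_(i < k.+1) - ((L ^+ (k + i))%:C * dirder v chiC (c0 + (L ^+ (k + i))%:C *: z))).
  have := isddZ (k.+1%:R^-1 : R)%:C (@isdd_sum R _ v z 'I_k.+1 (index_enum 'I_k.+1) xpredT _ _ (fun i _ => kap_isdd v z (l0 i))).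
  by apply: isdd_eq => y; rewrite /logcut rmorphM /= rmorph_sum.
rewrite (wirtbar_isdd j hD) mulrCA -mulrDr -mulrA; congr (_ * _).
rewrite mulr_sumr -big_split /= mulr_suml; apply: eq_bigr => i _.
rewrite /wirtbar; set x := c0 + _; move: (dirder (delta_mx 0 j) chiC x) (dirder _ chiC x) (_%:C) => a b l.
by field.
Qed.

Theorem log_cutoffs : exists (B : R) (m : nat -> point -> R), [/\ 0 <= B,
  (forall k, smooth_on setT (fun z => (m k z)%:C)) /\ (forall k z, `|m k z| <= B),
  forall k, exists2 r : R, 0 < r & forall z, nm z < r -> m k z = 0,
  forall del : R, 0 < del -> exists k0, forall k z, (k0 <= k)%N -> del <= nm z -> m k z = 1 &
  forall e : R, 0 < e -> exists k0, forall k, (k0 <= k)%N ->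
    (\int[mu]_(z in E `&` regcone f) (en (dmu (m k) z) `^ p)%:E <= e%:E)%E].
Proof.
have [r r0 hr] := chi_near; have [Bc Bc0 hBc] := chi_bound chi_cut.
have [Bd Bd0 hBd] := dchi_bound chi_cut.
have [K K0 hK] := volume_ball f_ci h_hefer mu_vol n_gt0.
have T0 : 0 <= T.
  apply: le_trans (nm_ge0 c0) (Om'T _); have [_ _ sub [W [_ sW hW]]] := chi_cut.
  apply: sub; apply: subset_closure => /=; rewrite hW ?oner_neq0 //; apply: sW; exact: subset_closure.
have nc : nm c0 <= T.
  have e1 : chi c0 = 1 by apply: (hr c0 _).1; rewrite subrr nm0.
  by rewrite leNgt; apply/negP => /chi_far; rewrite e1; apply/eqP; exact: oner_neq0.
pose S := T + T + 1; have S0 : 0 < S by rewrite ltr_wpDl // addr_ge0.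
(* The gradient of a dilate by lam lives on r <= lam |z| < S. As L r > S, consecutive annuli are
   disjoint, and L >= 2 makes the scales tend to 0. *)
pose L := S / r + 2.
have L1 : 1 < L by rewrite ltr_wpDl ?ltr1n // divr_ge0 ?ltW.
have L0 : 0 < L by exact: lt_trans ltr01 L1.
have Lx k : 0 < L ^+ k by rewrite exprn_gt0.
have aff lam z : 0 < lam -> nm (c0 + lam%:C *: z - c0) = lam * nm z.
  by move=> l0; rewrite addrC addKr nmZ cn_real gtr0_norm.
have near lam z : 0 < lam -> lam * nm z < r -> kap lam z = 0 /\ forall j, wirtbar j chiC (c0 + lam%:C *: z) = 0.
  by move=> l0 hz; have [|e1 e2] := hr (c0 + lam%:C *: z); rewrite ?aff // /kap e1 subrr.
have farT lam z : 0 < lam -> S <= lam * nm z -> T < nm (c0 + lam%:C *: z).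
  move=> l0 hz; have := nmB (c0 + lam%:C *: z) c0; rewrite aff // => h1.
  by rewrite /S in hz; lra.
have mk0 k : (0 : R) < k.+1%:R^-1 by rewrite invr_gt0.
have avg k (a : R) : k.+1%:R^-1 * (\sum_(i < k.+1) a) = a.
  by rewrite sumr_const card_ord -[a *+ _]mulr_natl mulrA mulVf ?mul1r // pnatr_eq0.
exists (1 + Bc), (logcut L); split.
- by rewrite addr_ge0.
- split=> [k|k z]; first by apply/smooth_onP => m; exact: logcut_CK.
  rewrite /logcut normrM gtr0_norm // -[leRHS](avg k) ler_pM2l // (le_trans (ler_norm_sum _ _ _)) //.
  by apply: ler_sum => i _; rewrite /kap (le_trans (ler_normB _ _)) // normr1 lerD2l.
- move=> k; exists (r / L ^+ (k + k)); first by rewrite divr_gt0.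
  move=> z hz; rewrite /logcut big1 ?mulr0 // => i _.
  apply: (near _ _ (Lx _) _).1; apply: (@le_lt_trans _ _ (L ^+ (k + k) * nm z)).
    rewrite ler_wpM2r ?nm_ge0 //; apply: ler_weXn2l; first exact: ltW.
    by rewrite leq_add2l -ltnS.
  by rewrite mulrC -ltr_pdivlMr.
(* The exponents of the dilations start at k, not at 0, so every factor is at least L^k >= 2^k. Once
   this exceeds S/del, all summands are 1 on |z| >= del. *)
- move=> del del0; exists (Num.bound (S / del)) => k z k0 hz.
  rewrite /logcut (eq_bigr (fun=> 1)) ?avg // => i _.
  rewrite /kap chi_far ?subr0 //; apply: farT => //.
  apply: (@le_trans _ _ (L ^+ (k + i) * del)); last by rewrite ler_pM2l.
  rewrite -ler_pdivrMr //; apply: (@le_trans _ _ (2 ^+ k)); last first.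
    apply: (@le_trans _ _ (L ^+ k)); last by apply: ler_weXn2l; [exact: ltW|rewrite leq_addr].
    by rewrite lerXn2r ?nnegrE ?(ltW L0) // /L lerDr divr_ge0 ?ltW.
  apply: ltW; apply: lt_le_trans (archi_boundP _) _; first by rewrite divr_ge0 ?ltW.
  by rewrite -natrX ler_nat (leq_trans k0) // ltnW // ltn_expl.
move=> e e0.
pose A := (N%:R * Bd) `^ p * (K * (S + 1) ^+ (2 * n)).
have A0 : 0 <= A by rewrite !mulr_ge0 ?powR_ge0 ?exprn_ge0 ?addr_ge0 ?(ltW S0).
have p0 : 0 < p by exact: lt_trans ltr01 p1.
have p10 : 0 < p - 1 by rewrite subr_gt0.
(* The integral will be at most A (k+1)^(1-p), which lies below e from this index on because p >
   1. *)
exists (Num.bound ((A / e) `^ (p - 1)^-1)) => k kk.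
pose lam (i : 'I_k.+1) := L ^+ (k + i); have lam0 i : 0 < lam i by exact: Lx.
have lam1 i : 1 <= lam i by rewrite exprn_ege1 // ltW.
pose cc (i : 'I_k.+1) := (k.+1%:R^-1 * (N%:R * Bd)) * lam i.
have cc0 i : 0 <= cc i by rewrite !mulr_ge0 ?(ltW (mk0 k)) ?(ltW (lam0 i)).
pose a (i : 'I_k.+1) (z : point) := if (r <= lam i * nm z) && (lam i * nm z < S) then cc i else 0.
have a0 i z : 0 <= a i z by rewrite /a; case: ifP.
have hdm z : en (dmu (logcut L k) z) <= \sum_i a i z.
  rewrite /dmu; apply: (@le_trans _ _ (\sum_(j < N) \sum_i k.+1%:R^-1 * (if (r <= lam i * nm z) && (lam i * nm z < S) then lam i * Bd else 0))).
    rewrite (le_trans (en_sum _ _ _)) //; apply: ler_sum => j _.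
    rewrite enZ en_gen mulr1 logcut_wirtbar // cnM cn_real gtr0_norm // -mulr_sumr ler_pM2l //.
    rewrite (le_trans (cn_sum _ _ _)) //; apply: ler_sum => i _; rewrite cnN cnM cn_real gtr0_norm //.
    case: (ltP (lam i * nm z) r) => [h1|h1] /=; first by rewrite (near _ _ (lam0 i) h1).2 cn0 mulr0.
    case: (ltP (lam i * nm z) S) => [h2|h2] /=; first by rewrite ler_pM2l //; exact: hBd.
    by rewrite wirtbar_far ?cn0 ?mulr0 //; exact: farT.
  rewrite exchange_big /=; apply: ler_sum => i _; rewrite sumr_const card_ord /a /cc.
  case: ifP => _; last by rewrite mulr0 mul0rn.
  by rewrite -[leLHS]mulr_natl le_eqVlt; apply/orP; left; apply/eqP; ring.
(* At every point at most one summand is nonzero, so the p-th power of the sum is the sum of the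
   p-th powers. This is the gain over a single cut-off. *)
have one z : (\sum_i a i z) `^ p <= \sum_i a i z `^ p.
  case: (pickP (fun i => (r <= lam i * nm z) && (lam i * nm z < S))) => [i hi|no].
    rewrite (bigD1 i) //= big1 ?addr0.
      by rewrite [leRHS](bigD1 i) //= lerDl sumr_ge0 // => l _; exact: powR_ge0.
    move=> l li; rewrite /a; case: ifP => // /andP[h1 h2]; move/andP: hi => [h3 h4].
    have sep (x y : 'I_k.+1) : (x < y)%N -> r <= lam x * nm z -> lam y * nm z < S -> False.
      move=> xy g1 g2.
      have : L * r < S.
        apply: le_lt_trans g2; apply: (@le_trans _ _ (L * (lam x * nm z))); first by rewrite ler_pM2l.
        rewrite mulrA ler_wpM2r ?nm_ge0 // -exprS; apply: ler_weXn2l; first exact: ltW.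
        by rewrite -addnS leq_add2l.
      by rewrite /L mulrDl divfK ?gt_eqF // ltNge lerDl mulr_ge0 // ltW.
    have [il|il|il] := ltngtP i l.
    - by case: (sep i l il h3 h2).
    - by case: (sep l i il h1 h4).
    - by case/negP: li; apply/eqP/val_inj.
  rewrite big1 ?powR0 ?gt_eqF ?sumr_ge0 // => i _; first exact: powR_ge0.
  by rewrite /a no.
pose Bl i : set (Borel R N) := [set z | nm (z - 0) < (S + 1) / lam i].
have mBl i : measurable (Bl i) by exact: ball_meas.
pose F i (z : Borel R N) := ((cc i `^ p)%:E * (\1_(Bl i) z)%:E)%E.
have F0 i z : (0 <= F i z)%E by rewrite /F -EFinM lee_fin mulr_ge0 ?powR_ge0.
have mEX : measurable (E `&` regcone f : set (Borel R N)) by apply: measurableI => //; exact: regcone_meas.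
have mInd i : measurable_fun (E `&` regcone f) (EFin \o (\1_(Bl i) : Borel R N -> R)).
  by apply/measurable_EFinP; exact: measurable_indic.
have mF i : measurable_fun (E `&` regcone f) (F i) by exact: measurable_funeM (mInd i).
apply: (@le_trans _ _ (\int[mu]_(z in E `&` regcone f) \sum_(i < k.+1) F i z)%E).
  apply: mono_integral => z _; apply: (@le_trans _ _ (\sum_i a i z `^ p)%:E).
    rewrite lee_fin (le_trans _ (one z)) //; apply: ge0_ler_powR; first exact: ltW.
    - by rewrite nnegrE en_ge0.
    - by rewrite nnegrE; apply: sumr_ge0 => i _; exact: a0.
    - exact: hdm.
  rewrite -sumEFin; apply: lee_sum => i _; rewrite /a.
  case: ifP => [/andP[_ h2]|_]; last by rewrite powR0 ?gt_eqF.
  rewrite /F indicE mem_set ?mule1 // /Bl /= subr0 ltr_pdivlMr // mulrC (lt_trans h2) //.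
  by rewrite ltrDl.
rewrite ge0_integral_sum //.
apply: (@le_trans _ _ (\sum_(i < k.+1) ((k.+1%:R^-1) `^ p * A)%:E)%E).
  apply: lee_sum => i _.
  have i0 x : (E `&` regcone f) x -> (0 <= (EFin \o (\1_(Bl i) : Borel R N -> R)) x)%E by move=> _; rewrite lee_fin.
  rewrite (ge0_integralZl mu mEX (mInd i) i0) ?lee_fin ?powR_ge0 // integral_indic //.
  have hm : (mu (Bl i `&` (E `&` regcone f)) <= (K * ((S + 1) / lam i) ^+ (2 * n))%:E)%E.
    have Sl : 0 < (S + 1) / lam i by rewrite divr_gt0 // addr_gt0.
    apply: le_trans (hK 0 _ Sl); apply: le_measure; rewrite ?inE.
    - exact: measurableI.
    - by apply: measurableI; [exact: ball_meas|exact: regcone_meas].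
    - by move=> x [h1 [_ h2]].
  apply: le_trans (lee_wpmul2l _ hm) _; first by rewrite lee_fin powR_ge0.
  rewrite -EFinM lee_fin /cc /A.
  have nb0 : 0 <= N%:R * Bd by rewrite mulr_ge0.
  rewrite (powRM p (mulr_ge0 (ltW (mk0 k)) nb0) (ltW (lam0 i))) (powRM p (ltW (mk0 k)) nb0) expr_div_n.
  (* The gradient contributes lam^p and the volume of the annulus lam^(-2n); since lam >= 1, the
     condition p <= 2n is exactly what bounds the product. *)
  have hl : lam i `^ p / lam i ^+ (2 * n) <= 1.
    rewrite ler_pdivrMr ?exprn_gt0 // mul1r -powR_mulrn ?(ltW (lam0 i)) //.
    exact: ler_powR.
  have c1 : 0 <= k.+1%:R^-1 `^ p * ((N%:R * Bd) `^ p * (K * (S + 1) ^+ (2 * n))).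
    by rewrite !mulr_ge0 ?powR_ge0 ?exprn_ge0 ?addr_ge0 ?(ltW S0).
  move: c1 hl (ler_wpM2l c1 hl) => _ _; rewrite mulr1; apply: le_trans.
  move: (_ `^ p) (_ `^ p) (_ ^+ _) (lam i `^ p) (lam i ^+ _)^-1 => a1 a2 a3 a4 a5.
  by rewrite le_eqVlt; apply/orP; left; apply/eqP; ring.
rewrite sumEFin lee_fin sumr_const card_ord -[leLHS]mulr_natl.
have kp : (0 : R) < k.+1%:R by [].
have -> : k.+1%:R * ((k.+1%:R^-1) `^ p * A) = A / k.+1%:R `^ (p - 1) :> R.
  rewrite -powR_inv1 ?(ltW kp) // -powRrM mulN1r powRN.
  rewrite -[in LHS](mulr_powRB1 (ltW kp) p0); field.
  by rewrite !gt_eqF // powR_gt0.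
rewrite ler_pdivrMr ?powR_gt0 // mulrC -ler_pdivrMr //.
have Ae0 : 0 <= A / e by rewrite divr_ge0 // ltW.
have -> : A / e = ((A / e) `^ (p - 1)^-1) `^ (p - 1) by rewrite -powRrM mulVf ?gt_eqF // powRr1.
apply: ge0_ler_powR; rewrite ?nnegrE ?powR_ge0 ?(ltW p10) ?(ltW kp) //.
apply: ltW; apply: lt_le_trans (archi_boundP (powR_ge0 _ _)) _; rewrite ler_nat.
exact: leq_trans kk _.
Qed.

End Cutoffs.

(** * Approximation in the graph norm *)

Section FormSpaces.
Context {R : realType} (n nu : nat).
Local Notation C := R[i].
Local Notation N := (n + nu)%N.
Local Notation point := 'rV[C]_N.
Local Notation formX := (@formX R N).
Variable f : 'I_nu -> mpoly N C.
Variable mu : {measure set (Borel R N) -> \bar R}.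
Implicit Types (W : set point) (u v w : formX) (g : point -> R).

(** The measurability clause of [Lp] separated from integrability, so that forms can be manipulated
    before their norms are known to be finite. *)
Definition has_rep W u := exists Phi : formX, eq_on n f W u Phi /\ emeas (Phi : Borel R N -> _).

Lemma has_rep_emeas W u : emeas (u : Borel R N -> _) -> has_rep W u.
Proof. by move=> mu_; exists u; split. Qed.

Lemma has_repD W u v : has_rep W u -> has_rep W v -> has_rep W (fun z => u z + v z).
Proof.
move=> [a [ha ma]] [b [hb mb]]; exists (fun z => a z + b z); split; last exact: emeasD.
by move=> z Wz rz; rewrite !restrD ha // hb.
Qed.

Lemma has_repZ W g u : cmeas (fun z : Borel R N => (g z)%:C) -> has_rep W u ->
  has_rep W (fun z => (g z)%:C *: u z).
Proof.
move=> mg [a [ha ma]]; exists (fun z => (g z)%:C *: a z); split; last exact: emeasZ.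
by move=> z Wz rz; rewrite !restrZ ha.
Qed.

Lemma has_repB W u v : has_rep W u -> has_rep W v -> has_rep W (fun z => u z - v z).
Proof.
move=> [a [ha ma]] [b [hb mb]]; exists (fun z => a z - b z); split; last exact: emeasB.
by move=> z Wz rz; rewrite !restrB ha // hb.
Qed.

Lemma has_repM W v u : emeas (v : Borel R N -> _) -> has_rep W u -> has_rep W (fun z => v z * u z).
Proof.
move=> mv [a [ha ma]]; exists (fun z => v z * a z); split; last exact: emeasM.
by move=> z Wz rz; rewrite !restrM ha.
Qed.

Lemma has_rep_sub W W' u : W `<=` W' -> has_rep W' u -> has_rep W u.
Proof. by move=> WW [a [ha ma]]; exists a; split=> // z /WW; exact: ha. Qed.

Lemma has_rep_proj W u : open W -> has_rep W u -> emeas (proj_rep f W u : Borel R N -> _).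
Proof. by move=> oW [a [ha ma]]; exact: (proj_rep_meas (borel_open oW) ha ma). Qed.

Lemma gauge_meas W u : has_rep W u -> measurable_fun (domX f W) (fun x : Borel R N => gauge f x (u x)).
Proof.
move=> [a [ha ma]].
apply: (eq_measurable_fun (fun x : Borel R N => gauge f x (a x))).
  by move=> x /set_mem[Wx rx]; rewrite (gauge_restr (n := n) erefl rx (ha _ Wx rx)).
by apply: measurable_funTS; apply: meas_en; exact: emeas_pform.
Qed.

Variable p : R.
Hypothesis p0 : 0 < p.

Definition gint W u : \bar R := (\int[mu]_(x in domX f W) (gauge f x (u x) `^ p)%:E)%E.

Lemma gauge_pow_meas W u : has_rep W u -> measurable_fun (domX f W) (fun x : Borel R N => (gauge f x (u x) `^ p)%:E).
Proof. by move=> hu; apply/measurable_EFinP; apply: meas_powR; exact: gauge_meas. Qed.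

Lemma gint_eq W u v : eq_on n f W u v -> gint W u = gint W v.
Proof.
by move=> e; apply: eq_integral => x /set_mem[Wx rx]; rewrite (gauge_restr (n := n) erefl rx (e _ Wx rx)).
Qed.

Lemma gint0 W u : eq_on n f W u (fun=> 0) -> gint W u = 0%E.
Proof.
move=> e; rewrite (gint_eq e); apply: integral0_eq => x _.
by rewrite gauge0 powR0 ?gt_eqF.
Qed.

Lemma gint_sub W W' u : open W -> open W' -> W `<=` W' -> has_rep W' u -> measurable (regcone f : set (Borel R N)) ->
  (gint W u <= gint W' u)%E.
Proof.
move=> oW oW' WW hu mX; apply: ge0_subset_integral.
- by apply: measurableI => //; exact: borel_open.
- by apply: measurableI => //; exact: borel_open.
- exact: gauge_pow_meas.
- by move=> x _; rewrite lee_fin powR_ge0.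
- by move=> x [/WW h1 h2].
Qed.

Lemma pow_mono (a b : R) : 0 <= a -> a <= b -> a `^ p <= b `^ p.
Proof.
move=> a0 ab; apply: ge0_ler_powR => //; rewrite ?nnegrE ?(le_trans a0 ab) //.
exact: ltW.
Qed.

Section Open.
Variable W : set point.
Hypothesis mD : measurable (domX f W).

Lemma gint_le u (c : R) v : 0 <= c -> has_rep W v ->
  (forall x, W x -> regcone f x -> gauge f x (u x) <= c * gauge f x (v x)) ->
  (gint W u <= (c `^ p)%:E * gint W v)%E.
Proof.
move=> c0 hv le.
rewrite /gint -(ge0_integralZl mu mD (gauge_pow_meas hv)) ?lee_fin ?powR_ge0 //; last first.
  by move=> x _; rewrite lee_fin powR_ge0.
apply: mono_integral => x [Wx rx]; rewrite -EFinM lee_fin -powRM ?gauge_ge0 //.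
by apply: pow_mono; [exact: gauge_ge0|exact: le].
Qed.

Lemma gintD u v : has_rep W u -> has_rep W v ->
  (gint W (fun x => (u x + v x)%R) <= (2 `^ p)%:E * (gint W u + gint W v))%E.
Proof.
move=> hu hv; have mu_ := gauge_pow_meas hu; have mv := gauge_pow_meas hv.
have nu_ x : domX f W x -> (0 <= (gauge f x (u x) `^ p)%:E)%E by move=> _; rewrite lee_fin powR_ge0.
have nv x : domX f W x -> (0 <= (gauge f x (v x) `^ p)%:E)%E by move=> _; rewrite lee_fin powR_ge0.
rewrite /gint -(ge0_integralD mu mD nu_ mu_ nv mv).
have ms : measurable_fun (domX f W) (fun x : Borel R N => (gauge f x (u x) `^ p)%:E + (gauge f x (v x) `^ p)%:E)%E.
  exact: emeasurable_funD.
rewrite -(ge0_integralZl mu mD ms) ?lee_fin ?powR_ge0 //; last first.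
  by move=> x Dx; rewrite adde_ge0 ?nu_ ?nv.
apply: mono_integral => x [Wx rx]; rewrite -EFinD -EFinM lee_fin.
apply: le_trans (powR_add_le (gauge_ge0 _ _ _) (gauge_ge0 _ _ _) (ltW p0)).
by apply: pow_mono; [exact: gauge_ge0|exact: gaugeD].
Qed.

Lemma gintB u v : has_rep W u -> has_rep W v ->
  (gint W (fun x => (u x - v x)%R) <= (2 `^ p)%:E * (gint W u + gint W v))%E.
Proof.
move=> hu hv; have hn : has_rep W (fun x => - v x).
  have [a [ha ma]] := hv; exists (fun x => - a x); split; last exact: emeasN.
  by move=> z Wz rz; rewrite !restrN ha.
have e : gint W (fun x => - v x) = gint W v by apply: eq_integral => x _; rewrite gaugeN.
by have := gintD hu hn; rewrite e.
Qed.

Lemma gint_close u v : has_rep W u -> has_rep W v ->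
  (gint W (fun x => (u x - v x)%R) < +oo)%E -> (gint W v < +oo)%E -> (gint W u < +oo)%E.
Proof.
move=> hu hv h1 h2.
have -> : gint W u = gint W (fun x => ((u x - v x) + v x)%R).
  by apply: eq_integral => x _; rewrite subrK.
have p2 : (0 <= (2 `^ p)%:E :> \bar R)%E by rewrite lee_fin powR_ge0.
exact: (le_lt_trans (gintD (has_repB hu hv) hv) (lte_mul_pinfty p2 isT (lte_add_pinfty h1 h2))).
Qed.

Lemma gint_triangle u v w (a b : R) : has_rep W u -> has_rep W v -> has_rep W w ->
  (gint W (fun x => (u x - v x)%R) <= a%:E)%E -> (gint W (fun x => (v x - w x)%R) <= b%:E)%E ->
  (gint W (fun x => (u x - w x)%R) <= (2 `^ p * (a + b))%:E)%E.
Proof.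
move=> hu hv hw h1 h2.
have -> : gint W (fun x => (u x - w x)%R) = gint W (fun x => ((u x - v x) + (v x - w x))%R).
  by apply: eq_integral => x _; rewrite addrA subrK.
apply: le_trans (gintD (has_repB hu hv) (has_repB hv hw)) _.
rewrite EFinM EFinD; apply: lee_wpmul2l; first by rewrite lee_fin powR_ge0.
exact: leeD.
Qed.

Local Notation Fc := (@fcst R N n).

Lemma Lp_power_le_gint u : has_rep W u -> (Lp_power n f mu p W u <= (Fc `^ p)%:E * gint W u)%E.
Proof.
move=> hu; rewrite /gint -(ge0_integralZl mu mD (gauge_pow_meas hu)) ?lee_fin ?powR_ge0 //; last first.
  by move=> x _; rewrite lee_fin powR_ge0.
apply: mono_integral => x [Wx rx]; rewrite -EFinM lee_fin -powRM ?gauge_ge0 ?(ltW (fcst_gt0 _ _)) //.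
by apply: pow_mono; [exact: fnorm_ge0|exact: fnorm_le_gauge].
Qed.

(** A constant cannot be pulled out of the integral of [fnorm], whose measurability is not at hand.
    So u is scaled down first, the constant leaves the integral of the gauge, and monotonicity
    compares the rest with [fnorm]. *)
Lemma gint_le_Lp_power u : has_rep W u -> (gint W u <= (Fc `^ p)%:E * Lp_power n f mu p W u)%E.
Proof.
move=> hu; have F0 : 0 < Fc by exact: fcst_gt0.
have hv : has_rep W (fun x => (Fc^-1)%:C *: u x).
  by apply: (has_repZ (g := fun=> Fc^-1)) => //; exact: cmeas_cst.
apply: (@le_trans _ _ ((Fc `^ p)%:E * gint W (fun x => (Fc^-1)%:C *: u x)%R)%E).
  apply: gint_le => //; first exact: ltW.
  move=> x _ _; rewrite gaugeZ cn_real gtr0_norm ?invr_gt0 // mulVKf ?gt_eqF //.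
apply: lee_wpmul2l; first by rewrite lee_fin powR_ge0.
apply: mono_integral => x [Wx rx]; rewrite lee_fin; apply: pow_mono; first exact: gauge_ge0.
rewrite gaugeZ cn_real gtr0_norm ?invr_gt0 // ler_pdivrMl //; exact: gauge_le_fnorm.
Qed.

Lemma LpP q u : Lp n f mu p W q u <-> [/\ of_degree q u, has_rep W u & (gint W u < +oo)%E].
Proof.
have F0 : (0 <= (Fc `^ p)%:E :> \bar R)%E by rewrite lee_fin powR_ge0.
split=> -[h1 h2 h3]; have hr : has_rep W u by exact: h2.
  by split; [exact: h1|exact: hr|exact: (le_lt_trans (gint_le_Lp_power hr) (lte_mul_pinfty F0 isT h3))].
by split; [exact: h1|exact: h2|exact: (le_lt_trans (Lp_power_le_gint hr) (lte_mul_pinfty F0 isT h3))].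
Qed.

End Open.

(** The projected form has the same restriction as u, so it is itself an ambient representative once
    its coefficients are Borel. *)
Lemma prep_rep W u : (forall S, cmeas (fun x : Borel R N => if x \in domX f W then pform f x (u x) S else 0)) ->
  has_rep W u.
Proof.
move=> hm; exists (fun x => [ffun S => if (x : Borel R N) \in domX f W then pform f x (u x) S else 0]); split.
  move=> z Wz rz; rewrite -(restr_pform (n := n) erefl _ rz); congr (restr n f z _).
  by apply/ffunP => S; rewrite ffunE mem_set.
by move=> S; apply: cmeas_eq (hm S) => x; rewrite ffunE.
Qed.

Lemma local_rep W u : measurable (domX f W) ->
  (forall z0, W z0 -> regcone f z0 -> exists V (Phi : formX), [/\ open V, V z0,
     emeas (fun x : Borel R N => if x \in V then Phi x else 0) & eq_on n f V u Phi]) ->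
  has_rep W u.
Proof.
move=> mD hl; apply: prep_rep => S.
apply: (local_meas (h := fun x => pform f x (u x) S) mD) => z0 [Wz rz].
have [V [Phi [oV Vz mP e]]] := hl _ Wz rz.
exists V, (fun x => pform f x (if (x : Borel R N) \in V then Phi x else 0) S); split => //.
  exact: (emeas_pform f mP).
move=> y Vy [_ ry]; rewrite mem_set // !(pformE (n := n) erefl _ ry).
by rewrite e.
Qed.

Lemma dbar_rep V (Phi : formX) : open V -> (forall S, smooth_on V (fun z => Phi z S)) ->
  emeas (fun x : Borel R N => if x \in V then dbarform id Phi x else (0 : @ext R 'I_N)).
Proof.
move=> oV hP.
apply: (emeas_eq (a := fun x : Borel R N => \sum_j gen j *
   ([ffun S => if x \in V then wirtbar j (fun y => Phi y S) x else 0] : @ext R 'I_N))).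
  move=> x; case: ifP => xV.
    by apply: eq_bigr => j _; rewrite wedgeE; congr (_ * _); apply/ffunP => S; rewrite !ffunE.
  by rewrite big1 // => j _; rewrite (_ : [ffun _ => _] = 0) ?mulr0 //; apply/ffunP => S; rewrite !ffunE.
apply: emeas_sum => j _; apply: emeasM; first exact: emeas_cst.
move=> S; apply: (cmeas_eq (f := fun x : Borel R N => if x \in V then wirtbar j (fun y => Phi y S) x else 0)).
  by move=> x; rewrite ffunE.
apply: cts_meas => // x Vx; apply: cts_wirtbar Vx.
by have /smooth_onP := hP S; apply.
Qed.

Lemma smooth_rep V (Phi : formX) : open V -> (forall S, smooth_on V (fun z => Phi z S)) ->
  emeas (fun x : Borel R N => if x \in V then Phi x else (0 : @ext R 'I_N)).
Proof.
move=> oV hP S; apply: (cmeas_eq (f := fun x : Borel R N => if x \in V then Phi x S else 0)).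
  by move=> x; case: ifP => _; rewrite ?ext0E.
apply: cts_meas => // x Vx; have /smooth_onP hS := hP S.
exact: (CK_cts (hS 0%N) Vx).
Qed.

(** Smoothness provides only local ambient forms; their projections agree on overlaps and are glued
    by countably many of the neighbourhoods. *)
Lemma smooth_dbar_rep W q u v : measurable (domX f W) ->
  smooth_dbar n f (regcone f `&` W) q u v -> has_rep W u /\ has_rep W v.
Proof.
move=> mD [_ _ hl]; split; apply: local_rep => // z0 Wz rz.
  have [V [Phi [[oV Vz] _ sP e1 e2]]] := hl z0 (conj rz Wz).
  by exists V, Phi; split => //; exact: smooth_rep.
have [V [Phi [[oV Vz] _ sP e1 e2]]] := hl z0 (conj rz Wz).
by exists V, (dbarform id Phi); split => //; exact: dbar_rep.
Qed.

Lemma CK_dirderivable V (v : point) (k : point -> C) x : CK 1 V k -> V x -> dirderivable v k x.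
Proof. by move=> hk Vx; have /isddP[] := CK_der v hk Vx. Qed.

Lemma dbarform_mul V g (Phi : formX) x : smooth_on setT (fun z => (g z)%:C) ->
  (forall S, smooth_on V (fun z => Phi z S)) -> V x ->
  dbarform id (fun z => (g z)%:C *: Phi z) x = dmu g x * Phi x + (g x)%:C *: dbarform id Phi x :> @ext R 'I_N.
Proof.
move=> /smooth_onP sg hP Vx; rewrite /dmu mulr_suml scaler_sumr -big_split /=.
apply: eq_bigr => j _; rewrite !wedgeE -scalerAl scalerAr scalerAr -mulrDr; congr (_ * _).
apply/ffunP => S; rewrite extDE !extZE !ffunE.
have /smooth_onP hS := hP S.
have -> : (fun y => ((g y)%:C *: Phi y) S) = (fun y => (g y)%:C * Phi y S) by apply/funext => y; rewrite extZE.
rewrite (@wirtbarM _ _ j (fun y => (g y)%:C)) // => v; first exact: CK_dirderivable (sg 1%N) _.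
exact: CK_dirderivable (hS 1%N) Vx.
Qed.

Lemma smooth_dbar_mul A q u v g : smooth_on setT (fun z => (g z)%:C) -> smooth_dbar n f A q u v ->
  smooth_dbar n f A q (fun z => (g z)%:C *: u z) (fun z => dmu g z * u z + (g z)%:C *: v z).
Proof.
move=> sg [du dv hl]; split.
- by move=> z; apply: hdegZ; exact: du.
- move=> z; apply: hdegD; last by apply: hdegZ; exact: dv.
  rewrite -add1n; apply: hdegM; last exact: du.
  by apply: hdeg_sum => j _; apply: hdegZ; exact: hdeg_gen.
move=> z0 Az; have [V [Phi [[oV Vz] dP sP e1 e2]]] := hl _ Az.
exists V, (fun z => (g z)%:C *: Phi z); split.
- by split.
- by move=> z; apply: hdegZ; exact: dP.
- move=> S; apply/smooth_onP => k.
  apply: (CK_eq (h := fun z => (g z)%:C * Phi z S)) => //; first by move=> y _; rewrite extZE.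
  have /smooth_onP hS := sP S; have /smooth_onP hg := sg.
  by apply: CKM => //; apply: CK_sub (hg k).
- by move=> z Vz' rz; rewrite !restrZ e1.
move=> z Vz' rz; rewrite (dbarform_mul sg sP Vz') !restrD !restrM !restrZ e1 //.
by rewrite e2.
Qed.

Lemma smooth_dbar_eq A W q u v v' : open W -> A `<=` W -> of_degree q.+1 v' -> eq_on n f W v v' ->
  smooth_dbar n f A q u v -> smooth_dbar n f A q u v'.
Proof.
move=> oW AW dv' e [du dv hl]; split => // z0 Az; have [V [Phi [[oV Vz] dP sP e1 e2]]] := hl _ Az.
exists (V `&` W), Phi; split => //.
- by split; [exact: openI|split=> //; exact: AW].
- move=> S; apply/smooth_onP => k; have /smooth_onP hS := sP S.
  by apply: CK_sub (hS k) => x [].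
- by move=> z [Vz' Wz] rz; exact: e1.
- by move=> z [Vz' Wz] rz; rewrite -e // e2.
Qed.

Lemma smooth_dbar_sub A A' q u v : A `<=` A' -> smooth_dbar n f A' q u v -> smooth_dbar n f A q u v.
Proof. by move=> AA [du dv hl]; split => // z0 /AA; exact: hl. Qed.

(** A form that is zero near the origin is there the restriction of the ambient form 0. This gives
    the smoothness at the singular point that the Koppelman formula asks for. *)
Lemma smooth_dbar_vanish A (r : R) q u v : 0 < r -> (forall z, nm z < r -> u z = 0 /\ v z = 0) ->
  smooth_dbar n f A q u v -> smooth_dbar n f (A `|` [set 0]) q u v.
Proof.
move=> r0 z0 [du dv hl]; split => // z [Az|/= ->]; first exact: hl.
exists [set x | nm (x - 0) < r], (fun=> 0); split.
- by split; [exact: open_nm_ball|rewrite /= subrr nm0].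
- by move=> x S _; rewrite ext0E.
- move=> S; apply/smooth_onP => k.
  apply: (@CK_eq _ _ _ _ (fun=> 0)); [exact: open_nm_ball|by move=> y _; rewrite ext0E|].
  by apply: CK_cst; exact: open_nm_ball.
- by move=> x /=; rewrite subr0 => /z0[-> _].
move=> x /=; rewrite subr0 => /z0[_ ->] rx; congr (restr n f x _).
rewrite /dbarform big1 // => j _; rewrite wedgeE (_ : [ffun _ => _] = 0) ?mulr0 //.
apply/ffunP => S; rewrite !ffunE; apply: (@wirtbar_const _ _ _ _ _ setT 0) => //; exact: openT.
Qed.

End FormSpaces.

(** * The L^p estimates for the given kernel *)

Section KoppelmanEstimates.
Context {R : realType} (n nu : nat).
Local Notation C := R[i].
Local Notation N := (n + nu)%N.
Local Notation point := 'rV[C]_N.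
Local Notation formX := (@formX R N).
Local Notation kgen := (kgen N).
Variables (f : 'I_nu -> mpoly N C) (d : 'I_nu -> nat).
Variable h : 'I_nu -> 'I_N -> mpoly (N + N) C.
Variables (Om Om' : set point) (chi : point -> R) (s : 'I_N -> 'rV[C]_(N + N) -> C) (eps : bool).
Hypothesis n_gt0 : (0 < n)%N.
Hypothesis f_ci : smooth_complete_intersection f d.
Hypothesis h_hefer : is_hefer f d h.
Variable mu : {measure set (Borel R N) -> \bar R}.
Hypothesis mu_vol : is_volume n f mu.
Hypothesis chi_cut : is_cutoff Om Om' chi.
Hypothesis s_weight : is_weight Om chi s.
Hypotheses (oOm : open Om) (oOm' : open Om') (cOm : compact (closure Om)) (OmOm' : closure Om `<=` Om').
Variables (T p : R).
Hypotheses (T0 : 0 <= T) (Om'T : forall x, Om' x -> nm x <= T).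
Hypotheses (deg_lt : (mdegree d < (2 * n).-1)%N)
  (p_gt : (2 * n)%:R / ((2 * n)%:R - (mdegree d)%:R) < p) (p_le : p <= (2 * n)%:R).

Local Notation K := (Kop n f mu Om' eps h chi s).
Local Notation gI := (gint f mu p).

(** With the convention that dividing by 0 gives 0, the Bochner-Martinelli coefficients vanish on
    the diagonal, so the kernel bound needs no exception there. *)
Lemma Kg_diag U V z : Kg f h chi s eps U V z z = 0.
Proof.
have e0 : bmg (row_mx z z) = 0 :> @ext R kgen.
  rewrite /bmg /gsum; apply: big1 => k _.
  rewrite (_ : eform _ = 0) ?mul0r // /eform; apply: big1 => j _.
  have -> : bmc j (row_mx z z) = 0; last by rewrite scale0r.
  rewrite /bmc row_mxKl row_mxKr subrr; set e := _ 0 j; have -> : e = 0 by rewrite /e mxE.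
  by rewrite (rmorph0 (conjc : {rmorphism C -> C})) mul0r mulr0.
have e1 k : eta_part k (0 : @ext R kgen) = 0.
  by apply/ffunP => S; rewrite ffunE ext0E; case: ifP.
have e2 : strip_eta (0 : @ext R kgen) = 0.
  by apply/ffunP => S; rewrite ffunE ext0E mulr0 ext0E; case: ifP.
by rewrite /Kg e0 mulr0 e1 mulr0 e2 mulr0 scaler0.
Qed.

(** Collects what the homotopy argument uses: continuity, measurability, and boundedness near 0 of K
    u for u vanishing there. The size of the kernel enters through [Kg_bound] and the exponents
    through [kernel_split]. *)
Theorem Kop_estimates : 1 < p /\ exists2 B : R, 0 <= B & forall u v : formX,
  has_rep f Om' u -> has_rep f Om' v -> (gI Om' u < +oo)%E -> (gI Om' v < +oo)%E ->
  [/\ (gI Om (fun z => (K u z - K v z)%R) <= B%:E * gI Om' (fun z => (u z - v z)%R))%E,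
      has_rep f Om (K u) &
      forall r, 0 < r -> (forall x, Om' x -> regcone f x -> nm x < r -> gauge f x (u x) = 0) ->
        exists2 M : R, 0 <= M & forall z, Om z -> regcone f z -> nm z < r / 2 -> gauge f z (K u z) <= M].
Proof.
have [p1 [al [be [B [al0 alp be0 bep [B0 hB]]]]]] := kernel_split n_gt0 deg_lt p_gt p_le.
split=> //; have [U [V [[oU sU] [oV sV] ss _ _]]] := s_weight.
have [Bg Bg0 hBg] := Kg_bound eps n_gt0 f_ci h_hefer chi_cut cOm sU sV ss T0.
pose Kk := Kg f h chi s eps U V; pose Kr := Kker n f eps h chi s.
have Kk_meas : emeas (fun q : Borel R N * Borel R N => Kk q.1 q.2).
  exact: (Kg_meas f h eps chi_cut oU oV ss).
have KrE zeta z : Om z -> zeta != z -> Kr zeta z = Kk zeta z.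
  by move=> Oz zz; apply: KgE => //; apply: sV; exact: subset_closure.
have OmT x : Om x -> nm x <= T by move=> Ox; apply: Om'T; apply: OmOm'; exact: subset_closure.
have Bk0 : 0 <= Bg * B by exact: mulr_ge0.
have Kk_bound zeta z : domX f Om' zeta -> domX f Om z -> zeta != 0 -> en (Kk zeta z) <= Bg * B * kb (n := n) al be zeta z.
  move=> [Dx rx] [Ez rz] z0; have [->|zz] := eqVneq zeta z.
    by rewrite /Kk Kg_diag en0; apply: mulr_ge0; [exact: Bk0|exact: kb_ge0].
  apply: le_trans (hBg zeta z rx.1 z0 zz (@subset_closure _ Om _ Ez) (Om'T Dx) (OmT _ Ez)) _.
  rewrite -[leRHS]mulrA; apply: ler_wpM2l; first exact: Bg0.
  rewrite /kb; apply: hB; rewrite ?nm_gt0 ?nm_ge0 ?subr_eq0 //.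
  by rewrite nmBC; exact: ler_nmB.
have Kk_away r : 0 < r -> exists2 B : R, 0 <= B & forall zeta z,
    domX f Om' zeta -> domX f Om z -> r <= nm zeta -> nm z < r / 2 -> en (Kk zeta z) <= B.
  move=> r0; exists (Bg * ((T + T) ^+ mdegree d / r ^+ mdegree d / (r / 2) ^+ (2 * n).-1)).
    by rewrite mulr_ge0 // !divr_ge0 ?exprn_ge0 ?addr_ge0 ?divr_ge0 ?(ltW r0).
  move=> zeta z [Dx rx] [Ez rz] h1 h2.
  have z0 : zeta != 0 by rewrite -nm_gt0 (lt_le_trans r0).
  have h3 : r / 2 <= nm (zeta - z).
    by rewrite (le_trans _ (ler_nmB zeta z)) // lerBrDr (le_trans _ h1) // [leRHS]splitr lerD2l ltW.
  have zz : zeta != z by rewrite -subr_eq0 -nm_gt0 (lt_le_trans _ h3) // divr_gt0.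
  apply: le_trans (hBg zeta z rx.1 z0 zz (@subset_closure _ Om _ Ez) (Om'T Dx) (OmT _ Ez)) _.
  have nz := nm_ge0 zeta; have nz' := nm_ge0 z.
  apply: ler_wpM2l; first exact: Bg0.
  have r2 : 0 < r / 2 by exact: divr_gt0.
  apply: ler_pM.
  - by rewrite divr_ge0 ?exprn_ge0 ?addr_ge0.
  - by rewrite invr_ge0 exprn_ge0 ?nm_ge0.
  - apply: ler_pM; first by rewrite exprn_ge0 ?addr_ge0.
    + by rewrite invr_ge0 exprn_ge0.
    + apply: lerXn2r; rewrite ?nnegrE ?addr_ge0 //; apply: lerD; [exact: Om'T|exact: OmT].
    + rewrite lef_pV2 ?posrE ?exprn_gt0 ?nm_gt0 //; apply: lerXn2r; rewrite ?nnegrE ?(ltW r0) //.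
  - rewrite lef_pV2 ?posrE ?exprn_gt0 ?nm_gt0 ?subr_eq0 //; apply: lerXn2r; rewrite ?nnegrE ?(ltW r2) ?nm_ge0 //.
have [A A0 hA] := KO_bound f_ci h_hefer mu_vol n_gt0 oOm oOm' T0 OmT Om'T p1 al0 alp be0 bep Kk_meas KrE Bk0 Kk_bound.
exists A => // u v hu hv iu iv.
have pu := has_rep_proj oOm' hu; have pv := has_rep_proj oOm' hv.
split.
- exact: (hA u v pu pv iu iv).
- have [Psi [mPsi e]] := KO_rep f_ci h_hefer mu_vol n_gt0 oOm' Kk_meas KrE pu.
  by exists Psi; split=> // z Oz _; rewrite -(e _ Oz).
move=> r r0 ur.
have [M M0 hM] := KO_bounded f_ci h_hefer mu_vol n_gt0 oOm' T0 Om'T p1 Kk_meas KrE Kk_away r0 pu iu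
  (fun x Dx => ur x Dx.1 Dx.2).
by exists M => // z Oz rz; exact: hM (conj Oz rz).
Qed.

End KoppelmanEstimates.

Section Approximation.
Context {R : realType} (n nu : nat).
Local Notation C := R[i].
Local Notation N := (n + nu)%N.
Local Notation point := 'rV[C]_N.
Local Notation formX := (@formX R N).
Variables (f : 'I_nu -> mpoly N C).
Variable mu : {measure set (Borel R N) -> \bar R}.
Implicit Types (W : set point) (u v w : formX) (g : point -> R).
Variable p : R.
Hypothesis p0 : 0 < p.
Local Notation gI := (gint f mu p).

(** The graph closure behind [dbar_s] with a tolerance in place of sequences and with the gauge in
    place of [fnorm], so that only finitely many inequalities are handled at a time. *)
Definition approximable W q u v := forall e : R, 0 < e -> exists us vs : formX,
  [/\ smooth_dbar n f (regcone f `&` W) q us vs, ~ supp n f W us 0,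
      (gI W (fun z => (us z - u z)%R) <= e%:E)%E & (gI W (fun z => (vs z - v z)%R) <= e%:E)%E].

Section OnOpen.
Variable W : set point.
Hypothesis mD : measurable (domX f W).
Local Notation Fc := (@fcst R N n).

Let Fp0 : 0 < Fc `^ p. Proof. by rewrite powR_gt0 // fcst_gt0. Qed.

Lemma dbar_s_approximable q u v : dbar_s n f mu p W q u v -> approximable W q u v.
Proof.
move=> [/(LpP mu p0 mD)[_ ru _] /(LpP mu p0 mD)[_ rv _] [us [vs [hs cu cv]]]] e e0.
have ep : 0 < e / Fc `^ p by exact: divr_gt0.
have small (a : nat -> \bar R) : a @ \oo --> 0%E -> \forall j \near \oo, (a j < (e / Fc `^ p)%:E)%E.
  move=> ca; have H : nbhs (0%E : \bar R) [set y | (y < (e / Fc `^ p)%:E)%E].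
    by apply: open_nbhs_nbhs; split; [exact: open_ereal_lt_ereal|rewrite /= lte_fin].
  exact: (ca _ H).
have [j0 _ h0] := small _ cu; have [j1 _ h1] := small _ cv.
pose j := maxn j0 j1; have [sj _ nj] := hs j.
have [ruj rvj] := smooth_dbar_rep mD sj.
have conv (a b : formX) : has_rep f W a -> has_rep f W b ->
    (Lp_power n f mu p W (fun z => (a z - b z)%R) < (e / Fc `^ p)%:E)%E -> (gI W (fun z => (a z - b z)%R) <= e%:E)%E.
  move=> ha hb hl; apply: le_trans (gint_le_Lp_power mu p0 mD (has_repB ha hb)) _.
  have Fp0' : (0 <= (Fc `^ p)%:E :> \bar R)%E by rewrite lee_fin ltW.
  apply: le_trans (lee_wpmul2l Fp0' (ltW hl)) _.
  by rewrite -EFinM lee_fin mulrCA divff ?mulr1 // gt_eqF.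
exists (us j), (vs j); split; [exact: sj|exact: nj| |].
  by apply: conv => //; apply: (h0 j); exact: leq_maxl.
by apply: conv => //; apply: (h1 j); exact: leq_maxr.
Qed.

Lemma approximable_dbar_s q u v : Lp n f mu p W q u -> Lp n f mu p W q.+1 v -> approximable W q u v ->
  dbar_s n f mu p W q u v.
Proof.
move=> Lu Lv ha; have [du ru iu] := (LpP mu p0 mD _ _).1 Lu; have [dv rv iv] := (LpP mu p0 mD _ _).1 Lv.
have hj (j : nat) : 0 < j.+1%:R^-1 :> R by rewrite invr_gt0.
have /choice[us /choice[vs hs]] := fun j : nat => ha _ (hj j).
split; [exact: Lu|exact: Lv|exists us, vs].
have conv (a : nat -> formX) b : (forall j, has_rep f W (a j)) -> has_rep f W b ->
    (forall j, (gI W (fun z => (a j z - b z)%R) <= (j.+1%:R^-1)%:E)%E) ->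
    (fun j => Lp_power n f mu p W (fun z => a j z - b z)) @ \oo --> 0%E.
  move=> ra rb hab.
  apply: (@squeeze_cvge _ _ _ _ (fun=> 0%E) _ (fun j => (Fc `^ p * j.+1%:R^-1)%:E)).
  - apply: nearW => j; apply/andP; split.
      by apply: integral_ge0 => x _; rewrite lee_fin powR_ge0.
    have Fp0' : (0 <= (Fc `^ p)%:E :> \bar R)%E by rewrite lee_fin ltW.
    apply: le_trans (Lp_power_le_gint mu p0 mD (has_repB (ra j) rb)) _.
    by rewrite EFinM; exact: lee_wpmul2l Fp0' _ _ (hab j).
  - exact: cvg_cst.
  apply: cvg_EFin; first by apply: nearW.
  have hc : (fun j => Fc `^ p * (harmonic j : R)) @ \oo --> Fc `^ p * 0.
    by apply: cvgMr; exact: cvg_harmonic.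
  by rewrite mulr0 in hc.
have rs j := smooth_dbar_rep mD (let: And4 h _ _ _ := hs j in h).
split.
- move=> j; have [sj nj h1 h2] := hs j; split; [exact: sj| |exact: nj].
  apply/(LpP mu p0 mD); split; [by have [] := sj|exact: (rs j).1|].
  apply: (gint_close p0 mD (rs j).1 ru _ iu); exact: le_lt_trans h1 (ltry _).
- exact: (conv us u (fun j => (rs j).1) ru (fun j => let: And4 _ _ h _ := hs j in h)).
- exact: (conv vs v (fun j => (rs j).2) rv (fun j => let: And4 _ _ _ h := hs j in h)).
Qed.

End OnOpen.

Lemma smooth_cmeas g : smooth_on setT (fun z => (g z)%:C) -> cmeas (fun z : Borel R N => (g z)%:C).
Proof. by move=> /smooth_onP sg; apply: cts_cmeas => y; exact: CK_cts (sg 0%N) _. Qed.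

Lemma smooth_dmu_meas g : smooth_on setT (fun z => (g z)%:C) -> emeas (dmu g : Borel R N -> _).
Proof.
move=> /smooth_onP sg; apply: emeas_sum => j _; apply: emeasZ; last exact: emeas_cst.
by apply: cts_cmeas => y; exact: cts_wirtbar (sg 1%N) _.
Qed.

Section Cutoff.
Hypothesis null0 : mu [set (0 : point)] = 0%E.
Variables (m : nat -> point -> R) (B : R).
Hypothesis m_smooth : forall k, smooth_on setT (fun z => (m k z)%:C).
Hypotheses (B0 : 0 <= B) (mB : forall k z, `|m k z| <= B).
Hypothesis m_one : forall del : R, 0 < del -> exists k0, forall k z, (k0 <= k)%N -> del <= nm z -> m k z = 1.

Lemma dmu_zero (del : R) k x : (forall z, del <= nm z -> m k z = 1) -> del < nm x -> dmu (m k) x = 0.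
Proof.
move=> h1 hx; rewrite /dmu big1 // => j _.
rewrite (@wirtbar_const _ _ j _ x [set y | del < nm y] 1) ?scale0r //.
  apply/open_nmP => y /= hy; exists (nm y - del); first by rewrite subr_gt0.
  move=> z hz; have := ler_nmB y z; rewrite nmBC => h2.
  by rewrite -subr_gt0; move: (lt_le_trans hz (lexx _)); lra.
by move=> y /= hy; rewrite h1 // ltW.
Qed.

(** Dominated convergence: off the origin, which is a null set, m_k is eventually 1, and a multiple
    of w dominates. *)
Lemma cutoff_tail W w : measurable (domX f W) -> has_rep f W w -> (gI W w < +oo)%E ->
  forall e : R, 0 < e -> exists k0, forall k, (k0 <= k)%N ->
    (gI W (fun z => (m k z - 1)%:C *: w z)%R <= e%:E)%E.
Proof.
move=> mD rw iw e e0.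
have mm k : cmeas (fun z : Borel R N => (m k z - 1)%:C).
  apply: (cmeas_eq (f := fun z : Borel R N => (m k z)%:C - 1)); first by move=> z; rewrite rmorphB rmorph1.
  by apply: cmeasB; [exact: smooth_cmeas|exact: cmeas_cst].
have rk k : has_rep f W (fun z => (m k z - 1)%:C *: w z) by exact: (has_repZ (g := fun z => m k z - 1)).
pose F k (x : Borel R N) := (gauge f x ((m k x - 1)%:C *: w x) `^ p)%:E.
pose G (x : Borel R N) := (((B + 1) `^ p)%:E * (gauge f x (w x) `^ p)%:E)%E.
have mF k : measurable_fun (domX f W) (F k) by exact: gauge_pow_meas.
have mG0 := gauge_pow_meas p rw.
have G00 x : domX f W x -> (0 <= (gauge f x (w x) `^ p)%:E)%E by move=> _; rewrite lee_fin powR_ge0.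
have b0 : (0 <= ((B + 1) `^ p)%:E :> \bar R)%E by rewrite lee_fin powR_ge0.
have iG : mu.-integrable (domX f W) G.
  apply/integrableP; split; first exact: measurable_funeM.
  under eq_integral do rewrite gee0_abs ?mule_ge0 ?lee_fin ?powR_ge0 //.
  by rewrite (ge0_integralZl mu mD mG0 G00 b0); exact: lte_mul_pinfty b0 isT iw.
have cF : {ae mu, forall x, domX f W x -> (fun k => F k x) @ \oo --> (0%E : \bar R)}.
  exists [set (0 : point)]; split; [by apply: borel_closed; exact: closed_nm1|exact: null0|].
  move=> x /= nx; apply: contrapT => /eqP x0; apply: nx => Dx.
  have nx0 : 0 < nm x by rewrite nm_gt0.
  have [k0 hk] := m_one nx0.
  apply: cvg_near_cst; exists k0 => // k /= kk.
  by rewrite /F hk // subrr scale0r gauge0 powR0 // gt_eqF.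
have bF : {ae mu, forall x k, domX f W x -> (`|F k x| <= G x)%E}.
  apply: aeW => x k _; rewrite gee0_abs; last by rewrite lee_fin powR_ge0.
  have -> : G x = ((B + 1) `^ p * gauge f x (w x) `^ p)%:E by [].
  rewrite lee_fin.
  rewrite -powRM ?gauge_ge0 ?addr_ge0 //; apply: (pow_mono p0); first exact: gauge_ge0.
  rewrite gaugeZ cn_real; apply: ler_wpM2r; first exact: gauge_ge0.
  by rewrite (le_trans (ler_normB _ _)) // normr1 lerD2r.
have [_ _ cI] := dominated_convergence mD mF (measurable_cst 0%E) cF iG bF.
move: cI; rewrite integral0 => cI.
have [k0 _ hk] : \forall k \near \oo, ((fun k => \int[mu]_(x in domX f W) F k x) k < e%:E)%E.
  have H : nbhs (0%E : \bar R) [set y | (y < e%:E)%E].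
    by apply: open_nbhs_nbhs; split; [exact: open_ereal_lt_ereal|rewrite /= lte_fin].
  exact: (cI _ H).
by exists k0 => k /hk /ltW.
Qed.

Hypothesis m_zero : forall k, exists2 r : R, 0 < r & forall z, nm z < r -> m k z = 0.

Lemma cutoff_supp W k u : ~ supp n f W (fun z => (m k z)%:C *: u z) 0.
Proof.
move=> [_ /closure_nmP hc]; have [r r0 hr] := m_zero k; have [y [_ _ hy]] := hc r r0.
by rewrite subr0 => /hr e; apply: hy; rewrite e scale0r restr0.
Qed.

Lemma not_supp_zero W u : ~ supp n f W u 0 -> cone f 0 -> W 0 ->
  exists2 r : R, 0 < r & forall x, W x -> regcone f x -> nm x < r -> restr n f x (u x) = 0.
Proof.
move=> ns c0 W0; apply: contrapT => hn; apply: ns; split=> //; apply/closure_nmP => r r0.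
apply: contrapT => hy; apply: hn; exists r => // x Wx rx hx; apply: contrapT => hne.
by apply: hy; exists x; rewrite ?subr0.
Qed.

End Cutoff.
End Approximation.

(** * Passage to the limit in the Koppelman formula *)

Section Homotopy.
Context {R : realType} (n nu : nat).
Local Notation C := R[i].
Local Notation N := (n + nu)%N.
Local Notation point := 'rV[C]_N.
Local Notation formX := (@formX R N).
Local Notation kgen := (kgen N).
Variables (f : 'I_nu -> mpoly N C) (d : 'I_nu -> nat).
Variable h : 'I_nu -> 'I_N -> mpoly (N + N) C.
Variables (Om Om' : set point) (chi : point -> R) (s : 'I_N -> 'rV[C]_(N + N) -> C) (eps : bool).
Hypothesis n_gt0 : (0 < n)%N.
Hypothesis f_ci : smooth_complete_intersection f d.
Hypothesis h_hefer : is_hefer f d h.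
Variable mu : {measure set (Borel R N) -> \bar R}.
Hypothesis mu_vol : is_volume n f mu.
Hypothesis chi_cut : is_cutoff Om Om' chi.
Hypothesis s_weight : is_weight Om chi s.
Hypotheses (oOm : open Om) (oOm' : open Om') (cOm : compact (closure Om)) (OmOm' : closure Om `<=` Om').
Variables (T p : R).
Hypotheses (T0 : 0 <= T) (Om'T : forall x, Om' x -> nm x <= T).
Hypotheses (deg_lt : (mdegree d < (2 * n).-1)%N)
  (p_gt : (2 * n)%:R / ((2 * n)%:R - (mdegree d)%:R) < p) (p_le : p <= (2 * n)%:R).

Local Notation K := (Kop n f mu Om' eps h chi s).
Local Notation gI := (gint f mu p).

Lemma Kop0 z : K (fun=> 0) z = 0.
Proof.
apply/ffunP => L; rewrite ffunE /= ext0E /cintegral /Rintegral.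
have e (zeta : point) : density n f zeta L (wedge (Kker n f eps h chi s zeta z) (in_zetab 0)) = 0.
  by rewrite wedgeE in_zetabE (subst0 _) mulr0 density0.
rewrite !integral0_eq //= => x _; rewrite e //.
Qed.

Lemma cone0 : cone f 0.
Proof.
move=> i; have [/(_ i)[di hd] _] := f_ci.
by have := homog_scale 0 0 hd; rewrite scale0r expr0n gtn_eqF // mul0r.
Qed.

Lemma cone_regcone z : cone f z -> z != 0 -> regcone f z.
Proof. by move=> cz z0; split=> //; have [_] := f_ci; apply. Qed.

Variables (q : nat) (phi dphi : formX).
Hypothesis koppelman : koppelman_smooth n f Om Om' K.
Hypothesis q_range : (1 <= q <= n)%N.
Hypothesis phi_dom : dbar_s n f mu p Om' q phi dphi.

Let p1 : 1 < p.
Proof. by have [] := Kop_estimates eps n_gt0 f_ci h_hefer mu_vol chi_cut s_weight oOm oOm' cOm OmOm' T0 Om'T deg_lt p_gt p_le. Qed.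

Let p0 : 0 < p. Proof. exact: lt_trans ltr01 p1. Qed.
Let mD : measurable (domX f Om'). Proof. exact: (domX_meas f oOm'). Qed.
Let mE : measurable (domX f Om). Proof. exact: (domX_meas f oOm). Qed.
Let OmS : Om `<=` Om'. Proof. by move=> x Ox; apply: OmOm'; exact: subset_closure. Qed.
Let null0 : mu [set (0 : point)] = 0%E. Proof. exact: (point_null f_ci h_hefer mu_vol n_gt0). Qed.
Let c2 : R := 2 `^ p.
Let c2_ge1 : 1 <= c2. Proof. have e : (1 : R) `^ p = 1 by rewrite powR1.
by rewrite /c2 -[leLHS]e; apply: (pow_mono p0); rewrite ?ler01 ?ler1n. Qed.
Let c20 : 0 < c2. Proof. exact: lt_le_trans ltr01 c2_ge1. Qed.

Let LpPhi : [/\ of_degree q phi, has_rep f Om' phi & (gI Om' phi < +oo)%E].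
Proof. by have [/(LpP mu p0 mD)] := phi_dom. Qed.
Let LpDphi : [/\ of_degree q.+1 dphi, has_rep f Om' dphi & (gI Om' dphi < +oo)%E].
Proof. by have [_ /(LpP mu p0 mD)] := phi_dom. Qed.

(** The approximating forms are smooth on the whole cone, vertex included, so that the Koppelman
    formula applies to them. Near 0 the ambient form itself has to vanish, whereas the support
    condition of [dbar_s] speaks only of restrictions to X. *)
Definition regularizable := forall e : R, 0 < e -> exists u v : formX,
  [/\ smooth_dbar n f (cone f `&` Om') q u v, has_rep f Om' u, has_rep f Om' v &
   [/\ (gI Om' (fun z => (u z - phi z)%R) <= e%:E)%E, (gI Om' (fun z => (v z - dphi z)%R) <= e%:E)%E &
    Om' 0 -> exists2 r : R, 0 < r & forall x, nm x < r -> u x = 0]].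

(** If 0 is not in Omega', the cone is regular there and nothing has to be changed. Otherwise a
    cut-off replaces a form whose restriction vanishes near 0 by one that vanishes identically near
    0; on X this does not alter the form, and dbar is corrected by a term that is small by
    [cutoff_tail]. *)
Lemma regularize (c0 : point) : Om c0 -> regularizable.
Proof.
move=> Oc e e0; have ha := dbar_s_approximable p0 mD phi_dom.
have [_ rphi _] := LpPhi; have [_ rd id] := LpDphi.
have [Oz0|nOz0] := pselect (Om' 0); last first.
  have [u [v [sd ns h1 h2]]] := ha e e0; have [ru rv] := smooth_dbar_rep mD sd.
  exists u, v; split; [|exact: ru|exact: rv|by split].
  apply: smooth_dbar_sub sd => z [cz Oz]; split; last exact: Oz.
  by apply: cone_regcone => //; apply/eqP => z0; apply: nOz0; rewrite -z0.
have [B [m [B0 [ms mB] mz m1 _]]] := log_cutoffs f_ci h_hefer mu_vol n_gt0 chi_cut Om'T Oc p1 p_le (borel_open oOm).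
(* Fits the splitting of m vs - dphi into m (vs - dphi), bounded by B^p e2, and (m - 1) dphi,
   bounded by e2, with c2 = 2^p for the sum. *)
pose e2 := e / (c2 * (B `^ p + 1)).
have D0 : 0 < c2 * (B `^ p + 1) by rewrite mulr_gt0 // ltr_wpDl ?powR_ge0.
have D1 : 1 <= c2 * (B `^ p + 1).
  by apply: mulr_ege1; [exact: c2_ge1|rewrite lerDr powR_ge0].
have e20 : 0 < e2 by exact: divr_gt0.
have e2e : e2 <= e by rewrite ler_pdivrMr // ler_peMr // ltW.
have [us [vs [sd ns h1 h2]]] := ha e2 e20; have [ru rv] := smooth_dbar_rep mD sd.
have [r r0 hr] := not_supp_zero ns cone0 Oz0.
have r20 : 0 < r / 2 by exact: divr_gt0.
(* The gradient of the cut-off vanishes for |z| > r/2, and [us] restricts to 0 for |z| < r. These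
   ranges overlap, so on X the gradient term of the product rule is 0. *)
have [k1 hk1] := m1 _ r20.
have [k2 hk2] := cutoff_tail p0 null0 ms B0 mB m1 mD rd id e20.
pose k := maxn k1 k2; have g1 z : r / 2 <= nm z -> m k z = 1 by apply: hk1; exact: leq_maxl.
have rlt x : ~ nm x < r -> r / 2 < nm x.
  by move=> /negP; rewrite -leNgt; apply: lt_le_trans; rewrite ltr_pdivrMr // ltr_pMr // ltr1n.
have [r' r'0 hr'] := mz k.
have mm := smooth_cmeas (ms k).
have rku := has_repZ mm ru; have rkv := has_repZ mm rv.
exists (fun z => (m k z)%:C *: us z), (fun z => (m k z)%:C *: vs z).
have dm x : ~ nm x < r -> dmu (m k) x = 0 by move=> /rlt; exact: (dmu_zero (m := m) (k := k) g1).
split; [|exact: rku|exact: rkv|split].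
- have s1 := smooth_dbar_mul (ms k) sd.
  have s2 : smooth_dbar n f (regcone f `&` Om') q (fun z => (m k z)%:C *: us z) (fun z => (m k z)%:C *: vs z).
    apply: (smooth_dbar_eq oOm' _ _ _ s1) => [x []//|z|z Oz rz].
      by apply: hdegZ; have [_ dv _] := sd; exact: dv.
    rewrite restrD restrM; have [hz|hz] := pselect (nm z < r).
      by rewrite (hr _ Oz rz hz) mulr0 add0r.
    by rewrite dm // restr0 mul0r add0r.
  have s3 : smooth_dbar n f ((regcone f `&` Om') `|` [set 0]) q (fun z => (m k z)%:C *: us z) (fun z => (m k z)%:C *: vs z).
    by apply: (smooth_dbar_vanish r'0 _ s2) => z hz; rewrite hr' // !scale0r.
  apply: smooth_dbar_sub s3 => z [cz Oz]; have [->|z0] := eqVneq z 0; first by right.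
  by left; split; [exact: cone_regcone|exact: Oz].
- have -> : gI Om' (fun z => ((m k z)%:C *: us z - phi z)%R) = gI Om' (fun z => (us z - phi z)%R); last first.
    by apply: le_trans h1 _; rewrite lee_fin.
  apply: (gint_eq mu p) => z Oz rz; rewrite !restrB restrZ; congr (_ - _).
  have [hz|hz] := pselect (nm z < r); first by rewrite (hr _ Oz rz hz) scaler0.
  by rewrite g1 ?scale1r // ltW // rlt.
- have rvd := has_repB rv rd.
  have ra := has_repZ mm rvd.
  have rb : has_rep f Om' (fun z => (m k z - 1)%:C *: dphi z).
    apply: (has_repZ (g := fun z => m k z - 1) _ rd).
    apply: (cmeas_eq (f := fun z : Borel R N => (m k z)%:C - 1)); first by move=> z; rewrite rmorphB rmorph1.
    by apply: cmeasB; [exact: mm|exact: cmeas_cst].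
  have -> : gI Om' (fun z => ((m k z)%:C *: vs z - dphi z)%R) =
      gI Om' (fun z => ((m k z)%:C *: (vs z - dphi z) + (m k z - 1)%:C *: dphi z)%R).
    congr (gI Om' _); apply/funext => z.
    by rewrite scalerBr rmorphB rmorph1 scalerBl scale1r addrA subrK.
  apply: le_trans (gintD mu p0 mD ra rb) _.
  have t1 : (gI Om' (fun z => ((m k z)%:C *: (vs z - dphi z))%R) <= (B `^ p * e2)%:E)%E.
    apply: le_trans (gint_le mu p0 mD (c := B) B0 rvd _) _.
      move=> x _ _; rewrite gaugeZ cn_real; apply: ler_wpM2r; [exact: gauge_ge0|exact: mB].
    by rewrite EFinM; apply: lee_wpmul2l; [rewrite lee_fin powR_ge0|exact: h2].
  have t2 := hk2 k (leq_maxr _ _).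
  have c2p : (0 <= c2%:E :> \bar R)%E by rewrite lee_fin ltW.
  apply: le_trans (lee_wpmul2l c2p (leeD t1 t2)) _.
  rewrite -EFinD -EFinM lee_fin le_eqVlt; apply/orP; left; apply/eqP.
  have -> : B `^ p * e2 + e2 = (B `^ p + 1) * e2 by rewrite mulrDl mul1r.
  by rewrite mulrA /e2 mulrC divfK // gt_eqF.
move=> _; exists r' => // x hx; by rewrite hr' // scale0r.
Qed.

Local Notation dK := (fun z => phi z - K dphi z).

Let Kest : exists2 B : R, 0 <= B & forall u v : formX,
  has_rep f Om' u -> has_rep f Om' v -> (gI Om' u < +oo)%E -> (gI Om' v < +oo)%E ->
  [/\ (gI Om (fun z => (K u z - K v z)%R) <= B%:E * gI Om' (fun z => (u z - v z)%R))%E,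
      has_rep f Om (K u) &
      forall r, 0 < r -> (forall x, Om' x -> regcone f x -> nm x < r -> gauge f x (u x) = 0) ->
        exists2 M : R, 0 <= M & forall z, Om z -> regcone f z -> nm z < r / 2 -> gauge f z (K u z) <= M].
Proof. by have [] := Kop_estimates eps n_gt0 f_ci h_hefer mu_vol chi_cut s_weight oOm oOm' cOm OmOm' T0 Om'T deg_lt p_gt p_le. Qed.

(** The estimate for differences with second form 0, as K 0 = 0. *)
Lemma Lp_Kop k u : (0 < k)%N -> Lp n f mu p Om' k u -> Lp n f mu p Om k.-1 (K u).
Proof.
move=> k0 /(LpP mu p0 mD)[du ru iu]; apply/(LpP mu p0 mE).
have [B B0 hB] := Kest.
have r0 : has_rep f Om' (fun=> 0) by apply: has_rep_emeas; exact: emeas_cst.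
have i0 : gI Om' (fun=> 0) = 0%E by exact: (gint0 mu p0).
have i0' : (gI Om' (fun=> 0%R) < +oo)%E by rewrite i0 ltry.
have [h1 rK _] := hB u (fun=> 0) ru r0 iu i0'.
split; [exact: Kop_degree|exact: rK|].
have -> : gI Om (K u) = gI Om (fun z => (K u z - K (fun=> 0) z)%R).
  by apply: eq_integral => z _; rewrite Kop0 subr0.
apply: le_lt_trans h1 _; apply: lte_mul_pinfty; [by rewrite lee_fin|by []|].
have -> : gI Om' (fun z => (u z - 0)%R) = gI Om' u by apply: eq_integral => z _; rewrite subr0.
exact: iu.
Qed.

Lemma Lp_restrict : Lp n f mu p Om q phi.
Proof.
have [dp rp ip] := LpPhi; apply/(LpP mu p0 mE); split; [exact: dp|exact: (has_rep_sub OmS rp)|].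
apply: le_lt_trans ip; exact: (gint_sub mu p oOm oOm' OmS rp (regcone_meas f)).
Qed.

Lemma Lp_dK : Lp n f mu p Om q dK.
Proof.
have [_ /Lp_Kop -/(_ isT) L2 _] := phi_dom.
have /(LpP mu p0 mE)[d1 r1 i1] := Lp_restrict; have /(LpP mu p0 mE)[d2 r2 i2] := L2.
apply/(LpP mu p0 mE); split.
- by move=> z; apply: hdegD; [exact: d1|apply: hdegN; exact: d2].
- exact: has_repB.
have c2p : (0 <= (2 `^ p)%:E :> \bar R)%E by rewrite lee_fin powR_ge0.
exact: (le_lt_trans (gintB mu p0 mE r1 r2) (lte_mul_pinfty c2p isT (lte_add_pinfty i1 i2))).
Qed.

(** K u for the regularized u is smooth on the regular part but need not vanish near 0. It is
    multiplied by a logarithmic cut-off; the gradient term is small in L^p because K u is bounded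
    near 0, and the other errors are tails of fixed L^p forms. *)
Lemma Kop_approximable (c0 : point) : Om c0 -> approximable f mu p Om q.-1 (K phi) dK.
Proof.
move=> Oc e e0; have [B B0 hB] := Kest.
have [dp rp ip] := LpPhi; have [dd rd id] := LpDphi.
(* The final triangle inequality adds 2 c2 e1, from the gradient and the tail, and c2 (1 + B) e1,
   from u - phi and K v - K dphi, and multiplies the sum by c2. *)
pose D := c2 * c2 * (3 + B).
have B3 : 0 < 3 + B by rewrite ltr_wpDr.
have D0 : 0 < D by rewrite !mulr_gt0.
pose e1 := e / D; have e10 : 0 < e1 by exact: divr_gt0.
have De : D * e1 = e by rewrite mulrC divfK // gt_eqF.
have [u [v [sd ru rv [h1 h2 h3]]]] := regularize Oc e10.
have iu : (gI Om' u < +oo)%E := gint_close p0 mD ru rp (le_lt_trans h1 (ltry _)) ip.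
have iv : (gI Om' v < +oo)%E := gint_close p0 mD rv rd (le_lt_trans h2 (ltry _)) id.
have [g1 rKu bKu] := hB u phi ru rp iu ip.
have [g2 rKv _] := hB v dphi rv rd iv id.
have [_ rKp _] := hB phi phi rp rp ip ip.
have [_ rKd _] := hB dphi dphi rd rd id id.
have Bp : (0 <= B%:E :> \bar R)%E by rewrite lee_fin.
have k1 : (gI Om (fun z => (K u z - K phi z)%R) <= (B * e1)%:E)%E.
  exact: (le_trans g1 (lee_wpmul2l Bp h1)).
have k2 : (gI Om (fun z => (K v z - K dphi z)%R) <= (B * e1)%:E)%E.
  exact: (le_trans g2 (lee_wpmul2l Bp h2)).
(* By the Koppelman formula for u this is dbar of K u on the regular part of X over Omega. *)
pose w z := u z - K v z.
have rw : has_rep f Om w by apply: has_repB => //; exact: (has_rep_sub OmS ru).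
have rdK : has_rep f Om dK by apply: has_repB => //; exact: (has_rep_sub OmS rp).
have k3 : (gI Om (fun z => (w z - dK z)%R) <= (c2 * (e1 + B * e1))%:E)%E.
  have ra : has_rep f Om (fun z => u z - phi z) by apply: has_rep_sub OmS _; exact: has_repB.
  have -> : gI Om (fun z => (w z - dK z)%R) = gI Om (fun z => ((u z - phi z) - (K v z - K dphi z))%R).
    congr (gI Om _); apply/funext => z; rewrite /w.
    move: (u z) (K v z) (phi z) (K dphi z) => a b a' b'.
    by rewrite !opprD !opprK addrACA.
  apply: le_trans (gintB mu p0 mE ra (has_repB rKv rKd)) _.
  rewrite EFinM EFinD; apply: lee_wpmul2l; first by rewrite lee_fin ltW.
  apply: leeD; last exact: k2.
  exact: le_trans (gint_sub mu p oOm oOm' OmS (has_repB ru rp) (regcone_meas f)) h1.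
have sK : smooth_dbar n f (regcone f `&` Om) q.-1 (K u) w by exact: (koppelman q_range sd).
have c2c2 : c2 <= c2 * c2 by rewrite ler_peMl // ltW.
have [Oz0|nOz0] := pselect (Om' 0); last first.
  exists (K u), w; split; [exact: sK| | |].
  - by move=> [[_ Oz] _]; apply: nOz0; exact: OmS.
  - apply: le_trans k1 _; rewrite lee_fin -De ler_wpM2r ?(ltW e10) // /D.
    rewrite -[leLHS]mul1r; apply: ler_pM => //; last by rewrite lerDr.
    exact: le_trans c2_ge1 c2c2.
  - apply: le_trans k3 _; rewrite lee_fin -De.
    have -> : e1 + B * e1 = (1 + B) * e1 by rewrite mulrDl mul1r.
    rewrite mulrA ler_wpM2r ?(ltW e10) // /D; apply: ler_pM => //.
    + exact: ltW.
    + by rewrite addr_ge0.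
    + by rewrite lerD2r ler1n.
have [r r0 u0] := h3 Oz0.
have [M M0 hM] : exists2 M : R, 0 <= M & forall z, Om z -> regcone f z -> nm z < r / 2 -> gauge f z (K u z) <= M.
  by apply: (bKu r r0) => x _ _ hx; rewrite u0 // gauge0.
have [A [m [A0 [ms mA] mz m1 mI]]] := log_cutoffs f_ci h_hefer mu_vol n_gt0 chi_cut Om'T Oc p1 p_le (borel_open oOm).
have iKu : (gI Om (K u) < +oo)%E.
  have /(LpP mu p0 mE)[_ _ iK] : Lp n f mu p Om q.-1 (K phi).
    by apply: Lp_Kop; [have /andP[] := q_range|have [] := phi_dom].
  exact: (gint_close p0 mE rKu rKp (le_lt_trans k1 (ltry _)) iK).
have iw : (gI Om w < +oo)%E.
  have /(LpP mu p0 mE)[_ _ iK] := Lp_dK.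
  exact: (gint_close p0 mE rw rdK (le_lt_trans k3 (ltry _)) iK).
(* Bounds the gauge of the gradient term by G times the size of the gradient: gcst^2 passes from the
   ambient norm to the gauge, M bounds K u, and 1 keeps G positive. *)
pose G := @gcst R N n ^+ 2 * M + 1.
have G0 : 0 < G by rewrite ltr_wpDl // mulr_ge0 // exprn_ge0 // gcst_ge0.
have Gp : 0 < G `^ p by exact: powR_gt0.
have [j1 hj1] := cutoff_tail p0 null0 ms A0 mA m1 mE rKu iKu e10.
have [j2 hj2] := cutoff_tail p0 null0 ms A0 mA m1 mE rw iw e10.
(* K u is bounded only for |z| < r/2. A cut-off equal to 1 from r/4 on has zero gradient for |z| >=
   r/2, including the boundary value. *)
have r40 : 0 < r / 4 by exact: divr_gt0.
have [j3 hj3] := m1 _ r40.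
have [j4 hj4] := mI _ (divr_gt0 e10 Gp).
pose k := maxn (maxn j1 j2) (maxn j3 j4).
have t1 := hj1 k (leq_trans (leq_maxl _ _) (leq_maxl _ _)).
have t2 := hj2 k (leq_trans (leq_maxr _ _) (leq_maxl _ _)).
have t3 z := hj3 k z (leq_trans (leq_maxl _ _) (leq_maxr _ _)).
have t4 := hj4 k (leq_trans (leq_maxr _ _) (leq_maxr _ _)).
have mm := smooth_cmeas (ms k); have md := smooth_dmu_meas (ms k).
have rm (x : formX) : has_rep f Om x -> has_rep f Om (fun z => (m k z - 1)%:C *: x z).
  move=> rx; apply: (has_repZ (g := fun z => m k z - 1) _ rx).
  apply: (cmeas_eq (f := fun z : Borel R N => (m k z)%:C - 1)); first by move=> z; rewrite rmorphB rmorph1.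
  by apply: cmeasB; [exact: mm|exact: cmeas_cst].
have rmu := has_repM md rKu.
have tmu : (gI Om (fun z => (dmu (m k) z * K u z)%R) <= e1%:E)%E.
  have mdp : measurable_fun (domX f Om) (fun z : Borel R N => (en (dmu (m k) z) `^ p)%:E).
    by apply/measurable_EFinP; apply: measurable_funTS; apply: meas_powR; exact: meas_en.
  have ndp z : domX f Om z -> (0 <= (en (dmu (m k) z) `^ p)%:E)%E by move=> _; rewrite lee_fin powR_ge0.
  have Gp' : (0 <= (G `^ p)%:E :> \bar R)%E by rewrite lee_fin ltW.
  apply: (@le_trans _ _ (\int[mu]_(z in domX f Om) ((G `^ p)%:E * (en (dmu (m k) z) `^ p)%:E))%E).
    apply: mono_integral => z [Oz rz]; rewrite -EFinM lee_fin -powRM ?en_ge0 ?(ltW G0) //.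
    apply: (pow_mono p0); first exact: gauge_ge0.
    have [hz|hz] := ltP (nm z) (r / 2).
      apply: le_trans (gaugeM f z (dmu (m k) z) (K u z)) _.
      apply: (@le_trans _ _ (@gcst R N n ^+ 2 * en (dmu (m k) z) * M)).
        apply: ler_pM; [exact: gauge_ge0|exact: gauge_ge0| |exact: hM].
        exact: gauge_le_en.
      by rewrite mulrAC ler_wpM2r ?en_ge0 // lerDl.
    rewrite (dmu_zero t3) ?mul0r ?gauge0 ?mulr_ge0 ?en_ge0 ?(ltW G0) //.
    apply: lt_le_trans hz; rewrite ltr_pM2l // ltf_pV2 ?posrE ?ltr0n //.
    by rewrite ltr_nat.
  rewrite (ge0_integralZl mu mE mdp ndp Gp').
  apply: le_trans (lee_wpmul2l Gp' t4) _.
  by rewrite -EFinM lee_fin mulrCA divff ?mulr1 // gt_eqF.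
exists (fun z => (m k z)%:C *: K u z), (fun z => dmu (m k) z * K u z + (m k z)%:C *: w z).
have sub1 (x : formX) z : (m k z)%:C *: x z - x z = (m k z - 1)%:C *: x z.
  by rewrite rmorphB rmorph1 scalerBl scale1r.
split.
- exact: (smooth_dbar_mul (ms k) sK).
- exact: (cutoff_supp mz).
- have t1' : (gI Om (fun z => ((m k z)%:C *: K u z - K u z)%R) <= e1%:E)%E.
    by apply: le_trans t1; rewrite /gint; under eq_integral do rewrite sub1.
  apply: le_trans (gint_triangle p0 mE (has_repZ mm rKu) rKu rKp t1' k1) _.
  rewrite lee_fin -De -/c2.
  have -> : e1 + B * e1 = (1 + B) * e1 by rewrite mulrDl mul1r.
  rewrite mulrA ler_wpM2r ?(ltW e10) // /D; apply: ler_pM => //.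
  + exact: ltW.
  + by rewrite addr_ge0.
  + by rewrite lerD2r ler1n.
- have t2' : (gI Om (fun z => ((dmu (m k) z * K u z + (m k z)%:C *: w z) - w z)%R) <= (c2 * (e1 + e1))%:E)%E.
    have -> : gI Om (fun z => ((dmu (m k) z * K u z + (m k z)%:C *: w z) - w z)%R) =
        gI Om (fun z => (dmu (m k) z * K u z + (m k z - 1)%:C *: w z)%R).
      by apply: eq_integral => z _; rewrite -addrA sub1.
    apply: le_trans (gintD mu p0 mE rmu (rm _ rw)) _.
    have c2p : (0 <= (2 `^ p)%:E :> \bar R)%E by rewrite lee_fin powR_ge0.
    exact: (lee_wpmul2l c2p (leeD tmu t2)).
  apply: le_trans (gint_triangle p0 mE (has_repD rmu (has_repZ mm rw)) rw rdK t2' k3) _.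
  rewrite lee_fin -De -/c2 le_eqVlt; apply/orP; left; apply/eqP.
  by rewrite /D; ring.
Qed.

Theorem dbar_s_Kop : dbar_s n f mu p Om q.-1 (K phi) dK.
Proof.
have /andP[q1 _] := q_range; have qS : q.-1.+1 = q by rewrite prednK.
have L1 : Lp n f mu p Om q.-1 (K phi) by apply: Lp_Kop; [exact: q1|have [] := phi_dom].
have L2 : Lp n f mu p Om q.-1.+1 dK by rewrite qS; exact: Lp_dK.
apply: (approximable_dbar_s p0 mE L1 L2).
(* The cut-offs are centred at a point of Omega; for an empty domain every norm is 0 and the zero
   form approximates. *)
have [[c0 Oc]|nO] := pselect (exists c, Om c); first exact: (Kop_approximable Oc).
move=> e e0; exists (fun=> 0), (fun=> 0).
have g0 (x : formX) : gI Om x = 0%E by apply: (gint0 mu p0) => z Oz; case: nO; exists z.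
split; last 2 first.
- by rewrite g0 lee_fin ltW.
- by rewrite g0 lee_fin ltW.
- by split=> [z S _|z S _|z [_ Oz]]; rewrite ?ext0E //; case: nO; exists z.
- by move=> [[_ Oz] _]; apply: nO; exists 0.
Qed.

(** Equality of distributions includes integrability of both pairings. The test form is bounded by
    compactness of its support, the form phi is estimated by 1 + |phi|^p, and the volume is
    finite. *)
Theorem pairing_integrable theta : test_form n Om q theta ->
  let pairing z := density n f z finset.set0 (wedge (in_zetab (phi z)) (theta z)) in
  mu.-integrable (domX f Om) (fun z => (complex.Re (pairing z))%:E) /\
  mu.-integrable (domX f Om) (fun z => (complex.Im (pairing z))%:E).
Proof.
move=> [st [Kc [cK KO0 tK]] _] pairing.
have [dp [Phi [ePhi mPhi]] ip] := LpPhi.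
have ct S z : ctsat (fun z => theta z S) z by have /smooth_onP hS := st S; exact: CK_cts (hS 0%N) _.
have mt : emeas (theta : Borel R N -> _) by move=> S; apply: cts_cmeas => y; exact: ct.
have [Bt Bt0 hBt] : exists2 Bt : R, 0 <= Bt & forall z, en (theta z) <= Bt.
  have /choice[b hb] : forall S : {set kgen}, exists b : R, 0 <= b /\ forall z, cn (theta z S) <= b.
    move=> S; have [b b0 hb] := compact_cts_bound cK (fun x _ => ct S x).
    exists b; split=> [|z]; first exact: ltW.
    have [Kz|nKz] := pselect (Kc z); first exact: hb.
    by rewrite tK // ext0E cn0 ltW.
  exists (\sum_S b S) => [|z]; first by apply: sumr_ge0 => S _; have [] := hb S.
  by apply: ler_sum => S _; have [_] := hb S.
have [c hc] := density_dtop (n := n) f erefl finset.set0.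
pose F (z : Borel R N) := c * dtop n f z finset.set0 (in_zetab (Phi z) * theta z).
have mF : cmeas F.
  apply: cmeasZ; apply: cmeas_dtop; first exact: measurable_id.
  by apply: emeasM => //; exact: emeas_in_zetab.
have PF z : domX f Om z -> pairing z = F z.
  move=> [Oz rz]; rewrite /pairing /F -hc // wedgeE.
  by apply: (density_restr_l (n := n)); exact: (ePhi z (OmS Oz) rz).
pose g (z : Borel R N) := en (pform f z (Phi z)).
have mg : measurable_fun setT g by apply: meas_en; exact: emeas_pform.
have gE z : domX f Om z -> gauge f z (phi z) = g z.
  by move=> [Oz rz]; rewrite (gauge_restr (n := n) erefl rz (ePhi _ (OmS Oz) rz)).
pose cc := @kcst R N n * Bt; have cc0 : 0 <= cc by rewrite mulr_ge0 ?kcst_ge0.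
pose k (z : Borel R N) := cc * (1 + g z `^ p).
have mk : measurable_fun setT k.
  apply: measurable_funM; first exact: measurable_cst.
  by apply: measurable_funD; [exact: measurable_cst|exact: meas_powR].
have Fk z : domX f Om z -> cn (F z) <= k z.
  move=> Dz; have [Oz rz] := Dz; rewrite -PF // /pairing wedgeE.
  have -> : density n f z finset.set0 (in_zetab (phi z) * theta z) =
      density n f z finset.set0 (in_zetab (pform f z (phi z)) * theta z).
    by apply: (density_restr_l (n := n)); rewrite (restr_pform (n := n) erefl _ rz).
  apply: le_trans (density_le (n := n) erefl _ _ rz) _.
  rewrite /k /cc -mulrA; apply: ler_wpM2l; first exact: kcst_ge0.
  apply: le_trans (enM _ _) _; rewrite mulrC; apply: ler_pM; [exact: en_ge0|exact: en_ge0|exact: hBt|].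
  apply: le_trans (en_in_zetab _) _; rewrite -/(gauge f z (phi z)) (gE _ Dz).
  by have := young_split (en_ge0 (pform f z (Phi z))) (ltr01 : 0 < 1 :> R) (ltW p1); rewrite powR1 mul1r.
have ik : (\int[mu]_(z in domX f Om) (k z)%:E < +oo)%E.
  have n1 (z : Borel R N) : domX f Om z -> (0 <= (1%:E : \bar R))%E by move=> _; rewrite lee_fin.
  have n2 z : domX f Om z -> (0 <= (g z `^ p)%:E)%E by move=> _; rewrite lee_fin powR_ge0.
  have m1 : measurable_fun (domX f Om) (fun _ : Borel R N => 1%:E : \bar R) by exact: measurable_cst.
  have m2 : measurable_fun (domX f Om) (fun z => (g z `^ p)%:E).
    by apply/measurable_EFinP; apply: measurable_funTS; exact: meas_powR.
  have m3 : measurable_fun (domX f Om) (fun z => 1%:E + (g z `^ p)%:E)%E by exact: (emeasurable_funD m1 m2).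
  have n3 z : domX f Om z -> (0 <= 1%:E + (g z `^ p)%:E)%E by move=> Dz; exact: adde_ge0 (n1 z Dz) (n2 z Dz).
  have c0' : (0 <= cc%:E :> \bar R)%E by rewrite lee_fin.
  have -> : (\int[mu]_(z in domX f Om) (k z)%:E = \int[mu]_(z in domX f Om) (cc%:E * (1%:E + (g z `^ p)%:E)))%E by [].
  rewrite (ge0_integralZl mu mE m3 n3 c0') (ge0_integralD mu mE n1 m1 n2 m2) (integral_cst mu mE) mul1e.
  apply: (lte_mul_pinfty c0' isT); apply: lte_add_pinfty.
    exact: (volume_finite f_ci h_hefer mu_vol n_gt0 mE (fun x h => h.2) T0 (fun x h => Om'T (OmS h.1))).
  apply: le_lt_trans ip; apply: le_trans (gint_sub mu p oOm oOm' OmS _ (regcone_meas f)); last by exists Phi.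
  by apply: mono_integral => z Dz; rewrite (gE _ Dz).
have [mFR mFI] := mF.
have iR := integrable_bound mE mFR mk (fun z Dz => le_trans (cn_Re _) (Fk z Dz)) ik.
have iI := integrable_bound mE mFI mk (fun z Dz => le_trans (cn_Im _) (Fk z Dz)) ik.
split.
  by apply: (eq_integrable mE (EFin \o (fun x => complex.Re (F x))) _ _ iR) => z /set_mem Dz /=; rewrite (PF _ Dz).
by apply: (eq_integrable mE (EFin \o (fun x => complex.Im (F x))) _ _ iI) => z /set_mem Dz /=; rewrite (PF _ Dz).
Qed.

End Homotopy.

Theorem corollary1p5 (R : realType) (N nu n : nat) (d : 'I_nu -> nat)
  (f : 'I_nu -> mpoly N R[i])
  (mu : {measure set (Borel R N) -> \bar R})
  (Om Om' : set 'rV[R[i]]_N)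
  (h : 'I_nu -> 'I_N -> mpoly (N + N) R[i])
  (chi : 'rV[R[i]]_N -> R) (s : 'I_N -> 'rV[R[i]]_(N + N) -> R[i])
  (eps : bool) (p : R) (q : nat) (phi dphi : @formX R N) :
  let deg := (\sum_(i < nu) d i)%N in
  let K := Kop n f mu Om' eps h chi s in
  N = (n + nu)%N ->
  smooth_complete_intersection f d ->
  (deg < 2 * n + nu - 1)%N ->
  is_volume n f mu ->
  strictly_pseudoconvex Om ->
  strictly_pseudoconvex Om' ->
  closure Om `<=` Om' ->
  is_hefer f d h ->
  is_cutoff Om Om' chi ->
  is_weight Om chi s ->
  koppelman_smooth n f Om Om' K ->
  (1 <= q <= n)%N ->
  (2 * n)%:R / ((2 * n)%:R - (deg%:R - nu%:R)) < p ->
  p <= (2 * n)%:R ->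
  dbar_s n f mu p Om' q phi dphi ->
  exists dKphi : @formX R N,
    dbar_s n f mu p Om q.-1 (K phi) dKphi /\
    eq_distr n f mu Om q phi (fun z => dKphi z + K dphi z).
Proof.
move=> deg K eN f_ci hdeg mu_vol [oOm _ cOm _] [oOm' _ cOm' _] OmOm' h_hefer chi_cut s_weight koppelman q_range.
subst N; rewrite /deg in hdeg *; move=> p_gt p_le phi_dom.
have n0 : (0 < n)%N by case/andP: q_range => h1 h2; exact: leq_trans h1 h2.
have [T T0 hT] := compact_bounded cOm'.
have Om'T x : Om' x -> nm x <= T by move=> Ox; apply: hT; exact: subset_closure.
(* All degrees are positive, so the truncated differences d_i - 1 add up to d - nu. This translates
   d < 2n + nu - 1 into the bound below 2n - 1 required by [kernel_split]. *)
have degE : (\sum_(i < nu) d i = mdegree d + nu)%N.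
  have -> : (mdegree d + nu = \sum_(i < nu) ((d i).-1 + 1))%N by rewrite big_split /= sum1_card card_ord.
  by apply: eq_bigr => i _; have [/(_ i)[di _] _] := f_ci; rewrite addn1 prednK.
have deg_lt : (mdegree d < (2 * n).-1)%N by move: hdeg; rewrite degE; lia.
rewrite degE natrD addrK in p_gt.
exists (fun z => phi z - K dphi z); split.
  exact: (dbar_s_Kop n0 f_ci h_hefer mu_vol chi_cut s_weight oOm oOm' cOm OmOm' (ltW T0) Om'T deg_lt p_gt p_le koppelman q_range phi_dom).
have e : (fun z => (phi z - K dphi z) + K dphi z) = phi by apply/funext => z; rewrite subrK.
rewrite e => theta ht pairing; split; last by [].
have hi := pairing_integrable eps n0 f_ci h_hefer mu_vol chi_cut s_weight oOm oOm' cOm OmOm' (ltW T0) Om'T deg_lt p_gt p_le phi_dom ht.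
by move=> a [] ->.
Qed.
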